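(* Let $j\in\{1,\dots,q\}$ and $\delta>0$. Then $$\frac{T}{\beta-\alpha}\int_\alpha^\beta \phi^{(\kappa_j)}_{T,0}(x+iy,0)\,dx\;\longrightarrow\;\frac{1}{\mu(\Gamma\backslash G)}\int_0^{2\pi}\!\!\int_0^1 h(x,\theta)\,dx\,d\theta$$ as $T\to\infty$ and $Ty\to 0$ (with $T>y$ and $0<Ty<1$), uniformly for all real $\alpha<\beta$ satisfying $$\beta-\alpha\ \ge\ \max\Big\{T^{-1/6},\Big(\tfrac{Ty}{B_1}\Big)^{1/2}\Big\}\Big(\tfrac{Ty}{B_1}\Big)^{-\delta}.$$ Precisely: for every $\epsilon>0$ there are $T_0$ and $c_0>0$ such that for all $T\ge T_0$, all $y$ with $y<T$ and $0<Ty<c_0$, and all $\alpha<\beta$ obeying the displayed inequality, the left-hand side differs from the right-hand side by less than $\epsilon$.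
   Context: Let $G=\mathrm{PSL}_2(\mathbb R)$ act on $\mathbb H=\{z=x+iy:y>0\}$ and on $T^1\mathbb H\cong\mathbb H\times\mathbb R/2\pi\mathbb Z$ by $\gamma(z,\theta)=\big(\tfrac{az+b}{cz+d},\theta-2\arg(cz+d)\big)$ for $\gamma=\pm\begin{pmatrix}a&b\\c&d\end{pmatrix}$; identify $G$ with $T^1\mathbb H$ via $\gamma\mapsto\gamma(i,0)$, and let $\mu$ be the Haar measure, corresponding to $y^{-2}\,dx\,dy\,d\theta$. Let $\Gamma\subset G$ be a non-cocompact Fuchsian group of finite covolume with a complete set of inequivalent cusps $\kappa_1,\dots,\kappa_q$ and stabilizers $\Gamma_1,\dots,\Gamma_q$, normalized so that $\kappa_1=\infty$ and $\Gamma_1=\Gamma_\infty=\{\begin{pmatrix}1&b\\0&1\end{pmatrix}:b\in\mathbb Z\}$. For each $j$ fix a scaling matrix $\sigma_j\in G$ with $\sigma_j\infty=\kappa_j$, $\sigma_j^{-1}\Gamma_j\sigma_j=\Gamma_\infty$, $\sigma_1=\mathrm{id}$, chosen so that for a canonical fundamental domain $F\subset[0,1]\times(0,\infty)$ and a constant $B_0>1$ depending on $\Gamma$ one has $\sigma_j^{-1}(\overline F)\cap\{y\ge B\}=[0,1]\times[B,\infty)$ for all $B\ge B_0$ and all $j$. Fix $B_1>B_0$ and set $\eta_0=\min\{(B_1-B_0)/2,1/4\}$. Let $h:\mathbb R/\mathbb Z\times\mathbb R/2\pi\mathbb Z\to\mathbb C$ be $C^\infty$. Write $e(w)=e^{2\pi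 i w}$. Let $\rho(x)=\ell^{-1}e^{-1/(1-x^2)}$ for $|x|<1$ and $\rho(x)=0$ for $|x|\ge1$, where $\ell=\int_{-1}^1e^{-1/(1-x^2)}dx$, and $\rho_\varepsilon(x)=\varepsilon^{-1}\rho(x/\varepsilon)$. For $T\ge B_1$ and real $\eta$ with $|\eta|\le\eta_0$, let $\mathbb 1_{[T,\infty),0}$ be the indicator function of $[T,\infty)$ on $(0,\infty)$, and for $\eta\ne0$ let $\mathbb 1_{[T,\infty),\eta}(y)=(\mathbb 1_{[-T+\eta/2,\infty)}*\rho_{|\eta|/2})(y-2T)$ (a smooth $[0,1]$-valued function equal to $0$ for $y\le\min(T,T+\eta)$ and to $1$ for $y\ge\max(T,T+\eta)$). Define $f_{T,\eta}(z,\theta)=\mathbb 1_{[T,\infty),\eta}(y)\,h(x,\theta)$ and the automorphic function $\phi^{(\kappa_j)}_{T,\eta}(z,\theta)=\sum_{\gamma\in\Gamma_j\backslash\Gamma}f_{T,\eta}(\sigma_j^{-1}\gamma(z,\theta))$. *)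

(* Defs.v *)
From HB Require Import structures.
From mathcomp Require Import all_boot all_order all_algebra.
From mathcomp Require Import all_classical all_reals all_analysis.
Set Implicit Arguments. Unset Strict Implicit. Unset Printing Implicit Defensive.
Import Order.TTheory GRing.Theory Num.Theory.
Import numFieldNormedType.Exports.
Local Open Scope classical_set_scope.
Local Open Scope ring_scope.

Section Defs.
Variable R : realType.
Notation M2 := 'M[R]_2.

Definition ma (A : M2) : R := A ord0 ord0.
Definition mb (A : M2) : R := A ord0 ord_max.
Definition mc (A : M2) : R := A ord_max ord0.
Definition md (A : M2) : R := A ord_max ord_max.

Definition mx2 (a b c d : R) : M2 :=
  \matrix_(i < 2, j < 2)
    (if i == ord0 then (if j == ord0 then a else b)
     else (if j == ord0 then c else d)).

(* points of H are pairs (x, y) with z = x + i y, y > 0 *)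
Definition Hplane : set (R * R) := [set p | 0 < p.2].

(* Moebius action z |-> (a z + b)/(c z + d) on H, in coordinates *)
Definition mob (A : M2) (p : R * R) : R * R :=
  let: (x, y) := p in
  let n := (mc A * x + md A) ^+ 2 + (mc A * y) ^+ 2 in
  (((ma A * x + mb A) * (mc A * x + md A) + ma A * mc A * y ^+ 2) / n, y / n).

Definition carg (u v : R) : R :=
  let r := Num.sqrt (u ^+ 2 + v ^+ 2) in
  if 0 <= v then acos (u / r) else - acos (u / r).

(* the angle part of the action on T^1 H:  theta |-> theta - 2 arg(c z + d) *)
Definition mob_angle (A : M2) (p : R * R) (t : R) : R :=
  t - 2 * carg (mc A * p.1 + md A) (mc A * p.2).

(* boundary points R u {oo}; None stands for oo *)
Definition bmob (A : M2) (k : option R) : option R :=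
  match k with
  | None => if mc A == 0 then None else Some (ma A / mc A)
  | Some r => if mc A * r + md A == 0 then None
              else Some ((ma A * r + mb A) / (mc A * r + md A))
  end.

(* Gamma is given through its full preimage in SL_2(R) *)
Definition SL2_subgroup (Gam : set M2) : Prop :=
  [/\ forall g, Gam g -> \det g = 1,
      Gam 1, Gam (- 1),
      forall g h, Gam g -> Gam h -> Gam (g * h)
    & forall g, Gam g -> Gam (invmx g)].

Definition discrete_grp (Gam : set M2) : Prop :=
  exists2 e : R, 0 < e &
    forall g, Gam g -> (forall i j, `|g i j - (1 : M2) i j| < e) -> g = 1.

Definition Fuchsian (Gam : set M2) : Prop := SL2_subgroup Gam /\ discrete_grp Gam.

Definition parabolic (A : M2) : Prop :=
  A <> 1 /\ A <> - 1 /\ `|\tr A| = 2.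

Definition is_cusp (Gam : set M2) (k : option R) : Prop :=
  exists g, [/\ Gam g, parabolic g & bmob g k = k].

Definition equiv_bd (Gam : set M2) (k k' : option R) : Prop :=
  exists2 g, Gam g & bmob g k = k'.

Definition stab (Gam : set M2) (k : option R) : set M2 :=
  [set g | Gam g /\ bmob g k = k].

Definition Gamma_inf : set M2 :=
  [set g | exists b : int,
     g = mx2 1 b%:~R 0 1 \/ g = mx2 (-1) (- b%:~R) 0 (-1)].

Definition cusp_set (Gam : set M2) (q : nat) (kappa : nat -> option R) : Prop :=
  [/\ forall j, (j < q)%N -> is_cusp Gam (kappa j),
      forall k, is_cusp Gam k -> (exists2 j, (j < q)%N & equiv_bd Gam k (kappa j))
    & forall i j, (i < q)%N -> (j < q)%N ->
         equiv_bd Gam (kappa i) (kappa j) -> i = j].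

Definition conj_set (s : M2) (S : set M2) : set M2 :=
  [set invmx s * g * s | g in S].

Definition scaling (Gam : set M2) (k : option R) (s : M2) : Prop :=
  [/\ \det s = 1, bmob s None = k & conj_set s (stab Gam k) = Gamma_inf].

Definition leb2 := ((@lebesgue_measure R) \x (@lebesgue_measure R))%E.

Definition fund_domain (Gam : set M2) (F : set (R * R)) : Prop :=
  [/\ [/\ open F, measurable F & F `<=` Hplane],
      forall p, Hplane p -> (exists2 g, Gam g & closure F (mob g p)),
      forall p p' g, F p -> F p' -> Gam g -> mob g p = p' -> p = p'
    & leb2 (closure F `\` F) = 0%E].

Definition hyp_area (F : set (R * R)) : \bar R :=
  (\int[leb2]_(p in F) (p.2 ^-2)%:E)%E.

(* mu(Gamma \ G) for the Haar measure y^-2 dx dy dtheta *)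
Definition covol (F : set (R * R)) : R := 2 * pi * fine (hyp_area F).

Definition lcoset (S : set M2) (g : M2) : set M2 := [set k * g | k in S].
Definition cosets (S Gam : set M2) : set (set M2) := [set lcoset S g | g in Gam].

(* f_{T,0}(z, theta) = 1_{[T,oo)}(y) h(x, theta) for a real-valued part h *)
Definition fT0 (h : R -> R -> R) (T : R) (p : R * R) (t : R) : R :=
  if T <= p.2 then h p.1 t else 0.

(* phi^{(kappa_j)}_{T,0}(z, theta): sum over Gamma_j \ Gamma of
   f_{T,0}(sigma_j^-1 gamma (z, theta)); a representative of each coset is
   chosen with xget (the value does not depend on the choice). *)
Definition phiT0 (Gam : set M2) (k : option R) (s : M2)
    (h : R -> R -> R) (T : R) (p : R * R) (t : R) : R :=
  \sum_(C \in cosets (stab Gam k) Gam)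
     (let M := invmx s * xget 1 C in fT0 h T (mob M p) (mob_angle M p t)).

Fixpoint pder (w : seq bool) (f : R -> R -> R) : R -> R -> R :=
  match w with
  | [::] => f
  | b :: w' => let g := pder w' f in
      if b then (fun x t => 'D_1 (fun x' => g x' t) x)
      else (fun x t => 'D_1 (fun t' => g x t') t)
  end.

Definition smooth2 (f : R -> R -> R) : Prop :=
  forall w : seq bool,
    [/\ forall x t, derivable (fun x' => pder w f x' t) x 1,
        forall x t, derivable (fun t' => pder w f x t') t 1
      & continuous (fun p : R * R => pder w f p.1 p.2)].

End Defs.

(* Main.v *)
Require Import Defs.
From HB Require Import structures.
From mathcomp Require Import all_boot all_order all_algebra finmap.
From mathcomp Require Import all_classical all_reals all_analysis.
From mathcomp Require Import measurable_realfun ring lra.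
Set Implicit Arguments. Unset Strict Implicit. Unset Printing Implicit Defensive.
Import Order.TTheory GRing.Theory Num.Theory.
Import numFieldNormedType.Exports.
Local Open Scope classical_set_scope.
Local Open Scope ring_scope.

(** Unfolding the sum over [Gamma_j \ Gamma] gives a sum over the vectors [(c, d)], [c > 0],
in the discrete orbit of bottom rows of [sigma_j^-1 Gamma]; the term of [(c, d)] lives on an
interval of length of order [sqrt (y / T) / c] around the slope [- d / c].  There the first
argument of [h] runs through many periods, so [h] can be replaced by its mean in [x], and it
remains to count the orbit vectors with [c <= Q := (T y)^(-1/2)] and slope in an interval of
length [L], where [L Q] is large.  Such a count is a Siegel-type function on [Gamma \ G],
evaluated along a piece of a closed horocycle.  Siegel's formula gives its mean; the mean ergodic
theorem for the unipotent flow together with Mautner's phenomenon shows that the normalised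
counts converge to the mean in [L^2]; their monotonicity in the group element upgrades this to
pointwise convergence at the points of the horocycle lying in the thick part; and by Zassenhaus'
commutator argument only a small proportion of the horocycle lies in the thin part. *)

(** * Two-by-two matrices as quadruples *)

Section TwoByTwo.
Variable R : realType.
Local Notation M4 := (R * R * R * R)%type.
Implicit Types (m n g s u w : M4) (r e x y z : R).

(** The test function moves with [T]: its support climbs into the cusp and its mass decays like
    [1/T], so equidistribution of a fixed function does not apply directly. Unfolding trades it for
    a count at the scale [Q], and the two limits separate. [T y -> 0] makes [Q] large, as the count
    requires; [T -> oo] makes each term oscillate, since the coefficient [1/(c^2 y)] of its phase is
    at least [1/(Q^2 y) = T]. The length condition acts through [L Q], which it bounds below by a
    constant times a negative power of [T y]. No spectral theory and no rate is involved. Ergodicity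
    is used at a scale [S] that depends only on the accuracy and on the thickness [r]. An interval
    of slopes is cut into cells of width [S^2/Q^2], and on each cell the count is the fixed function
    [orbN] of level [S] at a point of the horocycle; hence the uniformity in the position and length
    of the interval. Matrices are quadruples of reals, so that product measures and Fubini apply
    directly. The constant 200 goes back to the neighbourhood [1/100] of the identity in which
    commutators contract. *)

Definition mul4 m n : M4 :=
  (m.1.1.1 * n.1.1.1 + m.1.1.2 * n.1.2, m.1.1.1 * n.1.1.2 + m.1.1.2 * n.2,
   m.1.2 * n.1.1.1 + m.2 * n.1.2, m.1.2 * n.1.1.2 + m.2 * n.2).
Definition inv4 m : M4 := (m.2, - m.1.1.2, - m.1.2, m.1.1.1).
Definition opp4 m : M4 := (- m.1.1.1, - m.1.1.2, - m.1.2, - m.2).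
Definition one4 : M4 := (1, 0, 0, 1).
Definition det4 m : R := m.1.1.1 * m.2 - m.1.1.2 * m.1.2.
Definition upper4 x : M4 := (1, x, 0, 1).
Definition lower4 x : M4 := (1, 0, x, 1).
Definition diag4 x : M4 := (x, 0, 0, x^-1).

Lemma mul4A m n g : mul4 m (mul4 n g) = mul4 (mul4 m n) g.
Proof. by rewrite /mul4 /=; congr (_, _, _, _); ring. Qed.
Lemma mul41 m : mul4 m one4 = m.
Proof. by case: m => [[[a b] c] d]; rewrite /mul4 /=; congr (_, _, _, _); ring. Qed.
Lemma mul14 m : mul4 one4 m = m.
Proof. by case: m => [[[a b] c] d]; rewrite /mul4 /=; congr (_, _, _, _); ring. Qed.
Lemma inv4M m n : inv4 (mul4 m n) = mul4 (inv4 n) (inv4 m).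
Proof. by rewrite /mul4 /inv4 /=; congr (_, _, _, _); ring. Qed.
Lemma inv4K m : inv4 (inv4 m) = m.
Proof. by case: m => [[[a b] c] d]; rewrite /inv4 /= !opprK. Qed.
Lemma inv41 : inv4 one4 = one4.
Proof. by rewrite /inv4 /= oppr0. Qed.
Lemma opp4K m : opp4 (opp4 m) = m.
Proof. by case: m => [[[a b] c] d]; rewrite /opp4 /= !opprK. Qed.
Lemma mul4N m n : mul4 m (opp4 n) = opp4 (mul4 m n).
Proof. by rewrite /mul4 /opp4 /=; congr (_, _, _, _); ring. Qed.
Lemma mulN4 m n : mul4 (opp4 m) n = opp4 (mul4 m n).
Proof. by rewrite /mul4 /opp4 /=; congr (_, _, _, _); ring. Qed.
Lemma mul4V m : det4 m = 1 -> mul4 m (inv4 m) = one4.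
Proof.
case: m => [[[a b] c] d]; rewrite /det4 /mul4 /inv4 /= => h.
by congr (_, _, _, _); rewrite -?h; ring.
Qed.
Lemma mulV4 m : det4 m = 1 -> mul4 (inv4 m) m = one4.
Proof.
case: m => [[[a b] c] d]; rewrite /det4 /mul4 /inv4 /= => h.
by congr (_, _, _, _); rewrite -?h; ring.
Qed.
Lemma det4M m n : det4 (mul4 m n) = det4 m * det4 n.
Proof. by rewrite /det4 /mul4 /=; ring. Qed.
Lemma det4V m : det4 (inv4 m) = det4 m.
Proof. by rewrite /det4 /inv4 /=; ring. Qed.
Lemma det41 : det4 one4 = 1.
Proof. by rewrite /det4 /=; ring. Qed.
Lemma det4_upper x : det4 (upper4 x) = 1.
Proof. by rewrite /det4 /=; ring. Qed.
Lemma det4_lower x : det4 (lower4 x) = 1.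
Proof. by rewrite /det4 /=; ring. Qed.
Lemma det4_diag x : x != 0 -> det4 (diag4 x) = 1.
Proof. by move=> x0; rewrite /det4 /= mulfV//; ring. Qed.
Lemma mul4K m n : det4 n = 1 -> mul4 (mul4 m n) (inv4 n) = m.
Proof. by move=> h; rewrite -mul4A mul4V// mul41. Qed.
Lemma mul4VK m n : det4 n = 1 -> mul4 (mul4 m (inv4 n)) n = m.
Proof. by move=> h; rewrite -mul4A mulV4// mul41. Qed.
Lemma mulK4 m n : det4 n = 1 -> mul4 (inv4 n) (mul4 n m) = m.
Proof. by move=> h; rewrite mul4A mulV4// mul14. Qed.
Lemma mulVK4 m n : det4 n = 1 -> mul4 n (mul4 (inv4 n) m) = m.
Proof. by move=> h; rewrite mul4A mul4V// mul14. Qed.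
Lemma mul4_injr n m m' : det4 n = 1 -> mul4 m n = mul4 m' n -> m = m'.
Proof. by move=> h /(congr1 (fun k : M4 => mul4 k (inv4 n))); rewrite !mul4K. Qed.
Lemma mul4_injl n m m' : det4 n = 1 -> mul4 n m = mul4 n m' -> m = m'.
Proof. by move=> h /(congr1 (fun k : M4 => mul4 (inv4 n) k)); rewrite !mulK4. Qed.

Definition near4 r m :=
  [/\ `|m.1.1.1 - 1| <= r, `|m.1.1.2| <= r, `|m.1.2| <= r & `|m.2 - 1| <= r].

Lemma near4_le r e m : r <= e -> near4 r m -> near4 e m.
Proof. by move=> re [h1 h2 h3 h4]; split; apply: le_trans re. Qed.

(** A subgroup of PSL_2 is represented by its full preimage, which contains [-1]; every element is
    thus counted twice, the source of the factors 2 in the unfolding formulas. Discreteness is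
    stated at the identity only. *)
Record dgroup (G : set M4) : Prop := DGroup {
  dg_det : forall m, G m -> det4 m = 1;
  dg1 : G one4;
  dgN1 : G (opp4 one4);
  dgM : forall m n, G m -> G n -> G (mul4 m n);
  dgV : forall m, G m -> G (inv4 m);
  dg_disc : exists2 e, 0 < e & forall m, G m -> near4 e m -> m = one4 }.

Definition conj4 s m : M4 := mul4 (mul4 (inv4 s) m) s.

Lemma conj4M s m n : det4 s = 1 -> conj4 s (mul4 m n) = mul4 (conj4 s m) (conj4 s n).
Proof.
move=> h; rewrite /conj4 -(mul4A _ s) (mul4A s) (mul4A s) mul4V// mul14.
by rewrite !mul4A.
Qed.
Lemma conj4V s m : conj4 s (inv4 m) = inv4 (conj4 s m).
Proof. by rewrite /conj4 !inv4M inv4K mul4A. Qed.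
Lemma conj41 s : det4 s = 1 -> conj4 s one4 = one4.
Proof. by move=> h; rewrite /conj4 mul41 mulV4. Qed.
Lemma conj4N s m : conj4 s (opp4 m) = opp4 (conj4 s m).
Proof. by rewrite /conj4 mul4N mulN4. Qed.
Lemma det4_conj s m : det4 s = 1 -> det4 (conj4 s m) = det4 m.
Proof. by move=> h; rewrite /conj4 !det4M det4V h mulr1 mul1r. Qed.
Lemma conj4K s m : det4 s = 1 -> conj4 (inv4 s) (conj4 s m) = m.
Proof.
by move=> h; rewrite /conj4 inv4K mul4A mul4K ?mul4A ?mul4V// mul14.
Qed.
Lemma conj4KV s m : det4 s = 1 -> conj4 s (conj4 (inv4 s) m) = m.
Proof. by move=> h; have := @conj4K (inv4 s) m; rewrite inv4K det4V; apply. Qed.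
Lemma conj4_conj s u m : conj4 s (conj4 u m) = conj4 (mul4 u s) m.
Proof. by rewrite /conj4 inv4M !mul4A. Qed.

(** The entries of [s m s^-1 - 1] are linear in [m - 1], with four coefficients that are products of
    two entries of [s]: hence [4 M^2]. The alternative [det4 s <> 1] allows [K] to be fixed before
    the determinant is known. *)
Lemma near4_conj s : exists2 K : R, 0 < K & forall r m, near4 r m ->
  near4 (K * r) (conj4 (inv4 s) m) \/ det4 s <> 1.
Proof.
case: s => [[[p q] k] t].
pose M := 1 + `|p| + `|q| + `|k| + `|t|.
have M0 : 0 < M by rewrite /M; have := normr_ge0 p; have := normr_ge0 q;
  have := normr_ge0 k; have := normr_ge0 t; lra.
have [hp hq hk ht] : [/\ `|p| <= M, `|q| <= M, `|k| <= M & `|t| <= M].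
  by rewrite /M; have := normr_ge0 p; have := normr_ge0 q;
   have := normr_ge0 k; have := normr_ge0 t => *; split; lra.
exists (4 * M ^+ 2); first by rewrite mulr_gt0// exprn_gt0.
move=> r [[[a b] c] d] [/= ha hb hc hd].
have [h|] := pselect (det4 (p, q, k, t) = 1); [left|by right].
have {}h : p * t - q * k = 1 by [].
have r0 : 0 <= r := le_trans (normr_ge0 _) ha.
have B (x1 x2 z : R) : `|x1| <= M -> `|x2| <= M -> `|z| <= r -> `|x1 * x2 * z| <= M ^+ 2 * r.
  by move=> h1 h2 h3; rewrite !normrM expr2; do ?apply: ler_pM; rewrite ?mulr_ge0.
have S4 (z1 z2 z3 z4 : R) : `|z1| <= M ^+ 2 * r -> `|z2| <= M ^+ 2 * r ->
   `|z3| <= M ^+ 2 * r -> `|z4| <= M ^+ 2 * r -> `|z1 + z2 + z3 + z4| <= 4 * M ^+ 2 * r.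
  move=> h1 h2 h3 h4; do 3?(apply: le_trans (ler_normD _ _) _); 
  rewrite -mulrA; have := ler_normD (z1 + z2) z3; have := ler_normD z1 z2; lra.
have N (z : R) : `|z| <= M -> `|- z| <= M by rewrite normrN.
rewrite /conj4 /mul4 /inv4 /near4 /=; split.
  rewrite [X in `|X|](_ : _ = p * t * (a - 1) + p * (- k) * b + q * t * c + q * (- k) * (d - 1)); last first.
    by lra.
  by apply: S4; apply: B => //; apply: N.
- rewrite [X in `|X|](_ : _ = p * (- q) * (a - 1) + p * p * b + q * (- q) * c + q * p * (d - 1)); last ring.
  by apply: S4; apply: B => //; apply: N.
- rewrite [X in `|X|](_ : _ = k * t * (a - 1) + k * (- k) * b + t * t * c + t * (- k) * (d - 1)); last ring.
  by apply: S4; apply: B => //; apply: N.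
- rewrite [X in `|X|](_ : _ = k * (- q) * (a - 1) + k * p * b + t * (- q) * c + t * p * (d - 1)); last first.
    by lra.
  by apply: S4; apply: B => //; apply: N.
Qed.

(** The set is [s^-1 G s], written as a preimage so that membership needs no witness; with a scaling
    matrix for [s] it carries a cusp to infinity. *)
Lemma dgroup_conj G s : dgroup G -> det4 s = 1 ->
  dgroup [set m | G (conj4 (inv4 s) m)].
Proof.
move=> dG ds; have ds' : det4 (inv4 s) = 1 by rewrite det4V.
split => /=.
- by move=> m /(dg_det dG); rewrite det4_conj.
- by rewrite conj41//; exact: dg1.
- by rewrite conj4N conj41//; exact: dgN1.
- by move=> m n hm hn; rewrite conj4M//; exact: dgM.
- by move=> m hm; rewrite conj4V; exact: dgV.
have [e e0 he] := dg_disc dG.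
have [K K0 hK] := near4_conj s.
exists (e / K); first exact: divr_gt0.
move=> m Gm nm; have [|//] := hK _ _ nm.
rewrite mulrC divfK ?gt_eqF// => /(he _ Gm) h.
by rewrite -(conj4KV m ds) h conj41.
Qed.

End TwoByTwo.
Arguments one4 {R}.

(** * Commutators near the identity *)

Section Zassenhaus.
Variable R : realType.
Local Notation M4 := (R * R * R * R)%type.
Implicit Types (m n g s u w : M4) (r e x y z : R).

Lemma normM_le x y e r : `|x| <= e -> `|y| <= r -> `|x * y| <= e * r.
Proof. by move=> h1 h2; rewrite normrM; apply: ler_pM. Qed.

Definition com4 u w : M4 := mul4 (mul4 u w) (inv4 (mul4 w u)).

(** [com4 u w - 1] is [(u w - w u) (w u)^-1], and [u w - w u] is bilinear in [u - 1] and [w - 1].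
    Its entries are at most [r/25], those of [(w u)^-1] at most 3, so the product is at most
    [6 r/25]. *)
Lemma near4_com r u w : det4 u = 1 -> det4 w = 1 -> r <= 100^-1 ->
  near4 100^-1 u -> near4 r w -> near4 (r / 2) (com4 u w).
Proof.
move=> du dw r1 nu nw.
have nw' : near4 100^-1 w by apply: near4_le nw.
have [m [mE hm]] : exists m, inv4 (mul4 w u) = m /\ 
   [/\ `|m.1.1.1| <= 3, `|m.1.1.2| <= 3, `|m.1.2| <= 3 & `|m.2| <= 3].
  exists (inv4 (mul4 w u)); split=> //.
  move: nu nw' => [u1 u2 u3 u4] [w1 w2 w3 w4].
  clear -u1 u2 u3 u4 w1 w2 w3 w4.
  have A (x : R) : `|x - 1| <= 100^-1 -> `|x| <= 11 / 10.
    by clear; rewrite !ler_norml => /andP[? ?]; apply/andP; split; lra.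
  have A' (x : R) : `|x| <= 100^-1 -> `|x| <= 11 / 10 by move=> ?; lra.
  have S (x y z t : R) : `|x| <= 11 / 10 -> `|y| <= 11 / 10 -> `|z| <= 11 / 10 -> 
     `|t| <= 11 / 10 -> `|x * y + z * t| <= 3.
    move=> h1 h2 h3 h4; apply: le_trans (ler_normD _ _) _.
    by move: (normM_le h1 h2) (normM_le h3 h4); clear; lra.
  by rewrite /inv4 /mul4 /= !normrN; split; apply: S; auto.
have e1 : mul4 (mul4 w u) m = one4 by rewrite -mE mul4V// det4M du dw mulr1.
rewrite /com4 mE; move: e1 hm {mE}.
case: m => [[[m1 m2] m3] m4]; move: nu nw {nw'}.
case: u du => [[[a b] c] d] du; case: w dw => [[[a' b'] c'] d'] dw.
rewrite /mul4 /near4 /= => -[u1 u2 u3 u4] [w1 w2 w3 w4] [E1 E2 E3 E4] [h1 h2 h3 h4].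
have r0 : 0 <= r := le_trans (normr_ge0 _) w1.
clear du dw.
have T (k1 k2 z1 z2 : R) : `|k1| <= r / 25 -> `|k2| <= r / 25 -> `|z1| <= 3 -> `|z2| <= 3 ->
   `|k1 * z1 + k2 * z2| <= r / 2.
  move=> g1 g2 g3 g4; apply: le_trans (ler_normD _ _) _.
  by move: (normM_le g1 g3) (normM_le g2 g4) r0; clear; lra.
have L (x1 x2 z1 z2 : R) : `|x1| <= 2 / 100 -> `|x2| <= 2 / 100 -> `|z1| <= r -> `|z2| <= r -> 
   `|x1 * z1 - x2 * z2| <= r / 25.
  move=> g1 g2 g3 g4; apply: le_trans (ler_normB _ _) _.
  by move: (normM_le g1 g3) (normM_le g2 g4) r0; clear; lra.
have D1 : `|a - d| <= 2 / 100.
  by move: u1 u4; clear; rewrite !ler_norml => /andP[? ?] /andP[? ?]; apply/andP; split; lra.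
have D2 : `|d' - a'| <= 2 * r.
  by move: w1 w4; clear; rewrite !ler_norml => /andP[? ?] /andP[? ?]; apply/andP; split; lra.
have K11 : `|b * c' - c * b'| <= r / 25 by apply: L => //; [move: u2|move: u3]; clear; lra.
have K12 : `|(a - d) * b' + b * (d' - a')| <= r / 25.
  apply: le_trans (ler_normD _ _) _.
  by move: (normM_le D1 w2) (normM_le u2 D2) r0; clear; lra.
have K21 : `|c * (a' - d') + (d - a) * c'| <= r / 25.
  rewrite distrC in D1; rewrite distrC in D2.
  apply: le_trans (ler_normD _ _) _.
  by move: (normM_le D1 w3) (normM_le u3 D2) r0; clear; lra.
have K22 : `|c * b' - b * c'| <= r / 25 by apply: L => //; [move: u3|move: u2]; clear; lra.
split.
- rewrite -[X in _ - X]E1 [X in `|X|](_ : _ = (b * c' - c * b') * m1 + ((a - d) * b' + b * (d' - a')) * m3); last ring.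
  exact: T.
- rewrite -[X in `|X|]subr0 -[X in _ - X]E2 [X in `|X|](_ : _ = (b * c' - c * b') * m2 + ((a - d) * b' + b * (d' - a')) * m4); last ring.
  exact: T.
- rewrite -[X in `|X|]subr0 -[X in _ - X]E3 [X in `|X|](_ : _ = (c * (a' - d') + (d - a) * c') * m1 + (c * b' - b * c') * m3); last ring.
  exact: T.
- rewrite -[X in _ - X]E4 [X in `|X|](_ : _ = (c * (a' - d') + (d - a) * c') * m2 + (c * b' - b * c') * m4); last ring.
  exact: T.
Qed.

(* If [w] rescales the nilpotent part of a unipotent element, iterated conjugation contracts it. *)
Lemma dgroup_unip_scale (G : set M4) p b c (al : R) w : dgroup G -> G w ->
  0 < al -> al < 1 ->
  (forall t : R, mul4 (mul4 w (1 + t * p, t * b, t * c, 1 - t * p)) (inv4 w) =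
     (1 + al * t * p, al * t * b, al * t * c, 1 - al * t * p)) ->
  G (1 + p, b, c, 1 - p) -> [/\ p = 0, b = 0 & c = 0].
Proof.
move=> dG Gw al0 al1 hw G1.
have Gk (k : nat) : G (1 + al ^+ k * p, al ^+ k * b, al ^+ k * c, 1 - al ^+ k * p).
  elim: k => [|k IH]; first by rewrite expr0 !mul1r.
  by rewrite exprS -hw; apply: (dgM dG); [apply: (dgM dG)|exact: (dgV dG)].
have [e e0 he] := dg_disc dG.
pose M := 1 + `|p| + `|b| + `|c|.
have [hp hb hc] : [/\ `|p| <= M, `|b| <= M & `|c| <= M].
  by rewrite /M; have := normr_ge0 p; have := normr_ge0 b;
   have := normr_ge0 c => *; split; lra.
have M0 : 0 < M by rewrite /M; have := normr_ge0 p; have := normr_ge0 b;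
  have := normr_ge0 c; lra.
have [k hk] : exists k : nat, al ^+ k <= e / M.
  have cv : (fun k => al ^+ k) @ \oo --> (0 : R).
    by apply: cvg_expr; rewrite ger0_norm// ltW.
  have eM : 0 < e / M by exact: divr_gt0.
  move/cvgrPdist_le : cv => /(_ _ eM)[k _ /(_ k (leqnn k))] /=.
  by rewrite sub0r normrN ger0_norm ?exprn_ge0 ?(ltW al0)// => h; exists k.
have ak0 : 0 < al ^+ k by rewrite exprn_gt0.
have B (z : R) : `|z| <= M -> `|al ^+ k * z| <= e.
  move=> hz; rewrite -[leRHS](divfK (lt0r_neq0 M0)).
  by apply: normM_le => //; rewrite ger0_norm ?(ltW ak0).
have [E1 E2 E3 _] : (1 + al ^+ k * p, al ^+ k * b, al ^+ k * c, 1 - al ^+ k * p) = one4.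
  apply: he => //; split=> /=; try exact: B.
  - by rewrite addrAC subrr add0r; exact: B.
  - by rewrite addrAC subrr add0r normrN; exact: B.
have Z (z : R) : al ^+ k * z = 0 -> z = 0.
  by move/eqP; rewrite mulf_eq0 gt_eqF//= => /eqP.
by split; apply: Z => //; lra.
Qed.

(** If [u] commutes with its commutator with [w], it commutes with [w u w^-1]. The traceless parts
    of these two elements are then proportional, with a factor [al] near 1. The determinant gives
    [al = 1] unless [u] is unipotent, and in that case discreteness excludes [al <> 1]. *)
Lemma dgroup_commute_step (G : set M4) u w : dgroup G -> G u -> G w ->
  near4 100^-1 u -> near4 100^-1 w ->
  mul4 u (com4 u w) = mul4 (com4 u w) u -> mul4 u w = mul4 w u.
Proof.
move=> dG Gu Gw nu nw.
have du := dg_det dG Gu; have dw := dg_det dG Gw.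
rewrite /com4 inv4M => hc.
have {}hc : mul4 (mul4 (mul4 w u) (inv4 w)) u = mul4 u (mul4 (mul4 w u) (inv4 w)).
  have e : mul4 u (mul4 (mul4 w (inv4 u)) (inv4 w)) = mul4 (mul4 (mul4 w (inv4 u)) (inv4 w)) u.
    apply: (@mul4_injl _ u) => //; rewrite !mul4A in hc *; exact: hc.
  have ei : inv4 (mul4 (mul4 w (inv4 u)) (inv4 w)) = mul4 (mul4 w u) (inv4 w).
    by rewrite !inv4M !inv4K mul4A.
  have dn : det4 (mul4 (mul4 w (inv4 u)) (inv4 w)) = 1 by rewrite !det4M !det4V du dw !mulr1.
  rewrite -ei; apply: (@mul4_injl _ (mul4 (mul4 w (inv4 u)) (inv4 w))) => //.
  by rewrite !mulVK4//; rewrite mul4A -e mul4K.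
suff PE : mul4 (mul4 w u) (inv4 w) = u by rewrite -[RHS](mul4VK _ dw) PE.
case: u du nu hc Gu => [[[a b] c] d] du nu hc Gu.
case: w dw nw hc Gw => [[[A B] C] D] dw nw hc Gw.
set P := mul4 (mul4 _ _) (inv4 _).
have dw' : A * D - B * C = 1 by [].
have du' : a * d - b * c = 1 by [].
clear du.
(* [u] is half its trace plus the traceless part [(p, b; c, -p)], on which conjugation by [w] acts
   linearly and close to the identity. *)
pose p := (a - d) / 2.
have aE : a = (a + d) / 2 + p by rewrite /p; lra.
have dE : d = (a + d) / 2 - p by rewrite /p; lra.
pose p' := p * (A * D + B * C) + c * (B * D) - b * (A * C).
pose b' := A ^+ 2 * b - B ^+ 2 * c - 2 * A * B * p.
pose c' := D ^+ 2 * c - C ^+ 2 * b + 2 * C * D * p.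
have conjE (t q1 q2 q3 : R) :
    mul4 (mul4 (A, B, C, D) (t + q1, q2, q3, t - q1)) (inv4 (A, B, C, D)) =
    (t + (q1 * (A * D + B * C) + q3 * (B * D) - q2 * (A * C)),
     A ^+ 2 * q2 - B ^+ 2 * q3 - 2 * A * B * q1,
     D ^+ 2 * q3 - C ^+ 2 * q2 + 2 * C * D * q1,
     t - (q1 * (A * D + B * C) + q3 * (B * D) - q2 * (A * C))).
  have tt : t = t * (A * D - B * C) by rewrite dw' mulr1.
  rewrite [in RHS]tt /mul4 /inv4 /=; congr (_, _, _, _); ring.
have PE : P = ((a + d) / 2 + p', b', c', (a + d) / 2 - p').
  by rewrite -conjE -aE -dE.
suff [e1 e2 e3] : [/\ p' = p, b' = b & c' = c] by rewrite PE e1 e2 e3 -aE -dE.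
have {}hc : [/\ p * b' = b * p', p * c' = c * p' & b * c' = c * b'].
  move: hc; rewrite -/P PE /mul4 /= => -[h1 h2 h3 h4].
  by move: h1 h2 h3 h4; rewrite /p; clear; split; lra.
pose M := Num.max `|p| (Num.max `|b| `|c|).
have hp : `|p| <= M by rewrite le_max lexx.
have hb : `|b| <= M by rewrite !le_max lexx orbT.
have hcM : `|c| <= M by rewrite !le_max lexx !orbT.
have [M0|M0] := leP M 0.
  have z (x : R) : `|x| <= M -> x = 0.
    by move=> h; apply/eqP; rewrite -normr_le0; apply: le_trans M0.
  rewrite /p' /b' /c' (z _ hp) (z _ hb) (z _ hcM); split; ring.
move: nw => [/= w1 w2 w3 w4].
have [/andP[A1 A2] /andP[D1 D2]] : 99 / 100 <= A <= 101 / 100 /\ 99 / 100 <= D <= 101 / 100.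
  by move: w1 w4; clear; rewrite !ler_norml => /andP[? ?] /andP[? ?]; split; apply/andP; split; lra.
move: w2 w3; rewrite !ler_norml => /andP[B1 B2] /andP[C1 C2].
have bnd (k1 k2 k3 : R) : `|k1| <= 1 / 20 -> `|k2| <= 1 / 20 -> `|k3| <= 1 / 20 ->
    `|k1 * p + k2 * b + k3 * c| <= M / 5.
  move=> h1 h2 h3.
  move: (normM_le h1 hp) (normM_le h2 hb) (normM_le h3 hcM).
  move: (ler_normD (k1 * p + k2 * b) (k3 * c)) (ler_normD (k1 * p) (k2 * b)) M0; clear; lra.
have dp : `|p' - p| <= M / 5.
  rewrite (_ : p' - p = (A * D + B * C - 1) * p + (- (A * C)) * b + (B * D) * c); last by rewrite /p'; ring.
  by apply: bnd; move: A1 A2 D1 D2 B1 B2 C1 C2; clear => *; rewrite ler_norml; apply/andP; split; nra.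
have db : `|b' - b| <= M / 5.
  rewrite (_ : b' - b = (- 2 * A * B) * p + (A ^+ 2 - 1) * b + (- B ^+ 2) * c); last by rewrite /b'; ring.
  by apply: bnd; move: A1 A2 D1 D2 B1 B2 C1 C2; clear => *; rewrite ler_norml; apply/andP; split; nra.
have dc : `|c' - c| <= M / 5.
  rewrite (_ : c' - c = (2 * C * D) * p + (- C ^+ 2) * b + (D ^+ 2 - 1) * c); last by rewrite /c'; ring.
  by apply: bnd; move: A1 A2 D1 D2 B1 B2 C1 C2; clear => *; rewrite ler_norml; apply/andP; split; nra.
(* The vanishing cross products give proportionality; the factor is read off the entry of largest
   modulus [M], where a perturbation of at most [M/5] keeps it in [[4/5, 6/5]]. *)
have [al [al1 ep eb ec]] : exists al : R, [/\ 4 / 5 <= al <= 6 / 5,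
    p' = al * p, b' = al * b & c' = al * c].
  have rat (x x' : R) : `|x| = M -> `|x' - x| <= M / 5 -> x != 0 /\ 4 / 5 <= x' / x <= 6 / 5.
    move=> xM h; have x0 : x != 0 by rewrite -normr_eq0 xM gt_eqF.
    split=> //; suff : `|x' / x - 1| <= 1 / 5.
      by clear; rewrite ler_norml => /andP[? ?]; apply/andP; split; lra.
    rewrite -[X in _ - X](mulfV x0) -mulrBl normrM normfV xM ler_pdivrMr//.
    by move: h; clear; lra.
  have [h1 h2 h3] := hc.
  have : [\/ `|p| = M, `|b| = M | `|c| = M].
    rewrite /M; clear; case: (leP `|b| `|c|) => ?; case: leP => ?;
    by [constructor 1|constructor 2|constructor 3].
  case=> [/rat /(_ dp)|/rat /(_ db)|/rat /(_ dc)] [x0 hx].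
  - exists (p' / p); split=> //; first by rewrite divfK.
    + by rewrite mulrAC [p' * b]mulrC -h1 mulrAC mulfV// mul1r.
    + by rewrite mulrAC [p' * c]mulrC -h2 mulrAC mulfV// mul1r.
  - exists (b' / b); split=> //; last 2 first.
    + by rewrite divfK.
    + by rewrite mulrAC [b' * c]mulrC -h3 mulrAC mulfV// mul1r.
    + by rewrite mulrAC [b' * p]mulrC h1 mulrAC mulfV// mul1r.
  - exists (c' / c); split=> //; last first.
    + by rewrite divfK.
    + by rewrite mulrAC [c' * b]mulrC h3 mulrAC mulfV// mul1r.
    + by rewrite mulrAC [c' * p]mulrC h2 mulrAC mulfV// mul1r.
(* Minus the determinant of the traceless part, invariant under conjugation: it forces [al^2 = 1]
   unless it vanishes. *)
have inva : p' ^+ 2 + b' * c' = p ^+ 2 + b * c.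
  have -> : p' ^+ 2 + b' * c' = (p ^+ 2 + b * c) * (A * D - B * C) ^+ 2.
    by rewrite /p' /b' /c'; ring.
  by rewrite dw' expr1n mulr1.
have {al1} /andP[al1 al2] := al1.
suff al1E : al = 1 by rewrite ep eb ec al1E !mul1r.
have [q0|q0] := eqVneq (p ^+ 2 + b * c) 0; last first.
  have : (al ^+ 2 - 1) * (p ^+ 2 + b * c) = 0.
    by rewrite mulrBl mul1r -{2}inva ep eb ec; ring.
  move/eqP; rewrite mulf_eq0 (negPf q0) orbF => /eqP h.
  have : (al - 1) * (al + 1) = 0 by rewrite -h; ring.
  by move: al1 al2; clear=> ? ? /eqP; rewrite mulf_eq0 => /orP[/eqP|/eqP]; lra.
(* When the form vanishes the trace is 2 or -2, and nearness to the identity selects 2: [u] is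
   unipotent and either [w] or its inverse contracts it. *)
have tr2 : (a + d) / 2 = 1.
  have : ((a + d) / 2 - 1) * ((a + d) / 2 + 1) = 0 by move: q0 du'; rewrite /p; clear; lra.
  move: nu => [/= u1 _ _ u4].
  move: u1 u4; clear; rewrite !ler_norml => /andP[? ?] /andP[? ?].
  by move/eqP; rewrite mulf_eq0 => /orP[/eqP|/eqP]; lra.
have uE : (a, b, c, d) = (1 + p, b, c, 1 - p) by rewrite -tr2 -aE -dE.
have hw (t : R) : mul4 (mul4 (A, B, C, D) (1 + t * p, t * b, t * c, 1 - t * p)) (inv4 (A, B, C, D)) =
     (1 + al * t * p, al * t * b, al * t * c, 1 - al * t * p).
  rewrite conjE -![al * t * _]mulrA ![al * (t * _)]mulrCA -ep -eb -ec.
  by rewrite /p' /b' /c'; congr (_, _, _, _); ring.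
have contra : ~ [/\ p = 0, b = 0 & c = 0].
  by move=> [hp0 hb0 hc0]; move: M0; rewrite /M hp0 hb0 hc0 normr0 !maxxx ltxx.
have al0 : 0 < al by move: al1; clear; lra.
have [altlt|algt|al1E] := ltgtP al 1; last exact: al1E.
  exfalso; apply: contra; apply: (dgroup_unip_scale dG Gw al0 altlt hw).
  by rewrite -uE.
exfalso; apply: contra.
apply: (@dgroup_unip_scale _ _ _ _ al^-1 _ dG (dgV dG Gw)).
- by rewrite invr_gt0.
- by rewrite invf_lt1.
- move=> t; rewrite inv4K; apply: (@mul4_injl _ (A, B, C, D)) => //.
  apply: (@mul4_injr _ (inv4 (A, B, C, D))); first by rewrite det4V.
  have -> : t = al * (al^-1 * t) by rewrite mulrA mulfV ?gt_eqF ?mul1r.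
  rewrite mulrA mulVf ?gt_eqF// mul1r.
  by rewrite hw mul4A mul4K// mul4A mul4V// mul14.
- by rewrite -uE.
Qed.

(* Zassenhaus: iterated commutators of elements near 1 converge to 1, hence are eventually 1. *)
Lemma dgroup_near_commute (G : set M4) u w : dgroup G -> G u -> G w ->
  near4 100^-1 u -> near4 100^-1 w -> mul4 u w = mul4 w u.
Proof.
move=> dG Gu Gw nu nw.
pose W := fix W (k : nat) := if k is k'.+1 then com4 u (W k') else w.
have du := dg_det dG Gu.
have GW k : G (W k).
  elim: k => [//|k IH] /=; rewrite /com4.
  by apply: (dgM dG); [|apply: (dgV dG)]; apply: (dgM dG).
have nW k : near4 (100^-1 / 2 ^+ k) (W k).
  elim: k => [|k IH]; first by rewrite expr0 divr1.
  rewrite exprSr invfM mulrA; apply: near4_com => //; first exact: (dg_det dG).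
  by rewrite ler_pdivrMr ?exprn_gt0// ler_peMr// exprn_ege1// ler1n.
have nW' k : near4 100^-1 (W k).
  apply: near4_le (nW k); by rewrite ler_pdivrMr ?exprn_gt0// ler_peMr// exprn_ege1// ler1n.
have [e e0 he] := dg_disc dG.
have [k hk] : exists k, W k == one4.
  have cv : (fun k => (2^-1) ^+ k) @ \oo --> (0 : R).
    by apply: cvg_expr; rewrite ger0_norm// invf_lt1// ltr1n.
  move/cvgrPdist_le : cv => /(_ _ e0)[k _ /(_ k (leqnn k))] /=.
  rewrite sub0r normrN ger0_norm ?exprn_ge0// => h; exists k; apply/eqP/he => //.
  apply: near4_le (nW k); apply: le_trans h; rewrite exprVn.
  by rewrite ler_piMl// ?invr_ge0 ?exprn_ge0//; lra.
(* Commutation with [u] is pulled back along the sequence, from a trivial commutator down to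
   [W 0 = w]. *)
have step k' : mul4 u (W k'.+1) = mul4 (W k'.+1) u -> mul4 u (W k') = mul4 (W k') u.
  by move=> h; apply: (dgroup_commute_step dG).
elim: k hk => [/eqP /= ->|k IH /eqP hk]; first by rewrite mul41 mul14.
have : mul4 u (W k) = mul4 (W k) u by apply: step; rewrite hk mul41 mul14.
move=> {IH hk}; elim: k => [//|k IH hk]; apply: IH; exact: step.
Qed.

End Zassenhaus.

(** * Orbits of bottom rows *)

Section Spacing.
Variable R : realType.
Local Notation M4 := (R * R * R * R)%type.
Implicit Types (m n g s u w : M4) (r e x y z : R).

Record cusp_at_infty (H : set M4) : Prop := CuspAtInfty {
  ci_dg : dgroup H;
  ci_upper : forall b : int, H (upper4 b%:~R);
  ci_stab : forall m, H m -> m.1.2 = 0 ->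
    exists b : int, m = upper4 b%:~R \/ m = opp4 (upper4 b%:~R) }.

Lemma conj4_diag t m : t != 0 ->
  conj4 (diag4 t) m = (m.1.1.1, m.1.1.2 / t ^+ 2, m.1.2 * t ^+ 2, m.2).
Proof.
by move=> t0; rewrite /conj4 /mul4 /inv4 /diag4 /=; congr (_, _, _, _); field.
Qed.

(** Shimizu's lemma with a weak constant. For small [c > 0], integer translations on both sides
    bring the diagonal entries into [[1, 1 + c]], and the determinant then puts the upper right
    entry in [[0, 3]]. A diagonal conjugation moves this element and the unit translation close to
    the identity; they commute, which forces [c = 0]. *)
Lemma cusp_c_lower (H : set M4) : cusp_at_infty H ->
  forall m, H m -> m.1.2 = 0 \/ (200 ^+ 2)^-1 <= `|m.1.2|.
Proof.
move=> cH; have dH := ci_dg cH.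
suff pos m : H m -> 0 < m.1.2 -> (200 ^+ 2)^-1 <= m.1.2.
  move=> m Hm; case: (ltgtP m.1.2 0) => [c0|c0|->]; [right|right|by left].
    have Hm' : H (opp4 m).
      by rewrite -[m]mul14 -mulN4; apply: (dgM dH) => //; exact: dgN1.
    have := pos _ Hm'; rewrite ltr0_norm//; apply; by rewrite /= oppr_gt0.
  by rewrite gtr0_norm//; exact: pos.
move=> Hm c0; rewrite leNgt; apply/negP => cs.
case: m Hm c0 cs => [[[a b] c] d] Hm /= c0 cs.
have [k /andP[k1 k2]] : exists k : int, 1 <= a + k%:~R * c <= 1 + c.
  exists (- Num.floor ((a - 1) / c)); rewrite rmorphN /= mulNr.
  have := Num.Theory.floor_le ((a - 1) / c); have := lt_succ_floor ((a - 1) / c).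
  rewrite ltr_pdivrMr// ler_pdivlMr// rmorphD /= mulrDl mul1r => h1 h2.
  by apply/andP; split; lra.
have [l /andP[l1 l2]] : exists k : int, 1 <= d + k%:~R * c <= 1 + c.
  exists (- Num.floor ((d - 1) / c)); rewrite rmorphN /= mulNr.
  have := Num.Theory.floor_le ((d - 1) / c); have := lt_succ_floor ((d - 1) / c).
  rewrite ltr_pdivrMr// ler_pdivlMr// rmorphD /= mulrDl mul1r => h1 h2.
  by apply/andP; split; lra.
set A := a + _ in k1 k2; set D := d + _ in l1 l2.
have [B HB] : exists B, H (A, B, c, D).
  exists (b + k%:~R * d + A * l%:~R).
  have -> : (A, b + k%:~R * d + A * l%:~R, c, D) =
      mul4 (mul4 (upper4 k%:~R) (a, b, c, d)) (upper4 l%:~R).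
    by rewrite /mul4 /= /A /D; congr (_, _, _, _); ring.
  by apply: (dgM dH); [apply: (dgM dH)|] => //; exact: ci_upper.
have dm : A * D - B * c = 1 := dg_det dH HB.
have cs' : c < 1 / 200 * (1 / 200) by move: cs; clear; rewrite expr2 invfM !mul1r.
have B0 : 0 <= B.
  rewrite -(pmulr_lge0 _ c0) (_ : B * c = A * D - 1); last by rewrite -dm; ring.
  by move: k1 l1; clear; nra.
have B3 : B <= 3.
  rewrite -(ler_pM2r c0) (_ : B * c = A * D - 1); last by rewrite -dm; ring.
  have c1 : c <= 1 by move: cs'; clear; nra.
  by move: k1 l1 k2 l2 c0 c1; clear; nra.
have H1 : H (1, 1, 0, 1) by have := ci_upper cH 1.
(* Conjugation by [diag4 18] divides upper right entries by 324 and multiplies [c] by 324; both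
   [3/324] and [324/200^2] are below [1/100]. *)
have ds : det4 (diag4 (18 : R)) = 1 by rewrite det4_diag.
have dH' := dgroup_conj dH ds.
have t0 : (18 : R) != 0 by [].
have := @dgroup_near_commute R _ (conj4 (diag4 18) (A, B, c, D)) (conj4 (diag4 18) (1, 1, 0, 1)) dH'.
rewrite /= !conj4K ?det4_diag// !conj4_diag//= => /(_ HB H1).
have c4 : c * 18 ^+ 2 <= 100^-1 by move: c0 cs'; clear; nra.
have c5 : c <= 100^-1 by move: c0 cs'; clear; nra.
have nn (z : R) : 0 <= z -> z <= 100^-1 -> `|z| <= 100^-1 by move=> ? ?; rewrite ger0_norm.
have : near4 100^-1 (A, B / 18 ^+ 2, c * 18 ^+ 2, D).
  split=> /=; apply: nn => //.
  - by rewrite subr_ge0.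
  - by move: k2 c5; clear; lra.
  - by rewrite divr_ge0// exprn_ge0.
  - by move: B3; clear; rewrite ler_pdivrMr ?exprn_gt0//; lra.
  - by rewrite mulr_ge0 ?exprn_ge0 ?(ltW c0).
  - by rewrite subr_ge0.
  - by move: l2 c5; clear; lra.
move=> h /(_ h).
have : near4 100^-1 (1 : R, 1 / 18 ^+ 2, 0 * 18 ^+ 2, 1 : R).
  split=> /=; rewrite ?mul0r ?subrr ?normr0 ?invr_ge0//.
  by rewrite ger0_norm ?divr_ge0 ?exprn_ge0//; lra.
move=> h' /(_ h'); rewrite /mul4 /= => -[e1 _ _ _].
by move: e1 c0; clear; nra.
Qed.

Definition rmul (v : R * R) g : R * R :=
  (v.1 * g.1.1.1 + v.2 * g.1.2, v.1 * g.1.1.2 + v.2 * g.2).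
Definition bot m : R * R := (m.1.2, m.2).
Definition wedge (v w : R * R) : R := v.1 * w.2 - v.2 * w.1.

Lemma bot_mul m n : bot (mul4 m n) = rmul (bot m) n.
Proof. by []. Qed.
Lemma rmulM v m n : rmul v (mul4 m n) = rmul (rmul v m) n.
Proof. by rewrite /rmul /=; congr (_, _); ring. Qed.
Lemma rmul1 v : rmul v one4 = v.
Proof. by case: v => c d; rewrite /rmul /=; congr (_, _); ring. Qed.
Lemma rmulN v m : rmul (- v) m = - rmul v m.
Proof. by case: v => c d; rewrite /rmul /=; congr (_, _); rewrite /=; ring. Qed.
Lemma rmulK v m : det4 m = 1 -> rmul (rmul v m) (inv4 m) = v.
Proof. by move=> h; rewrite -rmulM mul4V// rmul1. Qed.
Lemma rmulVK v m : det4 m = 1 -> rmul (rmul v (inv4 m)) m = v.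
Proof. by move=> h; rewrite -rmulM mulV4// rmul1. Qed.
Lemma wedge_rmul (v w : R * R) m : wedge (rmul v m) (rmul w m) = wedge v w * det4 m.
Proof. by rewrite /wedge /rmul /det4 /=; ring. Qed.

(** For [G] the modular group and [s] the identity these are the primitive integer vectors. In
    general, up to sign, the orbit parametrises the cosets of the stabiliser of the cusp. *)
Definition orb (G : set M4) s : set (R * R) := [set bot (mul4 (inv4 s) m) | m in G].

End Spacing.

Section Orbit.
Variable R : realType.
Local Notation M4 := (R * R * R * R)%type.
Variables (G : set M4) (s : M4).
Hypotheses (ds : det4 s = 1) (dG : dgroup G).
Hypothesis cS : cusp_at_infty [set m | G (conj4 (inv4 s) m)].
Local Notation Lam := (orb G s).

Lemma orb_rmul m v : G m -> Lam v -> Lam (rmul v m).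
Proof.
move=> Gm [n Gn <-]; exists (mul4 n m); first exact: (dgM dG).
by rewrite -bot_mul mul4A.
Qed.

Lemma dg_opp m : G m -> G (opp4 m).
Proof. by move=> Gm; rewrite -[m]mul14 -mulN4; apply: (dgM dG) => //; exact: (dgN1 dG). Qed.

Lemma orb_opp v : Lam v -> Lam (- v).
Proof. by move=> [n Gn <-]; exists (opp4 n); [exact: dg_opp|rewrite mul4N]. Qed.

Lemma wedge_bot (m n : M4) : det4 n = 1 ->
  wedge (bot m) (bot n) = (mul4 m (inv4 n)).1.2.
Proof. by rewrite /wedge /bot /= => _; ring. Qed.

(** The wedge of two bottom rows is the lower left entry of [s^-1 m n^-1 s], an element of the
    conjugate group whose cusp is at infinity, to which Shimizu's bound applies. *)
Lemma orb_spacing v w : Lam v -> Lam w ->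
  wedge v w = 0 \/ (200 ^+ 2)^-1 <= `|wedge v w|.
Proof.
move=> [m Gm <-] [n Gn <-]; have dn := dg_det dG Gn.
rewrite wedge_bot; last by rewrite det4M det4V ds dn mulr1.
apply: (cusp_c_lower cS) => /=.
rewrite inv4M inv4K /conj4 inv4K !mul4A mul4V// mul14 mul4K//.
by apply: (dgM dG) => //; exact: (dgV dG).
Qed.

(** A vanishing wedge puts [s^-1 m n^-1 s] into the stabiliser of infinity. *)
Lemma orb_same m n : G m -> G n -> 
  wedge (bot (mul4 (inv4 s) m)) (bot (mul4 (inv4 s) n)) = 0 ->
  exists b : int, mul4 (inv4 s) m = mul4 (upper4 b%:~R) (mul4 (inv4 s) n) \/
     mul4 (inv4 s) m = opp4 (mul4 (upper4 b%:~R) (mul4 (inv4 s) n)).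
Proof.
move=> Gm Gn; have dn := dg_det dG Gn.
have dsn : det4 (mul4 (inv4 s) n) = 1 by rewrite det4M det4V ds dn mulr1.
rewrite wedge_bot// => h.
have [|b hb] := ci_stab cS _ h.
  rewrite /= inv4M inv4K /conj4 inv4K !mul4A mul4V// mul14 mul4K//.
  by apply: (dgM dG) => //; exact: (dgV dG).
exists b; case: hb => hb; [left|right].
  by rewrite -hb mul4VK.
by rewrite -mulN4 -hb mul4VK.
Qed.

Lemma orb_wedge0 v w : Lam v -> Lam w -> wedge v w = 0 -> v = w \/ v = - w.
Proof.
move=> [m Gm <-] [n Gn <-] h; have [b [->|->]] := orb_same Gm Gn h; [left|right].
  by rewrite /bot /mul4 /=; congr (_, _); ring.
by rewrite /bot /mul4 /=; congr (_, _); rewrite /=; ring.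
Qed.

Lemma orb_neq0 v : Lam v -> v != 0.
Proof.
move=> [m Gm <-]; apply/eqP => -[h1 h2].
have : det4 (mul4 (inv4 s) m) = 1 by rewrite det4M det4V ds (dg_det dG Gm) mulr1.
rewrite /det4; move: h1 h2; rewrite /bot /= => -> ->; rewrite !mulr0 subr0 => /eqP.
by rewrite eq_sym oner_eq0.
Qed.

End Orbit.

(** * Cardinality of finite sets and of separated sets *)

Section Counting.
Variable R : realType.
Implicit Types (x y z : R).

(** [fset_set] is empty on infinite sets, so [cnt] is 0 there; monotonicity and additivity need
    finiteness. *)
Definition cnt {T : choiceType} (A : set T) : R := (#|` fset_set A|)%:R.

Lemma cnt_ge0 (T : choiceType) (A : set T) : 0 <= cnt A.
Proof. exact: ler0n. Qed.

Lemma cnt0 (T : choiceType) : cnt (@set0 T) = 0.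
Proof. by rewrite /cnt fset_set0 cardfs0. Qed.

Lemma cnt_le (T : choiceType) (A B : set T) : finite_set B -> A `<=` B -> cnt A <= cnt B.
Proof.
move=> fB AB; rewrite /cnt ler_nat; apply: fsubset_leq_card.
by rewrite -fset_set_sub//; exact: sub_finite_set fB.
Qed.

Lemma cntU_le (T : choiceType) (A B : set T) : finite_set A -> finite_set B ->
  cnt (A `|` B) <= cnt A + cnt B.
Proof.
move=> fA fB; rewrite /cnt fset_setU// -natrD ler_nat.
exact: (leq_card_fsetU (fset_set A) (fset_set B)).1.
Qed.

Lemma cntU (T : choiceType) (A B : set T) : finite_set A -> finite_set B ->
  A `&` B = set0 -> cnt (A `|` B) = cnt A + cnt B.
Proof.
move=> fA fB AB0; rewrite /cnt fset_setU// -natrD; congr _%:R.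
by rewrite -cardfsUI -fset_setI// AB0 fset_set0 cardfs0 addn0.
Qed.

Lemma finite_bigcup_lt (T : choiceType) (K : nat) (A : nat -> set T) :
  (forall k, (k < K)%N -> finite_set (A k)) -> finite_set (\bigcup_(k in `I_K) A k).
Proof. by move=> h; apply: bigcup_finite => //; exact: finite_II. Qed.

Lemma cnt_bigcup_le (T : choiceType) (K : nat) (A : nat -> set T) :
  (forall k, (k < K)%N -> finite_set (A k)) ->
  cnt (\bigcup_(k in `I_K) A k) <= \sum_(k < K) cnt (A k).
Proof.
elim: K => [|K IH] h.
  by rewrite big_ord0 II0 bigcup_set0 cnt0.
rewrite big_ord_recr /= IIS bigcup_setU bigcup_set1.
have hK : forall k, (k < K)%N -> finite_set (A k) by move=> k ?; apply: h; exact: ltnW.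
apply: (le_trans (cntU_le _ _)); first exact: finite_bigcup_lt.
  exact: h.
by rewrite lerD2r; exact: IH.
Qed.

Lemma cnt_inj (T : choiceType) (A : set T) (f : T -> nat) (m : nat) :
  {in A &, injective f} -> (forall v, A v -> (f v < m)%N) ->
  finite_set A /\ cnt A <= m%:R.
Proof.
move=> fi fm.
have le : (A #<= `I_m)%card.
  rewrite -(card_le_eql (inj_card_eq fi)); apply: subset_card_le.
  by move=> _ [v Av <-]; exact: fm.
split; first by apply/finite_set_leP; exists m.
by rewrite /cnt ler_nat; exact: geq_card_fset_set.
Qed.

(** Each cell of length [d] counted from [p] holds at most one value of [f]. The bound is restricted
    to nonempty [A] because for [q < p] its right side may be negative. *)
Lemma cnt_separated (T : choiceType) (A : set T) (f : T -> R) p q d : 0 < d ->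
  (forall v, A v -> p <= f v <= q) ->
  (forall v w, A v -> A w -> v <> w -> d <= `|f v - f w|) ->
  finite_set A /\ (A !=set0 -> cnt A <= 1 + (q - p) / d).
Proof.
move=> d0 hf sep.
pose g v := Num.trunc ((f v - p) / d).
have g0 v : A v -> 0 <= (f v - p) / d.
  by move=> /hf /andP[h _]; rewrite divr_ge0 ?subr_ge0// ltW.
have gi : {in A &, injective g}.
  move=> v w; rewrite !inE => Av Aw gE; apply: contrapT => /(sep _ _ Av Aw) h.
  have /andP[v1 v2] := Num.Theory.truncn_itv (g0 _ Av).
  have /andP[w1 w2] := Num.Theory.truncn_itv (g0 _ Aw).
  move: v1 v2 w1 w2; rewrite -/(g v) -/(g w) gE => v1 v2 w1 w2.
  have : `|(f v - p) / d - (f w - p) / d| < 1.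
    by rewrite ltr_norml; move: v1 v2 w1 w2; clear; rewrite -!natr1 => *; apply/andP; split; lra.
  rewrite -mulrBl normrM normfV (gtr0_norm d0) ltr_pdivrMr// mul1r.
  rewrite opprB addrA subrK => h'; by move: (le_lt_trans h h'); rewrite ltxx.
have gb v : A v -> (g v < (Num.trunc ((q - p) / d)).+1)%N.
  move=> Av; rewrite ltnS; apply: Num.Theory.le_truncn.
  by rewrite ler_pM2r ?invr_gt0// lerD2r; have /andP[] := hf _ Av.
have [fA cA] := cnt_inj gi gb.
split=> // -[v Av]; apply: (le_trans cA).
rewrite -natr1 addrC lerD2l Num.Theory.truncn_le.
by apply: le_trans (g0 _ Av) _; rewrite ler_pM2r ?invr_gt0// lerD2r; have /andP[] := hf _ Av.
Qed.

Lemma cnt_separated_le (T : choiceType) (A : set T) (f : T -> R) p q d : 0 < d -> p <= q ->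
  (forall v, A v -> p <= f v <= q) ->
  (forall v w, A v -> A w -> v <> w -> d <= `|f v - f w|) ->
  finite_set A /\ cnt A <= 1 + (q - p) / d.
Proof.
move=> d0 pq hf sep; have [fA h] := cnt_separated d0 hf sep; split=> //.
have [->|/set0P/h//] := eqVneq A set0.
by rewrite cnt0 addr_ge0// divr_ge0 ?subr_ge0// ltW.
Qed.

Lemma cnt_separated_diam (T : choiceType) (A : set T) (f : T -> R) w d : 0 < d -> 0 <= w ->
  (forall v v', A v -> A v' -> `|f v - f v'| <= w) ->
  (forall v v', A v -> A v' -> v <> v' -> d <= `|f v - f v'|) ->
  finite_set A /\ cnt A <= 1 + 2 * w / d.
Proof.
move=> d0 w0 hf sep.
have [->|/set0P[a Aa]] := eqVneq A set0.
  by rewrite cnt0; split=> //; rewrite addr_ge0// divr_ge0// ?mulr_ge0// ltW.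
have -> : 2 * w = (f a + w) - (f a - w) by ring.
apply: (@cnt_separated_le _ _ f) => //; first by move: w0; clear; lra.
by move=> v Av; have := hf _ _ Av Aa; clear; rewrite ler_norml => /andP[? ?]; apply/andP; split; lra.
Qed.

End Counting.

(** * The thin part *)

Section Nondivergence.
Variable R : realType.
Local Notation M4 := (R * R * R * R)%type.
Implicit Types (m n g s u w : M4) (r e x y z : R).

(** Locked so that the arithmetic tactics meet an atom and not a numeral. *)
Definition bigc : R := locked 1000.
Lemma bigcE : bigc = 1000. Proof. by rewrite /bigc -lock. Qed.
Lemma bigc_gt0 : 0 < bigc. Proof. by rewrite bigcE; exact: ltr0Sn. Qed.

(** It sends [i] to [x + i y]; for fixed [y] these elements trace a horocycle. *)
Definition geo x y : M4 := mul4 (upper4 x) (diag4 (Num.sqrt y)).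

(** Failure of injectivity at scale [r]: a nontrivial group element looks close to the identity from
    [g], as happens high in a cusp. *)
Definition thin (G : set M4) r g := exists m, [/\ G m, m <> one4 & near4 r (conj4 g m)].

Lemma det4_geo x y : 0 < y -> det4 (geo x y) = 1.
Proof. by move=> y0; rewrite /geo det4M det4_upper det4_diag ?mulr1// gt_eqF ?sqrtr_gt0. Qed.

Lemma conj4_geo x y m : 0 < y -> conj4 (geo x y) m =
  (m.1.1.1 - x * m.1.2, (m.1.1.2 + (m.1.1.1 - m.2) * x - m.1.2 * x ^+ 2) / y,
   m.1.2 * y, m.2 + m.1.2 * x).
Proof.
move=> y0; rewrite /geo -conj4_conj conj4_diag; last by rewrite gt_eqF ?sqrtr_gt0.
rewrite sqr_sqrtr ?(ltW y0)// /conj4 /mul4 /inv4 /=; congr (_, _ / y, _ * y, _); ring.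
Qed.


(* The data of a short element of the thin part at [geo x y], with [c > 0]. *)
Definition short (G : set M4) r x y m :=
  [/\ G m, (200 ^+ 2)^-1 <= m.1.2, m.1.2 * y <= r &
   [/\ `|m.1.1.1 - x * m.1.2 - 1| <= r, `|m.2 + m.1.2 * x - 1| <= r &
       `|m.1.1.2 + (m.1.1.1 - m.2) * x - m.1.2 * x ^+ 2| <= r * y]].

(** Passing to the inverse makes [c >= 0]. If [c = 0], the element is an integer translation by at
    most [r y < 1], hence trivial, or minus a translation, whose diagonal is far from 1. Otherwise
    [cusp_c_lower] applies. *)
Lemma thin_short (G : set M4) r x y : cusp_at_infty G -> 0 < y -> r <= 1000^-1 -> y <= 1 -> thin G r (geo x y) ->
  exists m, short G r x y m.
Proof.
move=> cG y0 r1 y1 [m [Gm m1 nm]].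
have dG := ci_dg cG.
have [m' [Gm' m'1 nm' c0]] : exists m', [/\ G m', m' <> one4, near4 r (conj4 (geo x y) m') & 0 <= m'.1.2].
  have [c0|c0] := leP 0 m.1.2; first by exists m.
  exists (inv4 m); split; first exact: (dgV dG).
  - by move=> h; apply: m1; rewrite -(inv4K m) h inv41.
  - by move: nm; rewrite conj4V => -[*]; split=> /=; rewrite ?normrN.
  - by rewrite /= oppr_ge0 ltW.
move: nm'; rewrite conj4_geo// => -[/= h1 h2 h3 h4].
have [c00|] := cusp_c_lower cG Gm'; last first.
  rewrite ger0_norm// => cl; exists m'; split=> //.
    by move: h3; rewrite ger0_norm ?mulr_ge0 ?(ltW y0).
  by split=> //; move: h2; rewrite normrM normfV (gtr0_norm y0) ler_pdivrMr.
exfalso; apply: m'1.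
have [b [E|E]] := ci_stab cG Gm' c00; last first.
  exfalso; move: h1; rewrite E /=; rewrite oppr0 mulr0 subr0 -opprD normrN.
  rewrite ger0_norm//; by move: r1; clear; lra.
move: h2; rewrite E /= subrr !mul0r addr0 subr0.
rewrite normrM normfV (gtr0_norm y0) ler_pdivrMr// => h2.
suff -> : b = 0 by [].
have : `|b%:~R : R| < 1.
  apply: le_lt_trans h2 _; have r0 : 0 <= r := le_trans (normr_ge0 _) h1.
  by move: r1 y1 y0 r0; clear; nra.
rewrite -intr_norm -[1]/(1%:~R) ltr_int.
by case: b {E h2} => -[|n].
Qed.

(** Seen from a common point at a height comparable to [1/X], both elements lie within [1/100] of
    the identity, so they commute. The conclusion says that their fixed-point forms
    [c z^2 + (d - a) z - b] are proportional. *)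
Lemma short_commute (G : set M4) r x x' y X m m' : cusp_at_infty G -> 0 < y -> 0 < X -> r <= 1000^-1 ->
  short G r x y m -> short G r x' y m' ->
  X <= m.1.2 < 4 * X -> X <= m'.1.2 < 4 * X -> `|x - x'| <= (bigc * X)^-1 ->
  m.1.1.2 * m'.1.2 = m'.1.1.2 * m.1.2 /\
  (m.1.1.1 - m.2) * m'.1.2 = (m'.1.1.1 - m'.2) * m.1.2.
Proof.
move=> cG y0 X0 r1 [Gm cl cy [a1 d1 f1]] [Gm' cl' cy' [a1' d1' f1']] cX cX' xx.
have dG := ci_dg cG.
(* As [c < 4 X], this height gives [c t < 1/100]; the upper right entry is at most [2/(10^5 X)], and
   division by [t] makes it [8/1000]. *)
pose t := (400 * X)^-1.
have t0 : 0 < t by rewrite invr_gt0; exact: mulr_gt0 (ltr0Sn _ _) X0.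
rewrite bigcE in xx.
have ds := det4_geo x t0.
have tX : t * X = 400^-1.
  by rewrite /t invfM -mulrA (mulVf (lt0r_neq0 X0)) mulr1.
have dX : `|x - x'| * X <= 1000^-1.
  by rewrite -(ler_pdivlMr _ _ X0) -invfM.
have r0 : 0 <= r := le_trans (normr_ge0 _) a1.
have key (k b c d : R) : `|k - 1| <= r + 4 / 1000 -> `|d - 1| <= r + 4 / 1000 ->
    0 <= c < 4 * X -> `|b| <= 2 / 100 / 1000 / X -> near4 100^-1 (k, b / t, c * t, d).
  move=> hk hd /andP[c0 c4] hb; split=> /=.
  - by move: hk r1; clear; lra.
  - rewrite normrM normfV (gtr0_norm t0) ler_pdivrMr//.
    apply: (le_trans hb); rewrite (ler_pdivrMr _ _ X0) -[_ * t * X]mulrA tX; clear; lra.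
  - rewrite ger0_norm ?mulr_ge0 ?(ltW t0)//.
    have : c * t <= 4 * X * t by rewrite ler_pM2r// ltW.
    rewrite -mulrA [X * t]mulrC tX; clear; lra.
  - by move: hd r1; clear; lra.
have ryX (c : R) : X <= c -> c * y <= r -> r * y <= 1 / 1000 / 1000 / X.
  move=> Xc cyr; rewrite ler_pdivlMr//.
  have yX : y * X <= r by apply: le_trans cyr; rewrite mulrC ler_pM2r.
  have : r * (y * X) <= 1000^-1 * 1000^-1 by apply: ler_pM => //; rewrite ?mulr_ge0 ?(ltW y0) ?(ltW X0)// (le_trans yX).
  by rewrite mulrA; clear; lra.
have n1 : near4 100^-1 (conj4 (geo x t) m).
  have /andP[X1 X2] := cX.
  rewrite conj4_geo//; apply: key.
  - by move: a1; clear; lra.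
  - by move: d1; clear; lra.
  - by apply/andP; split=> //; exact: le_trans (ltW X0) X1.
  - apply: le_trans f1 _; apply: le_trans (ryX _ X1 cy) _.
    by rewrite ler_pM2r ?invr_gt0//; clear; lra.
have n2 : near4 100^-1 (conj4 (geo x t) m').
  have /andP[X1 X2] := cX'.
  have c0 : 0 <= m'.1.2 by exact: le_trans (ltW X0) X1.
  set dd := x - x' in xx dX.
  have cdd : `|m'.1.2 * dd| <= 4 / 1000.
    rewrite normrM (ger0_norm c0).
    have : m'.1.2 * `|dd| <= 4 * X * `|dd| by rewrite ler_wpM2r// ltW.
    rewrite -mulrA [X * _]mulrC; move: dX; clear; lra.
  rewrite conj4_geo//; apply: key.
  - rewrite (_ : _ - 1 = (m'.1.1.1 - x' * m'.1.2 - 1) - m'.1.2 * dd); last by rewrite /dd; ring.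
    by apply: le_trans (ler_normB _ _) _; exact: lerD.
  - rewrite (_ : _ - 1 = (m'.2 + m'.1.2 * x' - 1) + m'.1.2 * dd); last by rewrite /dd; ring.
    by apply: le_trans (ler_normD _ _) _; exact: lerD.
  - by apply/andP; split.
  - rewrite (_ : _ - _ = (m'.1.1.2 + (m'.1.1.1 - m'.2) * x' - m'.1.2 * x' ^+ 2) +
       ((m'.1.1.1 - x' * m'.1.2 - 1) - (m'.2 + m'.1.2 * x' - 1) - m'.1.2 * dd) * dd); last first.
      by rewrite /dd; ring.
    apply: le_trans (ler_normD _ _) _.
    have B1 := le_trans f1' (ryX _ X1 cy').
    have B2 : `|(m'.1.1.1 - x' * m'.1.2 - 1) - (m'.2 + m'.1.2 * x' - 1) - m'.1.2 * dd| <= 6 / 1000.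
      move: (ler_normB (m'.1.1.1 - x' * m'.1.2 - 1 - (m'.2 + m'.1.2 * x' - 1)) (m'.1.2 * dd)).
      move: (ler_normB (m'.1.1.1 - x' * m'.1.2 - 1) (m'.2 + m'.1.2 * x' - 1)).
      by move: a1' d1' cdd r1; clear; lra.
    have B3 : `|dd| <= 1 / 1000 / X by rewrite mul1r -invfM.
    move: (lerD B1 (normM_le B2 B3)) => h; apply: (le_trans h).
    rewrite mulrA -mulrDl ler_pM2r ?invr_gt0//; clear; lra.
have dH := dgroup_conj dG ds.
have := dgroup_near_commute dH (_ : _ (conj4 (geo x t) m)) (_ : _ (conj4 (geo x t) m')) n1 n2.
rewrite /= !conj4K// => /(_ Gm Gm').
rewrite -!conj4M// => /(congr1 (conj4 (inv4 (geo x t)))); rewrite !conj4K//.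
by rewrite /mul4 => -[e1 _ e3 _]; split; [move: e1|move: e3]; clear; lra.
Qed.

(** A dyadic scale for the square root of [c], started at [1/200] because nonzero [c] are at least
    [1/200^2]. *)
Definition lev (k : nat) : R := 2 ^+ k / 200.

Lemma lev_gt0 k : 0 < lev k.
Proof. exact: divr_gt0 (exprn_gt0 _ (ltr0Sn _ _)) (ltr0Sn _ _). Qed.

Lemma levS k : lev k.+1 = 2 * lev k.
Proof. by rewrite /lev exprS mulrA. Qed.

Lemma lev_exists (c : R) : (200 ^+ 2)^-1 <= c -> exists k, lev k ^+ 2 <= c < 4 * lev k ^+ 2.
Proof.
move=> c0.
have ex : exists k, c < 4 * lev k ^+ 2.
  have [k hk] : exists k : nat, c * 200 ^+ 2 <= k%:R.
    by exists (Num.trunc (c * 200 ^+ 2)).+1; rewrite ltW// Num.Theory.truncnS_gt.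
  exists k; rewrite /lev expr_div_n mulrA (ltr_pdivlMr _ _ (exprn_gt0 2 (ltr0Sn R 199))).
  have k2 : (k%:R : R) < 2 ^+ k by rewrite -natrX ltr_nat ltn_expl.
  have : (2 : R) ^+ k <= (2 ^+ k) ^+ 2.
    rewrite expr2 ler_peMl ?exprn_ge0// exprn_ege1// ler1n//.
  move: hk k2 (ler0n R k); clear; lra.
have [k hk min] := ex_minnP ex.
exists k; rewrite hk andbT.
case: k hk min => [_ _|k hk min]; first by rewrite /lev expr0 mul1r exprVn.
rewrite levS exprMn leNgt; apply/negP => h.
suff /min : c < 4 * lev k ^+ 2 by rewrite ltnn.
by move: h; rewrite (_ : (2 : R) ^+ 2 = 4)//; ring.
Qed.

Lemma lev_le j k : (j <= k)%N -> lev j <= lev k.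
Proof. by move=> jk; rewrite /lev ler_wpM2r ?invr_ge0 ?ler0n// ler_weXn2l// ler1n. Qed.

Lemma sum_lev_inv K : \sum_(k < K) (lev k)^-1 <= 400.
Proof.
suff -> : \sum_(k < K) (lev k)^-1 = 400 - 2 / lev K.
  by rewrite gerBl divr_ge0// ltW// lev_gt0.
elim: K => [|K IH]; first by rewrite big_ord0 /lev expr0 mul1r invrK; ring.
rewrite big_ord_recr /= IH levS; field; exact: lt0r_neq0 (lev_gt0 K).
Qed.

Lemma sum_lev K : \sum_(k < K) lev k <= lev K.
Proof.
suff -> : \sum_(k < K) lev k = lev K - lev 0 by rewrite gerBl ltW// lev_gt0.
elim: K => [|K IH]; first by rewrite big_ord0; ring.
by rewrite big_ord_recr /= IH levS; ring.
Qed.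

(** The positions are cut into intervals of length [1/(1000 lev k ^ 2)], the proximity at which
    [short_commute] works for the dyadic range [k]. *)
Definition bucket (G : set M4) r al y (n k j : nat) : set nat := [set i | [/\ (i < n)%N,
  (exists2 m, short G r (al + i%:R * y) y m & lev k ^+ 2 <= m.1.2 < 4 * lev k ^+ 2) &
  Num.trunc (bigc * lev k ^+ 2 * (i%:R * y)) = j]].

(** All short elements of a bucket share one fixed-point form, so at its points the single quadratic
    [q0 - (x - x0)^2] is at most [r y / lev k ^ 2] in modulus. On each side of [x0] such points have
    mutual distance at most [w = 2 y rho / lev k]. Being [y]-separated, they number at most
    [1 + 2 w / y] per side, in all at most [10 rho / lev k]. *)
Lemma bucket_cnt (G : set M4) r al y (n k j : nat) (rho := Num.sqrt (r / y)) :
  cusp_at_infty G -> 0 < r -> r <= 1000^-1 -> 0 < y -> lev k <= rho ->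
  finite_set (bucket G r al y n k j) /\ cnt R (bucket G r al y n k j) <= 10 * rho / lev k.
Proof.
move=> cG r0 r1 y0 krho.
have rho2 : rho ^+ 2 = r / y by rewrite sqr_sqrtr// divr_ge0// ltW.
pose px (i : nat) : R := al + i%:R * y.
set B := bucket G r al y n k j.
set X := lev k ^+ 2.
have l0 := lev_gt0 k.
have X0 : 0 < X by rewrite exprn_gt0.
have rl : 1 <= rho / lev k by rewrite ler_pdivlMr// mul1r.
have [->|/set0P[i0 [i0n [m0 s0 /andP[X1 X2]] t0]]] := eqVneq (B) set0.
  by rewrite cnt0; split=> //; exact: divr_ge0 (mulr_ge0 (ler0n _ _) (sqrtr_ge0 _)) (ltW l0).
pose x0 := (m0.1.1.1 - m0.2) / m0.1.2 / 2.
have c0 : 0 < m0.1.2 by exact: lt_le_trans X0 X1.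
pose q0 := m0.1.1.2 / m0.1.2 + x0 ^+ 2.
have bF i : B i -> `|q0 - (px i - x0) ^+ 2| <= r * y / X.
  move=> [_ [m sm /andP[X1' X2']] ti].
  have c0' : 0 < m.1.2 by exact: lt_le_trans X0 X1'.
  have dist : `|px i - px i0| <= (bigc * X)^-1.
    have tr (a : nat) : (Num.trunc (bigc * X * (a%:R * y)))%:R <= bigc * X * (a%:R * y)
        < (Num.trunc (bigc * X * (a%:R * y))).+1%:R.
      by apply: Num.Theory.truncn_itv; exact: mulr_ge0 (mulr_ge0 (ltW bigc_gt0) (ltW X0)) (mulr_ge0 (ler0n _ _) (ltW y0)).
    have /andP[u1 u2] := tr i; have /andP[v1 v2] := tr i0.
    move: u1 u2 v1 v2; rewrite -/X in ti t0; rewrite ti t0 /px => u1 u2 v1 v2.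
    have p0 : 0 < bigc * X by exact: mulr_gt0 bigc_gt0 X0.
    rewrite -[leLHS](mulKf (lt0r_neq0 p0)) -[leRHS]mulr1 ler_pM2l ?invr_gt0//.
    rewrite -{1}(gtr0_norm p0) -normrM ler_norml; move: u1 u2 v1 v2; rewrite -natr1; clear => *.
    by apply/andP; split; lra.
  have [e1 e2] := short_commute cG y0 X0 r1 sm s0 (introT andP (conj X1' X2')) (introT andP (conj X1 X2)) dist.
  have [_ _ _ [_ _ f1]] := sm.
  have qE : q0 - (px i - x0) ^+ 2 = (m.1.1.2 + (m.1.1.1 - m.2) * px i - m.1.2 * px i ^+ 2) / m.1.2.
    have e1' : m0.1.1.2 / m0.1.2 = m.1.1.2 / m.1.2.
      by apply/eqP; rewrite (eqr_div _ _ (lt0r_neq0 c0) (lt0r_neq0 c0')) -e1 eqxx.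
    have e2' : (m0.1.1.1 - m0.2) / m0.1.2 = (m.1.1.1 - m.2) / m.1.2.
      by apply/eqP; rewrite (eqr_div _ _ (lt0r_neq0 c0) (lt0r_neq0 c0')) -e2 eqxx.
    rewrite /q0 e1' /x0 e2'; field; exact: lt0r_neq0.
  rewrite qE normrM normfV (gtr0_norm c0') ler_pdivrMr//.
  apply: (le_trans f1); rewrite mulrAC ler_pdivlMr// ler_pM2l//; exact: mulr_gt0.
pose w := 2 * y * rho / lev k.
have w0 : 0 <= w by exact: divr_ge0 (mulr_ge0 (mulr_ge0 (ler0n _ _) (ltW y0)) (sqrtr_ge0 _)) (ltW l0).
have w2 : 4 * (r * y / X) = w ^+ 2.
  rewrite /w /X; have -> : r = rho ^+ 2 * y by rewrite rho2 divfK ?gt_eqF.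
  move: (lt0r_neq0 l0); move: (lev k) => l ln; field; exact: ln.
have sep i i' : B i -> B i' -> i <> i' -> y <= `|px i - px i'|.
  move=> _ _ ii; rewrite /px opprD addrACA subrr add0r -mulrBl normrM (gtr0_norm y0).
  rewrite ler_peMl ?(ltW y0)//.
  rewrite -[i%:R]/(i%:Z%:~R) -[i'%:R]/(i'%:Z%:~R) -intrB -intr_norm -[1]/(1%:~R) ler_int.
  by rewrite -gtz0_ge1 normr_gt0 subr_eq0; apply/eqP => -[].
(* Two numbers of the same sign satisfy [(x - x')^2 <= |x^2 - x'^2|]; hence the separate treatment
   of the two sides of [x0]. *)
have half (P : R -> bool) :
   (forall x x' : R, P x -> P x' -> (x - x') ^+ 2 <= `|x ^+ 2 - x' ^+ 2|) ->
   let A := [set i | B i /\ P (px i - x0)] in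
   finite_set A /\ cnt R A <= 1 + 2 * w / y.
  move=> hP A; apply: (@cnt_separated_diam _ _ _ px) => //; last first.
    by move=> i i' [b1 _] [b2 _]; exact: sep.
  move=> i i' [b1 p1] [b2 p2].
  rewrite -(@ler_pXn2r _ 2)// ?nnegrE//.
  rewrite real_normK ?num_real//.
  have -> : px i - px i' = (px i - x0) - (px i' - x0) by ring.
  apply: le_trans (hP _ _ p1 p2) _; rewrite -w2.
  have := ler_normB (q0 - (px i' - x0) ^+ 2) (q0 - (px i - x0) ^+ 2).
  rewrite (_ : _ - _ - (_ - _) = (px i - x0) ^+ 2 - (px i' - x0) ^+ 2); last ring.
  move: (bF _ b1) (bF _ b2); move: (px i) (px i') => u v.
  have := mulr_ge0 (mulr_ge0 (ltW r0) (ltW y0)) (ltW (_ : 0 < X^-1)); rewrite invr_gt0 => /(_ X0).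
  clear; lra.
have [fA cA] : finite_set [set i | B i /\ 0 <= px i - x0] /\
   cnt R [set i | B i /\ 0 <= px i - x0] <= 1 + 2 * w / y.
  apply: (half (fun x => 0 <= x)) => x x' h h'.
  rewrite subr_sqr normrM -[leLHS]ger0_norm ?sqr_ge0// expr2 normrM.
  rewrite ler_wpM2l// (ger0_norm (addr_ge0 h h')) ler_norml; move: h h'; clear => *.
  by apply/andP; split; lra.
have [fB cB] : finite_set [set i | B i /\ px i - x0 < 0] /\
   cnt R [set i | B i /\ px i - x0 < 0] <= 1 + 2 * w / y.
  apply: (half (fun x => x < 0)) => x x' h h'.
  rewrite subr_sqr normrM -[leLHS]ger0_norm ?sqr_ge0// expr2 normrM.
  rewrite ler_wpM2l// (_ : `|x + x'| = - x - x').
    by rewrite ler_norml; move: h h'; clear => *; apply/andP; split; lra.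
  by rewrite ltr0_norm ?opprD//; move: h h'; clear; lra.
have E : B = [set i | B i /\ 0 <= px i - x0] `|` [set i | B i /\ px i - x0 < 0].
  apply/seteqP; split=> [i bi|i [[]|[]]//].
  by case: (leP 0 (px i - x0)) => h; [left|right].
rewrite E; split; first by rewrite finite_setU.
apply: (le_trans (cntU_le R fA fB)); apply: (le_trans (lerD cA cB)).
have -> : 2 * w / y = 4 * (rho / lev k).
  by rewrite /w; field; rewrite !gt_eqF.
rewrite -[leRHS]mulrA; move: rl; clear; lra.
Qed.

(** Since [c y <= r], only levels with [lev k <= rho] occur, and level [k] has at most
    [1 + 1000 lev k ^ 2 n y] buckets. The geometric sums of [1 / lev k] and of [lev k] yield the two
    terms, the second through [rho^2 y = r]. Thin points are therefore a small fraction once [r] is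
    small and [n] is much larger than [y^(-1/2)]. *)
Lemma thin_count (G : set M4) r al y (n : nat) (rho := Num.sqrt (r / y)) :
  cusp_at_infty G -> 0 < r -> r <= 1000^-1 -> 0 < y -> y <= 1 ->
  cnt R [set i | (i < n)%N /\ thin G r (geo (al + i%:R * y) y)] <=
    (4 * 1000) * rho + (20 * 1000) * (n%:R * r).
Proof.
rewrite -bigcE.
move=> cG r0; rewrite bigcE => r1 y0 y1; rewrite -bigcE.
have rho_gt0 : 0 < rho by rewrite sqrtr_gt0 divr_gt0.
have rho2 : rho ^+ 2 = r / y by rewrite sqr_sqrtr// divr_ge0// ltW.
pose bucket := bucket G r al y n.
have bucket_cnt k j := @bucket_cnt G r al y n k j cG r0 r1 y0.
have exK : exists k, rho < lev k.
  exists (Num.trunc (rho * 200)).+1; rewrite /lev (ltr_pdivlMr _ _ (ltr0Sn R 199)).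
  apply: lt_le_trans (Num.Theory.truncnS_gt _) _.
  by rewrite -natrX ler_nat ltnW// ltn_expl.
have [K hK Kmin] := ex_minnP exK.
have Kle k : (k < K)%N -> lev k <= rho.
  by move=> kK; rewrite leNgt; apply/negP => /Kmin; rewrite leqNgt kK.
pose J k := (Num.trunc (bigc * lev k ^+ 2 * (n%:R * y))).+1.
pose L k := \bigcup_(j in `I_(J k)) bucket k j.
have fL k : (k < K)%N -> finite_set (L k).
  by move=> kK; apply: finite_bigcup_lt => j _; have [] := bucket_cnt _ j (Kle _ kK).
have cL k : (k < K)%N -> cnt R (L k) <= (10 * rho) / lev k + (10 * bigc) * (n%:R * y * rho) * lev k.
  move=> kK; have l0 := lev_gt0 k.
  apply: (le_trans (@cnt_bigcup_le R _ (J k) (bucket k) _)).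
    by move=> j _; have [] := bucket_cnt _ j (Kle _ kK).
  apply: (@le_trans _ _ (\sum_(j < J k) (10 * rho / lev k))).
    by apply: ler_sum => j _; have [] := bucket_cnt _ j (Kle _ kK).
  rewrite sumr_const card_ord -[_ *+ J k]mulr_natr.
  have JB : (J k)%:R <= 1 + bigc * lev k ^+ 2 * (n%:R * y).
    rewrite -natr1 addrC lerD2l Num.Theory.truncn_le.
    exact: mulr_ge0 (mulr_ge0 (ltW bigc_gt0) (sqr_ge0 _)) (mulr_ge0 (ler0n _ _) (ltW y0)).
  have c0 : 0 <= 10 * rho / lev k by exact: divr_ge0 (mulr_ge0 (ler0n _ _) (ltW rho_gt0)) (ltW l0).
  apply: le_trans (ler_wpM2l c0 JB) _.
  rewrite le_eqVlt; apply/orP; left; apply/eqP.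
  by field; rewrite gt_eqF.
have sub : [set i | (i < n)%N /\ thin G r (geo (al + i%:R * y) y)] `<=` \bigcup_(k in `I_K) L k.
  move=> i [iN ti].
  have [m sm] := thin_short cG y0 r1 y1 ti.
  have [_ cl cy _] := sm.
  have [k hk] := lev_exists cl.
  exists k => /=.
    rewrite ltnNge; apply/negP => Kk.
    have : rho ^+ 2 < lev k ^+ 2.
      rewrite ltr_pXn2r// ?nnegrE ?(ltW rho_gt0) ?(ltW (lev_gt0 k))//.
      exact: lt_le_trans hK (lev_le Kk).
    rewrite rho2 ltr_pdivrMr// => h.
    have : lev k ^+ 2 * y <= m.1.2 * y by rewrite ler_pM2r//; have /andP[] := hk.
    by move: h cy; clear; lra.
  exists (Num.trunc (bigc * lev k ^+ 2 * (i%:R * y))) => //=.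
    rewrite ltnS; apply: Num.Theory.le_truncn; apply: ler_wpM2l.
      exact: mulr_ge0 (ltW bigc_gt0) (sqr_ge0 _).
    by rewrite ler_pM2r// ler_nat ltnW.
  by split=> //; exists m.
apply: (le_trans (@cnt_le R _ _ _ _ sub)); first exact: finite_bigcup_lt.
apply: (le_trans (@cnt_bigcup_le R _ K L fL)).
apply: (@le_trans _ _ (\sum_(k < K) ((10 * rho) / lev k + (10 * bigc) * (n%:R * y * rho) * lev k))).
  by apply: ler_sum => k _; exact: cL.
rewrite big_split /= -!mulr_sumr.
have h1 : 10 * rho * \sum_(k < K) (lev k)^-1 <= 10 * rho * 400.
  by rewrite ler_wpM2l ?sum_lev_inv// mulr_ge0 ?ler0n ?(ltW rho_gt0).
have s2 : \sum_(k < K) lev k <= 2 * rho.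
  case: (K) Kle => [_|K' /(_ K' (ltnSn _)) h]; first by rewrite big_ord0 mulr_ge0// ltW.
  by apply: le_trans (sum_lev _) _; rewrite levS ler_pM2l.
have h2 : (10 * bigc) * (n%:R * y * rho) * \sum_(k < K) lev k <= (10 * bigc) * (n%:R * y * rho) * (2 * rho).
  by rewrite ler_wpM2l// !mulr_ge0 ?ler0n ?(ltW rho_gt0) ?(ltW y0) ?(ltW bigc_gt0).
apply: le_trans (lerD h1 h2) _.
rewrite le_eqVlt; apply/orP; left; apply/eqP.
rewrite (_ : (10 * bigc) * (n%:R * y * rho) * (2 * rho) = (20 * bigc) * (n%:R * (rho ^+ 2 * y))); last ring.
by rewrite rho2 divfK ?gt_eqF// bigcE; ring.
Qed.

End Nondivergence.

(** * Haar measure *)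

Section OneDim.
Variable R : realType.
Local Notation leb := (@lebesgue_measure R).
Local Open Scope ereal_scope.

Lemma measurable_inv : measurable_fun [set: R] (fun x : R => x^-1)%R.
Proof.
have m0 : measurable [set~ (0%R : R)] by exact: measurableC.
rewrite -(setUv [set (0%R : R)]); apply/measurable_funU => //; split.
  exact: measurable_fun_set1.
apply: open_continuous_measurable_fun; first by rewrite openC; exact: closed_eq.
by move=> x; rewrite inE => /eqP x0; exact: inv_continuous.
Qed.

Lemma measurable_fun_inv d (T : measurableType d) (D : set T) (f : T -> R) :
  measurable_fun D f -> measurable_fun D (fun x => (f x)^-1)%R.
Proof. by move=> mf; apply: measurableT_comp mf; exact: measurable_inv. Qed.

(** Uniqueness of Lebesgue measure concerns the whole line, so [mu] on the positive half is glued
    with Lebesgue measure on the negative half. *)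
Lemma lebesgue_pos_unique (mu : {measure set (measurableTypeR R) -> \bar R}) :
  (forall b : R, (0 < b)%R -> mu `]0%R, b]%classic = b%:E) ->
  forall B : set R, measurable B -> mu (B `&` `]0%R, +oo[) = leb (B `&` `]0%R, +oo[).
Proof.
move=> hmu B mB.
have mpos : measurable (`]0%R, +oo[%classic : set (measurableTypeR R)) by exact: measurable_itv.
have mneg : measurable (`]-oo, 0%R]%classic : set (measurableTypeR R)) by exact: measurable_itv.
pose nu : {measure set (measurableTypeR R) -> \bar R} := measure_add (mrestr mu mpos) (mrestr leb mneg).
have nuE (A : set R) : nu A = mu (A `&` `]0%R, +oo[) + leb (A `&` `]-oo, 0%R]).
  exact: measure_addE.
have key : leb (B `&` `]0%R, +oo[) = nu (B `&` `]0%R, +oo[).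
  apply: (@lebesgue_measure_unique R nu); last exact: measurableI.
  move=> X [[a b] _ <-]; rewrite nuE /=.
  have [ab|ba] := ltP a b; last first.
    by rewrite set_itv_ge ?bnd_simp -?leNgt// !set0I !measure0 adde0.
  rewrite lebesgue_measure_itv /= lte_fin ab.
  have [b0|b0] := leP b 0%R.
    have -> : `]a, b] `&` `]0%R, +oo[ = set0 :> set R.
      apply/seteqP; split => x //=; rewrite !in_itv/= andbT => -[/andP[_ xb] x0].
      by have := lt_le_trans x0 xb; rewrite ltNge b0.
    have -> : `]a, b] `&` `]-oo, 0%R] = `]a, b]%classic :> set R.
      apply/setIidl => x /=; rewrite !in_itv/= => /andP[_ xb]; exact: le_trans b0.
    by rewrite measure0 add0e lebesgue_measure_itv /= lte_fin ab.
  have [a0|a0] := leP 0%R a.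
    have -> : `]a, b] `&` `]-oo, 0%R] = set0 :> set R.
      apply/seteqP; split => x //=; rewrite !in_itv/= => -[/andP[ax _] x0].
      by have := lt_le_trans ax x0; rewrite ltNge a0.
    have -> : `]a, b] `&` `]0%R, +oo[ = `]a, b]%classic :> set R.
      apply/setIidl => x /=; rewrite !in_itv/= andbT => /andP[xb _]; exact: le_lt_trans xb.
    rewrite measure0 adde0.
    have [a00|a0'] := leP a 0%R.
      have -> : a = 0%R by apply/eqP; rewrite eq_le a00.
      by rewrite hmu// sube0.
    have : mu `]0%R, b]%classic = mu `]0%R, a]%classic + mu `]a, b]%classic.
      rewrite -measureU//.
        congr (mu _); apply/seteqP; split=> x /=; rewrite !in_itv/=.
          move=> /andP[x0 xb]; have [xa|ax] := leP x a; [left|right]; first by rewrite x0.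
          by [].
        by move=> [/andP[-> xa]|/andP[ax ->]]; rewrite /= ?(le_trans xa (ltW ab))// (lt_trans a0').
      apply/seteqP; split => x //=; rewrite !in_itv/= => -[/andP[_ xa] /andP[ax _]].
      by move: (lt_le_trans ax xa); rewrite ltxx.
    rewrite !hmu// => h.
    have fin : mu `]a, b]%classic \is a fin_num.
      by move: h; case: (mu _) => //= r.
    rewrite -EFinB; move: h; rewrite -(fineK fin) -EFinD => -[h].
    by congr EFin; move: h; clear; lra.
  have -> : `]a, b] `&` `]0%R, +oo[ = `]0%R, b]%classic :> set R.
    apply/seteqP; split=> x /=; rewrite !in_itv/= andbT.
      by move=> [/andP[_ ->] ->].
    by move=> /andP[x0 xb]; rewrite xb (lt_trans a0 x0) x0.
  have -> : `]a, b] `&` `]-oo, 0%R] = `]a, 0%R]%classic :> set R.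
    apply/seteqP; split=> x /=; rewrite !in_itv/=.
      by move=> [/andP[-> _] ->].
    by move=> /andP[ax x0]; rewrite ax x0 (le_trans x0 (ltW b0)).
  rewrite hmu// lebesgue_measure_itv /= lte_fin a0 -EFinB -EFinB -EFinD.
  by congr EFin; ring.
rewrite key nuE.
have -> : B `&` `]0%R, +oo[ `&` `]-oo, 0%R] = set0 :> set R.
  apply/seteqP; split => x //=; rewrite !in_itv/= andbT => -[[_ x0] x0'].
  by have := lt_le_trans x0 x0'; rewrite ltxx.
by rewrite measure0 adde0 -setIA setIid.
Qed.

Lemma lebesgue_affine (a b : R) (A : set R) : a != 0%R -> measurable A ->
  leb ((fun x => a * x + b)%R @^-1` A) = `|a|^-1%:E * leb A.
Proof.
move=> a0 mA.
pose phi (x : measurableTypeR R) : measurableTypeR R := (a * x + b)%R.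
have mphi : measurable_fun [set: measurableTypeR R] phi.
  by apply: measurable_funD => //; apply: measurable_funM.
have na : (0 < `|a|)%R by rewrite normr_gt0.
pose nu0 : {measure set (measurableTypeR R) -> \bar R} := pushforward leb phi.
pose nu : {measure set (measurableTypeR R) -> \bar R} := mscale (NngNum (ltW na)) (nu0 mphi).
have H' (p q : R) : leb `]p, q]%classic = `|a|%:E * leb (phi @^-1` `]p, q]%classic).
  have [pq|qp] := ltP p q; last first.
    by rewrite set_itv_ge ?bnd_simp -?leNgt// preimage_set0 !measure0 mule0.
  rewrite lebesgue_measure_itv /= lte_fin pq.
  have [ap|an|ae] := ltgtP a 0%R; last by rewrite ae eqxx in a0.
    have -> : phi @^-1` `]p, q] = `[(q - b) / a, (p - b) / a[%classic%R.
      apply/seteqP; split=> x /=; rewrite /phi !in_itv/= ler_ndivrMr// ltr_ndivlMr// => /andP[h1 h2];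
      by apply/andP; split; move: h1 h2; clear; lra.
    rewrite lebesgue_measure_itv /= lte_fin ltr_ndivrMr// divfK//.
    rewrite ltrD2r pq ltr0_norm// -!EFinB -EFinM; congr EFin; field; exact: a0.
  have -> : phi @^-1` `]p, q] = `](p - b) / a, (q - b) / a]%classic%R.
    apply/seteqP; split=> x /=; rewrite /phi !in_itv/= ler_pdivlMr// ltr_pdivrMr// => /andP[h1 h2];
    by apply/andP; split; move: h1 h2; clear; lra.
  rewrite lebesgue_measure_itv /= lte_fin ltr_pdivrMr// divfK//.
  rewrite ltrD2r pq gtr0_norm// -!EFinB -EFinM; congr EFin; field; exact: a0.
have H : forall X, ocitv X -> leb X = nu X by move=> X [[p q] _ <-]; exact: H'.
have -> : leb A = `|a|%:E * leb (phi @^-1` A) := lebesgue_measure_unique H mA.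
by rewrite muleA -EFinM mulVf ?mul1e// gt_eqF.
Qed.

Lemma integral_affine (a b : R) (f : R -> \bar R) : a != 0%R ->
  measurable_fun setT f -> (forall x, 0 <= f x) ->
  \int[leb]_x f (a * x + b)%R = `|a|^-1%:E * \int[leb]_x f x.
Proof.
move=> a0 mf f0.
pose phi (x : measurableTypeR R) : measurableTypeR R := (a * x + b)%R.
have mphi : measurable_fun [set: measurableTypeR R] phi.
  by apply: measurable_funD => //; apply: measurable_funM.
have := ge0_integral_pushforward mphi leb measurableT mf (fun y _ => f0 y).
rewrite preimage_setT => /= <-.
have na : (0 <= `|a|^-1)%R by rewrite invr_ge0.
rewrite -[X in X%:E * _]/((NngNum na)%:num) -ge0_integral_mscale//.
apply: eq_measure_integral => A mA _.
exact: lebesgue_affine.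
Qed.

Lemma integral_shift (b : R) (f : R -> \bar R) :
  measurable_fun setT f -> (forall x, 0 <= f x) ->
  \int[leb]_x f (x + b)%R = \int[leb]_x f x.
Proof.
move=> mf f0; have := @integral_affine 1%R b f (oner_neq0 _) mf f0.
rewrite normr1 invr1 mul1e => <-; apply: eq_integral => x _.
by rewrite mul1r.
Qed.

End OneDim.

(** * Law of the squared norm in the plane, and inversion on the half line *)

Section Radial.
Variable R : realType.
Local Notation RM := (measurableTypeR R).
Local Notation leb := (@lebesgue_measure R).
Local Notation leb2 := (leb \x leb)%E.
Local Open Scope ereal_scope.

Lemma eq_integral_off0 (f g : RM -> \bar R) :
  measurable_fun setT f -> measurable_fun setT g ->
  (forall x, 0 <= f x) -> (forall x, 0 <= g x) ->
  (forall x : R, x != 0%R -> f x = g x) ->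
  \int[leb]_x f x = \int[leb]_x g x.
Proof.
move=> mf mg f0 g0 fg; apply: ge0_ae_eq_integral => //.
exists [set 0%R]; split => //.
  exact: lebesgue_measure_set1.
move=> x /=; apply: contra_notP => /eqP x0 _; exact: fg.
Qed.

Lemma integral_id_pos (S : R) : (0 < S)%R ->
  \int[leb]_(c in `]0%R, S]) c%:E = (S ^+ 2 / 2)%:E.
Proof.
move=> S0; rewrite integral_itv_obnd_cbnd//=.
rewrite (@continuous_FTC2 _ (fun c => c) (fun c => c ^+ 2 / 2)%R)//.
- by rewrite expr0n/= mul0r sube0.
- by apply: continuous_subspaceT => x; exact: cvg_id.
- split.
  + by move=> x _; apply: ex_derive.
  + by apply: cvg_at_right_filter; apply: cvgM; [exact: exprn_continuous|exact: cvg_cst].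
  + by apply: cvg_at_left_filter; apply: cvgM; [exact: exprn_continuous|exact: cvg_cst].
- move=> x _; rewrite derive1E.
  have -> : (fun c : R => (c ^+ 2 / 2)%R) = (fun c => 2^-1 *: (c ^+ 2))%R.
    by apply/funext => c; rewrite mulrC.
  by rewrite deriveZ//= exp_derive /GRing.scale /= mulr1 expr1 mulrA mulVf ?mul1r.
Qed.

Definition nsq (v : RM * RM) : RM := (v.1 ^+ 2 + v.2 ^+ 2)%R.

Lemma measurable_nsq : measurable_fun setT nsq.
Proof.
by apply: measurable_funD; apply: measurable_funX; [exact: measurable_fst|exact: measurable_snd].
Qed.

(** The substitution [d = c t] in the inner integral, with Jacobian [|c|], followed by an exchange
    of the integrals, leaves [s / (1 + t^2)] to integrate over the line. *)
Lemma disk_area (s : R) : (0 < s)%R -> leb2 (nsq @^-1` `]0%R, s]%classic) = (pi * s)%:E.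
Proof.
move=> s0; set A := nsq @^-1` _.
have mA : measurable A.
  by rewrite -[A]setTI; apply: measurable_nsq => //; exact: measurable_itv.
rewrite -[A]setIT -(@integral_indic _ _ _ leb2 setT)//.
have mI : measurable_fun setT (fun v : RM * RM => (\1_A v)%:E : \bar R).
  by apply/measurable_EFinP; exact: measurable_indic.
rewrite fubini_tonelli1//= /fubini_F.
pose H (v : RM * RM) := (`|v.1| * \1_A (v.1, v.1 * v.2))%:E.
have mH : measurable_fun setT H.
  apply/measurable_EFinP; apply: measurable_funM.
    by apply: measurableT_comp => //; exact: measurable_fst.
  apply: measurableT_comp; first exact: measurable_indic.
  apply: measurable_fun_pair; first exact: measurable_fst.
  by apply: measurable_funM; [exact: measurable_fst|exact: measurable_snd].
have H0 v : 0 <= H v by rewrite lee_fin mulr_ge0.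
transitivity (\int[leb]_c \int[leb]_t H (c, t)).
  apply: eq_integral_off0.
  - by apply: (measurable_fun_fubini_tonelli_F _ mI) => v; rewrite lee_fin.
  - exact: (measurable_fun_fubini_tonelli_F _ mH).
  - by move=> c; apply: integral_ge0 => d _; rewrite lee_fin.
  - by move=> c; apply: integral_ge0.
  - move=> c c0.
    have mIc : measurable_fun setT (fun d : RM => (\1_A (c, d))%:E : \bar R).
      by apply: (measurableT_comp mI); exact: measurable_pair1.
    have Aff := @integral_affine R c 0%R (fun d => (\1_A (c, d))%:E) c0 mIc (fun d => _).
    transitivity (`|c|%:E * \int[leb]_t (\1_A (c, c * t + 0)%R)%:E).
      rewrite Aff; last by move=> d; rewrite lee_fin.
      by rewrite muleA -EFinM mulfV ?mul1e// normr_eq0.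
    have mIt : measurable_fun setT (fun t : RM => (\1_A (c, (c * t + 0)%R))%:E : \bar R).
      apply: (measurableT_comp mIc).
      by apply: measurable_funD => //; exact: measurable_funM.
    rewrite -ge0_integralZl//; try by move=> t _; rewrite lee_fin.
    by apply: eq_integral => t _; rewrite addr0 -EFinM.
rewrite (fubini_tonelli H)//=.
transitivity (\int[leb]_t (s * (oneDsqr t)^-1)%:E).
  apply: eq_integral => t _; rewrite /fubini_G /H /=.
  set q := oneDsqr t; have q0 : (0 < q)%R by rewrite /q /oneDsqr ltr_wpDr// sqr_ge0.
  pose rho := Num.sqrt (s / q).
  have rho0 : (0 < rho)%R by rewrite sqrtr_gt0 divr_gt0.
  have rho2 : (rho ^+ 2 = s / q)%R by rewrite sqr_sqrtr// divr_ge0// ltW.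
  pose p (c : RM) : \bar R := (c * \1_(`]0%R, rho]%classic) c)%:E.
  have mp : measurable_fun setT p.
    apply/measurable_EFinP; apply: measurable_funM => //.
  have p0 c : 0 <= p c.
    rewrite /p lee_fin indicE; case: (boolP (c \in _)); last by rewrite mulr0.
    by rewrite inE /= in_itv /= => /andP[c0 _]; rewrite mulr1 ltW.
  have E c : (`|c| * \1_A (c, (c * t)%R))%:E = p c + p (- 1 * c + 0)%R.
    rewrite /p mulN1r addr0 -EFinD; congr EFin.
    have AE : ((c, (c * t)%R) \in A) = (0%R < `|c| <= rho)%R.
      have -> : ((c, (c * t)%R) \in A) = (nsq (c, (c * t)%R) \in `]0%R, s]).
        by apply/idP/idP => [/set_mem|h]; [|apply/mem_set].
      rewrite /nsq /= in_itv /= (_ : c ^+ 2 + (c * t) ^+ 2 = c ^+ 2 * q)%R; last by rewrite /q /oneDsqr; ring.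
      rewrite pmulr_lgt0// -ler_pdivlMr// -rho2 -[(c ^+ 2)%R]real_normK ?num_real//.
      rewrite ler_pXn2r// ?nnegrE// ?(ltW rho0)//.
      by rewrite exprn_even_gt0//= normr_eq0 normr_gt0.
    have IE (u : RM) : (u \in (`]0%R, rho]%classic : set RM)) = (0 < u <= rho)%R.
      by apply/idP/idP => [/set_mem|h]; [|apply/mem_set]; rewrite /= in_itv.
    rewrite !indicE AE !IE.
    have [c0|c0|->] := ltgtP c 0%R.
    - by rewrite /= mulr0 add0r ltr0_norm// oppr_gt0 c0.
    - by rewrite gtr0_norm// c0 /= oppr_gt0 ltNge (ltW c0) /= mulr0 addr0.
    - by rewrite normr0 !mul0r oppr0 mul0r addr0.
  under eq_integral do rewrite E.
  rewrite ge0_integralD//; last first.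
    apply: (measurableT_comp mp); apply: measurable_funD => //; exact: measurable_funM.
  rewrite integral_affine ?oppr_eq0 ?oner_neq0//.
  rewrite normrN normr1 invr1 mul1e.
  have -> : \int[leb]_c p c = (rho ^+ 2 / 2)%:E.
    rewrite -integral_id_pos// [RHS]integral_mkcond.
    apply: eq_integral => c _; rewrite /p patchE indicE.
    by case: ifP => _; rewrite ?mulr1 ?mulr0.
  by rewrite -EFinD -splitr rho2.
under eq_integral do rewrite EFinM.
have mq : measurable_fun setT (fun t : RM => ((oneDsqr t)^-1)%:E : \bar R).
  apply/measurable_EFinP; apply: continuous_measurable_fun.
  exact: continuous_oneDsqrV.
rewrite ge0_integralZl//; last by rewrite lee_fin ltW.
rewrite (@ge0_symfun_integralT R (fun t => (oneDsqr t)^-1)%R)//; last 2 first.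
  - exact: continuous_oneDsqrV.
  - by move=> t /=; rewrite /oneDsqr sqrrN.
rewrite -set_itvcy integral0y_oneDsqr -!EFinM; congr EFin.
by rewrite mulrC; congr (_ * _)%R; field.
Qed.

(** Takes the place of polar coordinates: only the law of the squared norm is needed, and discs
    determine it. *)
Lemma leb2_radial (B : set RM) : measurable B -> B `<=` `]0%R, +oo[%classic ->
  leb2 (nsq @^-1` B) = pi%:E * leb B.
Proof.
move=> mB Bpos.
have pi0 : (0 <= pi^-1 :> R)%R by rewrite invr_ge0 pi_ge0.
have pin0 : (pi : R) != 0%R by rewrite gt_eqF// pi_gt0.
pose nu0 : {measure set RM -> \bar R} := pushforward leb2 nsq.
pose nu : {measure set RM -> \bar R} := mscale (NngNum pi0) (nu0 measurable_nsq).
have nuE (A : set RM) : nu A = pi^-1%:E * leb2 (nsq @^-1` A) by [].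
have := @lebesgue_pos_unique R nu _ B mB.
rewrite nuE (setIidl Bpos) => <-; first by rewrite muleA -EFinM mulfV// mul1e.
by move=> b b0; rewrite nuE disk_area// -EFinM mulrA mulVf// mul1r.
Qed.

(* y^-2 dy on the half line is the image of Lebesgue measure under inversion. *)
Lemma leb_inv (A : set RM) : measurable A -> A `<=` `]0%R, +oo[%classic ->
  leb ((fun s : RM => (s^-1)%R : RM) @^-1` A) = \int[leb]_(y in A) (y ^- 2)%:E.
Proof.
move=> mA Apos.
pose w (y : RM) : \bar R := (y ^- 2)%:E.
have mw : measurable_fun setT w.
  apply/measurable_EFinP; apply: measurable_fun_inv; exact: measurable_funX.
have w0 y : 0 <= w y by rewrite lee_fin invr_ge0 sqr_ge0.
pose W := fun A : set RM => \int[leb]_(y in A) w y.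
have W0 : W set0 = 0 by rewrite /W integral_set0.
have Wge0 X : 0 <= W X by apply: integral_ge0.
have Wadd : semi_sigma_additive W := semi_sigma_additive_nng_induced mw w0.
pose Wmx := isMeasure.Build _ RM R W W0 Wge0 Wadd.
pose Wm : {measure set RM -> \bar R} := HB.pack W Wmx.
pose iv (s : RM) : RM := (s^-1)%R.
have miv : measurable_fun [set: RM] iv by exact: measurable_inv.
pose mu0 : {measure set RM -> \bar R} := pushforward Wm iv.
have mivA : measurable (iv @^-1` A) by rewrite -[_ @^-1` _]setTI; exact: miv.
have ivK (s : RM) : iv (iv s) = s by rewrite /iv invrK.
have := @lebesgue_pos_unique R (mu0 miv) _ (iv @^-1` A) mivA.
have -> : iv @^-1` A `&` `]0%R, +oo[ = iv @^-1` A.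
  apply/setIidl => s /= /Apos /=; rewrite !in_itv /= !andbT /iv invr_gt0; exact.
move=> <-.
  by rewrite /mu0 /= /pushforward /= /W; congr integral; apply/seteqP; split => y /=; rewrite ivK.
move=> b b0; rewrite /mu0 /= /pushforward /= /W.
have -> : iv @^-1` `]0%R, b]%classic = `[b^-1, +oo[%classic%R.
  apply/seteqP; split=> y /=; rewrite /iv !in_itv /= andbT invr_gt0.
    by move=> /andP[y0 yb]; rewrite -lef_pV2 ?posrE ?invr_gt0// invrK.
  move=> by0; have y0 : (0 < y)%R by apply: lt_le_trans by0; rewrite invr_gt0.
  by rewrite y0 /= -[b]invrK lef_pV2 ?posrE ?invr_gt0.
rewrite (@ge0_continuous_FTC2y _ (fun y => y ^- 2) (fun y => - y^-1)%R _ 0%R)//.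
- by rewrite -EFinB invrK sub0r opprK.
- by move=> x _; rewrite invr_ge0 sqr_ge0.
- apply: continuous_in_subspaceT => x; rewrite inE /= in_itv /= andbT => bx.
  have x0 : x != 0%R by rewrite gt_eqF// (lt_le_trans _ bx)// invr_gt0.
  apply: (@continuous_comp _ _ _ (fun y : R => y ^+ 2)%R (fun y : R => y^-1)%R).
    exact: exprn_continuous.
  by apply: inv_continuous; rewrite expf_neq0.
- rewrite -oppr0; apply: cvgN.
  by apply/(@gtr0_cvgV0 _ _ _ _ (fun x : R => x)); [exists 0%R; split|exact: cvg_id].
- move=> x bx; have x0 : x != 0%R by rewrite gt_eqF// (lt_trans _ bx)// invr_gt0.
  by apply: derivableN; apply: derivableV.
- apply: cvgN; apply: cvg_at_right_filter; apply: inv_continuous.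
  by rewrite invr_neq0// gt_eqF.
- move=> x; rewrite in_itv /= andbT => bx.
  have x0 : x != 0%R by rewrite gt_eqF// (lt_trans _ bx)// invr_gt0.
  rewrite derive1E deriveN; last exact: derivableV.
  by rewrite deriveV//= derive_id /GRing.scale /= mulr1 opprK.
Qed.

End Radial.

Section SigmaFinite.
Local Open Scope ereal_scope.
Context d1 d2 (T1 : measurableType d1) (T2 : measurableType d2) (R : realType).
Variable m1 : {sigma_finite_measure set T1 -> \bar R}.
Variable m2 : {sigma_finite_measure set T2 -> \bar R}.

Lemma product_measure_sigma_finite : sigma_finite setT (m1 \x m2).
Proof.
have /sigma_finiteP[F [TF ndF Foo]] := sigma_finiteT m1.
have /sigma_finiteP[G [TG ndG Goo]] := sigma_finiteT m2.
exists (fun n => F n `*` G n).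
  rewrite -setXTT TF TG predeqE => -[x y]; split.
    move=> [/= [n _ Fnx] [k _ Gky]]; exists (maxn n k) => //; split.
    - by move: x Fnx; exact/subsetPset/ndF/leq_maxl.
    - by move: y Gky; exact/subsetPset/ndG/leq_maxr.
  by move=> [n _ []/= ? ?]; split; exists n.
move=> k; have [? ?] := Foo k; have [? ?] := Goo k.
split; first exact: measurableX.
by rewrite product_measure1E// lte_mul_pinfty// ge0_fin_numE.
Qed.
End SigmaFinite.

Section LebesgueProducts.
Variable R : realType.
Local Notation RM := (measurableTypeR R).
Local Notation leb := (@lebesgue_measure R).
Local Open Scope ereal_scope.
(** Repacked with its sigma-finiteness so that the product can be iterated and Tonelli's theorem
    applied to it. *)
Definition L2 : {sigma_finite_measure set (RM * RM)%type -> \bar R} :=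
  HB.pack (leb \x leb) (Measure_isSigmaFinite.Build _ _ _ (leb \x leb) (product_measure_sigma_finite leb leb)).
Definition L3 : {sigma_finite_measure set (RM * RM * RM)%type -> \bar R} :=
  HB.pack (L2 \x leb) (Measure_isSigmaFinite.Build _ _ _ (L2 \x leb) (product_measure_sigma_finite L2 leb)).
Lemma L3_fubini (f : RM * RM * RM -> \bar R) : measurable_fun setT f -> (forall p, 0 <= f p) ->
  \int[L3]_p f p = \int[L2]_v \int[leb]_x f (v, x).
Proof. by move=> mf f0; exact: (fubini_tonelli1 f mf f0). Qed.
Lemma L2_fubini1 (f : RM * RM -> \bar R) : measurable_fun setT f -> (forall p, 0 <= f p) ->
  \int[L2]_v f v = \int[leb]_x \int[leb]_y f (x, y).
Proof. by move=> mf f0; exact: (fubini_tonelli1 f mf f0). Qed.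
Lemma L2_fubini2 (f : RM * RM -> \bar R) : measurable_fun setT f -> (forall p, 0 <= f p) ->
  \int[L2]_v f v = \int[leb]_y \int[leb]_x f (x, y).
Proof. by move=> mf f0; exact: (fubini_tonelli2 f mf f0). Qed.
Lemma L3_fubini2 (f : RM * RM * RM -> \bar R) : measurable_fun setT f -> (forall p, 0 <= f p) ->
  \int[L3]_p f p = \int[leb]_x \int[L2]_v f (v, x).
Proof. by move=> mf f0; exact: (fubini_tonelli2 f mf f0). Qed.
End LebesgueProducts.

(** * Haar measure of SL_2 in the coordinates bottom row and abscissa *)

Section Haar.
Variable R : realType.
Local Notation RM := (measurableTypeR R).
Local Notation M4 := (RM * RM * RM * RM)%type.
Local Notation leb := (@lebesgue_measure R).
Local Notation leb2 := (L2 R).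
Local Notation leb3 := (L3 R).

(** The determinant 1 matrix with bottom row [v] that sends [i] to a point of real part [x]. At
    [v = 0] the convention [0^-1 = 0] yields the zero matrix, which is outside the group but has
    measure zero. *)
Definition mat (p : RM * RM * RM) : M4 :=
  (p.2 * p.1.1 + p.1.2 * (nsq p.1)^-1, p.2 * p.1.2 - p.1.1 * (nsq p.1)^-1, p.1.1, p.1.2).
(** For determinant 1, [xc m + i yc m] is the image of [i] under [m]. *)
Definition xc (m : M4) : RM := (m.1.1.1 * m.1.2 + m.1.1.2 * m.2) / nsq (bot m).
Definition yc (m : M4) : RM := (nsq (bot m))^-1.

Lemma nsq_gt0 (v : RM * RM) : v != 0 -> 0 < nsq v.
Proof.
case: v => c d; rewrite /nsq /= => h; rewrite lt_def addr_ge0 ?sqr_ge0// andbT.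
rewrite paddr_eq0 ?sqr_ge0// !sqrf_eq0; apply: contra h => /andP[/eqP -> /eqP ->].
exact: eqxx.
Qed.

Lemma bot_mat v x : bot (mat (v, x)) = v.
Proof. by case: v. Qed.

Lemma mat0 x : mat (0, x) = (0, 0, 0, 0).
Proof. by rewrite /mat /=; congr (_, _, _, _); rewrite ?mulr0 ?mul0r ?addr0 ?subr0. Qed.

Lemma det_mat v x : v != 0 -> det4 (mat (v, x)) = 1.
Proof.
move=> /nsq_gt0; case: v => c d h; rewrite /det4 /mat /=.
rewrite (_ : _ - _ = nsq (c, d) * (nsq (c, d))^-1); last by rewrite /nsq /=; ring.
by rewrite mulfV// gt_eqF.
Qed.

Lemma det4_bot (m : M4) : det4 m = 1 -> bot m != 0.
Proof.
case: m => [[[a b] c] d] h; apply/eqP => -[c0 d0]; move: h.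
by rewrite /det4 /= c0 d0 !mulr0 subr0 => /eqP; rewrite eq_sym oner_eq0.
Qed.

Lemma matK (m : M4) : det4 m = 1 -> mat (bot m, xc m) = m.
Proof.
move=> dm; have := nsq_gt0 (det4_bot dm).
case: m dm => [[[a b] c] d]; rewrite /det4 /xc /mat /= => dm h.
have q0 : nsq (bot (a, b, c, d)) != 0 by rewrite gt_eqF.
have qE : nsq (bot (a, b, c, d)) = c ^+ 2 + d ^+ 2 by [].
have e : b * c = a * d - 1 by rewrite -dm; ring.
have e' : a * d = b * c + 1 by rewrite -dm; ring.
congr (_, _, _, _).
- apply: (mulIf q0); rewrite mulrDl -!mulrA mulVf// [_^-1 * (c * _)]mulrCA [_^-1 * _]mulVf// !mulr1.
  transitivity (a * c ^+ 2 + d * (b * c) + d); first by ring.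
  by rewrite e qE; ring.
- apply: (mulIf q0); rewrite mulrBl -!mulrA mulVf// [_^-1 * (d * _)]mulrCA [_^-1 * _]mulVf// !mulr1.
  transitivity (c * (a * d) + b * d ^+ 2 - c); first by ring.
  by rewrite e' qE; ring.
Qed.

Lemma mat_upper v x : mat (v, x) = mul4 (upper4 x) (mat (v, 0)).
Proof. by rewrite /mat /mul4 /=; congr (_, _, _, _); ring. Qed.

Lemma xc_mat v x : v != 0 -> xc (mat (v, x)) = x.
Proof.
move=> v0; have := matK (det_mat x v0); rewrite bot_mat.
rewrite (mat_upper _ (xc _)) (mat_upper _ x).
move/mul4_injr => /(_ (det_mat 0 v0)).
by move=> [].
Qed.

Lemma mat_mul v x (u : M4) : det4 u = 1 ->
  mul4 (mat (v, x)) u = mat (rmul v u, x + xc (mul4 (mat (v, 0)) u)).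
Proof.
move=> du; have [->|v0] := eqVneq v 0.
  have -> : rmul 0 u = 0 by rewrite /rmul /= !mul0r addr0.
  by rewrite !mat0 /mul4 /=; congr (_, _, _, _); ring.
set m0 := mul4 (mat (v, 0)) u.
have dm0 : det4 m0 = 1 by rewrite det4M det_mat// du mulr1.
rewrite mat_upper -mul4A -/m0 -{1}(matK dm0) /m0 bot_mul bot_mat -/m0.
by rewrite (mat_upper _ (xc m0)) (mat_upper _ (x + _)) mul4A; congr mul4;
   rewrite /mul4 /upper4 /=; congr (_, _, _, _); ring.
Qed.

Local Open Scope ereal_scope.

Lemma measurable_p1 : measurable_fun setT (fun m : M4 => m.1.1.1).
Proof.
by apply: measurableT_comp; [exact: measurable_fst|apply: measurableT_comp; [exact: measurable_fst|exact: measurable_fst]].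
Qed.
Lemma measurable_p2 : measurable_fun setT (fun m : M4 => m.1.1.2).
Proof.
by apply: measurableT_comp; [exact: measurable_snd|apply: measurableT_comp; [exact: measurable_fst|exact: measurable_fst]].
Qed.
Lemma measurable_p3 : measurable_fun setT (fun m : M4 => m.1.2).
Proof. by apply: measurableT_comp; [exact: measurable_snd|exact: measurable_fst]. Qed.
Lemma measurable_p4 : measurable_fun setT (fun m : M4 => m.2).
Proof. exact: measurable_snd. Qed.

Lemma measurable_m4 d (T : measurableType d) (a b c e : T -> RM) :
  measurable_fun setT a -> measurable_fun setT b -> measurable_fun setT c -> measurable_fun setT e ->
  measurable_fun setT (fun t => (a t, b t, c t, e t) : M4).
Proof. by move=> *; do ![apply: measurable_fun_pair => //]. Qed.

Lemma measurable_mul4r (u : M4) : measurable_fun setT (fun m : M4 => mul4 m u : M4).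
Proof.
have h1 := measurable_p1; have h2 := measurable_p2; have h3 := measurable_p3; have h4 := measurable_p4.
by apply: measurable_m4; apply: measurable_funD; apply: measurable_funM.
Qed.

Lemma measurable_mul4l (u : M4) : measurable_fun setT (fun m : M4 => mul4 u m : M4).
Proof.
have h1 := measurable_p1; have h2 := measurable_p2; have h3 := measurable_p3; have h4 := measurable_p4.
by apply: measurable_m4; apply: measurable_funD; apply: measurable_funM.
Qed.

Lemma measurable_inv4 : measurable_fun setT (fun m : M4 => inv4 m : M4).
Proof.
apply: measurable_m4; try (exact: measurable_p4); try (exact: measurable_p1);
 by apply: measurableT_comp => //; [exact: measurable_p2 || exact: measurable_p3].
Qed.

Lemma measurable_bot : measurable_fun setT (fun m : M4 => bot m : RM * RM).
Proof. by apply: measurable_fun_pair; [exact: measurable_p3|exact: measurable_p4]. Qed.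

Lemma measurable_yc : measurable_fun setT yc.
Proof.
apply: measurable_fun_inv; apply: measurableT_comp; first exact: measurable_nsq.
exact: measurable_bot.
Qed.

Lemma measurable_xc : measurable_fun setT xc.
Proof.
apply: measurable_funM; last exact: measurable_yc.
apply: measurable_funD; apply: measurable_funM;
  by [exact: measurable_p1|exact: measurable_p2|exact: measurable_p3|exact: measurable_p4].
Qed.

Lemma measurable_mat : measurable_fun setT mat.
Proof.
have m1 : measurable_fun setT (fun p : RM * RM * RM => p.1.1).
  by apply: measurableT_comp; [exact: measurable_fst|exact: measurable_fst].
have m2 : measurable_fun setT (fun p : RM * RM * RM => p.1.2).
  by apply: measurableT_comp; [exact: measurable_snd|exact: measurable_fst].
have mq : measurable_fun setT (fun p : RM * RM * RM => (nsq p.1)^-1%R : RM).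
  apply: measurable_fun_inv; apply: measurableT_comp; first exact: measurable_nsq.
  exact: measurable_fst.
apply: measurable_m4 => //.
- apply: measurable_funD; apply: measurable_funM => //; exact: measurable_snd.
- apply: measurable_funB; apply: measurable_funM => //; exact: measurable_snd.
Qed.

Lemma measurable_rmul (u : M4) : measurable_fun setT (fun v : RM * RM => rmul v u : RM * RM).
Proof.
apply: measurable_fun_pair; apply: measurable_funD; apply: measurable_funM => //;
  by [exact: measurable_fst|exact: measurable_snd].
Qed.

Let inv2 (u : M4) := forall g : RM * RM -> \bar R, measurable_fun setT g -> (forall v, 0 <= g v) ->
  \int[leb2]_v g (rmul v u) = \int[leb2]_v g v.

Let inv2_mul (u w : M4) : inv2 u -> inv2 w -> inv2 (mul4 u w).
Proof.
move=> hu hw g mg g0; rewrite -(hw g mg g0).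
rewrite -(hu (fun v => g (rmul v w)))//; last first.
  by apply: (measurableT_comp mg); exact: measurable_rmul.
by apply: eq_integral => v _; rewrite rmulM.
Qed.

Let inv2_upper x : inv2 (upper4 x).
Proof.
move=> g mg g0.
have mgr : measurable_fun setT (fun v : RM * RM => g (rmul v (upper4 x))).
  by apply: (measurableT_comp mg); exact: measurable_rmul.
rewrite (L2_fubini1 mgr (fun v => g0 _)) (L2_fubini1 mg g0).
apply: eq_integral => c _.
have E d : rmul (c, d) (upper4 x) = (c, (d + c * x)%R).
  by rewrite /rmul /=; congr (_, _); ring.
under eq_integral do rewrite E.
apply: (@integral_shift R (c * x)%R (fun d => g (c, d))) => //.
by apply: (measurableT_comp mg); exact: measurable_pair1.
Qed.

Let inv2_lower x : inv2 (lower4 x).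
Proof.
move=> g mg g0.
have mgr : measurable_fun setT (fun v : RM * RM => g (rmul v (lower4 x))).
  by apply: (measurableT_comp mg); exact: measurable_rmul.
rewrite (L2_fubini2 mgr (fun v => g0 _)) (L2_fubini2 mg g0).
apply: eq_integral => d _.
have E c : rmul (c, d) (lower4 x) = ((c + d * x)%R, d).
  by rewrite /rmul /=; congr (_, _); ring.
under eq_integral do rewrite E.
apply: (@integral_shift R (d * x)%R (fun c => g (c, d))) => //.
by apply: (measurableT_comp mg); exact: measurable_pair2.
Qed.

(** Shears preserve area by translation invariance in one variable. A matrix with nonzero lower left
    entry is a product upper, lower, upper of shears, and one further shear reaches the other
    matrices. *)
Lemma leb2_rmul (u : M4) (g : RM * RM -> \bar R) : det4 u = 1%R ->
  measurable_fun setT g -> (forall v, 0 <= g v) ->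
  \int[leb2]_v g (rmul v u) = \int[leb2]_v g v.
Proof.
suff : det4 u = 1%R -> inv2 u by move=> h du; exact: h.
have lowne (p q r t : R) : (r != 0)%R -> (p * t - q * r = 1)%R -> inv2 (p, q, r, t).
  move=> r0 du.
  have -> : (p, q, r, t) = mul4 (mul4 (upper4 ((p - 1) / r)) (lower4 r)) (upper4 ((t - 1) / r)).
    rewrite /mul4 /=; congr (_, _, _, _); try by field.
    have -> : q = ((p * t - 1) / r)%R by rewrite -du; field.
    by field.
  by apply: inv2_mul => //; exact: inv2_mul.
case: u => [[[p q] r] t] du.
have {}du : (p * t - q * r = 1)%R by [].
have [r0|r0] := eqVneq r 0%R; last exact: lowne.
have t0 : t != 0%R.
  by apply/eqP => t0; move: du; rewrite r0 t0 !mulr0 subr0 => /eqP; rewrite eq_sym oner_eq0.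
have -> : (p, q, r, t) = mul4 ((p + q)%R, q, t, t) (lower4 (-1)).
  by rewrite /mul4 /= r0; congr (_, _, _, _); ring.
apply: inv2_mul => //; apply: lowne => //.
by rewrite -du r0; ring.
Qed.

Definition haar (f : M4 -> \bar R) : \bar R := \int[leb3]_p f (mat p).

Lemma haarE (f : M4 -> \bar R) : measurable_fun setT f -> (forall m, 0 <= f m) ->
  haar f = \int[leb2]_v \int[leb]_x f (mat (v, x)).
Proof.
move=> mf f0.
have mfm : measurable_fun setT (f \o mat) by apply: (measurableT_comp mf); exact: measurable_mat.
exact: L3_fubini mfm (fun p => f0 (mat p)).
Qed.

(** In the coordinates [(v, x)], right multiplication is a linear map of determinant 1 on [v] and a
    shift of [x] by an amount depending on [v] alone. *)
Lemma haar_right (u : M4) (f : M4 -> \bar R) : det4 u = 1%R ->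
  measurable_fun setT f -> (forall m, 0 <= f m) -> haar (fun m => f (mul4 m u)) = haar f.
Proof.
move=> du mf f0.
have mfu : measurable_fun setT (fun m : M4 => f (mul4 m u)).
  by apply: (measurableT_comp mf); exact: measurable_mul4r.
rewrite (haarE mfu (fun m => f0 _)) (haarE mf f0).
have mfm : measurable_fun setT (f \o mat) by apply: (measurableT_comp mf); exact: measurable_mat.
have mF := measurable_fun_fubini_tonelli_F (m2 := leb) _ mfm (fun p => f0 (mat p)).
rewrite -(leb2_rmul du mF); last by move=> v; apply: integral_ge0 => x _; exact: f0.
apply: eq_integral => v _; rewrite /fubini_F /=.
under eq_integral do rewrite mat_mul//.
apply: (@integral_shift R _ (fun x => f (mat (rmul v u, x)))) => //.
by apply: (measurableT_comp mfm); exact: measurable_pair1.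
Qed.

(** For fixed [c <> 0] both sides become integrals over the diagonal entries [a] and [d] with
    density [1/|c|]. In these coordinates inversion exchanges [a] and [d] and changes the sign of
    [c]. *)
Lemma haar_inv (f : M4 -> \bar R) :
  measurable_fun setT f -> (forall m, 0 <= f m) -> haar (fun m => f (inv4 m)) = haar f.
Proof.
move=> mf f0.
have mfi : measurable_fun setT (fun m : M4 => f (inv4 m)).
  by apply: (measurableT_comp mf); exact: measurable_inv4.
have mfm : measurable_fun setT (f \o mat) by apply: (measurableT_comp mf); exact: measurable_mat.
have mfim : measurable_fun setT (fun p => f (inv4 (mat p))).
  by apply: (measurableT_comp mfi); exact: measurable_mat.
pose F (v : RM * RM) := \int[leb]_x f (mat (v, x)).
pose Fi (v : RM * RM) := \int[leb]_x f (inv4 (mat (v, x))).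
have mF : measurable_fun setT F := measurable_fun_fubini_tonelli_F (m2 := leb) _ mfm (fun p => f0 (mat p)).
have mFi : measurable_fun setT Fi := measurable_fun_fubini_tonelli_F (m2 := leb) _ mfim (fun p => f0 _).
have F0 v : 0 <= F v by apply: integral_ge0.
have Fi0 v : 0 <= Fi v by apply: integral_ge0.
rewrite (haarE mfi (fun m => f0 _)) (haarE mf f0) -/F -/Fi.
rewrite (L2_fubini1 mFi Fi0) (L2_fubini1 mF F0).
have [Phi [PhiE mPhi Phi0]] : exists P : RM -> \bar R,
    [/\ forall c, P c = \int[leb]_d F (c, d), measurable_fun setT P & forall c, 0 <= P c].
  exists (fun c => \int[leb]_d F (c, d)); split; first by [].
  - exact: (measurable_fun_fubini_tonelli_F (m2 := leb) _ mF F0).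
  - by move=> c; apply: integral_ge0.
have [Phii [PhiiE mPhii Phii0]] : exists P : RM -> \bar R,
    [/\ forall c, P c = \int[leb]_d Fi (c, d), measurable_fun setT P & forall c, 0 <= P c].
  exists (fun c => \int[leb]_d Fi (c, d)); split; first by [].
  - exact: (measurable_fun_fubini_tonelli_F (m2 := leb) _ mFi Fi0).
  - by move=> c; apply: integral_ge0.
transitivity (\int[leb]_c Phii c); first by apply: eq_integral => c _; rewrite PhiiE.
transitivity (\int[leb]_c Phi c); last by apply: eq_integral => c _; rewrite PhiE.
have n1 : (-1 : R)%R != 0%R by rewrite oppr_eq0 oner_eq0.
transitivity (\int[leb]_c Phi (-1 * c + 0)%R); last first.
  by rewrite (@integral_affine R (-1)%R 0%R Phi n1 mPhi Phi0) normrN normr1 invr1 mul1e.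
apply: eq_integral_off0 => //.
  apply: (measurableT_comp mPhi); apply: measurable_funD => //; exact: measurable_funM.
move=> c c0; rewrite mulN1r addr0 PhiiE PhiE.
have cn0 : (`|c| != 0)%R by rewrite normr_eq0.
pose K (v : RM * RM) : \bar R := f (v.2, (- ((v.1 * v.2 - 1) / c))%R, (- c)%R, v.1).
have mK : measurable_fun setT K.
  apply: (measurableT_comp mf); apply: measurable_m4 => //.
  - apply: measurableT_comp => //; apply: measurable_funM => //; apply: measurable_funB => //.
    by apply: measurable_funM; [exact: measurable_fst|exact: measurable_snd].
have K0 v : 0 <= K v by exact: f0.
have FiE d : Fi (c, d) = `|c|^-1%:E * \int[leb]_a K (a, d).
  have mKd : measurable_fun setT (fun a : RM => K (a, d)).
    by apply: (measurableT_comp mK); exact: measurable_pair2.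
  rewrite -(@integral_affine R c (d * (nsq (c, d))^-1)%R (fun a => K (a, d)) c0 mKd (fun a => K0 _)).
  apply: eq_integral => x _; rewrite /K /inv4 /mat /=; congr f.
  have q0 : nsq (c, d) != 0%R.
    by rewrite gt_eqF// nsq_gt0//; apply/eqP => -[/eqP]; rewrite (negPf c0).
  have qE : nsq (c, d) = (c ^+ 2 + d ^+ 2)%R by [].
  congr (_, _, _, _); last by rewrite [(x * c)%R]mulrC.
  congr (- _)%R; apply: (mulIf c0); rewrite divfK//.
  by rewrite !qE in q0 *; field; exact: q0.
have mKi : measurable_fun setT (fun d : RM => \int[leb]_a K (a, d)).
  exact: (measurable_fun_fubini_tonelli_G (m1 := leb) _ mK K0).
under eq_integral do rewrite FiE.
rewrite ge0_integralZl//; last by move=> d _; apply: integral_ge0.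
rewrite -(fubini_tonelli K mK K0).
have FE a : \int[leb]_d K (a, d) = `|c|%:E * F ((- c)%R, a).
  pose q := (nsq ((- c)%R, a))^-1%R.
  have mfx : measurable_fun setT (fun x : RM => f (mat (((- c)%R : RM, a : RM), x))).
    by apply: (measurableT_comp mfm); exact: measurable_pair1.
  have := @integral_affine R (- c^-1)%R (a * q / c)%R (fun x => f (mat (((- c)%R, a), x))) _ mfx (fun x => f0 _).
  rewrite normrN normfV invrK oppr_eq0 invr_eq0 => <-//.
  apply: eq_integral => d _; rewrite /K /mat /=; congr f.
  have q0 : nsq ((- c)%R, a) != 0%R.
    rewrite gt_eqF// nsq_gt0//; apply/eqP => -[/eqP]; by rewrite oppr_eq0 (negPf c0).
  have qE : nsq ((- c)%R, a) = (c ^+ 2 + a ^+ 2)%R by rewrite /nsq /= sqrrN.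
  rewrite -/q; congr (_, _, _, _); first by field.
  have e : (c ^+ 2 * q = 1 - a ^+ 2 * q)%R.
    by apply: (mulIf q0); rewrite mulrBl -!mulrA mulVf// qE; ring.
  apply: (mulIf c0).
  rewrite (_ : ((- c^-1 * d + a * q / c) * a - - c * q) * c = - (a * d) * (c^-1 * c) + a ^+ 2 * q * (c^-1 * c) + c ^+ 2 * q)%R; last by ring.
  by rewrite mulVf// e mulNr divfK//; ring.
under eq_integral do rewrite FE.
rewrite ge0_integralZl//; last first.
  by apply: (measurableT_comp mF); exact: measurable_pair1.
by rewrite muleA -EFinM mulVf// mul1e.
Qed.

Lemma haar_left (g : M4) (f : M4 -> \bar R) : det4 g = 1%R ->
  measurable_fun setT f -> (forall m, 0 <= f m) -> haar (fun m => f (mul4 g m)) = haar f.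
Proof.
move=> dg mf f0.
have mfi : measurable_fun setT (fun m : M4 => f (inv4 m)).
  by apply: (measurableT_comp mf); exact: measurable_inv4.
have mfu : measurable_fun setT (fun m : M4 => f (inv4 (mul4 m (inv4 g)))).
  by apply: (measurableT_comp mfi); exact: measurable_mul4r.
rewrite -[RHS](haar_inv mf f0) -[RHS](@haar_right (inv4 g) (fun m => f (inv4 m)))//; last by rewrite det4V.
rewrite -[RHS](haar_inv mfu (fun m => f0 _)).
by congr haar; apply/funext => m; rewrite inv4M !inv4K.
Qed.

(* The bottom row and the real part of the base point are independent coordinates. *)
Lemma haar_bot_strip (Om : set (RM * RM)) : measurable Om -> ~ Om 0%R ->
  haar (fun m => (\1_Om (bot m) * \1_(`[0%R, 1%R[%classic) (xc m))%:E) = leb2 Om.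
Proof.
move=> mOm Om0.
have mI : measurable_fun setT (fun m : M4 => (\1_Om (bot m) * \1_(`[0%R, 1%R[%classic : set RM) (xc m))%:E : \bar R).
  apply/measurable_EFinP; apply: measurable_funM.
    by apply: measurableT_comp; [exact: measurable_indic|exact: measurable_bot].
  by apply: measurableT_comp; [exact: measurable_indic|exact: measurable_xc].
rewrite haarE//.
rewrite -[Om]setIT -(@integral_indic _ _ _ leb2 setT)// setIT.
apply: eq_integral => v _.
have [->|v0] := eqVneq v 0%R.
  rewrite indicE memNset// integral0_eq// => x _.
  by rewrite mul0r.
under eq_integral do rewrite bot_mat xc_mat// EFinM.
rewrite ge0_integralZl//; last by apply/measurable_EFinP; exact: measurable_indic.
rewrite integral_indic// setIT -[X in _ * X]/(leb `[0%R, 1%R[%classic) lebesgue_measure_itv /= lte_fin ltr01 sube0.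
by rewrite mule1.
Qed.

(** The squared norm [s] of the bottom row has law [pi ds], and [y = 1/s] turns [ds] into [y^-2 dy].
    This fixes the normalisation of [haar] against the hyperbolic area. *)
Lemma haar_base (B : set (RM * RM)) : measurable B -> B `<=` [set z | (0 < z.2)%R] ->
  haar (fun m => (\1_B (xc m, yc m))%:E) = pi%:E * \int[leb2]_(z in B) (z.2 ^- 2)%:E.
Proof.
move=> mB Bpos.
have mI : measurable_fun setT (fun m : M4 => (\1_B (xc m, yc m))%:E : \bar R).
  apply/measurable_EFinP; apply: measurableT_comp; first exact: measurable_indic.
  by apply: measurable_fun_pair; [exact: measurable_xc|exact: measurable_yc].
pose iv (s : RM) : RM := (s^-1)%R.
have miv : measurable_fun [set: RM] iv by exact: measurable_inv.
pose I3 (p : RM * RM * RM) : \bar R := (\1_B (p.2, iv (nsq p.1)))%:E.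
have mI3 : measurable_fun setT I3.
  apply/measurable_EFinP; apply: measurableT_comp; first exact: measurable_indic.
  apply: measurable_fun_pair; first exact: measurable_snd.
  apply: (measurableT_comp miv); apply: measurableT_comp; first exact: measurable_nsq.
  exact: measurable_fst.
have I30 p : 0 <= I3 p by rewrite lee_fin.
have -> : haar (fun m => (\1_B (xc m, yc m))%:E) = \int[leb3]_p I3 p.
  apply: eq_integral => -[v x] _; rewrite /I3 /=; congr EFin.
  have [->|v0] := eqVneq v 0%R; last by rewrite xc_mat// /yc bot_mat.
  have n0 : nsq (0%R : (RM * RM)%type) = 0%R by rewrite /nsq /= expr0n addr0.
  rewrite /yc bot_mat n0 /iv invr0 !indicE !memNset// => /Bpos /=; by rewrite ltxx.
rewrite (L3_fubini2 mI3 I30).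
pose w (z : RM * RM) : \bar R := (\1_B z * z.2 ^- 2)%:E.
have w0 z : 0 <= w z by rewrite lee_fin mulr_ge0 ?invr_ge0 ?sqr_ge0.
have mw : measurable_fun setT w.
  apply/measurable_EFinP; apply: measurable_funM; first exact: measurable_indic.
  by apply: measurable_fun_inv; apply: measurable_funX; exact: measurable_snd.
have -> : \int[leb2]_(z in B) (z.2 ^- 2)%:E = \int[leb2]_z w z.
  rewrite integral_mkcond; apply: eq_integral => z _.
  by rewrite /w patchE indicE; case: ifP => _; rewrite ?mul1r ?mul0r.
rewrite (L2_fubini1 mw w0).
have mW := measurable_fun_fubini_tonelli_F (m2 := leb) _ mw w0.
rewrite -ge0_integralZl//; try (by move=> x _; apply: integral_ge0); try by rewrite lee_fin pi_ge0.
apply: eq_integral => x _.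
pose A : set RM := xsection B x.
have mA : measurable A by exact: measurable_xsection.
have Apos : A `<=` `]0%R, +oo[%classic.
  by move=> y; rewrite /A /xsection /= inE => /Bpos /=; rewrite in_itv /= andbT.
have mivA : measurable (iv @^-1` A) by rewrite -[_ @^-1` _]setTI; exact: miv.
have mnA : measurable (@nsq R @^-1` (iv @^-1` A) : set (RM * RM)).
  by rewrite -[_ @^-1` _]setTI; exact: measurable_nsq.
transitivity (leb2 (@nsq R @^-1` (iv @^-1` A))).
  rewrite -[in RHS](setIT (@nsq R @^-1` _)) -(@integral_indic _ _ _ leb2 setT)//.
  apply: eq_integral => v _; rewrite /I3 /= !indicE; congr (_%:R%:E); congr nat_of_bool.
  by apply/idP/idP => [h|/set_mem h]; [apply/mem_set|].
have Ipos : iv @^-1` A `<=` `]0%R, +oo[%classic.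
  by move=> s /= /Apos /=; rewrite !in_itv /= !andbT /iv invr_gt0.
transitivity (pi%:E * leb (iv @^-1` A)); first exact: leb2_radial.
congr (_ * _); transitivity (\int[leb]_(y in A) (y ^- 2)%:E); first exact: leb_inv.
rewrite integral_mkcond; apply: eq_integral => y _.
rewrite /w patchE indicE /= mem_xsection; case: ifP => _; by rewrite ?mul1r ?mul0r.
Qed.

End Haar.

(** * Fundamental domains and unfolding *)

Section CountableGroup.
Variable R : realType.
Local Notation M4 := (R * R * R * R)%type.

Lemma cnt_series (A : set nat) : finite_set A ->
  (\sum_(0 <= k <oo) (\1_A k)%:E = (cnt R A)%:E)%E.
Proof.
move=> fA; rewrite nneseries_esum; last by move=> n _; rewrite lee_fin.
have -> : [set x : nat | true] = setT by apply/seteqP; split.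
transitivity (\esum_(k in A) (1 : \bar R))%E; last by rewrite finite_card_sum.
rewrite [RHS]esum_mkcond; apply: eq_esum => k _.
by rewrite indicE; case: (k \in A).
Qed.

Lemma mul4_close (g h : M4) (N dl : R) : det4 g = 1 -> 0 <= N ->
  [/\ `|g.1.1.1| <= N, `|g.1.1.2| <= N, `|g.1.2| <= N & `|g.2| <= N] ->
  [/\ `|h.1.1.1 - g.1.1.1| <= dl, `|h.1.1.2 - g.1.1.2| <= dl,
      `|h.1.2 - g.1.2| <= dl & `|h.2 - g.2| <= dl] ->
  near4 (2 * N * dl) (mul4 (inv4 g) h).
Proof.
case: g => [[[a b] c] d]; case: h => [[[a' b'] c'] d'] /= dg N0 [ha hb hc hd] [da db dc dd].
have {}dg : a * d - b * c = 1 by [].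
have T (x y z t : R) : `|x| <= N -> `|z| <= N -> `|y| <= dl -> `|t| <= dl -> `|x * y + z * t| <= 2 * N * dl.
  move=> h1 h2 h3 h4; apply: le_trans (ler_normD _ _) _.
  by move: (normM_le h1 h3) (normM_le h2 h4); clear; lra.
rewrite /mul4 /inv4 /near4 /=; split.
- rewrite (_ : _ - 1 = d * (a' - a) + (- b) * (c' - c)); last by rewrite -[X in _ - X]dg; ring.
  by apply: T; rewrite ?normrN.
- rewrite (_ : d * b' + - b * d' = d * (b' - b) + (- b) * (d' - d)); last by ring.
  by apply: T; rewrite ?normrN.
- rewrite (_ : - c * a' + a * c' = (- c) * (a' - a) + a * (c' - c)); last by ring.
  by apply: T; rewrite ?normrN.
- rewrite (_ : _ - 1 = (- c) * (b' - b) + a * (d' - d)); last by rewrite -[X in _ - X]dg; ring.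
  by apply: T; rewrite ?normrN.
Qed.

(** Among elements with entries bounded by [n], rounding the entries to the mesh [e/(2n+1)] is
    injective: if two roundings agree, [g^-1 h] is within [e] of the identity. *)
Lemma dgroup_countable (G : set M4) : dgroup G -> countable G.
Proof.
move=> dG; have [e e0 he] := dg_disc dG.
pose B (n : nat) : set M4 := [set g | G g /\
  [/\ `|g.1.1.1| <= n%:R, `|g.1.1.2| <= n%:R, `|g.1.2| <= n%:R & `|g.2| <= n%:R]].
have -> : G = \bigcup_(n in setT) B n.
  apply/seteqP; split => [g Gg|g [n _ []]//].
  pose M := `|g.1.1.1| + `|g.1.1.2| + `|g.1.2| + `|g.2|.
  have M0 : 0 <= M by rewrite !addr_ge0.
  exists (Num.trunc M).+1 => //; split=> //.
  have := ltW (Num.Theory.truncnS_gt M); rewrite /M.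
  move: (normr_ge0 g.1.1.1) (normr_ge0 g.1.1.2) (normr_ge0 g.1.2) (normr_ge0 g.2); clear => *.
  by split; lra.
apply: bigcup_countable => // n _.
pose dl := e / (2 * n%:R + 1).
have n1 : 0 < 2 * n%:R + 1 :> R by rewrite ltr_wpDl// mulr_ge0.
have dl0 : 0 < dl by exact: divr_gt0.
pose fl (x : R) : int := Num.floor (x / dl).
have flP x y : fl x = fl y -> `|x - y| <= dl.
  rewrite /fl => E.
  have h1 := Num.Theory.floor_le (x / dl); have h2 := lt_succ_floor (x / dl).
  have h3 := Num.Theory.floor_le (y / dl); have h4 := lt_succ_floor (y / dl).
  rewrite E in h1 h2.
  have : `|x / dl - y / dl| <= 1.
    by move: h1 h2 h3 h4; rewrite rmorphD /=; clear => *; rewrite ler_norml; apply/andP; split; lra.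
  by rewrite -mulrBl normrM normfV (gtr0_norm dl0) ler_pdivrMr// mul1r.
pose code (g : M4) : nat := choice.pickle (fl g.1.1.1, fl g.1.1.2, fl g.1.2, fl g.2).
apply/countable_injP; exists code => g h; rewrite !inE => -[Gg Bg] [Gh Bh].
move/(pcan_inj choice.pickleK) => -[E1 E2 E3 E4].
have := @mul4_close g h n%:R dl (dg_det dG Gg) (ler0n _ _) Bg.
move=> /(_ (And4 (flP _ _ (esym E1)) (flP _ _ (esym E2)) (flP _ _ (esym E3)) (flP _ _ (esym E4)))) nr.
have : mul4 (inv4 g) h = one4.
  apply: he; first by apply: (dgM dG) => //; exact: (dgV dG).
  apply: near4_le nr; rewrite /dl mulrA ler_pdivrMr// mulrC ler_pM2l// lerDl//.
move/(congr1 (mul4 g)); rewrite mulVK4 ?mul41//; exact: (dg_det dG).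
Qed.

Lemma cusp_group_enum (G : set M4) : cusp_at_infty G ->
  exists e : nat -> M4, set_bij [set: nat] G e.
Proof.
move=> cG; have cnt := dgroup_countable (ci_dg cG).
have inf : infinite_set G.
  apply/infiniteP.
  have fi : {in [set: nat] &, injective (fun n : nat => upper4 (n%:R : R))}.
    by move=> m n _ _ [] /eqP; rewrite eqr_nat => /eqP.
  rewrite -(card_le_eql (inj_card_eq fi)); apply: subset_card_le => _ [n _ <-].
  exact: (ci_upper cG n).
have : ([set: nat] #= G)%card by rewrite card_eq_sym; exact: eq_card_nat.
by move/card_set_bijP.
Qed.

End CountableGroup.

Section FundamentalDomain.
Variable R : realType.
Local Notation RM := (measurableTypeR R).
Local Notation M4 := (RM * RM * RM * RM)%type.
Local Notation leb := (@lebesgue_measure R).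
Local Open Scope ereal_scope.

Lemma L3_bot0 : (L3 R) [set p | p.1 = 0%R] = 0.
Proof.
have -> : [set p : RM * RM * RM | p.1 = 0%R] = [set (0%R, 0%R)] `*` setT.
  by apply/seteqP; split=> -[v x] /= => [->|[]].
have m0 : measurable ([set (0%R, 0%R)] : set (RM * RM)).
  have -> : [set (0%R, 0%R)] = [set 0%R] `*` [set 0%R] :> set (RM * RM).
    by apply/seteqP; split=> -[c d] /=; [move=> [-> ->]|move=> [-> ->]].
  by apply: measurableX.
transitivity ((L2 R) [set (0%R, 0%R)] * leb setT).
  exact: product_measure1E.
have -> : (L2 R) [set (0%R, 0%R)] = 0; last by rewrite mul0e.
have -> : [set (0%R, 0%R)] = [set 0%R] `*` [set 0%R] :> set (RM * RM).
  by apply/seteqP; split=> -[c d] /=; [move=> [-> ->]|move=> [-> ->]].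
transitivity (leb [set 0%R] * leb [set 0%R]); first exact: product_measure1E.
by rewrite lebesgue_measure_set1 mul0e.
Qed.

Lemma measurable_bot0 : measurable [set p : RM * RM * RM | p.1 = 0%R].
Proof.
have -> : [set p : RM * RM * RM | p.1 = 0%R] = ([set 0%R] `*` [set 0%R]) `*` setT.
  by apply/seteqP; split=> -[[c d] x] /=; [move=> [-> ->]|move=> [[-> ->] _]].
by apply: measurableX => //; apply: measurableX.
Qed.

Lemma measurable_comp_mat (f : M4 -> \bar R) : measurable_fun setT f ->
  measurable_fun setT (f \o @mat R).
Proof. by move=> mf; apply: (measurableT_comp mf); exact: measurable_mat. Qed.

Lemma haar_ge0 (f : M4 -> \bar R) : (forall m, 0 <= f m) -> 0 <= haar f.
Proof. by move=> f0; apply: integral_ge0 => p _; exact: f0. Qed.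

Lemma haar_null_eq (f h : M4 -> \bar R) (N : set M4) :
  measurable_fun setT f -> measurable_fun setT h ->
  (forall m, 0 <= f m) -> (forall m, 0 <= h m) ->
  measurable N -> haar (fun m => (\1_N m)%:E) = 0 ->
  (forall m, det4 m = 1%R -> ~ N m -> f m = h m) -> haar f = haar h.
Proof.
move=> mf mh f0 h0 mN N0 fh.
have mN' : measurable ((@mat R) @^-1` N) by rewrite -[_ @^-1` _]setTI; exact: measurable_mat.
apply: ge0_ae_eq_integral => //; try exact: measurable_comp_mat; try by move=> p _.
exists ([set p : RM * RM * RM | p.1 = 0%R] `|` (@mat R) @^-1` N); split.
- by apply: measurableU => //; exact: measurable_bot0.
- rewrite (@null_set_setU _ _ _ (L3 R))//; first exact: measurable_bot0.
    exact: L3_bot0.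
  transitivity (\int[L3 R]_p (\1_((@mat R) @^-1` N) p)%:E); first by rewrite integral_indic// setIT.
  rewrite -N0; apply: eq_integral => p _; rewrite !indicE; congr (_%:R%:E); congr nat_of_bool.
- move=> p /=; apply: contra_notP => /not_orP[p0 Np] _.
  case: p p0 Np => v x /= v0 Np; apply: fh => //.
  by apply: det_mat; apply/eqP.
Qed.

Lemma haar_le (f h : M4 -> \bar R) : measurable_fun setT f -> measurable_fun setT h ->
  (forall m, 0 <= f m) -> (forall m, det4 m = 1%R -> f m <= h m) ->
  (forall m, 0 <= h m) -> haar f <= haar h.
Proof.
move=> mf mh f0 fh h0.
pose D := [set m : M4 | det4 m = 1%R].
have mD : measurable D.
  have -> : D = (fun m : M4 => det4 m : RM) @^-1` [set 1%R] by [].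
  rewrite -[_ @^-1` _]setTI.
  have : measurable_fun setT (fun m : M4 => det4 m : RM).
    apply: measurable_funB; apply: measurable_funM;
    by [exact: measurable_p1|exact: measurable_p2|exact: measurable_p3|exact: measurable_p4].
  by apply.
have mfD : measurable_fun setT (fun m : M4 => f m * (\1_D m)%:E).
  by apply: emeasurable_funM => //; apply/measurable_EFinP; exact: measurable_indic.
have -> : haar f = haar (fun m => f m * (\1_D m)%:E).
  apply: (@haar_null_eq _ _ set0) => //.
  - by move=> m; rewrite mule_ge0// lee_fin.
  - by rewrite /haar; under eq_integral do rewrite indic0; rewrite integral0.
  - by move=> m dm _; rewrite indicE mem_set// mule1.
apply: ge0_le_integral => //.
- by move=> p _; rewrite mule_ge0// lee_fin.
- exact: (measurable_comp_mat mfD).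
- exact: (measurable_comp_mat mh).
- move=> p _; rewrite indicE; case: (boolP (_ \in D)) => pD; rewrite ?mule1 ?mule0//.
  by apply: fh; exact: (set_mem pD).
Qed.

Lemma haar_nneseries (f : nat -> M4 -> \bar R) :
  (forall k, measurable_fun setT (f k)) -> (forall k m, 0 <= f k m) ->
  haar (fun m => \sum_(0 <= k <oo) f k m) = \sum_(0 <= k <oo) haar (f k).
Proof.
move=> mf f0; rewrite /haar integral_nneseries//.
by move=> k; exact: (measurable_comp_mat (mf k)).
Qed.

Lemma measurable_nneseries (f : nat -> M4 -> \bar R) :
  (forall k, measurable_fun setT (f k)) -> (forall k m, 0 <= f k m) ->
  measurable_fun setT (fun m => \sum_(0 <= k <oo) f k m).
Proof. by move=> mf f0; apply: ge0_emeasurable_sum. Qed.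

(** Injectivity is asked of [F] and covering of [C], which exceeds [F] by a null set. Injectivity
    holds up to sign because [-1] acts trivially. *)
Record fundom (G : set M4) (F C : set (RM * RM)) : Prop := FunDom {
  fd_cusp : cusp_at_infty G;
  fd_mF : measurable F;
  fd_mC : measurable C;
  fd_pos : F `<=` [set z | (0 < z.2)%R];
  fd_null : L2 R ((C `\` F) `&` [set z | (0 < z.2)%R]) = 0;
  fd_cover : forall m : M4, det4 m = 1%R ->
    exists2 g : M4, G g & C (xc (mul4 g m), yc (mul4 g m));
  fd_inj : forall m g : M4, det4 m = 1%R -> G g -> F (xc m, yc m) ->
    F (xc (mul4 g m), yc (mul4 g m)) -> g = one4 \/ g = opp4 one4;
  fd_fin : \int[L2 R]_(z in F) (z.2 ^- 2)%:E < +oo }.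

Definition lift (F : set (RM * RM)) : set M4 := [set m | F (xc m, yc m)].

Lemma measurable_lift F : measurable F -> measurable (lift F).
Proof.
move=> mF.
have mxy : measurable_fun setT (fun m : M4 => (xc m, yc m)).
  by apply: measurable_fun_pair; [exact: measurable_xc|exact: measurable_yc].
by rewrite -[lift F]setTI; exact: mxy.
Qed.

Definition mulE (F : set (RM * RM)) (phi : M4 -> \bar R) (m : M4) := (\1_(lift F) m)%:E * phi m.

Lemma measurable_mulE F phi : measurable F -> measurable_fun setT phi ->
  measurable_fun setT (mulE F phi).
Proof.
move=> mF mphi; apply: emeasurable_funM => //; apply/measurable_EFinP.
by apply: measurable_indic; exact: measurable_lift.
Qed.

Lemma mulE_ge0 F phi m : (forall m, 0 <= phi m) -> 0 <= mulE F phi m.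
Proof. by move=> p0; rewrite mule_ge0// lee_fin. Qed.

Definition quo (F : set (RM * RM)) (phi : M4 -> \bar R) := haar (mulE F phi).

Lemma yc_gt0 (m : M4) : det4 m = 1%R -> (0 < yc m)%R.
Proof. by move=> dm; rewrite invr_gt0 nsq_gt0// det4_bot. Qed.

(** A generic point is moved into [F] by exactly two elements, some [g] and [-g]. The exceptional
    set is the union of the translates of the null set between [F] and [C]. *)
Lemma tile_sum G F C (e : nat -> M4) : fundom G F C -> set_bij setT G e ->
  exists N : set M4, [/\ measurable N, haar (fun m => (\1_N m)%:E) = 0 &
    forall m, det4 m = 1%R -> ~ N m -> \sum_(0 <= k <oo) (\1_(lift F) (mul4 (e k) m))%:E = 2%:E :> \bar R].
Proof.
move=> fd be.
have dG := ci_dg (fd_cusp fd).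
have Ge k : G (e k) by apply: (set_bij_homo be).
pose Z := (C `\` F) `&` [set z : RM * RM | (0 < z.2)%R].
have mZ : measurable Z.
  apply: measurableI; first by apply: measurableD; [exact: (fd_mC fd)|exact: (fd_mF fd)].
  have -> : [set z : RM * RM | (0 < z.2)%R] = snd @^-1` `]0%R, +oo[%classic.
    by apply/seteqP; split => z /=; rewrite in_itv /= andbT.
  rewrite -[_ @^-1` _]setTI; apply: measurable_snd => //.
pose Nk k : set M4 := (fun m : M4 => mul4 (e k) m : M4) @^-1` lift Z.
have mNk k : measurable (Nk k).
  by rewrite -[Nk k]setTI; apply: measurable_mul4l => //; exact: measurable_lift.
have mI (A : set M4) : measurable A -> measurable_fun setT (fun m : M4 => (\1_A m)%:E : \bar R).
  by move=> mA; apply/measurable_EFinP; exact: measurable_indic.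
have hZ : haar (fun m => (\1_(lift Z) m)%:E) = 0.
  have := @haar_base R Z mZ (@subIsetr _ _ _).
  rewrite (_ : haar _ = haar (fun m => (\1_(lift Z) m)%:E))//.
  move=> ->; have mw : measurable_fun Z (fun z : RM * RM => (z.2 ^- 2)%:E : \bar R).
    apply: measurable_funTS; apply/measurable_EFinP; apply: measurable_fun_inv.
    by apply: measurable_funX; exact: measurable_snd.
  by rewrite (null_set_integral mZ mw (fd_null fd)) mule0.
have hNk k : haar (fun m => (\1_(Nk k) m)%:E) = 0.
  have I0 (m : M4) : 0 <= (\1_(lift Z) m)%:E :> \bar R by rewrite lee_fin.
  by rewrite -hZ -(haar_left (dg_det dG (Ge k)) (mI _ (measurable_lift mZ)) I0).
exists (\bigcup_k Nk k); split; first exact: bigcup_measurable.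
  apply/eqP; rewrite eq_le haar_ge0 ?andbT; last by move=> m; rewrite lee_fin.
  apply: (@le_trans _ _ (haar (fun m => \sum_(0 <= k <oo) (\1_(Nk k) m)%:E))).
    apply: haar_le => //.
    - by apply: mI; exact: bigcup_measurable.
    - by apply: measurable_nneseries => [k|k m]; [exact: mI|rewrite lee_fin].
    - move=> m _; rewrite indicE; case: (boolP (m \in _)) => [/set_mem[k _ hk]|_]; last first.
        by apply: nneseries_ge0 => k _ _; rewrite lee_fin.
      apply: (le_trans _ (nneseries_lim_ge k.+1 _)); last by move=> i _; rewrite lee_fin.
      rewrite big_nat_recr//= [X in _ + X](_ : _ = 1%:E); last by rewrite indicE mem_set.
      by rewrite leeDr// sume_ge0// => i _; rewrite lee_fin.
    - by move=> m; apply: nneseries_ge0 => k _ _; rewrite lee_fin.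
  rewrite haar_nneseries//; last by move=> k; exact: mI.
  by rewrite eseries0// => k _ _.
have inje a b : e a = e b -> a = b by move=> ?; apply: (set_bij_inj be); rewrite ?inE.
move=> m dm Nm.
have [g Gg Cg] := fd_cover fd dm.
have [k0 _ ek0] := set_bij_surj be Gg.
have [k1 _ ek1] := set_bij_surj be (dg_opp dG Gg).
have dgm k : det4 (mul4 (e k) m) = 1%R by rewrite det4M dm (dg_det dG (Ge k)) mulr1.
have Fg : F (xc (mul4 (e k0) m), yc (mul4 (e k0) m)).
  rewrite ek0; apply: contrapT => nF; apply: Nm; exists k0 => //.
  by rewrite /Nk /lift /Z /= ek0; split=> //; rewrite -ek0; exact: yc_gt0.
have oE (n : M4) : xc (opp4 n) = xc n /\ yc (opp4 n) = yc n.
  by rewrite /xc /yc /nsq /bot /opp4 /= !sqrrN !mulrNN.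
have KE : [set k | lift F (mul4 (e k) m)] = [set k0; k1].
  apply/seteqP; split=> k /=.
    move=> Fk.
    have := @fd_inj _ _ _ fd (mul4 (e k0) m) (mul4 (e k) (inv4 (e k0))) (dgm k0) _ Fg.
    have -> : mul4 (mul4 (e k) (inv4 (e k0))) (mul4 (e k0) m) = mul4 (e k) m.
      by rewrite -mul4A mulK4//; exact: (dg_det dG).
    move=> /(_ (dgM dG (Ge k) (dgV dG (Ge k0))) Fk) h.
    have kE : mul4 (mul4 (e k) (inv4 (e k0))) (e k0) = e k by rewrite mul4VK//; exact: (dg_det dG).
    case: h => h; [left|right]; apply: inje; rewrite -kE h.
      by rewrite mul14.
    by rewrite mulN4 mul14 ek0 ek1.
  move=> [->|->]; first exact: Fg.
  rewrite /lift /= ek1 mulN4; have [-> ->] := oE (mul4 g m); by rewrite -ek0.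
have k01 : k0 <> k1.
  move=> E; have := congr1 e E; rewrite ek0 ek1 => gE.
  have : det4 g = 1%R := dg_det dG Gg.
  case: g gE {Gg Cg ek0 ek1} => [[[a b] c] d] [] h1 h2 h3 h4.
  have z (t : R) : t = (- t)%R -> t = 0%R by move=> h; lra.
  rewrite /det4 /= (z _ h1) (z _ h2) !mul0r subrr => /eqP; by rewrite eq_sym oner_eq0.
transitivity (\sum_(0 <= k <oo) (\1_[set k0; k1] k)%:E : \bar R).
  by apply: eq_eseriesr => k _; rewrite -KE !indicE; congr (_%:R%:E); congr nat_of_bool.
rewrite cnt_series; last exact: finite_set2.
congr EFin; rewrite /cnt fset_setU// !fset_set1 cardfs2.
by have -> : (k0 != k1) by apply/eqP.
Qed.

(** Multiply [f] by the tiling identity and carry each translate of the lift of [F] back by left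
    invariance; the factor 2 is the centre. *)
Lemma unfold G F C (e : nat -> M4) (f : M4 -> R) : fundom G F C -> set_bij setT G e ->
  measurable_fun setT (fun m : M4 => (f m)%:E : \bar R) -> (forall m, 0 <= f m)%R ->
  2%:E * haar (fun m => (f m)%:E) = quo F (fun m => \sum_(0 <= k <oo) (f (mul4 (e k) m))%:E).
Proof.
move=> fd be mf f0'.
have f0 m : 0 <= (f m)%:E by rewrite lee_fin.
have dG := ci_dg (fd_cusp fd).
have Ge k : G (e k) by apply: (set_bij_homo be).
have mL := measurable_lift (fd_mF fd).
have be' : set_bij setT G (fun k => inv4 (e k)).
  split.
  - by move=> k _; apply: (dgV dG).
  - by move=> k l _ _ /(congr1 (@inv4 R)); rewrite !inv4K => h; apply: (set_bij_inj be); rewrite ?inE.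
  - move=> g Gg; have [k _ ek] := set_bij_surj be (dgV dG Gg).
    by exists k => //; rewrite ek inv4K.
have [N [mN N0 hN]] := tile_sum fd be'.
pose t k (m : M4) : \bar R := (\1_(lift F) (mul4 (inv4 (e k)) m))%:E.
have mt k : measurable_fun setT (t k).
  apply/measurable_EFinP; apply: measurableT_comp; first exact: measurable_indic.
  exact: measurable_mul4l.
have t0 k m : 0 <= t k m by rewrite lee_fin.
transitivity (haar (fun m => \sum_(0 <= k <oo) (f m)%:E * t k m)).
  transitivity (haar (fun m => 2%:E * (f m)%:E)).
    rewrite /haar ge0_integralZl//; exact: (measurable_comp_mat mf).
  apply: (@haar_null_eq _ _ N) => //.
  - by apply: emeasurable_funM => //; exact: measurable_cst.
  - by apply: measurable_nneseries => [k|k m]; [exact: emeasurable_funM|exact: mule_ge0].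
  - by move=> m; apply: mule_ge0.
  - by move=> m; apply: nneseries_ge0 => k _ _; exact: mule_ge0.
  - move=> m dm Nm; rewrite nneseriesZl; last by move=> k _; exact: t0.
    by rewrite (hN m dm Nm) muleC.
rewrite haar_nneseries; [|by move=> k; exact: emeasurable_funM|by move=> k m; exact: mule_ge0].
transitivity (\sum_(0 <= k <oo) haar (fun m => mulE F (fun m => (f (mul4 (e k) m))%:E) m)).
  apply: eq_eseriesr => k _.
  have mk : measurable_fun setT (fun m : M4 => (f m)%:E * t k m) by exact: emeasurable_funM.
  rewrite -(haar_left (dg_det dG (Ge k)) mk (fun m => mule_ge0 (f0 m) (t0 k m))).
  congr haar; apply/funext => m; rewrite /mulE /t mulK4 ?(dg_det dG (Ge k))// muleC; congr (_ * _).
rewrite -haar_nneseries.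
- congr haar; apply/funext => m; rewrite /mulE nneseriesZl//.
- move=> k; apply: measurable_mulE; first exact: (fd_mF fd).
  by apply: (measurableT_comp mf); exact: measurable_mul4l.
- by move=> k m; exact: mulE_ge0.
Qed.

(** The left side is the integral of [phi] over the translated lift of [F]. Unfolding that
    restricted function gives, by invariance of [phi], [phi] times a tile sum, which is 2 almost
    everywhere. *)
Lemma quo_right G F C (phi : M4 -> R) (u : M4) : fundom G F C -> det4 u = 1%R ->
  measurable_fun setT (fun m : M4 => (phi m)%:E : \bar R) -> (forall m, 0 <= phi m)%R ->
  (forall g m, G g -> phi (mul4 g m) = phi m) ->
  quo F (fun m => (phi (mul4 m u))%:E) = quo F (fun m => (phi m)%:E).
Proof.
move=> fd du mphi phi0' phiG.
have phi0 m : 0 <= (phi m)%:E by rewrite lee_fin.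
have dG := ci_dg (fd_cusp fd).
have [e be] := cusp_group_enum (fd_cusp fd).
have Ge k : G (e k) by apply: (set_bij_homo be).
have mL := measurable_lift (fd_mF fd).
have du' : det4 (inv4 u) = 1%R by rewrite det4V.
pose f (m : M4) : R := (\1_(lift F) (mul4 m (inv4 u)) * phi m)%R.
have mIu : measurable_fun setT (fun m : M4 => (\1_(lift F) (mul4 m (inv4 u)))%:E : \bar R).
  apply/measurable_EFinP; apply: measurableT_comp; first exact: measurable_indic.
  exact: measurable_mul4r.
have mf : measurable_fun setT (fun m : M4 => (f m)%:E : \bar R).
  under eq_fun do rewrite EFinM; exact: emeasurable_funM.
have f0' m : (0 <= f m)%R by rewrite mulr_ge0.
have f0 m : 0 <= (f m)%:E by rewrite lee_fin.
have -> : quo F (fun m => (phi (mul4 m u))%:E) = haar (fun m => (f m)%:E).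
  rewrite -(haar_right du mf f0); congr haar; apply/funext => m.
  by rewrite /mulE /f mul4K// EFinM.
have [N [mN N0 hN]] := tile_sum fd be.
pose N' : set M4 := (fun m : M4 => mul4 m (inv4 u) : M4) @^-1` N.
have mN' : measurable N' by rewrite -[N']setTI; exact: measurable_mul4r.
have N'0 : haar (fun m => (\1_N' m)%:E) = 0.
  have I0 (m : M4) : 0 <= (\1_N m)%:E :> \bar R by rewrite lee_fin.
  have mIN : measurable_fun setT (fun m : M4 => (\1_N m)%:E : \bar R).
    by apply/measurable_EFinP; exact: measurable_indic.
  by rewrite -N0 -(haar_right du' mIN I0).
suff : 2%:E * haar (fun m => (f m)%:E) = 2%:E * quo F (fun m => (phi m)%:E).
  move/(congr1 (fun z => (2^-1)%:E * z)); rewrite !muleA -EFinM mulVf// !mul1e; exact.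
rewrite (unfold fd be mf f0').
transitivity (haar (fun m => 2%:E * mulE F (fun m => (phi m)%:E) m)); last first.
  have mE := measurable_mulE (fd_mF fd) mphi.
  rewrite /haar ge0_integralZl//; first exact: (measurable_comp_mat mE).
  by move=> p _; exact: mulE_ge0.
apply: (@haar_null_eq _ _ N') => //.
- apply: measurable_mulE; first exact: (fd_mF fd).
  apply: measurable_nneseries => [k|k m]; last exact: f0.
  by apply: (measurableT_comp mf); exact: measurable_mul4l.
- by apply: emeasurable_funM; [exact: measurable_cst|apply: measurable_mulE => //; exact: (fd_mF fd)].
- by move=> m; apply: mulE_ge0 => m'; apply: nneseries_ge0 => k _ _; exact: f0.
- by move=> m; apply: mule_ge0 => //; exact: mulE_ge0.
move=> m dm Nm; rewrite /mulE muleCA; congr (_ * _).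
transitivity (\sum_(0 <= k <oo) (phi m)%:E * (\1_(lift F) (mul4 (e k) (mul4 m (inv4 u))))%:E).
  by apply: eq_eseriesr => k _; rewrite /f phiG// mul4A EFinM muleC.
have I0 k : true -> 0 <= (\1_(lift F) (mul4 (e k) (mul4 m (inv4 u))))%:E :> \bar R.
  by move=> _; rewrite lee_fin.
rewrite (@nneseriesZl R (fun k => (\1_(lift F) (mul4 (e k) (mul4 m (inv4 u))))%:E) xpredT (phi m) 0%N I0).
rewrite (hN (mul4 m (inv4 u)) _ Nm) 1?muleC//.
by rewrite det4M dm mul1r.
Qed.

End FundamentalDomain.

(** * Siegel's formula *)

Section OrbitCount.
Variable R : realType.
Local Notation RM := (measurableTypeR R).
Local Notation M4 := (RM * RM * RM * RM)%type.
Local Notation leb := (@lebesgue_measure R).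

Lemma cnt_image (T U : choiceType) (f : T -> U) (A : set T) : finite_set A ->
  {in A &, injective f} -> cnt R (f @` A) = cnt R A.
Proof.
move=> fA fi; rewrite /cnt fset_set_image// card_in_imfset//= => x y.
by rewrite !in_fset_set// => xA yA; apply: fi.
Qed.

Lemma measurable_ltset d (T : measurableType d) (f g : T -> RM) :
  measurable_fun setT f -> measurable_fun setT g -> measurable [set x | f x < g x].
Proof.
move=> mf mg; rewrite -[X in measurable X]setTI.
exact: (measurable_fun_ltr mf mg measurableT (Y := [set true])).
Qed.
Lemma measurable_leset d (T : measurableType d) (f g : T -> RM) :
  measurable_fun setT f -> measurable_fun setT g -> measurable [set x | f x <= g x].
Proof.
move=> mf mg; rewrite -[X in measurable X]setTI.
exact: (measurable_fun_ler mf mg measurableT (Y := [set true])).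
Qed.

Definition tri (S : R) : set (RM * RM) := [set v | 0 < v.1 <= S /\ 0 <= - v.2 < v.1].

(* The points of the orbit with slope [-d/c] in [al, be) and [0 < c <= S]. *)
Definition sector (G : set M4) s m (S al be : R) : set (R * R) :=
  [set v | orb G s v /\ (0 < (rmul v m).1 <= S /\
     al * (rmul v m).1 <= - (rmul v m).2 < be * (rmul v m).1)].

(** The value 0 off determinant 1 keeps the function bounded and measurable on the whole space of
    quadruples. *)
Definition orbN (G : set M4) s (S : R) (m : M4) : R :=
  if det4 m == 1 then cnt R (sector G s m S 0 1) else 0.

Lemma sector01 G s m S : sector G s m S 0 1 = [set v | orb G s v /\ tri S (rmul v m)].
Proof. by apply/seteqP; split=> v; rewrite /sector /tri /= mul0r mul1r. Qed.

Lemma orbN_ge0 G s S m : 0 <= orbN G s S m.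
Proof. by rewrite /orbN; case: ifP => // _; exact: cnt_ge0. Qed.

(** The difference of two slopes is the wedge divided by the product of the first coordinates, and
    [orb_spacing] bounds the wedge below. *)
Lemma sector_sep G s m (S al be : R) (s0 := (200 ^+ 2)^-1 : R) : det4 s = 1 -> dgroup G ->
  cusp_at_infty [set m | G (conj4 (inv4 s) m)] -> det4 m = 1 -> 0 < S ->
  forall v w, sector G s m S al be v -> sector G s m S al be w -> v <> w ->
  s0 / S ^+ 2 <= `|- (rmul v m).2 / (rmul v m).1 - - (rmul w m).2 / (rmul w m).1|.
Proof.
move=> ds dG cS dm S0 v w [Lv [/andP[c1 c1'] _]] [Lw [/andP[c2 c2'] _]] vw.
have W0 : wedge v w <> 0.
  move=> h; have [//|vE] := orb_wedge0 ds dG cS Lv Lw h.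
  by move: c1; rewrite vE rmulN /= ltNge oppr_le0 ltW.
have := wedge_rmul v w m; rewrite dm mulr1.
have [//|hs] := orb_spacing ds dG cS Lv Lw.
move: hs; set V := rmul v m; set U := rmul w m => hs hw.
have -> : - V.2 / V.1 - - U.2 / U.1 = wedge v w / (V.1 * U.1).
  by rewrite -hw /wedge; field; rewrite (gt_eqF c1) (gt_eqF c2).
rewrite normrM normfV (gtr0_norm (mulr_gt0 c1 c2)).
apply: (ler_pM _ _ hs); [by rewrite invr_ge0 exprn_ge0 ?ler0n|by rewrite invr_ge0 sqr_ge0|].
rewrite lef_pV2 ?posrE ?mulr_gt0 ?exprn_gt0// expr2.
by apply: ler_pM => //; exact: ltW.
Qed.

Lemma sector_bound G s m (S al be : R) : det4 s = 1 -> dgroup G ->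
  cusp_at_infty [set m | G (conj4 (inv4 s) m)] -> det4 m = 1 -> 0 < S -> al <= be ->
  finite_set (sector G s m S al be) /\
  cnt R (sector G s m S al be) <= 1 + (be - al) * (S ^+ 2 * 200 ^+ 2).
Proof.
move=> ds dG cS dm S0 ab.
have d0 : 0 < (200 ^+ 2)^-1 / S ^+ 2 by apply: divr_gt0; [rewrite invr_gt0; apply: exprn_gt0; exact: ltr0Sn|exact: exprn_gt0].
have := @cnt_separated_le R _ (sector G s m S al be)
  (fun v => - (rmul v m).2 / (rmul v m).1) al be _ d0 ab.
have -> : S ^+ 2 * 200 ^+ 2 = ((200 ^+ 2)^-1 / S ^+ 2)^-1 by rewrite [RHS]invfM invrK mulrC [in RHS]invrK.
apply.
  move=> v [_ [/andP[c0 _] /andP[h1 h2]]].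
  by rewrite ler_pdivlMr// ler_pdivrMr// h1 ltW.
exact: sector_sep.
Qed.

Lemma orbN_bound G s S : det4 s = 1 -> dgroup G ->
  cusp_at_infty [set m | G (conj4 (inv4 s) m)] -> 0 < S ->
  forall m, orbN G s S m <= 1 + S ^+ 2 * 200 ^+ 2.
Proof.
move=> ds dG cS S0 m; rewrite /orbN; case: eqP => [dm|_].
  have [_] := sector_bound ds dG cS dm S0 (@ler01 R).
  by rewrite subr0 mul1r.
by apply: addr_ge0; [exact: ler01|]; apply: mulr_ge0; apply: exprn_ge0; [exact: ltW|exact: ler0n].
Qed.

Lemma orbN_left G s S g m : det4 s = 1 -> dgroup G ->
  cusp_at_infty [set m | G (conj4 (inv4 s) m)] -> 0 < S -> G g ->
  orbN G s S (mul4 g m) = orbN G s S m.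
Proof.
move=> ds dG cS S0 Gg; have dg := dg_det dG Gg.
rewrite /orbN det4M dg mul1r; case: eqP => // dm.
have [f1 _] := sector_bound ds dG cS (m := mul4 g m) (etrans (det4M _ _) (etrans (congr2 _ dg dm) (mulr1 1))) S0 (@ler01 R).
rewrite -(@cnt_image _ _ (fun v => rmul v g) _ f1); last first.
  by move=> v w _ _ /(congr1 (fun z => rmul z (inv4 g))); rewrite !rmulK.
congr cnt; apply/seteqP; split => [_ [v [Lv h] <-]|v [Lv h]].
  by split; [exact: orb_rmul|rewrite -rmulM].
exists (rmul v (inv4 g)); last by rewrite rmulVK.
by split; [apply: orb_rmul => //; exact: (dgV dG)|rewrite rmulM rmulVK].
Qed.

Lemma measurable_tri S : measurable (tri S).
Proof.
have -> : tri S = [set v : RM * RM | 0 < v.1] `&` [set v : RM * RM | v.1 <= S] `&`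
   ([set v : RM * RM | 0 <= - v.2] `&` [set v : RM * RM | - v.2 < v.1]).
  by apply/seteqP; split=> [v [/andP[? ?] /andP[? ?]]|v [[/= h1 h2] [/= h3 h4]]] //; split; apply/andP.
have m1 : measurable_fun setT (fun v : RM * RM => v.1) by exact: measurable_fst.
have m2 : measurable_fun setT (fun v : RM * RM => - v.2).
  by apply: measurableT_comp => //; exact: measurable_snd.
have mc (a : R) : measurable_fun setT (fun v : RM * RM => a : RM) by exact: measurable_cst.
by apply: measurableI; apply: measurableI;
  do ?[exact: measurable_ltset | exact: measurable_leset].
Qed.

Lemma tri_area S : 0 < S -> L2 R (tri S) = (S ^+ 2 / 2)%:E.
Proof.
move=> S0; have mT := measurable_tri S.
rewrite -[L2 R _](@mul1e R) -[1%E]/(1%:E) -integral_cst// integral_mkcond/=.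
transitivity (\int[L2 R]_v (\1_(tri S) v)%:E)%E.
  by rewrite -[LHS]integral_mkcond integral_cst// mul1e integral_indic// setIT.
have mI : measurable_fun setT (fun v : RM * RM => (\1_(tri S) v)%:E : \bar R).
  by apply/measurable_EFinP; exact: measurable_indic.
have I0 v : (0%R <= (\1_(tri S) v)%:E :> \bar R)%E by rewrite lee_fin.
rewrite (L2_fubini1 mI I0) -(integral_id_pos S0) [RHS]integral_mkcond/=.
apply: eq_integral => c _; rewrite patchE.
case: ifPn => [|]; rewrite ?inE ?notin_setE /= in_itv /= => hc.
  have -> : (fun d => (\1_(tri S) (c, d))%:E : \bar R) = (fun d => (\1_(`]- c, 0%R]%classic : set RM) d)%:E).
    apply/funext => d; rewrite !indicE; congr (_ %:R%:E)%E; congr nat_of_bool.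
    apply/idP/idP; rewrite !inE /tri /= in_itv /=.
      by move=> [_ /andP[h1 h2]]; rewrite ltrNl h2 -oppr_ge0.
    by move=> /andP[h1 h2]; split=> //; rewrite oppr_ge0 h2 ltrNl.
  rewrite integral_indic// setIT.
  have := @lebesgue_measure_itv R `]- c, 0%R]; rewrite /= lte_fin.
  by case/andP: hc => c0 _; rewrite oppr_lt0 c0 /= add0e opprK.
by apply: integral0_eq => d _; rewrite indicE memNset// => -[h _]; exact: hc.
Qed.

Lemma xc_upper (x : R) (m : M4) : det4 m = 1 -> xc (mul4 (upper4 x) m) = x + xc m.
Proof.
move=> dm; have b0 := det4_bot dm.
suff -> : mul4 (upper4 x) m = mat (bot m, x + xc m) by rewrite xc_mat.
rewrite -{1}(matK dm) (mat_upper _ (xc m)) (mat_upper _ (x + xc m)) mul4A; congr mul4.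
by rewrite /mul4 /upper4 /=; congr (_, _, _, _); ring.
Qed.

Definition orbf (s : M4) (S : R) (m : M4) : R :=
  \1_(tri S) (bot (mul4 (inv4 s) m)) * \1_(`[0%R, 1%R[%classic : set RM) (xc (mul4 (inv4 s) m)).

Lemma measurable_orbf s S : measurable_fun setT (fun m : M4 => (orbf s S m)%:E : \bar R).
Proof.
apply/measurable_EFinP; apply: measurable_funM; apply: measurableT_comp.
- by apply: measurable_indic; exact: measurable_tri.
- by apply: measurableT_comp; [exact: measurable_bot|exact: measurable_mul4l].
- by apply: measurable_indic; exact: measurable_itv.
- by apply: measurableT_comp; [exact: measurable_xc|exact: measurable_mul4l].
Qed.

(* Every orbit vector is the bottom row of exactly one element of [s^-1 G] with abscissa in [0, 1). *)
Lemma orbN_series G s S (e : nat -> M4) m : det4 s = 1 -> dgroup G ->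
  cusp_at_infty [set m | G (conj4 (inv4 s) m)] -> 0 < S -> set_bij setT G e -> det4 m = 1 ->
  (\sum_(0 <= k <oo) (orbf s S (mul4 (e k) m))%:E = (orbN G s S m)%:E)%E.
Proof.
move=> ds dG cS S0 be dm; rewrite /orbN dm eqxx.
have Ge k : G (e k) by apply: (set_bij_homo be).
have dsi : det4 (inv4 s) = 1 by rewrite det4V.
have dek k : det4 (mul4 (inv4 s) (e k)) = 1 by rewrite det4M dsi (dg_det dG (Ge k)) mulr1.
have [fin _] := sector_bound ds dG cS dm S0 (@ler01 R).
pose A := [set k | tri S (rmul (bot (mul4 (inv4 s) (e k))) m) /\
   0 <= xc (mul4 (mul4 (inv4 s) (e k)) m) < 1].
pose f k := bot (mul4 (inv4 s) (e k)).
have fE k : orbf s S (mul4 (e k) m) = \1_A k.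
  rewrite /orbf !mul4A bot_mul !indicE -natrM mulnb; congr (_%:R); congr nat_of_bool.
  apply/idP/idP.
    by move=> /andP[]; rewrite !inE /A /= in_itv /= => ? ?.
  by rewrite inE => -[h1 h2]; apply/andP; split; apply/mem_set => //=; rewrite in_itv.
under eq_eseriesr do rewrite fE.
have finj : {in A &, injective f}.
  move=> k l; rewrite !inE => -[tk /andP[k0 k1]] [tl /andP[l0 l1]] fkl.
  have : wedge (bot (mul4 (inv4 s) (e k))) (bot (mul4 (inv4 s) (e l))) = 0.
    by rewrite -/(f k) -/(f l) fkl /wedge mulrC subrr.
  move=> /(orb_same ds dG cS (Ge k) (Ge l)) [b [h|h]].
    have b0 : b = 0.
      move: k0 k1; rewrite h -mul4A xc_upper; last by rewrite det4M dek dm mulr1.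
      move: l0 l1; set x := xc _ => l0 l1 k0 k1.
      have h1 : (-1)%:~R < b%:~R :> R by rewrite mulrN1z; move: l1 k0; clear; lra.
      have h2 : b%:~R < 1%:~R :> R by move: l0 k1; clear; lra.
      by move: h1 h2; rewrite !ltr_int; clear; case: b => [[]|[]].
    have : mul4 (inv4 s) (e k) = mul4 (inv4 s) (e l).
      by rewrite h b0 (_ : upper4 _ = one4) ?mul14.
    by move/(mul4_injl dsi); apply: (set_bij_inj be); rewrite inE.
  have : f k = - f l by rewrite /f h /bot /mul4 /=; congr (_, _); rewrite /=; ring.
  rewrite fkl => hl; exfalso.
  case: tl => /andP[h1 _] _; case: tk => /andP[h2 _] _.
  by move: h2; rewrite -/(f k) fkl hl rmulN /= ltNge oppr_le0 ltW.
have fA : f @` A = sector G s m S 0 1.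
  rewrite sector01; apply/seteqP; split => [_ [k [tk _] <-]|v [[g Gg <-] tv]].
    by split=> //; exists (e k).
  pose b := - Num.floor (xc (mul4 (mul4 (inv4 s) g) m)).
  have [k _ ek] : (e @` setT) (mul4 (conj4 (inv4 s) (upper4 b%:~R)) g).
    apply: (set_bij_surj be); apply: (dgM dG) => //.
    exact: (ci_upper cS).
  have ek' : mul4 (inv4 s) (e k) = mul4 (upper4 b%:~R) (mul4 (inv4 s) g).
    by rewrite ek /conj4 inv4K !mul4A mulV4// mul14.
  have bE : bot (mul4 (inv4 s) (e k)) = bot (mul4 (inv4 s) g).
    by rewrite ek' /bot /mul4 /=; congr (_, _); ring.
  exists k => //; split; first by rewrite bE.
  rewrite ek' -mul4A xc_upper; last by rewrite !det4M dsi (dg_det dG Gg) dm !mulr1.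
  rewrite /b rmorphN /=; set x := xc _.
  have := Num.Theory.floor_le x; have := lt_succ_floor x.
  by rewrite rmorphD /= => h1 h2; apply/andP; split; lra.
have finA : finite_set A.
  by rewrite -(eq_finite_set (inj_card_eq finj)) fA.
by rewrite cnt_series// -fA cnt_image.
Qed.

Lemma orbN_det0 G s S m : det4 m != 1 -> orbN G s S m = 0.
Proof. by rewrite /orbN => /negPf ->. Qed.

Lemma measurable_det1 : measurable [set m : M4 | det4 m = 1].
Proof.
have md : measurable_fun setT (@det4 R : M4 -> RM).
  have h1 := @measurable_p1 R; have h2 := @measurable_p2 R.
  have h3 := @measurable_p3 R; have h4 := @measurable_p4 R.
  by apply: measurable_funB; apply: measurable_funM.
by rewrite -[X in measurable X]setTI; exact: (md measurableT [set 1]).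
Qed.

Lemma measurable_orbN G s S : det4 s = 1 -> cusp_at_infty G ->
  cusp_at_infty [set m | G (conj4 (inv4 s) m)] -> 0 < S ->
  measurable_fun setT (fun m : M4 => (orbN G s S m)%:E : \bar R).
Proof.
move=> ds cG cS S0; have [e be] := cusp_group_enum cG.
rewrite (_ : (fun m => _) = (fun m => (\1_[set m : M4 | det4 m = 1] m)%:E *
   \sum_(0 <= k <oo) (orbf s S (mul4 (e k) m))%:E)%E); last first.
  apply/funext => m; rewrite indicE; case: (eqVneq (det4 m) 1) => dm.
    by rewrite mem_set// mul1e (orbN_series ds (ci_dg cG) cS S0 be dm).
  by rewrite memNset ?mul0e ?orbN_det0//; exact/eqP.
apply: emeasurable_funM.
  by apply/measurable_EFinP; apply: measurable_indic; exact: measurable_det1.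
apply: measurable_nneseries => [k|k m].
  by apply: (measurableT_comp (measurable_orbf s S)); exact: measurable_mul4l.
by rewrite lee_fin mulr_ge0.
Qed.

(** Unfolding gives twice the Haar measure of the matrices with bottom row in [tri S] and abscissa
    in [[0, 1)], that is twice the area [S^2/2]. *)
Lemma siegel G F C s S : fundom G F C -> det4 s = 1 ->
  cusp_at_infty [set m | G (conj4 (inv4 s) m)] -> 0 < S ->
  quo F (fun m => (orbN G s S m)%:E) = (S ^+ 2)%:E.
Proof.
move=> fd ds cS S0; have [e be] := cusp_group_enum (fd_cusp fd).
have dG := ci_dg (fd_cusp fd).
have mf := measurable_orbf s S.
have f0 m : 0 <= orbf s S m by rewrite mulr_ge0.
transitivity (2%:E * haar (fun m => (orbf s S m)%:E))%E.
  rewrite (unfold fd be mf f0); apply: (@haar_null_eq _ _ _ set0) => //.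
  - by apply: measurable_mulE; [exact: (fd_mF fd)|exact: measurable_orbN (fd_cusp fd) _ _].
  - apply: measurable_mulE; first exact: (fd_mF fd).
    apply: measurable_nneseries => [k|k m]; last by rewrite lee_fin.
    by apply: (measurableT_comp mf); exact: measurable_mul4l.
  - by move=> m; apply: mulE_ge0 => m'; rewrite lee_fin orbN_ge0.
  - by move=> m; apply: mulE_ge0 => m'; apply: nneseries_ge0 => k _ _; rewrite lee_fin.
  - by rewrite /haar integral0_eq// => p _; rewrite indic0.
  - by move=> m dm _; rewrite /mulE (orbN_series ds dG cS S0 be dm).
have dsi : det4 (inv4 s) = 1 by rewrite det4V.
pose f1 (m : M4) : \bar R := (\1_(tri S) (bot m) * \1_(`[0%R, 1%R[%classic : set RM) (xc m))%:E.
have mf1 : measurable_fun setT f1.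
  apply/measurable_EFinP; apply: measurable_funM; apply: measurableT_comp.
  - by apply: measurable_indic; exact: measurable_tri.
  - exact: measurable_bot.
  - by apply: measurable_indic; exact: measurable_itv.
  - exact: measurable_xc.
have f10 m : (0 <= f1 m)%E by rewrite lee_fin mulr_ge0.
rewrite (haar_left dsi mf1 f10) haar_bot_strip; [|exact: measurable_tri|by move=> [/andP[]]; rewrite ltxx].
by rewrite tri_area// -EFinM; congr EFin; field.
Qed.
End OrbitCount.

(** * Mean ergodic theorem *)

Section Expectation.
Variable R : realType.
Local Notation RM := (measurableTypeR R).
Local Notation M4 := (RM * RM * RM * RM)%type.
Implicit Types (f h : M4 -> R) (G : set M4) (F C : set (RM * RM)).

Record adm G f : Prop := Adm {
  adm_meas : measurable_fun setT (fun m : M4 => (f m)%:E : \bar R);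
  adm_bd : exists c : R, forall m, `|f m| <= c;
  adm_inv : forall g m, G g -> f (mul4 g m) = f m }.

(** Not normalised: the mass of the constant 1 is half the covolume. *)
Definition Ex F f : R := fine (quo F (fun m => (f m)%:E)).

Lemma adm_cst G c : adm G (fun=> c).
Proof. by split=> //; exists `|c|. Qed.

Lemma admD G f h : adm G f -> adm G h -> adm G (fun m => f m + h m).
Proof.
move=> [mf [a fa] fi] [mh [b hb] hi]; split.
- by move: mf mh => /measurable_EFinP mf /measurable_EFinP mh; apply/measurable_EFinP; exact: measurable_funD.
- by exists (a + b) => m; rewrite (le_trans (ler_normD _ _))// lerD.
- by move=> g m Gg; rewrite fi// hi.
Qed.

Lemma admM G f h : adm G f -> adm G h -> adm G (fun m => f m * h m).
Proof.
move=> [mf [a fa] fi] [mh [b hb] hi]; split.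
- by move: mf mh => /measurable_EFinP mf /measurable_EFinP mh; apply/measurable_EFinP; exact: measurable_funM.
- by exists (a * b) => m; rewrite normrM ler_pM.
- by move=> g m Gg; rewrite fi// hi.
Qed.

Lemma admZ G c f : adm G f -> adm G (fun m => c * f m).
Proof. exact: admM (adm_cst _ _). Qed.

Lemma admB G f h : adm G f -> adm G h -> adm G (fun m => f m - h m).
Proof.
move=> af ah; have := admD af (admZ (-1) ah).
by congr adm; apply/funext => m; rewrite mulN1r.
Qed.

Lemma admX2 G f : adm G f -> adm G (fun m => f m ^+ 2).
Proof. by move=> af; have := admM af af. Qed.

Lemma adm_sum G (N : nat) (f : nat -> M4 -> R) : (forall k, adm G (f k)) ->
  adm G (fun m => \sum_(k < N) f k m).
Proof.
move=> af; elim: N => [|N IH].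
  by have := adm_cst G 0; congr adm; apply/funext => m; rewrite big_ord0.
by have := admD IH (af N); congr adm; apply/funext => m; rewrite big_ord_recr.
Qed.

Lemma adm_right G u f : adm G f -> adm G (fun m => f (mul4 m u)).
Proof.
move=> [mf [a fa] fi]; split.
- by apply: (measurableT_comp mf); exact: measurable_mul4r.
- by exists a => m; exact: fa.
- by move=> g m Gg; rewrite -mul4A fi.
Qed.

Lemma quo1_lt G F C : fundom G F C -> (quo F (fun=> 1%:E) < +oo)%E.
Proof.
move=> fd; rewrite /quo (_ : mulE _ _ = fun m => (\1_F (xc m, yc m))%:E); last first.
  by apply/funext => m; rewrite /mulE mule1 !indicE; congr (_%:R%:E); congr nat_of_bool; apply/idP/idP; rewrite !inE.
rewrite haar_base; [|exact: (fd_mF fd)|exact: (fd_pos fd)].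
by rewrite lte_mul_pinfty ?lee_fin ?pi_ge0//; exact: (fd_fin fd).
Qed.

Lemma Ex_integrable G F C f : fundom G F C -> adm G f ->
  (L3 R).-integrable setT (fun p => mulE F (fun m => (f m)%:E) (mat p)).
Proof.
move=> fd [mf [c fc] _].
have c0 : 0 <= c by apply: le_trans (fc (0, 0, 0, 0)).
have mm (f' : M4 -> R) : measurable_fun setT (fun m : M4 => (f' m)%:E : \bar R) ->
    measurable_fun setT (fun p => mulE F (fun m => (f' m)%:E) (mat p) : \bar R).
  move=> mf'; exact: (measurable_comp_mat (measurable_mulE (fd_mF fd) mf')).
have ic : (L3 R).-integrable setT (fun p => mulE F (fun m => c%:E) (mat p)).
  apply/integrableP; split; first by apply: mm; exact: measurable_cst.
  rewrite (_ : (fun _ => _) = (fun p => c%:E * mulE F (fun m => 1%:E) (mat p))%E); last first.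
    apply/funext => p; rewrite /mulE mule1 muleC gee0_abs// mule_ge0 ?lee_fin//.
  rewrite ge0_integralZl//.
  - by rewrite lte_mul_pinfty ?lee_fin//; exact: (quo1_lt fd).
  - by apply: mm; exact: measurable_cst.
  - by move=> p _; apply: mulE_ge0 => m; rewrite lee_fin.
apply: le_integrable ic => //; first exact: mm.
move=> p _; rewrite /mulE !abseM; apply: lee_pmul => //; rewrite lee_fin.
by rewrite (ger0_norm c0).
Qed.

Lemma Ex_EFin G F C f : fundom G F C -> adm G f ->
  (Ex F f)%:E = quo F (fun m => (f m)%:E).
Proof. by move=> fd af; rewrite /Ex fineK//; exact: integrable_fin_num (Ex_integrable fd af). Qed.

Lemma ExD G F C f h : fundom G F C -> adm G f -> adm G h ->
  Ex F (fun m => f m + h m) = Ex F f + Ex F h.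
Proof.
move=> fd af ah; apply: EFin_inj; rewrite EFinD !(Ex_EFin fd)//; last exact: admD.
rewrite -(integralD measurableT (Ex_integrable fd af) (Ex_integrable fd ah)).
by apply: eq_integral => p _; rewrite /mulE EFinD muleDr.
Qed.

Lemma ExZ G F C c f : fundom G F C -> adm G f -> Ex F (fun m => c * f m) = c * Ex F f.
Proof.
move=> fd af; apply: EFin_inj; rewrite EFinM !(Ex_EFin fd)//; last exact: admZ.
rewrite -(integralZl measurableT (Ex_integrable fd af)).
by apply: eq_integral => p _; rewrite /mulE EFinM muleCA.
Qed.

Lemma ExB G F C f h : fundom G F C -> adm G f -> adm G h ->
  Ex F (fun m => f m - h m) = Ex F f - Ex F h.
Proof.
move=> fd af ah; rewrite -mulN1r -(ExZ _ fd ah) -(ExD fd af (admZ _ ah)).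
by congr Ex; apply/funext => m; rewrite mulN1r.
Qed.

Lemma Ex_sum G F C N (f : nat -> M4 -> R) : fundom G F C -> (forall k, adm G (f k)) ->
  Ex F (fun m => \sum_(k < N) f k m) = \sum_(k < N) Ex F (f k).
Proof.
move=> fd af; elim: N => [|N IH].
  rewrite big_ord0; transitivity (Ex F (fun=> 0 * 0)).
    by congr Ex; apply/funext => m; rewrite big_ord0 mulr0.
  by rewrite (ExZ _ fd (adm_cst G 0)) mul0r.
rewrite big_ord_recr /= -IH -(ExD fd (adm_sum N af) (af N)).
by congr Ex; apply/funext => m; rewrite big_ord_recr.
Qed.

Lemma Ex_ge0 F f : (forall m, 0 <= f m) -> 0 <= Ex F f.
Proof. by move=> f0; apply: fine_ge0; apply: haar_ge0 => m; apply: mulE_ge0 => m'; rewrite lee_fin. Qed.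

Lemma Ex_le G F C f h : fundom G F C -> adm G f -> adm G h -> (forall m, f m <= h m) ->
  Ex F f <= Ex F h.
Proof.
by move=> fd af ah fh; rewrite -subr_ge0 -(ExB fd ah af) Ex_ge0// => m; rewrite subr_ge0.
Qed.

(** [quo_right] needs nonnegative functions, so a bound of [f] is added and subtracted. *)
Lemma Ex_right G F C u f : fundom G F C -> adm G f -> det4 u = 1 ->
  Ex F (fun m => f (mul4 m u)) = Ex F f.
Proof.
move=> fd af du; have [c fc] := adm_bd af.
pose h m := f m + c.
have ah : adm G h by exact: admD (adm_cst _ _).
have h0 m : 0 <= h m by have := fc m; rewrite ler_norml /h -subr_ge0 opprK addrC => /andP[].
have : Ex F (fun m => h (mul4 m u)) = Ex F h.
  by rewrite /Ex (quo_right fd du (adm_meas ah) h0 (adm_inv ah)).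
rewrite /h (ExD fd (adm_right u af) (adm_cst G c)) (ExD fd af (adm_cst G c)).
exact: addIr.
Qed.

End Expectation.

Section Riesz.
Variable R : realType.
Local Notation RM := (measurableTypeR R).
Local Notation M4 := (RM * RM * RM * RM)%type.
Implicit Types (f h : M4 -> R) (G : set M4) (F C : set (RM * RM)).

Definition sh (k : nat) f (m : M4) : R := f (mul4 m (upper4 k%:R)).
Definition av (N : nat) f (m : M4) : R := N%:R^-1 * \sum_(k < N) sh k f m.

Lemma sh_sh k l f m : sh k (sh l f) m = sh (k + l) f m.
Proof.
rewrite /sh -mul4A; congr (f (mul4 m _)).
by rewrite /mul4 /upper4 /= natrD; congr (_, _, _, _); ring.
Qed.

Lemma sh_av k N f m : sh k (av N f) m = av N (sh k f) m.
Proof.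
rewrite /av {1}/sh; congr (_ * _); apply: eq_bigr => i _.
by rewrite -/(sh k (sh i f) m) !sh_sh addnC.
Qed.

Lemma av_av N M f m : av N (av M f) m = av M (av N f) m.
Proof.
rewrite {1}/av; under eq_bigr do rewrite sh_av /av.
rewrite -mulr_sumr exchange_big /= mulrCA; congr (_ * _); rewrite mulr_sumr.
apply: eq_bigr => i _; rewrite sh_av /av; congr (_ * _); apply: eq_bigr => k _.
by rewrite !sh_sh addnC.
Qed.

Lemma avD N f h m : av N (fun m => f m + h m) m = av N f m + av N h m.
Proof. by rewrite /av -mulrDr -big_split. Qed.

Lemma avZ N c f m : av N (fun m => c * f m) m = c * av N f m.
Proof. by rewrite /av mulrCA; congr (_ * _); rewrite mulr_sumr. Qed.

Lemma av_bd N f (c : R) (m : M4) : (0 < N)%N ->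
  (forall k, (k < N)%N -> `|sh k f m - f m| <= c) -> `|av N f m - f m| <= c.
Proof.
move=> N0 fc; have N0' : 0 < N%:R :> R by rewrite ltr0n.
have -> : av N f m - f m = N%:R^-1 * \sum_(k < N) (sh k f m - f m).
  by rewrite sumrB mulrBr sumr_const card_ord -(mulr_natl (f m) N) mulrA mulVf ?mul1r ?gt_eqF.
rewrite normrM normfV (gtr0_norm N0') ler_pdivrMl//.
apply: le_trans (ler_norm_sum _ _ _) _.
rewrite mulr_natl -[X in c *+ X](card_ord N) -sumr_const.
by apply: ler_sum => k _; exact: fc.
Qed.

Lemma av_norm N f (c : R) m : (0 < N)%N -> (forall m, `|f m| <= c) -> `|av N f m| <= c.
Proof.
move=> N0 fc; have N0' : 0 < N%:R :> R by rewrite ltr0n.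
rewrite /av normrM normfV (gtr0_norm N0') ler_pdivrMl//.
apply: le_trans (ler_norm_sum _ _ _) _.
rewrite mulr_natl -[X in c *+ X](card_ord N) -sumr_const.
by apply: ler_sum => k _; exact: fc.
Qed.

Lemma sh_av_bd a N f (c : R) m : (0 < N)%N -> (forall m, `|f m| <= c) ->
  `|sh a (av N f) m - av N f m| <= a%:R * (2 * c) / N%:R.
Proof.
move=> N0 fc; have N0' : 0 < N%:R :> R by rewrite ltr0n.
elim: a m => [|a IH] m.
  by rewrite !mul0r /sh (_ : upper4 _ = one4) ?mul41 ?subrr ?normr0.
have -> : sh a.+1 (av N f) m - av N f m =
    (sh a.+1 (av N f) m - sh a (av N f) m) + (sh a (av N f) m - av N f m) by ring.
rewrite -addn1 natrD mulrDl mul1r mulrDl addrC [X in _ <= X]addrC.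
rewrite [X in `|X|]addrC; apply: le_trans (ler_normD _ _) _; apply: lerD; last exact: IH.
rewrite !sh_av /av -mulrBr -sumrB normrM normfV (gtr0_norm N0') mulrC ler_pM2r ?invr_gt0//.
rewrite (eq_bigr (fun k : 'I_N => sh (a + k.+1)%N f m - sh (a + k)%N f m)); last first.
  by move=> k _; rewrite !sh_sh addn1 (addnC k a.+1) (addnC k a) addSnnS.
rewrite -(big_mkord xpredT (fun k => sh (a + k.+1)%N f m - sh (a + k)%N f m)).
rewrite telescope_sumr// addn0.
by apply: le_trans (ler_normB _ _) _; rewrite mulrDl !mul1r lerD// fc.
Qed.

Lemma sum_sq_le N (a : nat -> R) : (\sum_(k < N) a k) ^+ 2 <= N%:R * \sum_(k < N) a k ^+ 2.
Proof.
rewrite expr2 mulr_suml.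
have -> : N%:R * \sum_(k < N) a k ^+ 2 =
    \sum_(i < N) \sum_(j < N) (a i ^+ 2 / 2 + a j ^+ 2 / 2).
  under [RHS]eq_bigr do rewrite big_split /= sumr_const card_ord -mulr_suml.
  rewrite big_split /= sumrMnl -mulr_suml sumr_const card_ord.
  by rewrite -[X in _ = X + _]mulr_natl -[X in _ = _ + X]mulr_natl; field.
apply: ler_sum => i _; rewrite mulr_sumr; apply: ler_sum => j _.
rewrite -subr_ge0 (_ : _ - _ = (a i - a j) ^+ 2 / 2); last by field.
by rewrite divr_ge0 ?sqr_ge0.
Qed.

Lemma adm_sh G k f : adm G f -> adm G (sh k f).
Proof. exact: adm_right. Qed.
Lemma adm_av G N f : adm G f -> adm G (av N f).
Proof. by move=> af; exact: (admZ _ (adm_sum N (fun k => adm_sh k af))). Qed.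

Lemma Ex_av_sq G F C N f : fundom G F C -> adm G f -> (0 < N)%N ->
  Ex F (fun m => av N f m ^+ 2) <= Ex F (fun m => f m ^+ 2).
Proof.
move=> fd af N0; have N0' : 0 < N%:R :> R by rewrite ltr0n.
have as2 k : adm G (fun m => sh k f m ^+ 2) by apply: admX2; exact: adm_sh.
have aS : adm G (fun m => N%:R^-1 * \sum_(k < N) sh k f m ^+ 2).
  exact: (admZ _ (adm_sum N as2)).
apply: (@le_trans _ _ (Ex F (fun m => N%:R^-1 * \sum_(k < N) sh k f m ^+ 2))).
  apply: (Ex_le fd) => //; first by apply: admX2; exact: adm_av.
  move=> m; rewrite /av exprMn expr2 -mulrA ler_pM2l ?invr_gt0// ler_pdivrMl//.
  exact: (sum_sq_le _ (fun k => sh k f m)).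
rewrite (ExZ _ fd (adm_sum N as2)) (Ex_sum _ fd as2).
rewrite (eq_bigr (fun=> Ex F (fun m => f m ^+ 2))); last first.
  by move=> k _; exact: (Ex_right fd (admX2 af) (det4_upper _)).
by rewrite sumr_const card_ord -(mulr_natl (Ex _ _) N) mulrA mulVf ?mul1r// gt_eqF.
Qed.

(* Riesz' proof of the mean ergodic theorem: averages of almost minimal norm are almost invariant. *)
Lemma almost_invariant G F C f (e : R) : fundom G F C -> adm G f -> 0 < e ->
  exists2 N, (0 < N)%N & forall i,
    Ex F (fun m => (av N f (mul4 m (upper4 i%:R)) - av N f m) ^+ 2) <= e.
Proof.
move=> fd af e0; have [c fc] := adm_bd af.
have c0 : 0 <= c by apply: le_trans (fc (0, 0, 0, 0)).
pose q (N : nat) := Ex F (fun m => av N.+1 f m ^+ 2).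
have hq : has_inf (range q).
  split; first by exists (q 0%N); exists 0%N.
  by exists 0 => _ [N _ <-]; apply: Ex_ge0 => m; exact: sqr_ge0.
have e4 : 0 < e / 4 by rewrite divr_gt0.
have [_ [N0 _ <-] hN] := inf_adherent e4 hq.
set mu := inf _ in hN.
have qmu N : mu <= q N by apply: ge_inf; [case: hq|exists N].
exists N0.+1 => // i; set N := N0.+1; set x := av N f.
have ax : adm G x by exact: adm_av.
pose z m := 2^-1 * (x m + sh i x m).
have az : adm G z := admZ _ (admD ax (adm_sh i ax)).
(* Parallelogram identity: the displacement is [4 E x^2 - 4 E z^2], which is at most
   [4 (mu + e/4) - 4 mu = e]. *)
suff hz : mu <= Ex F (fun m => z m ^+ 2).
  have -> : Ex F (fun m => (x (mul4 m (upper4 i%:R)) - x m) ^+ 2) =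
      2 * (Ex F (fun m => x m ^+ 2) + Ex F (fun m => sh i x m ^+ 2)) - 4 * Ex F (fun m => z m ^+ 2).
    have a1 := admX2 ax; have a2 := admX2 (adm_sh i ax); have a3 := admX2 az.
    rewrite -(ExD fd a1 a2) -(ExZ _ fd (admD a1 a2)) -(ExZ _ fd a3).
    rewrite -(ExB fd (admZ _ (admD a1 a2)) (admZ _ a3)).
    by congr Ex; apply/funext => m; rewrite /z /sh; field.
  rewrite (_ : Ex F (fun m => sh i x m ^+ 2) = Ex F (fun m => x m ^+ 2)); last first.
    exact: (Ex_right fd (admX2 ax) (det4_upper _)).
  by move: hN hz; rewrite /q -/x; lra.
(* The midpoint [z] is not itself an average [av M f], but averaging it over a long range [M]
   differs from [av M f] by [O(1/M)]. As averaging does not increase the norm, the infimum bounds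
   [E z^2] in the limit. *)
have near M m : (0 < M)%N -> `|av M z m - av M f m| <= (N + i)%:R * (2 * c) / M%:R.
  move=> M0; set K := (N + i)%:R * _ / _.
  have h1 k : (k <= N + i)%N -> `|sh k (av M f) m - av M f m| <= K.
    move=> kN; apply: le_trans (sh_av_bd k m M0 fc) _.
    by rewrite ler_wpM2r ?invr_ge0// ler_wpM2r ?mulr_ge0// ler_nat.
  have -> : av M z m = 2^-1 * (av N (av M f) m + av N (fun m => sh i (av M f) m) m).
    rewrite /z avZ avD (av_av M N); congr (_ * (_ + _)).
    rewrite -/(sh i _) -(sh_av i M) /sh (av_av M N) -/(sh i _) -/(sh i (av N (av M f)) m) sh_av.
    by [].
  have h2 : `|av N (av M f) m - av M f m| <= K.
    by apply: av_bd => // k kN; apply: h1; rewrite (leq_trans (ltnW kN))// leq_addr.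
  have h3 : `|av N (fun m => sh i (av M f) m) m - av M f m| <= K.
    have -> : av N (fun m => sh i (av M f) m) m - av M f m =
       N%:R^-1 * \sum_(k < N) (sh (k + i) (av M f) m - av M f m).
      rewrite sumrB mulrBr sumr_const card_ord -(mulr_natl (av M f m) N) mulrA mulVf ?mul1r ?pnatr_eq0//.
      by rewrite /av; congr (_ * _ - _); apply: eq_bigr => k _; rewrite -sh_sh.
    rewrite normrM normfV (ger0_norm (ler0n _ _)) ler_pdivrMl ?ltr0n//.
    apply: le_trans (ler_norm_sum _ _ _) _.
    rewrite mulr_natl -[X in K *+ X](card_ord N) -sumr_const.
    by apply: ler_sum => k _; apply: h1; rewrite leq_add2r ltnW.
  by move: h2 h3; rewrite !ler_norml => /andP[? ?] /andP[? ?]; apply/andP; split; lra.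
rewrite leNgt; apply/negP => lt.
pose K := (N + i)%:R * (2 * c) * (2 * c) * Ex F (fun=> 1).
have hM (M : nat) : mu <= Ex F (fun m => z m ^+ 2) + K / M.+1%:R.
  apply: le_trans (qmu M) _; rewrite /q.
  have b0 : adm G (fun m => av M.+1 z m ^+ 2) by apply: admX2; exact: adm_av.
  have b1 := adm_cst G ((N + i)%:R * (2 * c) * (2 * c) / M.+1%:R * 1).
  apply: (@le_trans _ _ (Ex F (fun m => av M.+1 z m ^+ 2 + (N + i)%:R * (2 * c) * (2 * c) / M.+1%:R * 1))).
    apply: (Ex_le fd); [by apply: admX2; exact: adm_av|exact: admD|].
    move=> m; have := near M.+1 m isT.
    have zc m' : `|z m'| <= c.
      have := av_norm m' (ltn0Sn N0) fc; have := av_norm (mul4 m' (upper4 i%:R)) (ltn0Sn N0) fc.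
      by rewrite /z /sh -/N -/x !ler_norml => /andP[? ?] /andP[? ?]; apply/andP; split; lra.
    have := av_norm m (ltn0Sn M) fc; have := av_norm m (ltn0Sn M) zc.
    set A := av _ z m; set B := av _ f m; rewrite !mulr1 => hA hB hAB.
    rewrite -lerBlDl (_ : B ^+ 2 - A ^+ 2 = (B - A) * (B + A)); last by ring.
    apply: le_trans (ler_norm _) _; rewrite normrM distrC [X in _ <= X]mulrAC.
    apply: ler_pM => //; apply: le_trans (ler_normD _ _) _.
    by move: hA hB; lra.
  rewrite (ExD fd b0 b1) (ExZ _ fd (adm_cst G 1)).
  apply: lerD; first exact: (Ex_av_sq fd az).
  by rewrite /K mulrAC.
have K0 : 0 <= K by rewrite /K !mulr_ge0// Ex_ge0.
have [M] : exists M : nat, K / (mu - Ex F (fun m => z m ^+ 2)) < M%:R.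
  by exists (Num.trunc (K / (mu - Ex F (fun m => z m ^+ 2)))).+1; exact: truncnS_gt.
rewrite ltr_pdivrMr ?subr_gt0// => hKM.
have := hM M; rewrite -lerBlDl ler_pdivlMr// leNgt => /negP; apply.
apply: lt_le_trans hKM _; rewrite mulrC ler_pM2l ?subr_gt0//.
by rewrite ler_nat.
Qed.

End Riesz.

Section Mautner.
Variable R : realType.
Local Notation M4 := (R * R * R * R)%type.

Lemma bruhat (u : M4) : det4 u = 1 -> u.1.2 != 0 ->
  u = mul4 (upper4 ((u.1.1.1 - 1) / u.1.2)) (mul4 (lower4 u.1.2) (upper4 ((u.2 - 1) / u.1.2))).
Proof.
case: u => [[[a b] c] d]; rewrite /det4 /= => du c0.
have -> : b = (a * d - 1) / c.
  by apply: (mulIf c0); rewrite mulfVK// -du; ring.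
by rewrite /mul4 /upper4 /lower4 /=; congr (_, _, _, _); field.
Qed.

(* [D] is a crude squared distance between a vector and its translate; the identity
   n(2j) n^-(1/2j) n(-j) = (2, 0; 1/2j, 1/2) turns invariance under the unipotent
   elements n(j) into invariance under the diagonal one. *)
Lemma mautner (K eps C0 r0 : R) : 1 <= K -> 0 < eps -> 0 <= C0 -> 0 < r0 ->
  exists2 e, 0 < e & forall D : M4 -> R,
  (forall u w, det4 u = 1 -> det4 w = 1 -> D (mul4 u w) <= 2 * D u + 2 * D w) ->
  (forall u, det4 u = 1 -> D (inv4 u) = D u) ->
  (forall u, 0 <= D u) ->
  (forall i : nat, D (upper4 i%:R) <= e) ->
  (forall r u, 0 < r -> r <= r0 -> near4 r u -> det4 u = 1 -> D u <= C0 * r) ->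
  forall u, det4 u = 1 ->
  [/\ `|u.1.1.1| <= K, `|u.1.1.2| <= K, `|u.1.2| <= K & `|u.2| <= K] -> D u <= eps.
Proof.
move=> K1 e0 C00 r00.
pose rho d : R := Num.min r0 (d / (C0 + 1)).
have C1 : 0 < C0 + 1 by lra.
have rho0 d : 0 < d -> 0 < rho d by move=> d0; rewrite lt_min r00 divr_gt0.
have K0 : 0 < K by lra.
(* Bounds the Bruhat coordinates [(t - 1)/c] when [|t| <= 2 K] and [|c| >= 1/(4 K)]: indeed
   [(2 K + 1) 4 K <= 12 K^2]. *)
pose K' := 12 * K ^+ 2.
have K'1 : 0 < K' by rewrite mulr_gt0// exprn_gt0.
pose d' := eps / 400.
have d'0 : 0 < d' := divr_gt0 e0 (ltr0Sn _ _).
have [k hk] : exists k : nat, K' / rho d' <= 4 ^+ k.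
  exists (Num.truncn (K' / rho d')).+1; apply: le_trans (ltW (truncnS_gt _)) _.
  by rewrite -natrX ler_nat ltnW// ltn_expl.
pose P : R := 4 ^+ k.
have P0 : 0 < P by rewrite exprn_gt0.
pose d := eps / 400 / (32 * P).
have d0 : 0 < d := divr_gt0 d'0 (mulr_gt0 (ltr0Sn _ _) P0).
exists d => // D DM DV D0 Dn Dc.
have Dr (x : R) u : 0 < x -> near4 (rho x) u -> det4 u = 1 -> D u <= x.
  move=> x0 nu du; apply: le_trans (Dc _ _ (rho0 x x0) _ nu du) _.
    by rewrite ge_min lexx.
  apply: (@le_trans _ _ (C0 * (x / (C0 + 1)))).
    by rewrite ler_wpM2l// ge_min lexx orbT.
  by rewrite mulrA ler_pdivrMr// mulrC ler_wpM2l ?ltW//; lra.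
have near_up (x t : R) : `|t| <= x -> near4 x (upper4 t).
  by move=> tx; have x0 := le_trans (normr_ge0 _) tx; split=> /=; rewrite ?subrr ?normr0.
have near_lo (x t : R) : `|t| <= x -> near4 x (lower4 t).
  by move=> tx; have x0 := le_trans (normr_ge0 _) tx; split=> /=; rewrite ?subrr ?normr0.
have D2 : D (diag4 2) <= 32 * d.
  pose j := (Num.truncn (rho d)^-1).+1.
  have j0 : 0 < j%:R :> R by rewrite ltr0n.
  have jr : j%:R^-1 <= rho d.
    by rewrite invf_ple ?posrE ?rho0//; exact: ltW (truncnS_gt _).
  have hE : diag4 2 = mul4 (upper4 (2 * j)%:R) (mul4 (lower4 (2 * j%:R)^-1)
      (mul4 (inv4 (upper4 j%:R)) (lower4 (- j%:R^-1)))) :> M4.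
    rewrite /mul4 /diag4 /upper4 /lower4 /inv4 /= natrM; move: j0; clear; set J := j%:R => J0.
    by congr (_, _, _, _); field; rewrite gt_eqF.
  have b1 := Dn (2 * j)%N.
  have b2 : D (inv4 (upper4 j%:R)) <= d by rewrite DV ?Dn// det4_upper.
  have b3 : D (lower4 (2 * j%:R)^-1) <= d.
    apply: Dr => //; [|exact: det4_lower].
    apply: near_lo; apply: le_trans _ jr; rewrite gtr0_norm ?invr_gt0 ?mulr_gt0//.
    by rewrite lef_pV2 ?posrE ?mulr_gt0// ler_peMl// ?ltW//; lra.
  have b4 : D (lower4 (- j%:R^-1)) <= d.
    apply: Dr => //; [|exact: det4_lower].
    by apply: near_lo; rewrite normrN gtr0_norm ?invr_gt0.
  have m1 := DM (inv4 (upper4 j%:R)) (lower4 (- j%:R^-1)) (etrans (det4V _) (det4_upper _)) (det4_lower _).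
  have m2 := DM (lower4 (2 * j%:R)^-1) _ (det4_lower _) (etrans (det4M (inv4 (upper4 j%:R)) (lower4 (- j%:R^-1))) (etrans (congr2 _ (etrans (det4V _) (det4_upper _)) (det4_lower _)) (mulr1 1))).
  rewrite hE; apply: le_trans (DM _ _ (det4_upper _) _) _.
    by rewrite !det4M det4V !det4_upper !det4_lower !mulr1.
  by move: b1 b2 b3 b4 m1 m2 d0; clear; lra.
have dg (x : R) : 0 < x -> det4 (diag4 x) = 1 by move=> x0; rewrite det4_diag// gt_eqF.
pose a : R := 2 ^+ k.
have a0 : 0 < a by rewrite exprn_gt0.
have Da : D (diag4 a) <= P * (32 * d).
  rewrite /a /P; elim: (k) => [|i IH].
    rewrite !expr0 mul1r (_ : diag4 1 = upper4 0%:R); last by rewrite /diag4 /upper4 invr1.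
    by apply: le_trans (Dn 0%N) _; move: d0; clear; lra.
  have -> : diag4 (2 ^+ i.+1) = mul4 (diag4 (2 ^+ i)) (diag4 2) :> M4.
    by rewrite /mul4 /diag4 /= exprSr invfM; congr (_, _, _, _); ring.
  apply: le_trans (DM _ _ _ _) _; [by apply: dg; rewrite exprn_gt0|exact: dg|].
  have : 1 <= 4 ^+ i :> R by rewrite exprn_ege1// ler1n.
  rewrite exprSr; move: IH D2 d0; clear; set p := 4 ^+ i; nra.
have P4 : P = a ^+ 2 by rewrite /P /a -exprM mulnC exprM; congr (_ ^+ _); ring.
have hPd : P * (32 * d) = eps / 400 by rewrite /d; field; rewrite gt_eqF.
have small (t : R) : `|t| <= K' -> `|t / P| <= rho d'.
  move=> tK; rewrite normrM normfV (gtr0_norm P0) ler_pdivrMr//.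
  by apply: le_trans tK _; rewrite mulrC -ler_pdivrMr// rho0.
(* Conjugation by [diag4 a], where [a^2 = P], shrinks a shear of size [K'] by the factor [P], into
   the range where the continuity of [D] at the identity applies. The cost is the bound on
   [D (diag4 a)]. *)
have Dlo t : `|t| <= K' -> D (lower4 t) <= eps / 40.
  move=> /small tK.
  have -> : lower4 t = mul4 (inv4 (diag4 a)) (mul4 (lower4 (t / P)) (diag4 a)) :> M4.
    by rewrite /mul4 /lower4 /diag4 /inv4 /= P4; congr (_, _, _, _); field; rewrite gt_eqF.
  apply: le_trans (DM _ _ _ _) _; [by rewrite det4V dg|by rewrite det4M det4_lower dg ?mulr1|].
  have := DM (lower4 (t / P)) (diag4 a) (det4_lower _) (dg _ a0).
  have := Dr _ (lower4 (t / P)) d'0 (near_lo _ _ tK) (det4_lower _).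
  by rewrite DV ?dg//; move: Da; rewrite hPd /d' => h1 h2 h3; move: h1 h2 h3 e0; clear; lra.
have Dup t : `|t| <= K' -> D (upper4 t) <= eps / 40.
  move=> /small tK.
  have -> : upper4 t = mul4 (diag4 a) (mul4 (upper4 (t / P)) (inv4 (diag4 a))) :> M4.
    by rewrite /mul4 /upper4 /diag4 /inv4 /= P4; congr (_, _, _, _); field; rewrite gt_eqF.
  apply: le_trans (DM _ _ _ _) _; [by rewrite dg|by rewrite det4M det4_upper det4V dg ?mulr1|].
  have := DM (upper4 (t / P)) (inv4 (diag4 a)) (det4_upper _) (etrans (det4V _) (dg _ a0)).
  have := Dr _ (upper4 (t / P)) d'0 (near_up _ _ tK) (det4_upper _).
  by rewrite DV ?dg//; move: Da; rewrite hPd /d' => h1 h2 h3; move: h1 h2 h3 e0; clear; lra.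
have main u : det4 u = 1 -> (4 * K)^-1 <= `|u.1.2| ->
    [/\ `|u.1.1.1| <= 2 * K, `|u.1.2| <= 2 * K & `|u.2| <= 2 * K] -> D u <= eps / 4.
  move=> du uc [ua uc' ud].
  have c0 : 0 < `|u.1.2| by apply: lt_le_trans uc; rewrite invr_gt0 mulr_gt0.
  have q (t : R) : `|t| <= 2 * K -> `|(t - 1) / u.1.2| <= K'.
    move=> tK; rewrite normrM normfV ler_pdivrMr//.
    apply: (@le_trans _ _ (K' * (4 * K)^-1)); last by rewrite ler_wpM2l// ltW.
    have -> : K' * (4 * K)^-1 = 3 * K by rewrite /K'; field; rewrite gt_eqF.
    apply: le_trans (ler_normB _ _) _; rewrite normr1.
    by move: tK K1; clear; lra.
  have cK : `|u.1.2| <= K'.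
    by apply: le_trans uc' _; rewrite /K'; move: K1; clear; nra.
  rewrite (bruhat du); last by rewrite -normr_gt0.
  have h1 := Dup _ (q _ ua); have h2 := Dup _ (q _ ud); have h3 := Dlo _ cK.
  apply: le_trans (DM _ _ (det4_upper _) _) _; first by rewrite det4M det4_upper det4_lower mulr1.
  have := DM (lower4 u.1.2) (upper4 ((u.2 - 1) / u.1.2)) (det4_lower _) (det4_upper _).
  by move: h1 h2 h3 e0; clear; lra.
move=> u du [ua ub uc ud].
have le2 (t : R) : `|t| <= K -> `|t| <= 2 * K by move: K1; clear; lra.
have [h|h] := leP (4 * K)^-1 `|u.1.2|.
  apply: le_trans (main u du h _) _; first by split; exact: le2.
  by move: e0; clear; lra.
pose w := mul4 (lower4 1) u.
have uE : u = mul4 (inv4 (lower4 1)) w by rewrite /w mulK4// det4_lower.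
have dw : det4 w = 1 by rewrite det4M det4_lower du mulr1.
have Dw : D w <= eps / 4.
  apply: main => //; last first.
    split; rewrite /w /= ?mul1r ?mul0r ?addr0; first exact: le2.
      by apply: le_trans (ler_normD _ _) _; move: ua uc; clear; lra.
    by apply: le_trans (ler_normD _ _) _; move: ub ud; clear; lra.
  rewrite /w /= !mul1r leNgt; apply/negP => h'.
  have : 1 <= `|u.1.1.1| * K + K * `|u.1.2|.
    rewrite -[X in X <= _](normr1 R) -du /det4; apply: le_trans (ler_normB _ _) _.
    by rewrite !normrM lerD// ?ler_wpM2l ?ler_wpM2r.
  have : `|u.1.1.1| <= (4 * K)^-1 + (4 * K)^-1.
    rewrite (_ : u.1.1.1 = (u.1.1.1 + u.1.2) - u.1.2); last by ring.
    by apply: le_trans (ler_normB _ _) _; rewrite lerD// ltW.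
  have : (4 * K)^-1 * K = 4^-1 by field; rewrite gt_eqF.
  move: h K0; clear; set iK := (4 * K)^-1; set A := `|u.1.1.1|; set Cc := `|u.1.2|; nra.
rewrite uE; apply: le_trans (DM _ _ _ dw) _; first by rewrite det4V det4_lower.
rewrite DV ?det4_lower//.
have : D (lower4 1) <= eps / 40.
  by apply: Dlo; rewrite normr1 /K'; move: K1; clear; nra.
by move: Dw e0; clear; lra.
Qed.

End Mautner.

(** * Effect of shears, dilations and small pushes on sector counts *)

Section SectorAlgebra.
Variable R : realType.
Local Notation RM := (measurableTypeR R).
Local Notation M4 := (RM * RM * RM * RM)%type.
Implicit Types (G : set M4) (s m u : M4) (S al be ga x y : R).

Lemma sector_shift G s m x S al be :
  sector G s (mul4 m (upper4 x)) S al be = sector G s m S (al + x) (be + x).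
Proof.
have e v : rmul v (mul4 m (upper4 x)) = ((rmul v m).1, (rmul v m).1 * x + (rmul v m).2).
  by rewrite rmulM /rmul /= !mulr1 mulr0 addr0.
have k v (c : R) : (c * (rmul v m).1 <= - ((rmul v m).1 * x + (rmul v m).2)) =
    ((c + x) * (rmul v m).1 <= - (rmul v m).2).
  by rewrite -subr_ge0 -[RHS]subr_ge0; congr (_ <= _); ring.
have k' v (c : R) : (- ((rmul v m).1 * x + (rmul v m).2) < c * (rmul v m).1) =
    (- (rmul v m).2 < (c + x) * (rmul v m).1).
  by rewrite -subr_gt0 -[RHS]subr_gt0; congr (_ < _); ring.
have e1 v : (rmul v (mul4 m (upper4 x))).1 = (rmul v m).1 by rewrite e.
have e2 v : (rmul v (mul4 m (upper4 x))).2 = (rmul v m).1 * x + (rmul v m).2 by rewrite e.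
by apply/seteqP; split=> v [Lv H]; split=> //; move: H; rewrite e1 e2 k k'.
Qed.

Lemma sector_diag G s m a S al be : 0 < a ->
  sector G s (mul4 m (diag4 a)) S al be = sector G s m (S / a) (al * a ^+ 2) (be * a ^+ 2).
Proof.
move=> a0; have e v : rmul v (mul4 m (diag4 a)) = ((rmul v m).1 * a, (rmul v m).2 / a).
  by rewrite rmulM /rmul /= !mulr0 addr0 add0r.
have h v : (0 < (rmul v m).1 * a <= S) = (0 < (rmul v m).1 <= S / a).
  by rewrite pmulr_lgt0// ler_pdivlMr.
have k v (c : R) : (c * ((rmul v m).1 * a) <= - ((rmul v m).2 / a)) = (c * a ^+ 2 * (rmul v m).1 <= - (rmul v m).2).
  rewrite -mulNr ler_pdivlMr//; congr (_ <= _); ring.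
have k' v (c : R) : (- ((rmul v m).2 / a) < c * ((rmul v m).1 * a)) = (- (rmul v m).2 < c * a ^+ 2 * (rmul v m).1).
  rewrite -mulNr ltr_pdivrMr//; congr (_ < _); ring.
have e1 v : (rmul v (mul4 m (diag4 a))).1 = (rmul v m).1 * a by rewrite e.
have e2 v : (rmul v (mul4 m (diag4 a))).2 = (rmul v m).2 / a by rewrite e.
by apply/seteqP; split=> v [Lv H]; split=> //; move: H; rewrite e1 e2 h k k'.
Qed.

Lemma sector_cat G s m S al be ga : det4 s = 1 -> dgroup G ->
  cusp_at_infty [set m | G (conj4 (inv4 s) m)] -> det4 m = 1 -> 0 < S -> al <= be -> be <= ga ->
  cnt R (sector G s m S al ga) = cnt R (sector G s m S al be) + cnt R (sector G s m S be ga).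
Proof.
move=> ds dG cS dm S0 ab bg.
have [f1 _] := sector_bound ds dG cS dm S0 ab.
have [f2 _] := sector_bound ds dG cS dm S0 bg.
rewrite -cntU//; last first.
  rewrite -subset0 => v [[_ [_ /andP[_ h1]]] [_ [_ /andP[h2 _]]]].
  by move: (lt_le_trans h1 h2); rewrite ltxx.
congr cnt; apply/seteqP; split=> v.
  move=> [Lv [hS /andP[h1 h2]]].
  have [h|h] := leP (be * (rmul v m).1) (- (rmul v m).2); [right|left];
    by split=> //; split=> //; apply/andP.
move=> [|] [Lv [hS /andP[h1 h2]]]; have c0 : 0 < (rmul v m).1 by case/andP: hS.
  by split=> //; split=> //; rewrite h1 (lt_le_trans h2)// ler_pM2r.
by split=> //; split=> //; rewrite h2 andbT (le_trans _ h1)// ler_pM2r.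
Qed.

Lemma sector_le G s m S S' al al' be be' : det4 s = 1 -> dgroup G ->
  cusp_at_infty [set m | G (conj4 (inv4 s) m)] -> det4 m = 1 -> 0 < S' ->
  S <= S' -> al' <= al -> be <= be' -> al' <= be' ->
  cnt R (sector G s m S al be) <= cnt R (sector G s m S' al' be').
Proof.
move=> ds dG cS dm S0 SS aa bb ab; have [f1 _] := sector_bound ds dG cS dm S0 ab.
apply: cnt_le => // v [Lv [/andP[c0 cS'] /andP[h1 h2]]]; split=> //; split.
  by rewrite c0 (le_trans cS').
by rewrite (le_trans _ h1) ?(lt_le_trans h2)// ler_pM2r.
Qed.

Lemma sector_sum G s m S al y (n : nat) : det4 s = 1 -> dgroup G ->
  cusp_at_infty [set m | G (conj4 (inv4 s) m)] -> det4 m = 1 -> 0 < S -> 0 <= y ->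
  cnt R (sector G s m S al (al + n%:R * y)) =
  \sum_(i < n) cnt R (sector G s m S (al + i%:R * y) (al + i%:R * y + y)).
Proof.
move=> ds dG cS dm S0 y0; elim: n => [|n IH].
  rewrite big_ord0 mul0r addr0 (_ : sector _ _ _ _ _ _ = set0) ?cnt0//.
  rewrite -subset0 => v [_ [_ /andP[h1 h2]]].
  by move: (lt_le_trans h2 h1); rewrite ltxx.
rewrite big_ord_recr /= -IH -sector_cat//.
- by congr (cnt _ (sector _ _ _ _ _ _)); rewrite -addn1 natrD; ring.
- by rewrite lerDl mulr_ge0.
- by rewrite lerDl.
Qed.

Lemma orbN_geo G s x y S : 0 < y ->
  orbN G s S (geo x y) = cnt R (sector G s one4 (S / Num.sqrt y) x (x + y)).
Proof.
move=> y0; rewrite /orbN det4_geo// eqxx /geo sector_diag ?sqrtr_gt0// sqr_sqrtr ?ltW//.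
by rewrite -[upper4 x]mul14 sector_shift mul0r mul1r add0r addrC.
Qed.

(** The link between ergodic averages and large scales: [N] consecutive unit sectors of level 1 form
    one sector with slopes in [[0, N)], which a diagonal matrix rescales to the unit sector of level
    [sqrt N]. *)
Lemma orbN_av G s (N : nat) m : det4 s = 1 -> dgroup G ->
  cusp_at_infty [set m | G (conj4 (inv4 s) m)] -> (0 < N)%N ->
  av N (orbN G s 1) m =
  orbN G s (Num.sqrt N%:R) (mul4 m (diag4 (Num.sqrt N%:R))) / Num.sqrt N%:R ^+ 2.
Proof.
move=> ds dG cS N0; set a : R := Num.sqrt N%:R.
have a0 : 0 < a by rewrite sqrtr_gt0 ltr0n.
rewrite /av [orbN G s a _]/orbN det4M (det4_diag (lt0r_neq0 a0)) mulr1 mulrC sqr_sqrtr//; congr (_ / _).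
have [dm|dm] := eqVneq (det4 m) 1; last first.
  by rewrite big1// => k _; rewrite /sh /orbN det4M det4_upper mulr1 (negPf dm).
rewrite sector_diag// mul0r (divff (lt0r_neq0 a0)) mul1r sqr_sqrtr//.
rewrite -[X in sector _ _ _ _ _ X]mulr1 -[X in sector _ _ _ _ _ X]add0r.
rewrite sector_sum//; apply: eq_bigr => k _.
by rewrite /sh /orbN det4M det4_upper mulr1 dm eqxx sector_shift mulr1 !add0r addrC.
Qed.

(* Small elements pushing the triangle [tri S] into its dilate by [1 + 10 eta]. *)
Definition Up (eta : R) : set M4 := [set u | [/\ det4 u = 1, - (2 * eta) <= u.1.1.2 <= - eta,
  1 - 8 * eta <= u.2 <= 1 - 6 * eta & - eta <= u.1.2 <= eta]].

Lemma Up_a eta u : 0 < eta -> eta <= 100^-1 -> Up eta u -> 1 + 5 * eta <= u.1.1.1 <= 1 + 9 * eta.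
Proof.
case: u => [[[p q] r] t] e0 e1 [/= du /andP[q1 q2] /andP[t1 t2] /andP[r1 r2]].
move: du; rewrite /det4 /= => du.
have e1' : eta <= 1 / 100 by rewrite mul1r.
have t0 : 0 < t by move: e1' t1; clear; lra.
have qr1 : q * r <= 2 * eta ^+ 2 by move: q1 q2 r1 r2 e0; clear; nra.
have qr2 : - (2 * eta ^+ 2) <= q * r by move: q1 q2 r1 r2 e0; clear; nra.
have pt : p * t = 1 + q * r by rewrite -du; ring.
have p1 : (1 + 5 * eta) * t <= p * t by rewrite pt; move: t2 qr2 e0 e1'; clear; nra.
have p2 : p * t <= (1 + 9 * eta) * t by rewrite pt; move: t1 qr1 e0 e1'; clear; nra.
by move: p1 p2; rewrite !ler_pM2r// => -> ->.
Qed.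

(** The signs in [Up] make both edges move inwards: slope 0 is raised, slope 1 is lowered to at most
    [(1 - 4 eta)/(1 + 4 eta)]. Only the cutoff on the first coordinate has to grow. *)
Lemma tri_Up eta u S v : 0 < eta -> eta <= 100^-1 -> Up eta u -> tri S v ->
  tri ((1 + 10 * eta) * S) (rmul v u).
Proof.
move=> e0 e1 hu; have /andP[p1 p2] := Up_a e0 e1 hu.
case: u hu p1 p2 => [[[p q] r] t] [/= _ /andP[q1 q2] /andP[t1 t2] /andP[r1 r2]] p1 p2.
case: v => c d [/= /andP[c0 cS] /andP[d0 dc]].
have e1' : eta <= 1 / 100 by rewrite mul1r.
have h1 : c * p + d * r <= (1 + 10 * eta) * c by move: p2 r1 r2 c0 d0 dc e0; clear; nra.
have h2 : (1 + 4 * eta) * c <= c * p + d * r by move: p1 r1 r2 c0 d0 dc e0; clear; nra.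
have h3 : 0 <= - (c * q + d * t) by move: q2 t1 c0 d0 e0 e1'; clear; nra.
have h4 : - (c * q + d * t) < c by move: q1 t2 t1 c0 d0 dc e0 e1'; clear; nra.
split; rewrite /rmul /=; apply/andP; split.
- by apply: lt_le_trans h2; rewrite mulr_gt0//; move: e0; clear; lra.
- by apply: le_trans h1 _; rewrite ler_pM2l//; move: e0; clear; lra.
- exact: h3.
- by apply: lt_le_trans h4 _; apply: le_trans h2; move: c0 e0; clear; nra.
Qed.

Lemma orbN_Up G s eta u S m : det4 s = 1 -> dgroup G ->
  cusp_at_infty [set m | G (conj4 (inv4 s) m)] -> 0 < S -> 0 < eta -> eta <= 100^-1 -> Up eta u ->
  orbN G s S m <= orbN G s ((1 + 10 * eta) * S) (mul4 m u).
Proof.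
move=> ds dG cS S0 e0 e1 hu; have du : det4 u = 1 by case: hu.
rewrite /orbN det4M du mulr1; case: eqP => // dm.
have S1 : 0 < (1 + 10 * eta) * S by rewrite mulr_gt0//; move: e0; clear; lra.
have dmu : det4 (mul4 m u) = 1 by rewrite det4M du dm mulr1.
have [f1 _] := sector_bound ds dG cS dmu S1 (@ler01 R).
apply: cnt_le => //; rewrite !sector01 => v [Lv tv]; split=> //.
by rewrite rmulM; exact: tri_Up.
Qed.

End SectorAlgebra.

(** * Mean square displacement of the normalised counts *)

Section Displacement.
Variable R : realType.
Local Notation RM := (measurableTypeR R).
Local Notation M4 := (RM * RM * RM * RM)%type.
Implicit Types (G : set M4) (s m u w : M4) (y : M4 -> R) (F C : set (RM * RM)).

Definition disp F y u : R := Ex F (fun m => (y (mul4 m u) - y m) ^+ 2).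

Lemma adm_disp G y u : adm G y -> adm G (fun m => (y (mul4 m u) - y m) ^+ 2).
Proof. by move=> ay; apply: admX2; apply: admB => //; exact: adm_right. Qed.

Lemma disp_ge0 F y u : 0 <= disp F y u.
Proof. by apply: Ex_ge0 => m; exact: sqr_ge0. Qed.

Lemma disp_mul G F C y u w : fundom G F C -> adm G y -> det4 u = 1 ->
  disp F y (mul4 u w) <= 2 * disp F y u + 2 * disp F y w.
Proof.
move=> fd ay du; have a1 := adm_disp u ay; have a2 := adm_disp w ay.
have a3 := adm_right u a2.
rewrite /disp -(Ex_right fd a2 du) -(ExZ _ fd a1) -(ExZ _ fd a3) -(ExD fd (admZ _ a1) (admZ _ a3)).
apply: (Ex_le fd); [exact: adm_disp|by apply: admD; exact: admZ|].
move=> m; rewrite mul4A; move: (y _) (y (mul4 m u)) (y m) => a b c.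
rewrite -subr_ge0 (_ : _ - _ = (a - b - (b - c)) ^+ 2) ?sqr_ge0//; ring.
Qed.

Lemma disp_inv G F C y u : fundom G F C -> adm G y -> det4 u = 1 ->
  disp F y (inv4 u) = disp F y u.
Proof.
move=> fd ay du; rewrite /disp -(Ex_right fd (adm_disp (inv4 u) ay) du).
by congr Ex; apply/funext => m; rewrite mul4K// -[RHS]sqrrN opprB.
Qed.

Definition orby G s (S : R) m : R := orbN G s S m / S ^+ 2.

Lemma orby_adm G s (S : R) : det4 s = 1 -> cusp_at_infty G ->
  cusp_at_infty [set m | G (conj4 (inv4 s) m)] -> 0 < S -> adm G (orbN G s S).
Proof.
move=> ds cG cS S0; have dG := ci_dg cG; split.
- exact: measurable_orbN.
- by exists (1 + S ^+ 2 * 200 ^+ 2) => m; rewrite ger0_norm ?orbN_ge0//; exact: orbN_bound.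
- by move=> g m Gg; exact: orbN_left.
Qed.

Lemma adm_orby G s (S : R) : det4 s = 1 -> cusp_at_infty G ->
  cusp_at_infty [set m | G (conj4 (inv4 s) m)] -> 0 < S -> adm G (orby G s S).
Proof.
move=> ds cG cS S0; have := admZ (S ^+ 2)^-1 (orby_adm ds cG cS S0).
by congr adm; apply/funext => m; rewrite mulrC.
Qed.

Lemma Ex_orbN G F C s (S : R) : fundom G F C -> det4 s = 1 ->
  cusp_at_infty [set m | G (conj4 (inv4 s) m)] -> 0 < S -> Ex F (orbN G s S) = S ^+ 2.
Proof. by move=> fd ds cS S0; rewrite /Ex (siegel fd). Qed.

Lemma Ex_orby G F C s (S : R) : fundom G F C -> det4 s = 1 ->
  cusp_at_infty [set m | G (conj4 (inv4 s) m)] -> 0 < S -> Ex F (orby G s S) = 1.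
Proof.
move=> fd ds cS S0; rewrite -(_ : (S ^+ 2)^-1 * S ^+ 2 = 1); last by rewrite mulVf// gt_eqF// exprn_gt0.
rewrite -{2}(Ex_orbN fd ds cS S0) -(ExZ _ fd (orby_adm ds (fd_cusp fd) cS S0)).
by congr Ex; apply/funext => m; rewrite mulrC.
Qed.

Definition cb : R := 1 + 200 ^+ 2.
Lemma cb_gt0 : 0 < cb. Proof. exact: ltr_pwDl ltr01 (exprn_ge0 _ (ler0n _ _)). Qed.

Lemma orby_bd G s (S : R) : det4 s = 1 -> dgroup G ->
  cusp_at_infty [set m | G (conj4 (inv4 s) m)] -> 1 <= S -> forall m, 0 <= orby G s S m <= cb.
Proof.
move=> ds dG cS S1 m; have S0 := lt_le_trans (@ltr01 R) S1.
rewrite /orby divr_ge0 ?orbN_ge0 ?sqr_ge0//= ler_pdivrMr ?exprn_gt0//.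
apply: le_trans (orbN_bound ds dG cS S0 m) _.
by rewrite /cb mulrDl mul1r [_ * S ^+ 2]mulrC lerD2r exprn_ege1.
Qed.

(** Both [orbN S] at [m] and at [m u] lie below [orbN S'] at [m u], and Siegel's formula makes each
    mean excess [S'^2 - S^2]. So the displacement is small in mean, uniformly in [S]; the bound [cb]
    on [orby] makes it small in mean square. *)
Lemma disp_Up G F C s (S eta : R) u : fundom G F C -> det4 s = 1 ->
  cusp_at_infty [set m | G (conj4 (inv4 s) m)] -> 1 <= S -> 0 < eta -> eta <= 100^-1 -> Up eta u ->
  disp F (orby G s S) u <= cb * (60 * eta).
Proof.
move=> fd ds cS S1 e0 e1 hu; have du : det4 u = 1 by case: hu.
have S0 := lt_le_trans (@ltr01 R) S1.
have cG := fd_cusp fd; have dG := ci_dg cG.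
have ay := adm_orby ds cG cS S0.
set S' := (1 + 10 * eta) * S.
have S'0 : 0 < S' by rewrite mulr_gt0//; move: e0; clear; lra.
have aN' := orby_adm ds cG cS S'0; have aN := orby_adm ds cG cS S0.
have S2 : 0 < S ^+ 2 by rewrite exprn_gt0.
pose h m := cb * (S ^+ 2)^-1 * ((orbN G s S' (mul4 m u) - orbN G s S (mul4 m u)) + (orbN G s S' (mul4 m u) - orbN G s S m)).
have a1 := admB (adm_right u aN') (adm_right u aN).
have a2 := admB (adm_right u aN') aN.
apply: (@le_trans _ _ (Ex F h)).
  apply: (Ex_le fd); [exact: adm_disp|exact: (admZ _ (admD a1 a2))|].
  move=> m; have /andP[b1 b2] := orby_bd ds dG cS S1 m.
  have /andP[b3 b4] := orby_bd ds dG cS S1 (mul4 m u).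
  have n1 := orbN_Up m ds dG cS S0 e0 e1 hu.
  have n2 : orbN G s S (mul4 m u) <= orbN G s S' (mul4 m u).
    rewrite /orbN; case: eqP => // dm; apply: sector_le => //.
    by rewrite /S' ler_peMl ?ltW//; move: e0; clear; lra.
  rewrite -real_normK ?num_real// expr2 /h -mulrA; apply: ler_pM => //.
    by rewrite ler_norml; move: b1 b2 b3 b4; clear; set a := orby _ _ _ _; set b := orby _ _ _ _ => *; apply/andP; split; lra.
  rewrite /orby -mulrBl normrM normfV (gtr0_norm S2) mulrC ler_pM2l ?invr_gt0//.
  move: n1 n2; clear; rewrite -/S'; set a := orbN _ _ S _; set b := orbN _ _ S _; set c := orbN _ _ _ _ => *.
  by rewrite ler_norml; apply/andP; split; lra.
rewrite /h (ExZ _ fd (admD a1 a2)) (ExD fd a1 a2) (ExB fd (adm_right u aN') (adm_right u aN)).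
rewrite (ExB fd (adm_right u aN') aN) !(Ex_right fd _ du)//.
rewrite !(Ex_orbN fd ds cS)// -mulrA ler_pM2l ?cb_gt0//.
rewrite ler_pdivrMl// /S' exprMn.
have e1' : eta <= 1 / 100 by rewrite mul1r.
set T := S ^+ 2; rewrite [X in X <= _](_ : _ = T * (2 * ((1 + 10 * eta) ^+ 2 - 1))); last by ring.
by rewrite ler_pM2l//; move: e0 e1'; clear; nra.
Qed.

(** [Up] does not contain the identity, but [u = (u u0) u0^-1] where both [u0] and [u u0] lie in
    [Up (4 r)]; the constant is [960 = 2 * 60 * 4 + 2 * 60 * 4]. *)
Lemma disp_near G F C s (S r : R) u : fundom G F C -> det4 s = 1 ->
  cusp_at_infty [set m | G (conj4 (inv4 s) m)] -> 1 <= S -> 0 < r -> r <= 400^-1 ->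
  near4 r u -> det4 u = 1 -> disp F (orby G s S) u <= cb * 960 * r.
Proof.
move=> fd ds cS S1 r0 r1 nu du; have S0 := lt_le_trans (@ltr01 R) S1.
have ay := adm_orby ds (fd_cusp fd) cS S0.
pose eta := 4 * r.
have r1' : r <= 1 / 400 by rewrite mul1r.
have e0 : 0 < eta by rewrite mulr_gt0.
have e1 : eta <= 100^-1 by rewrite /eta -[100^-1]mul1r; move: r1'; clear; lra.
pose t0 := 1 - 7 * eta.
have t00 : 0 < t0 by rewrite /t0 /eta; move: r1'; clear; lra.
(* The centre of [Up eta]: a perturbation of size [r = eta/4] stays inside. *)
pose u0 : M4 := (t0^-1, - (3 / 2 * eta), 0, t0).
have du0 : det4 u0 = 1 by rewrite /det4 /= mulr0 subr0 mulVf// gt_eqF.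
have U0 : Up eta u0.
  by split=> //=; rewrite /t0; apply/andP; move: e0; clear; split; lra.
have U1 : Up eta (mul4 u u0).
  have dd : det4 (mul4 u u0) = 1 by rewrite det4M du du0 mulr1.
  case: u nu {du} dd => [[[p q] k] t] [/=]; rewrite !ler_norml => /andP[p1 p2] /andP[q1 q2] /andP[k1 k2] /andP[t1 t2] dd.
  split=> //=.
  - rewrite /t0 /eta; apply/andP; move: p1 p2 q1 q2 r0 r1'; clear; split; nra.
  - rewrite /t0 /eta; apply/andP; move: k1 k2 t1 t2 r0 r1'; clear; split; nra.
  - rewrite mulr0 addr0; have ti : 0 < t0^-1 by rewrite invr_gt0.
    have ti2 : t0^-1 <= 2 by rewrite invf_ple ?posrE// /t0 /eta; move: r1'; clear; lra.
    by rewrite /eta; apply/andP; move: k1 k2 ti ti2 r0; clear; set i := t0^-1; split; nra.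
rewrite -(mul4K u du0).
apply: le_trans (disp_mul _ fd ay _) _; first by rewrite det4M du du0 mulr1.
rewrite (disp_inv fd ay du0).
have := disp_Up fd ds cS S1 e0 e1 U0; have := disp_Up fd ds cS S1 e0 e1 U1.
by rewrite /eta; clear; move: (disp _ _ _) (disp _ _ _) => A B; lra.
Qed.

End Displacement.

(** * From small displacement on a large bounded set to small variance *)

Section Variance.
Variable R : realType.
Local Notation RM := (measurableTypeR R).
Local Notation M4 := (RM * RM * RM * RM)%type.
Local Notation P3 := (RM * RM * RM)%type.
Implicit Types (G : set M4) (s m u w : M4) (y : M4 -> R) (F C : set (RM * RM)).
Local Open Scope ereal_scope.

Definition bd (K : R) : set M4 :=
  [set m | [/\ `|m.1.1.1| <= K, `|m.1.1.2| <= K, `|m.1.2| <= K & `|m.2| <= K]%R].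

Lemma measurable_bd K : measurable (bd K).
Proof.
have mc : measurable_fun setT (fun m : M4 => K : RM) by exact: measurable_cst.
have mn (p : M4 -> RM) : measurable_fun setT p -> measurable [set m : M4 | (`|p m| <= K)%R].
  by move=> mp; apply: measurable_leset => //; exact: measurableT_comp.
have -> : bd K = [set m : M4 | (`|m.1.1.1| <= K)%R] `&` [set m : M4 | (`|m.1.1.2| <= K)%R] `&`
    [set m : M4 | (`|m.1.2| <= K)%R] `&` [set m : M4 | (`|m.2| <= K)%R].
  by apply/seteqP; split=> [m []|m [[[? ?] ?] ?]].
apply: measurableI; [apply: measurableI; [apply: measurableI|]|]; apply: mn;
  [exact: measurable_p1|exact: measurable_p2|exact: measurable_p3|exact: measurable_p4].
Qed.

Lemma measurable_indicE (A : set M4) : measurable A ->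
  measurable_fun setT (fun m : M4 => (\1_A m)%:E : \bar R).
Proof. by move=> mA; apply/measurable_EFinP; exact: measurable_indic. Qed.

Lemma haar_indic (A : set M4) : measurable A -> haar (fun m => (\1_A m)%:E) = L3 R (@mat R @^-1` A).
Proof.
move=> mA; rewrite /haar -[@mat R @^-1` A]setIT -integral_indic//.
by rewrite -[X in measurable X]setTI; apply: measurable_mat.
Qed.

Lemma lift_det F p : F `<=` [set z | (0 < z.2)%R] -> lift F (mat p) -> det4 (mat p) = 1%R.
Proof.
case: p => v x Fp; have [->|v0 _] := eqVneq v 0%R; last exact: det_mat.
by rewrite mat0 => /Fp; rewrite /yc /nsq /= !expr0n /= addr0 invr0 ltxx.
Qed.

Lemma exhaust G F C (e : R) : fundom G F C -> (0 < e)%R ->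
  exists n : nat, haar (fun m => (\1_(lift F `\` bd n%:R) m)%:E) <= e%:E.
Proof.
move=> fd e0; have mL := measurable_lift (fd_mF fd).
pose B (n : nat) : set P3 := @mat R @^-1` (lift F `\` bd n%:R).
have mB n : measurable (B n).
  rewrite -[X in measurable X]setTI; apply: measurable_mat => //.
  by apply: measurableD => //; exact: measurable_bd.
have B0 : \bigcap_n B n = set0.
  rewrite -subset0 => p hp.
  pose K : R := (`|(mat p).1.1.1| + `|(mat p).1.1.2| + `|(mat p).1.2| + `|(mat p).2|)%R.
  have [_ /=] := hp (Num.truncn K).+1 I; apply.
  have hK := ltW (truncnS_gt K).
  have n1 := normr_ge0 (mat p).1.1.1; have n2 := normr_ge0 (mat p).1.1.2.
  have n3 := normr_ge0 (mat p).1.2; have n4 := normr_ge0 (mat p).2.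
  by split; apply: le_trans hK; rewrite /K; move: n1 n2 n3 n4; clear; lra.
have hB n : haar (fun m => (\1_(lift F `\` bd n%:R) m)%:E) = L3 R (B n).
  by rewrite haar_indic//; apply: measurableD => //; exact: measurable_bd.
have := @nonincreasing_cvg_mu _ _ _ (L3 R) B.
rewrite B0 measure0 => /(_ _ mB measurable0) H.
have {H} : (L3 R \o B) x @[x --> \oo] --> (0%R)%:E.
  apply: H.
    apply: (@le_lt_trans _ _ (haar (fun m => (\1_(lift F `\` bd 0%N%:R) m)%:E))); first by rewrite hB.
    apply: le_lt_trans (quo1_lt fd).
    apply: haar_le.
    - by apply: measurable_indicE; apply: measurableD => //; exact: measurable_bd.
    - by apply: measurable_mulE; [exact: (fd_mF fd)|exact: measurable_cst].
    - by move=> m; rewrite lee_fin.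
    - move=> m _; rewrite /mulE mule1 lee_fin !indicE ler_nat; case: (boolP (m \in _ `\` _)) => //.
      by rewrite inE => -[h _]; rewrite mem_set.
    - by move=> m; apply: mulE_ge0 => m'; rewrite lee_fin.
  move=> n k nk; apply/subsetPset => p [h1 h2]; split=> // h3; apply: h2.
  have nk' : (n%:R <= k%:R :> R)%R by rewrite ler_nat.
  by case: h3 => *; split; apply: le_trans nk'.
move=> /fine_cvgP[h1 /cvgrPdist_le /(_ _ e0) h2].
have [n _ hn] := h1; have [n' _ hn'] := h2.
exists (maxn n n'); rewrite hB.
have hf : L3 R (B (maxn n n')) \is a fin_num := hn (maxn n n') (leq_maxl _ _).
rewrite -(fineK hf).
have := hn' (maxn n n') (leq_maxr _ _); rewrite /= sub0r normrN => h.
by rewrite lee_fin; apply: le_trans (ler_norm _) h.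
Qed.

(** With [n] the squared norm of the bottom row, the first row has squared norm [x^2 n + 1/n]. A
    bound on it bounds [1/n], then [x^2], so the coordinates stay in a box. *)
Lemma haar_bd_lt (K : R) : (0 < K)%R ->
  haar (fun m => (\1_(bd K `&` [set m | det4 m = 1%R]) m)%:E) < +oo.
Proof.
move=> K0; have mA : measurable (bd K `&` [set m : M4 | det4 m = 1%R]).
  by apply: measurableI; [exact: measurable_bd|exact: measurable_det1].
rewrite haar_indic//.
pose I : set RM := `[(- (K + 2 * K ^+ 2))%R, (K + 2 * K ^+ 2)%R]%classic.
have mI : measurable I by exact: measurable_itv.
have K2 : (0 < K + 2 * K ^+ 2)%R by rewrite addr_gt0// mulr_gt0// exprn_gt0.
have lI : lebesgue_measure I < +oo.
  by rewrite /I lebesgue_measure_itv/=; case: ifP => // _; rewrite -EFinB ltry.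
apply: (@le_lt_trans _ _ (L3 R ((I `*` I) `*` I))); last first.
  have e2 : L2 R (I `*` I) = lebesgue_measure I * lebesgue_measure I by exact: product_measure1E.
  have -> : L3 R ((I `*` I) `*` I) = lebesgue_measure I * lebesgue_measure I * lebesgue_measure I.
    by rewrite -e2; apply: product_measure1E => //; exact: measurableX.
  by rewrite lte_mul_pinfty ?mule_ge0// ge0_fin_numE ?mule_ge0// lte_mul_pinfty// ge0_fin_numE.
apply: le_measure; rewrite ?inE.
- by rewrite -[X in measurable X]setTI; apply: measurable_mat.
- by apply: measurableX => //; exact: measurableX.
case=> -[c d] x [[/= ha hb hc hd] dm].
have cc z : (`|z| <= K)%R -> I z.
  rewrite ler_norml /I /= in_itv /= => /andP[h1 h2].
  have k2 : (0 < K ^+ 2)%R by rewrite exprn_gt0.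
  by apply/andP; move: h1 h2 k2; clear; split; lra.
split; first by split; exact: cc.
have v0 : (c, d) != 0%R :> RM * RM.
  by apply: contra_eqN dm => /eqP ->; rewrite mat0 /det4 /= mulr0 subrr eq_sym oner_eq0.
have n0 := nsq_gt0 v0; move: ha hb n0; set n := nsq (c, d) => ha hb n0.
have e1 : ((x * c + d * n^-1) ^+ 2 + (x * d - c * n^-1) ^+ 2 = x ^+ 2 * n + n^-1)%R.
  transitivity (x ^+ 2 * (c ^+ 2 + d ^+ 2) + (c ^+ 2 + d ^+ 2) * (n^-1) ^+ 2)%R; first by ring.
  by rewrite -[(c ^+ 2 + d ^+ 2)%R]/n expr2 [in LHS](expr2 n^-1) [(n * (_ * _))%R]mulrA mulfV ?mul1r// gt_eqF.
have sq z : (`|z| <= K)%R -> (z ^+ 2 <= K ^+ 2)%R.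
  by move=> h; rewrite -real_normK ?num_real// ler_pXn2r// nnegrE// ltW.
have e2 : (x ^+ 2 * n + n^-1 <= 2 * K ^+ 2)%R.
  by rewrite -e1 mulrDl mul1r lerD// sq.
have i0 : (0 < n^-1)%R by rewrite invr_gt0.
have x2 : (x ^+ 2 <= (2 * K ^+ 2) ^+ 2)%R.
  have h1 : (n^-1 <= 2 * K ^+ 2)%R.
    by apply: le_trans e2; rewrite lerDr mulr_ge0 ?sqr_ge0// ltW.
  have h2 : (x ^+ 2 * n <= 2 * K ^+ 2)%R.
    by apply: le_trans e2; rewrite lerDl ltW.
  have -> : (x ^+ 2 = (x ^+ 2 * n) * n^-1)%R by rewrite mulfK// gt_eqF.
  by rewrite [leRHS]expr2; apply: ler_pM => //; [rewrite mulr_ge0 ?sqr_ge0// ltW|exact: ltW].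
have : (`|x| <= 2 * K ^+ 2)%R.
  rewrite -ler_sqr ?nnegrE ?real_normK ?num_real//.
  by rewrite mulr_ge0 ?sqr_ge0.
rewrite ler_norml /I /= in_itv /= => /andP[h1 h2].
by apply/andP; move: h1 h2 K0; clear; split; lra.
Qed.

Lemma bd_mul (K : R) g h : (0 <= K)%R -> det4 g = 1%R -> bd K g -> bd K (mul4 g h) -> bd (2 * K ^+ 2) h.
Proof.
move=> K0 dg; rewrite -{2}(mulK4 h dg); move: (mul4 g h) => k.
case: g {dg} => [[[a b] c] d] [/= ha hb hc hd]; case: k => [[[a' b'] c'] d'] [/= ka kb kc kd].
have t (x1 x2 x3 x4 : R) : (`|x1| <= K -> `|x2| <= K -> `|x3| <= K -> `|x4| <= K ->
    `|x1 * x2 + x3 * x4| <= 2 * K ^+ 2)%R.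
  move=> *; apply: le_trans (ler_normD _ _) _; rewrite !normrM mulrDl mul1r expr2.
  by apply: lerD; apply: ler_pM.
by split=> /=; apply: t; rewrite ?normrN.
Qed.

Lemma haarD (f h : M4 -> \bar R) : measurable_fun setT f -> measurable_fun setT h ->
  (forall m, 0 <= f m) -> (forall m, 0 <= h m) -> haar (fun m => f m + h m) = haar f + haar h.
Proof.
move=> mf mh f0 h0; apply: ge0_integralD => //.
  exact: (measurable_comp_mat mf).
exact: (measurable_comp_mat mh).
Qed.

Lemma haarZ (c : R) (f : M4 -> \bar R) : (0 <= c)%R -> measurable_fun setT f ->
  (forall m, 0 <= f m) -> haar (fun m => c%:E * f m) = c%:E * haar f.
Proof.
by move=> c0 mf f0; rewrite /haar ge0_integralZl//; exact: (measurable_comp_mat mf).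
Qed.

Lemma measurable_pair_mul (y : M4 -> R) : measurable_fun setT (fun m : M4 => (y m)%:E : \bar R) ->
  measurable_fun setT (fun z : P3 * P3 => ((y (mat z.1) - y (mul4 (mat z.1) (mat z.2))) ^+ 2)%R : RM).
Proof.
move=> /measurable_EFinP my.
have m1 : measurable_fun setT (fun z : P3 * P3 => mat z.1).
  by apply: measurableT_comp; [exact: measurable_mat|exact: measurable_fst].
have m2 : measurable_fun setT (fun z : P3 * P3 => mat z.2).
  by apply: measurableT_comp; [exact: measurable_mat|exact: measurable_snd].
apply: measurable_funX; apply: measurable_funB; first exact: measurableT_comp.
apply: measurableT_comp => //.
have h1 := @measurable_p1 R; have h2 := @measurable_p2 R; have h3 := @measurable_p3 R; have h4 := @measurable_p4 R.
have q (p : M4 -> RM) (k : P3 * P3 -> M4) : measurable_fun setT p -> measurable_fun setT k ->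
   measurable_fun setT (fun z => p (k z)) by move=> mp mk; exact: measurableT_comp.
by apply: measurable_m4; apply: measurable_funD; apply: measurable_funM;
  do ?[exact: (q _ _ h1 m1)|exact: (q _ _ h2 m1)|exact: (q _ _ h3 m1)|exact: (q _ _ h4 m1)
      |exact: (q _ _ h1 m2)|exact: (q _ _ h2 m2)|exact: (q _ _ h3 m2)|exact: (q _ _ h4 m2)].
Qed.

(** Tonelli: with [u] outside, the inner integral over [m] is [disp F y u], bounded by hypothesis.
    Measurability is stated separately because it is needed when [t] is added to other functions. *)
Lemma displacement_swap G F C (y : M4 -> R) (K : set M4) (eps : R) :
  fundom G F C -> adm G y -> measurable K -> (K `<=` [set u | det4 u = 1%R]) ->
  (forall u, K u -> disp F y u <= eps)%R -> (0 <= eps)%R ->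
  let t m := (\1_(lift F) m)%:E * haar (fun u => (\1_K u)%:E * ((y m - y (mul4 m u)) ^+ 2)%:E) in
  measurable_fun setT (fun p => t (mat p)) /\ haar t <= eps%:E * haar (fun u => (\1_K u)%:E).
Proof.
move=> fd ay mK Kd Ke eps0; have mL := measurable_lift (fd_mF fd).
pose J (z : P3 * P3) : \bar R := (\1_(lift F) (mat z.1) * (\1_K (mat z.2) * (y (mat z.1) - y (mul4 (mat z.1) (mat z.2))) ^+ 2))%:E.
have J0 z : 0 <= J z by rewrite lee_fin mulr_ge0// mulr_ge0// sqr_ge0.
have mJ : measurable_fun setT J.
  apply/measurable_EFinP; apply: measurable_funM.
    apply: measurableT_comp; first exact: measurable_indic.
    by apply: measurableT_comp; [exact: measurable_mat|exact: measurable_fst].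
  apply: measurable_funM; last exact: measurable_pair_mul (adm_meas ay).
  apply: measurableT_comp; first exact: measurable_indic.
  by apply: measurableT_comp; [exact: measurable_mat|exact: measurable_snd].
have sw := fubini_tonelli (m1 := L3 R) (m2 := L3 R) J mJ J0.
move=> t; have tE p : t (mat p) = \int[L3 R]_q J (p, q).
  have ma : measurable_fun setT (fun h : M4 => ((y (mat p) - y h) ^+ 2)%:E : \bar R).
    exact: (adm_meas (admX2 (admB (adm_cst G (y (mat p))) ay))).
  pose g u : \bar R := (\1_K u)%:E * ((y (mat p) - y (mul4 (mat p) u)) ^+ 2)%:E.
  have mg : measurable_fun setT g.
    apply: emeasurable_funM; first exact: measurable_indicE.
    by apply: (measurableT_comp ma); exact: measurable_mul4l.
  have g0 u : 0 <= g u.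
    by apply: mule_ge0; [rewrite lee_fin|rewrite lee_fin; exact: sqr_ge0].
  have l0 : (0 <= \1_(lift F) (mat p) :> R)%R by [].
  rewrite /t -(haarZ l0 mg g0); apply: eq_integral => q _.
  by rewrite /J /g /= !EFinM.
split.
  by under eq_fun do rewrite tE; exact: (measurable_fun_fubini_tonelli_F (m2 := L3 R) J mJ J0).
have -> : haar t = \int[L3 R]_p \int[L3 R]_q J (p, q).
  by rewrite /haar; apply: eq_integral => p _; exact: tE.
have K0 u : 0 <= (\1_K u)%:E :> \bar R by rewrite lee_fin.
rewrite sw -(haarZ eps0 (measurable_indicE mK) K0).
have g0 q : 0 <= eps%:E * (\1_K (mat q))%:E by apply: mule_ge0; [rewrite lee_fin|exact: K0].
rewrite /haar; apply: ge0_le_integral.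
- exact: measurableT.
- by move=> q _; apply: integral_ge0 => p _; exact: J0.
- exact: (measurable_fun_fubini_tonelli_G (m1 := L3 R) J mJ J0).
- exact: (measurable_comp_mat (emeasurable_funM (measurable_cst _) (measurable_indicE mK))).
move=> q _; rewrite /J /=; have [qK|qK] := pselect (K (mat q)); last first.
  rewrite integral0_eq; last by move=> p _; rewrite [\1_K _]indicE (memNset qK) mul0r mulr0.
  exact: g0.
rewrite [\1_K _]indicE (mem_set qK) mule1.
apply: le_trans (_ : (disp F y (mat q))%:E <= _); last by rewrite lee_fin Ke.
rewrite /disp (Ex_EFin fd (adm_disp _ ay)) /quo /haar /mulE.
by under eq_integral do rewrite mul1r -[X in (_ * X)%:E]sqrrN opprB EFinM.
Qed.

(** Quantitative form of the fact that an invariant function is constant. The variance is half the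
    double integral of [(y g - y h)^2]. For [g] and [h] in a bounded part of the domain, [h = g u]
    with [u] bounded, so displacements control it; the remaining part of the domain has small
    mass. *)
Lemma variance_small G F C (b e : R) : fundom G F C -> (0 < b)%R -> (0 < e)%R ->
  exists K eps : R, [/\ (1 <= K)%R, (0 < eps)%R & forall y, adm G y -> (forall m, 0 <= y m <= b)%R ->
    (forall u, det4 u = 1%R -> bd K u -> disp F y u <= eps)%R ->
    (Ex F (fun=> 1) * Ex F (fun m => y m ^+ 2) - Ex F y ^+ 2 <= e)%R].
Proof.
move=> fd b0 e0; have mL := measurable_lift (fd_mF fd); have dG := ci_dg (fd_cusp fd).
set nu := Ex F (fun=> 1%R); have nu0 : (0 <= nu)%R by apply: Ex_ge0.
pose e' := (e / (2 * b ^+ 2 * nu + 1))%R.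
have den : (0 < 2 * b ^+ 2 * nu + 1)%R.
  by apply: ltr_wpDl => //; apply: mulr_ge0 => //; apply: mulr_ge0 => //; exact: sqr_ge0.
have e'0 : (0 < e')%R by rewrite divr_gt0.
have [n hn] := exhaust fd e'0.
pose A := lift F `&` bd n%:R; pose Ac := lift F `\` bd n%:R.
have mA : measurable A by apply: measurableI => //; exact: measurable_bd.
have mAc : measurable Ac by apply: measurableD => //; exact: measurable_bd.
(* Bounds the entries of [g^-1 h] for [g] and [h] bounded by [n]; [n.+1] ensures [1 <= K] even for
   [n = 0]. *)
pose K : R := (2 * n.+1%:R ^+ 2)%R.
have K1 : (1 <= K)%R.
  by rewrite /K mulr_ege1 ?ler1n// exprn_ege1 ?ler1n.
pose KK := bd K `&` [set m : M4 | det4 m = 1%R].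
have mKK : measurable KK by apply: measurableI; [exact: measurable_bd|exact: measurable_det1].
have K0 := lt_le_trans (@ltr01 R) K1.
have kf : haar (fun m => (\1_KK m)%:E) \is a fin_num.
  by rewrite ge0_fin_numE ?haar_bd_lt//; apply: haar_ge0 => m; rewrite lee_fin.
set k := fine (haar (fun m => (\1_KK m)%:E)).
have k0 : (0 <= k)%R by apply: fine_ge0; apply: haar_ge0 => m; rewrite lee_fin.
have k1 : (0 < k + 1)%R by rewrite ltr_wpDl.
exists K, (e / (k + 1))%R; split => //; first by rewrite divr_gt0.
move=> y ay yb Dy; set eps := (e / (k + 1))%R in Dy *.
have [/measurable_EFinP my _ yG] := ay.
(* Its integral over [g] is twice the variance. *)
pose ph g : R := Ex F (fun h => (y g - y h) ^+ 2)%R.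
have ac g : adm G (fun h => (y g - y h) ^+ 2)%R by apply: admX2; exact: (admB (adm_cst _ _) ay).
have phE g : ph g = (nu * y g ^+ 2 - 2 * Ex F y * y g + Ex F (fun m => y m ^+ 2))%R.
  rewrite /ph; transitivity (Ex F (fun h => (y g ^+ 2 * 1 - 2 * y g * y h) + y h ^+ 2)%R).
    by congr Ex; apply/funext => h; ring.
  rewrite (ExD fd (admB (admZ _ (adm_cst G 1%R)) (admZ _ ay)) (admX2 ay)).
  rewrite (ExB fd (admZ _ (adm_cst G 1%R)) (admZ _ ay)) (ExZ _ fd (adm_cst G 1%R)) (ExZ _ fd ay).
  by rewrite /nu; ring.
have a1 : adm G (fun m => nu * y m ^+ 2)%R := admZ _ (admX2 ay).
have a2 : adm G (fun m => 2 * Ex F y * y m)%R := admZ _ ay.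
have a3 := admB a1 a2; have a4 := adm_cst G (Ex F (fun m => y m ^+ 2)%R * 1)%R.
have aph : adm G ph.
  by have := admD a3 a4; congr adm; apply/funext => g; rewrite phE mulr1.
have Eph : Ex F ph = (2 * (nu * Ex F (fun m => y m ^+ 2) - Ex F y ^+ 2))%R.
  transitivity (Ex F (fun m => (nu * y m ^+ 2 - 2 * Ex F y * y m) + Ex F (fun m => y m ^+ 2) * 1))%R.
    by congr Ex; apply/funext => g; rewrite phE mulr1.
  rewrite (ExD fd a3 a4) (ExB fd a1 a2) (ExZ _ fd (admX2 ay)) (ExZ _ fd ay) (ExZ _ fd (adm_cst G 1%R)).
  by rewrite -/nu; ring.
suff : (Ex F ph <= 2 * e)%R by rewrite Eph ler_pM2l.
have ph0 g : (0 <= ph g)%R by apply: Ex_ge0 => m; exact: sqr_ge0.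
have sqb g h : ((y g - y h) ^+ 2 <= b ^+ 2)%R.
  have b1 := ltW b0; rewrite -real_normK ?num_real// ler_pXn2r ?nnegrE// ler_norml.
  have := yb g; have := yb h => /andP[h1 h2] /andP[h3 h4].
  by apply/andP; move: h1 h2 h3 h4; clear; split; lra.
have phb g : (ph g <= b ^+ 2 * nu)%R.
  rewrite /ph /nu -(ExZ _ fd (adm_cst G 1%R)); apply: (Ex_le fd) => //; first exact: adm_cst.
  by move=> h; rewrite mulr1.
pose psi g : \bar R := haar (fun u => (\1_KK u)%:E * ((y g - y (mul4 g u)) ^+ 2)%:E).
have msq g : measurable_fun setT (fun h : M4 => ((y g - y h) ^+ 2)%:E : \bar R) := adm_meas (ac g).
have psi0 g : 0 <= psi g.
  by apply: haar_ge0 => u; rewrite mule_ge0 ?lee_fin ?sqr_ge0.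
(* The unbounded part of the domain costs [b^2 e']. On the rest, left invariance substitutes
   [h = g u], and [bd_mul] puts [u] in [KK]. *)
have phpsi g : A g -> det4 g = 1%R -> (ph g)%:E <= (b ^+ 2 * e')%:E + psi g.
  move=> [Lg bg] dg; rewrite (Ex_EFin fd (ac g)).
  pose f1 (h : M4) := (b ^+ 2)%:E * (\1_Ac h)%:E; pose f2 (h : M4) := (\1_A h)%:E * ((y g - y h) ^+ 2)%:E.
  have m1 : measurable_fun setT f1.
    by apply: emeasurable_funM; [exact: measurable_cst|exact: measurable_indicE].
  have m2 : measurable_fun setT f2.
    by apply: emeasurable_funM => //; exact: measurable_indicE.
  have f10 h : 0 <= f1 h by rewrite mule_ge0 ?lee_fin ?sqr_ge0.
  have f20 h : 0 <= f2 h by rewrite mule_ge0 ?lee_fin ?sqr_ge0.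
  apply: (@le_trans _ _ (haar (fun h => f1 h + f2 h))).
    apply: haar_le => //.
    - by apply: measurable_mulE => //; exact: (fd_mF fd).
    - exact: emeasurable_funD.
    - by move=> h; apply: mulE_ge0 => h'; rewrite lee_fin sqr_ge0.
    - move=> h _; rewrite /mulE /f1 /f2.
      have [hL|hL] := pselect (lift F h); last first.
        by rewrite [\1_(lift F) h]indicE (memNset hL) mul0e; exact: adde_ge0 (f10 h) (f20 h).
      have [hb|hb] := pselect (bd n%:R h).
        rewrite [\1_Ac h]indicE (memNset (fun z : Ac h => z.2 hb)) mule0 add0e.
        by rewrite !indicE (mem_set hL) (mem_set (conj hL hb : A h)).
      rewrite [\1_A h]indicE (memNset (fun z : A h => hb z.2)) mul0e adde0.
      by rewrite !indicE (mem_set hL) (mem_set (conj hL hb : Ac h)) mul1e mule1 lee_fin.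
    - by move=> h; exact: adde_ge0.
  rewrite haarD// haarZ ?sqr_ge0//; last exact: measurable_indicE.
  apply: leeD; first by rewrite [(b ^+ 2 * e')%:E]EFinM; apply: lee_wpmul2l; [rewrite lee_fin sqr_ge0|exact: hn].
  rewrite -(haar_left dg m2 f20); apply: haar_le.
  - by apply: (measurableT_comp m2); exact: measurable_mul4l.
  - apply: emeasurable_funM; first exact: measurable_indicE.
    by apply: (measurableT_comp (msq g)); exact: measurable_mul4l.
  - by move=> u; exact: f20.
  - move=> u du; rewrite /f2; apply: lee_wpmul2r; first by rewrite lee_fin sqr_ge0.
    rewrite lee_fin !indicE ler_nat; case: (boolP (mul4 g u \in A)) => //; rewrite inE => -[_ bgu].
    rewrite mem_set//; split=> //.
    have le (m : M4) : bd n%:R m -> bd n.+1%:R m.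
      have nn : (n%:R <= n.+1%:R :> R)%R by rewrite ler_nat.
      by move=> [*]; split; apply: le_trans nn.
    exact: (bd_mul (ler0n _ _) dg (le _ bg) (le _ bgu)).
  - by move=> u; rewrite mule_ge0 ?lee_fin ?sqr_ge0.
have swap := displacement_swap fd ay mKK (fun u h => h.2) (fun u h => Dy u h.2 h.1) (ltW (divr_gt0 e0 k1)).
rewrite -lee_fin (Ex_EFin fd aph).
pose t1 (m : M4) := (b ^+ 2 * e')%:E * mulE F (fun=> 1%:E) m.
pose t2 (m : M4) := (b ^+ 2 * nu)%:E * (\1_Ac m)%:E.
pose t3 (m : M4) := (\1_(lift F) m)%:E * psi m.
have mt1 : measurable_fun setT t1.
  apply: emeasurable_funM; first exact: measurable_cst.
  by apply: measurable_mulE; [exact: (fd_mF fd)|exact: measurable_cst].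
have mt2 : measurable_fun setT t2.
  by apply: emeasurable_funM; [exact: measurable_cst|exact: measurable_indicE].
have one0 m : 0 <= mulE F (fun=> 1%:E) m by apply: mulE_ge0 => h; rewrite lee_fin.
have be0 : (0 <= b ^+ 2 * e')%R by apply: mulr_ge0; [exact: sqr_ge0|exact: ltW].
have bn0 : (0 <= b ^+ 2 * nu)%R by apply: mulr_ge0; [exact: sqr_ge0|].
have t10 m : 0 <= t1 m by apply: mule_ge0; [rewrite lee_fin|exact: one0].
have t20 m : 0 <= t2 m by apply: mule_ge0; rewrite lee_fin.
have t30 m : 0 <= t3 m by apply: mule_ge0; [rewrite lee_fin|exact: psi0].
have [mt3 ht3] := swap.
have mc (f : M4 -> \bar R) : measurable_fun setT f -> measurable_fun setT (fun p => f (mat p)).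
  by move=> mf; exact: (measurable_comp_mat mf).
have -> : (2 * e)%:E = (e%:E + e%:E) by rewrite -EFinD; congr EFin; ring.
apply: (@le_trans _ _ (haar (fun m => (t1 m + t2 m) + t3 m))).
  apply: ge0_le_integral => //.
  - by move=> p _; apply: mulE_ge0 => m; rewrite lee_fin.
  - apply: (mc (mulE F (fun m => (ph m)%:E))); apply: measurable_mulE; first exact: (fd_mF fd).
    exact: adm_meas aph.
  - apply: emeasurable_funD; last exact: mt3.
    by apply: emeasurable_funD; exact: mc.
  - move=> p _; rewrite /mulE; have [hL|hL] := pselect (lift F (mat p)); last first.
      by rewrite [\1_(lift F) _]indicE (memNset hL) mul0e !adde_ge0.
    rewrite /t1 /t3 /mulE !indicE (mem_set hL) !mul1e mule1.
    have [hb|hb] := pselect (bd n%:R (mat p)).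
      apply: le_trans (phpsi _ (conj hL hb) (lift_det (fd_pos fd) hL)) _.
      by apply: leeD => //; rewrite leeDl.
    rewrite /t2 indicE (mem_set (conj hL hb : Ac (mat p))) mule1.
    apply: (@le_trans _ _ (b ^+ 2 * nu)%:E); first by rewrite lee_fin.
    by rewrite addeAC leeDr// adde_ge0// lee_fin.
rewrite /haar ge0_integralD//; last 2 first.
- by move=> p _; rewrite adde_ge0.
- by apply: emeasurable_funD; exact: mc.
rewrite -/(haar t3) -/(haar (fun m => t1 m + t2 m)); apply: leeD; last first.
  apply: le_trans ht3 _; rewrite -(fineK kf) -/k -EFinM lee_fin.
  by rewrite mulrAC ler_pdivrMr// ler_wpM2l ?(ltW e0)// lerDl.
have mo := measurable_mulE (fd_mF fd) (measurable_cst (1%:E : \bar R)).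
have i0 m : 0 <= (\1_Ac m)%:E :> \bar R by rewrite lee_fin.
rewrite (haarD mt1 mt2 t10 t20) (haarZ be0 mo one0) (haarZ bn0 (measurable_indicE mAc) i0).
rewrite -/(quo F (fun=> 1%:E)) -(Ex_EFin fd (adm_cst G 1%R)) -/nu.
apply: (@le_trans _ _ ((b ^+ 2 * e')%:E * nu%:E + (b ^+ 2 * nu)%:E * e'%:E)).
  by apply: leeD => //; apply: lee_wpmul2l => //; rewrite lee_fin.
rewrite -!EFinM -EFinD lee_fin.
have -> : (b ^+ 2 * e' * nu + b ^+ 2 * nu * e' = e' * (2 * b ^+ 2 * nu))%R by ring.
by rewrite /e' mulrAC ler_pdivrMr// ler_wpM2l ?(ltW e0)// lerDl.
Qed.
End Variance.

(** * Convergence in mean square, and good points near thick points *)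

Section Ergodic.
Variable R : realType.
Local Notation RM := (measurableTypeR R).
Local Notation M4 := (RM * RM * RM * RM)%type.
Implicit Types (G : set M4) (s m u w g : M4) (y : M4 -> R) (F C : set (RM * RM)).

(** [orby] has mean 1 and is at most [cb]; in particular the covolume is positive. *)
Lemma vol_cb G F C s : fundom G F C -> det4 s = 1 ->
  cusp_at_infty [set m | G (conj4 (inv4 s) m)] -> 1 <= cb R * Ex F (fun=> 1).
Proof.
move=> fd ds cS; rewrite -[X in X <= _](Ex_orby fd ds cS ltr01) -(ExZ _ fd (adm_cst G 1)).
apply: (Ex_le fd); [exact: (adm_orby ds (fd_cusp fd) cS ltr01)|exact: adm_cst|].
by move=> m; rewrite mulr1; have /andP[] := orby_bd ds (ci_dg (fd_cusp fd)) cS (lexx 1) m.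
Qed.

Lemma vol_gt0 G F C s : fundom G F C -> det4 s = 1 ->
  cusp_at_infty [set m | G (conj4 (inv4 s) m)] -> 0 < Ex F (fun=> 1).
Proof.
move=> fd ds cS; rewrite -(pmulr_rgt0 _ (cb_gt0 R)).
exact: lt_le_trans ltr01 (vol_cb fd ds cS).
Qed.

(** Riesz' averages are almost invariant under integer translations; [orbN_av] identifies them with
    normalised counts, [mautner] extends the invariance to a bounded set, and [variance_small]
    concludes. The limit is [1/nu] because the mean of [orby] is 1. *)
Lemma ergodic G F C s (e : R) : fundom G F C -> det4 s = 1 ->
  cusp_at_infty [set m | G (conj4 (inv4 s) m)] -> 0 < e ->
  exists2 S : R, 1 <= S & Ex F (fun m => (orby G s S m - (Ex F (fun=> 1))^-1) ^+ 2) <= e.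
Proof.
move=> fd ds cS e0; set nu := Ex F (fun=> 1); have nu0 : 0 < nu := vol_gt0 fd ds cS.
have cG := fd_cusp fd; have dG := ci_dg cG.
have [K [eps [K1 eps0 hvar]]] := variance_small fd (cb_gt0 R) (mulr_gt0 e0 nu0).
have r00 : 0 < 400^-1 :> R by rewrite invr_gt0 ltr0Sn.
have C00 : 0 <= cb R * 960 by apply: mulr_ge0; [exact: ltW (cb_gt0 R)|exact: ler0n].
have [e2 e20 hM] := mautner K1 eps0 C00 r00.
have aN := orby_adm ds cG cS ltr01.
have [N N0 hN] := almost_invariant fd aN e20.
pose S : R := Num.sqrt N%:R.
have S1 : 1 <= S by rewrite -sqrtr1 ler_sqrt ?ler1n.
have S0 := lt_le_trans ltr01 S1.
exists S => //; have ay := adm_orby ds cG cS S0.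
have hy := orby_bd ds dG cS S1.
have da : det4 (diag4 S) = 1 by rewrite det4_diag// gt_eqF.
have avE m : av N (orbN G s 1) m = orby G s S (mul4 m (diag4 S)).
  by rewrite (orbN_av _ ds dG cS N0).
have hD u : det4 u = 1 -> bd K u -> disp F (orby G s S) u <= eps.
  apply: hM.
  - by move=> u' w' du' dw'; exact: (disp_mul _ fd ay du').
  - by move=> u'; exact: (disp_inv fd ay).
  - by move=> u'; exact: disp_ge0.
  (* Moving [diag4 S] past a translation by [i] multiplies it by [S^2 = N], so the bound is used at
     [i * N]. *)
  - move=> i; apply: le_trans (hN (i * N)%N).
    rewrite /disp -(Ex_right fd (adm_disp (upper4 i%:R) ay) da) le_eqVlt; apply/orP; left; apply/eqP.
    congr Ex; apply/funext => m; rewrite !avE -!mul4A.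
    suff -> : mul4 (diag4 S) (upper4 i%:R) = mul4 (upper4 (i * N)%:R) (diag4 S) by [].
    rewrite /mul4 /diag4 /upper4 /= natrM.
    have -> : N%:R = S * S :> R by rewrite -expr2 sqr_sqrtr.
    by move: (i%:R) (S) S0; clear => x T T0; congr (_, _, _, _); field; rewrite ?gt_eqF.
  - by move=> r u' r0 r1 nu' du'; exact: (disp_near fd ds cS S1 r0 r1).
have := hvar _ ay hy hD; rewrite (Ex_orby fd ds cS S0) -/nu expr1n => hv.
have -> : Ex F (fun m => (orby G s S m - nu^-1) ^+ 2) = Ex F (fun m => orby G s S m ^+ 2) - nu^-1.
  pose c := nu^-1.
  transitivity (Ex F (fun m => (orby G s S m ^+ 2 - 2 * c * orby G s S m) + c ^+ 2 * 1)).
    by congr Ex; apply/funext => m; rewrite -/c; ring.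
  have a1 := admX2 ay; have a2 := admZ (2 * c) ay; have a3 := admZ (c ^+ 2) (adm_cst G 1).
  rewrite (ExD fd (admB a1 a2) a3) (ExB fd a1 a2) (ExZ _ fd ay) (ExZ _ fd (adm_cst G 1)).
  rewrite (Ex_orby fd ds cS S0) -/nu /c; field; exact: lt0r_neq0.
by rewrite -(ler_pM2l nu0) mulrBr divff ?gt_eqF// [nu * e]mulrC.
Qed.

Lemma thick_mass G F C (U : set M4) (r a : R) g (psi : M4 -> R) : fundom G F C ->
  measurable U -> (forall u u', U u -> U u' -> near4 r (mul4 u (inv4 u'))) ->
  U `<=` [set u | det4 u = 1] -> ~ thin G r g -> det4 g = 1 ->
  adm G psi -> (forall m, 0 <= psi m) -> 0 <= a -> (forall u, U u -> a <= psi (mul4 g u)) ->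
  (a%:E * haar (fun u => (\1_U u)%:E) <= (Ex F psi)%:E)%E.
Proof.
move=> fd mU Unear Udet thick dg ap p0 a0 hU.
have dG := ci_dg (fd_cusp fd).
have [e be] := cusp_group_enum (fd_cusp fd).
have Ge k : G (e k) by apply: (set_bij_homo be).
have dgi : det4 (inv4 g) = 1 by rewrite det4V.
pose f (m : M4) : R := \1_U (mul4 (inv4 g) m) * psi m.
have mI : measurable_fun setT (fun m : M4 => (\1_U (mul4 (inv4 g) m))%:E : \bar R).
  by apply: (measurableT_comp (measurable_indicE mU)); exact: measurable_mul4l.
have mf : measurable_fun setT (fun m : M4 => (f m)%:E : \bar R).
  by under eq_fun do rewrite EFinM; apply: emeasurable_funM => //; exact: (adm_meas ap).
have f0 m : 0 <= f m by rewrite mulr_ge0.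
have fE0 m : (0 <= (f m)%:E)%E by rewrite lee_fin.
apply: (@le_trans _ _ (2%:E * haar (fun m => (f m)%:E))%E).
  apply: (@le_trans _ _ (haar (fun m => (f m)%:E))); last first.
    by rewrite -[X in (X <= _)%E]mul1e; apply: lee_wpmul2r; [exact: haar_ge0|rewrite lee_fin ler1n].
  have U0 u : (0 <= (\1_U u)%:E :> \bar R)%E by rewrite lee_fin.
  rewrite -(haar_left dgi (measurable_indicE mU) U0) -(haarZ a0 mI (fun m => U0 _)).
  apply: haar_le => //.
  - by apply: emeasurable_funM => //; exact: measurable_cst.
  - by move=> m; apply: mule_ge0; rewrite lee_fin.
  - move=> m dm; rewrite /f indicE -EFinM lee_fin.
    case: (boolP (_ \in U)) => [|_]; last by rewrite mulr0 mul0r.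
    by rewrite inE mulr1 mul1r => /hU; rewrite mulVK4.
rewrite (unfold fd be mf f0) (Ex_EFin fd ap); apply: haar_le.
- apply: measurable_mulE; first exact: (fd_mF fd).
  apply: measurable_nneseries => [k|k m]; last exact: fE0.
  by apply: (measurableT_comp mf); exact: measurable_mul4l.
- by apply: measurable_mulE; [exact: (fd_mF fd)|exact: (adm_meas ap)].
- by move=> m; apply: mulE_ge0 => m'; apply: nneseries_ge0 => k _ _; exact: fE0.
- move=> m dm; rewrite /mulE; apply: lee_wpmul2l; first by rewrite lee_fin.
  pose A := [set k | U (mul4 (inv4 g) (mul4 (e k) m))].
  have Asub k l : A k -> A l -> k = l.
    move=> Ak Al; have := Unear _ _ Ak Al.
    have -> : mul4 (mul4 (inv4 g) (mul4 (e k) m)) (inv4 (mul4 (inv4 g) (mul4 (e l) m))) =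
       conj4 g (mul4 (e k) (inv4 (e l))).
      by rewrite /conj4 !inv4M inv4K !mul4A; congr mul4; rewrite mul4K.
    move=> hn; apply: (set_bij_inj be); rewrite ?inE//.
    apply: contrapT => hkl; apply: thick; exists (mul4 (e k) (inv4 (e l))); split=> //.
      by apply: (dgM dG) => //; exact: (dgV dG).
    by move=> /(congr1 (fun z => mul4 z (e l))); rewrite mul4VK ?mul14 ?(dg_det dG)//; exact: hkl.
  have [fA cA] := @cnt_inj R _ A (fun=> 0%N) 1%N (fun k l Ak Al _ => Asub k l (set_mem Ak) (set_mem Al)) (fun _ _ => isT).
  have -> : (\sum_(0 <= k <oo) (f (mul4 (e k) m))%:E = \sum_(0 <= k <oo) (psi m)%:E * (\1_A k)%:E)%E.
    by apply: eq_eseriesr => k _; rewrite /f (adm_inv ap)// EFinM muleC.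
  have A0 (k : nat) : true -> (0 <= (\1_A k)%:E :> \bar R)%E by rewrite lee_fin.
  rewrite (@nneseriesZl R (fun k => (\1_A k)%:E) xpredT (psi m) 0%N A0) cnt_series//.
  by rewrite -EFinM lee_fin -[leRHS]mulr1 ler_wpM2l.
- by move=> m; apply: mulE_ge0 => m'; rewrite lee_fin.
Qed.

Lemma measurable_Up (eta : R) : measurable (Up eta : set M4).
Proof.
have h2 := @measurable_p2 R; have h3 := @measurable_p3 R; have h4 := @measurable_p4 R.
have -> : Up eta = [set m : M4 | det4 m = 1] `&` (((fun m : M4 => m.1.1.2) @^-1` `[- (2 * eta), - eta]%classic) `&`
   (((fun m : M4 => m.2) @^-1` `[1 - 8 * eta, 1 - 6 * eta]%classic) `&` ((fun m : M4 => m.1.2) @^-1` `[- eta, eta]%classic))).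
  by apply/seteqP; split=> [m [*]|m [? [+ [+ +]]]] /=; rewrite ?in_itv /=.
apply: measurableI; first exact: measurable_det1.
by apply: measurableI; [|apply: measurableI]; rewrite -[X in measurable X]setTI;
  [apply: h2|apply: h4|apply: h3] => //; exact: measurable_itv.
Qed.

(** [Up eta] contains the image of an explicit box in the coordinates bottom row and abscissa. *)
Lemma haar_Up_gt0 (eta : R) : 0 < eta -> eta <= 100^-1 -> (0 < haar (fun u => (\1_(Up eta) u)%:E))%E.
Proof.
move=> e0 e1; rewrite haar_indic; last exact: measurable_Up.
have e1' : eta <= 1 / 100 by rewrite mul1r.
pose I1 : set RM := `[- (eta / 100), eta / 100]%classic.
pose I2 : set RM := `[1 - 15 / 2 * eta, 1 - 13 / 2 * eta]%classic.
pose I3 : set RM := `[- (8 / 5 * eta), - (7 / 5 * eta)]%classic.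
have pos (p q : R) : p < q -> (0 < lebesgue_measure (`[p, q]%classic : set RM))%E.
  by move=> pq; rewrite lebesgue_measure_itv/= lte_fin pq -EFinB lte_fin subr_gt0.
have mI (p q : R) : measurable (`[p, q]%classic : set RM) by exact: measurable_itv.
have e2 : L2 R (I1 `*` I2) = (lebesgue_measure I1 * lebesgue_measure I2)%E.
  exact: (product_measure1E _ _ (mI _ _) (mI _ _)).
have e3 : L3 R ((I1 `*` I2) `*` I3) = (lebesgue_measure I1 * lebesgue_measure I2 * lebesgue_measure I3)%E.
  by rewrite -e2; exact: (product_measure1E (L2 R) _ (measurableX (mI _ _) (mI _ _)) (mI _ _)).
apply: (@lt_le_trans _ _ (L3 R ((I1 `*` I2) `*` I3))).
  by rewrite e3 !mule_gt0// pos//; move: e0; clear; lra.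
apply: le_measure; rewrite ?inE.
- exact: (measurableX (measurableX (mI _ _) (mI _ _)) (mI _ _)).
- by rewrite -[X in measurable X]setTI; apply: measurable_mat => //; exact: measurable_Up.
case=> -[c d] x [[/=]]; rewrite /I1 /I2 /I3 /= !in_itv /= => /andP[c1 c2] /andP[d1 d2] /andP[x1 x2].
have d0 : 9 / 10 <= d by move: d1 e1'; clear; lra.
have v0 : (c, d) != 0 :> RM * RM.
  by apply/eqP => -[_ dd]; move: d0; rewrite dd; clear; lra.
have n0 := nsq_gt0 v0.
split; rewrite /=; first exact: det_mat.
- set i := (nsq (c, d))^-1.
  have i0 : 0 < i by rewrite invr_gt0.
  have i2 : i <= 3 / 2.
    by rewrite invf_ple ?posrE// /nsq /=; move: d0; clear; nra.
  have hx : x * d <= - (5 / 4 * eta) by move: x2 d0 e0; clear; nra.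
  have hx' : - (8 / 5 * eta) <= x * d by move: x1 x2 d0 d2 e0; clear; nra.
  have ci : c * i <= eta / 50 by move: c1 c2 i0 i2 e0; clear; nra.
  have ci' : - (eta / 50) <= c * i by move: c1 c2 i0 i2 e0; clear; nra.
  by apply/andP; move: hx hx' ci ci' e0; clear; split; lra.
- by apply/andP; move: d1 d2 e0; clear; split; lra.
- by apply/andP; move: c1 c2 e0; clear; split; lra.
Qed.

Lemma Up_near (eta : R) (u u' : M4) : 0 < eta -> eta <= 100^-1 -> Up eta u -> Up eta u' ->
  near4 (20 * eta) (mul4 u (inv4 u')) /\ near4 (20 * eta) (mul4 (inv4 u) u').
Proof.
move=> e0 e1 hu hu'; have /andP[] := Up_a e0 e1 hu; have /andP[] := Up_a e0 e1 hu'.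
case: hu => _ /andP[b1 b2] /andP[d1 d2] /andP[c1 c2].
case: hu' => _ /andP[b1' b2'] /andP[d1' d2'] /andP[c1' c2'].
case: u b1 b2 d1 d2 c1 c2 => [[[a b] c] d] /= b1 b2 d1 d2 c1 c2.
case: u' b1' b2' d1' d2' c1' c2' => [[[a' b'] c'] d'] /= b1' b2' d1' d2' c1' c2' a1' a2' a1 a2.
have e1' : eta <= 1 / 100 by rewrite mul1r.
have near x : `|x| <= 20 * eta -> `|x| <= 20 * eta by [].
pose A := a - 1; pose D := d - 1; pose A' := a' - 1; pose D' := d' - 1.
have pr (x y : R) : `|x| <= 9 * eta -> `|y| <= 9 * eta -> `|x * y| <= eta.
  move=> hx hy; rewrite normrM; apply: (@le_trans _ _ ((9 * eta) * (9 * eta))); first exact: ler_pM.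
  by move: e0 e1'; clear; nra.
have nn (x : R) : - (9 * eta) <= x <= 9 * eta -> `|x| <= 9 * eta by rewrite ler_norml.
have hA : `|A| <= 9 * eta by apply: nn; rewrite /A; apply/andP; move: a1 a2 e0; clear; split; lra.
have hD : `|D| <= 9 * eta by apply: nn; rewrite /D; apply/andP; move: d1 d2 e0; clear; split; lra.
have hB : `|b| <= 2 * eta by rewrite ler_norml; apply/andP; move: b1 b2 e0; clear; split; lra.
have hC : `|c| <= eta by rewrite ler_norml; apply/andP; move: c1 c2 e0; clear; split; lra.
have hA' : `|A'| <= 9 * eta by apply: nn; rewrite /A'; apply/andP; move: a1' a2' e0; clear; split; lra.
have hD' : `|D'| <= 9 * eta by apply: nn; rewrite /D'; apply/andP; move: d1' d2' e0; clear; split; lra.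
have hB' : `|b'| <= 2 * eta by rewrite ler_norml; apply/andP; move: b1' b2' e0; clear; split; lra.
have hC' : `|c'| <= eta by rewrite ler_norml; apply/andP; move: c1' c2' e0; clear; split; lra.
have w (x k : R) : k <= 9 -> `|x| <= k * eta -> `|x| <= 9 * eta.
  by move=> k9 h; apply: le_trans h _; rewrite ler_pM2r.
have hB9 := w _ _ (ltac:(by rewrite ler_nat) : 2 <= 9 :> R) hB.
have hB9' := w _ _ (ltac:(by rewrite ler_nat) : 2 <= 9 :> R) hB'.
have hC9 : `|c| <= 9 * eta by move: hC e0; clear; lra.
have hC9' : `|c'| <= 9 * eta by move: hC' e0; clear; lra.
have t4 (x y z t k : R) : `|x| <= 9 * eta -> `|y| <= 9 * eta -> `|z| <= eta -> `|t| <= eta ->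
    k = x + y + z + t -> `|k| <= 20 * eta.
  move=> hx hy hz ht ->; apply: le_trans (ler_normD _ _) _.
  have := ler_normD (x + y) z; have := ler_normD x y.
  by move: hx hy hz ht; clear; lra.
have N (x k : R) : `|x| <= k -> `|- x| <= k by rewrite normrN.
split; split=> /=.
- by apply: (t4 A D' (A * D') (- (b * c'))); rewrite ?normrN ?pr//; rewrite /A /D'; ring.
- by apply: (t4 b (- b') (- (A * b')) (b * A')); rewrite ?normrN ?pr//; rewrite /A /A'; ring.
- by apply: (t4 c (- c') (c * D') (- (D * c'))); rewrite ?normrN ?pr//; rewrite /D /D'; ring.
- by apply: (t4 D A' (D * A') (- (c * b'))); rewrite ?normrN ?pr//; rewrite /D /A'; ring.
- by apply: (t4 D A' (D * A') (- (b * c'))); rewrite ?normrN ?pr//; rewrite /D /A'; ring.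
- by apply: (t4 b' (- b) (D * b') (- (b * D'))); rewrite ?normrN ?pr//; rewrite /D /D'; ring.
- by apply: (t4 c' (- c) (A * c') (- (c * A'))); rewrite ?normrN ?pr//; rewrite /A /A'; ring.
- by apply: (t4 A D' (A * D') (- (c * b'))); rewrite ?normrN ?pr//; rewrite /A /D'; ring.
Qed.

(** Chebyshev's inequality made local: if the deviation exceeded [e1] on all of [g Up], [thick_mass]
    would contradict mean square convergence. Translates by [Up] serve the upper bound and by its
    inverses the lower bound; [S] does not depend on [g]. *)
Lemma good_translate G F C s (eta r e1 : R) (ka := (Ex F (fun=> 1))^-1) : fundom G F C -> det4 s = 1 ->
  cusp_at_infty [set m | G (conj4 (inv4 s) m)] -> 0 < eta -> eta <= 100^-1 -> 20 * eta <= r -> 0 < e1 ->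
  exists2 S : R, 1 <= S & forall g, det4 g = 1 -> ~ thin G r g ->
    (exists2 u, Up eta u & `|orby G s S (mul4 g u) - ka| <= e1) /\
    (exists2 u, Up eta u & `|orby G s S (mul4 g (inv4 u)) - ka| <= e1).
Proof.
move=> fd ds cS e0 e100 er e10.
have hp := haar_Up_gt0 e0 e100; have mU := measurable_Up eta.
have [h [h0 hh]] : exists h : R, 0 < h /\ (h%:E <= haar (fun u => (\1_(Up eta) u)%:E))%E.
  case: (haar _) hp => [x||//]; first by rewrite lte_fin => x0; exists x.
  by move=> _; exists 1; rewrite leey.
(* Half the mass [e1^2 h] that a bad translate would carry. *)
have e2 : 0 < e1 ^+ 2 * h / 2 by rewrite divr_gt0// mulr_gt0// exprn_gt0.
have [S S1 hS] := ergodic fd ds cS e2; exists S => // g dg thick.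
have S0 := lt_le_trans ltr01 S1.
have aS : adm G (fun m => (orby G s S m - ka) ^+ 2).
  by apply: admX2; apply: admB; [exact: (adm_orby ds (fd_cusp fd) cS S0)|exact: adm_cst].
have psi0 m : 0 <= (orby G s S m - ka) ^+ 2 by exact: sqr_ge0.
have main (U : set M4) : measurable U -> (h%:E <= haar (fun u => (\1_U u)%:E))%E ->
   (forall u u', U u -> U u' -> near4 (20 * eta) (mul4 u (inv4 u'))) -> U `<=` [set u | det4 u = 1] ->
   exists2 u, U u & `|orby G s S (mul4 g u) - ka| <= e1.
  move=> mU' hU' nU dU; apply: contrapT => hne.
  have := @thick_mass G F C U r (e1 ^+ 2) g _ fd mU' (fun u u' a b => near4_le er (nU u u' a b)) dU thick dg aS psi0 (sqr_ge0 _).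
  move=> H; have {H} : ((e1 ^+ 2)%:E * haar (fun u => (\1_U u)%:E) <= (Ex F (fun m => (orby G s S m - ka) ^+ 2))%:E)%E.
    apply: H => u Uu; rewrite leNgt; apply/negP => hlt; apply: hne; exists u => //.
    rewrite leNgt; apply/negP => h1; move: hlt; rewrite -[ltLHS]real_normK ?num_real//.
    by rewrite ltr_pXn2r ?nnegrE ?(ltW e10)// => /(lt_trans h1); rewrite ltxx.
  move=> H; have : ((e1 ^+ 2)%:E * h%:E <= (e1 ^+ 2 * h / 2)%:E)%E.
    apply: le_trans (_ : (e1 ^+ 2)%:E * haar (fun u => (\1_U u)%:E) <= _)%E.
      by apply: lee_wpmul2l; rewrite ?lee_fin ?sqr_ge0.
    by apply: le_trans H _; rewrite lee_fin.
  have : 0 < e1 ^+ 2 * h by rewrite mulr_gt0// exprn_gt0.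
  by rewrite -EFinM lee_fin; clear; set x := e1 ^+ 2 * h; lra.
split.
  apply: main => //; [by move=> u u' a b; have [] := Up_near e0 e100 a b|by move=> u []].
have [||||u [w uw <-] hu] := main [set inv4 u | u in Up eta].
- have -> : [set inv4 u | u in Up eta] = setT `&` (fun m : M4 => inv4 m : M4) @^-1` Up eta.
    apply/seteqP; split=> [_ [u hu <-]|u [_ hu]]; first by split=> //=; rewrite inv4K.
    by exists (inv4 u) => //; rewrite inv4K.
  exact: (@measurable_inv4 R measurableT _ mU).
- rewrite (_ : (fun u => _) = (fun u => (\1_(Up eta) (inv4 u))%:E)); last first.
    apply/funext => u; rewrite !indicE; congr (_%:R%:E); congr nat_of_bool; apply/idP/idP; rewrite !inE.
      by move=> [w hw <-]; rewrite inv4K.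
    by move=> hu; exists (inv4 u) => //; rewrite inv4K.
  by rewrite (haar_inv (measurable_indicE mU)).
- move=> _ _ [u hu <-] [w hw <-]; rewrite inv4K.
  by have [] := Up_near e0 e100 hu hw.
- by move=> _ [u [du _ _ _] <-] /=; rewrite det4V.
by exists w.
Qed.

End Ergodic.

(** * Counting orbit vectors with slope in short intervals *)

Section CountAsymptotics.
Variable R : realType.
Local Notation RM := (measurableTypeR R).
Local Notation M4 := (RM * RM * RM * RM)%type.
Implicit Types (G : set M4) (s m u w g : M4) (F C : set (RM * RM)).

(** Monotonicity passes from mean square to pointwise: the count at [g] is at most the count of
    level [(1 + 10 eta) S] at a good point [g u]. The choice of [eta] absorbs the ratio of the
    squared levels into [e]. *)
Lemma thick_upper G F C s (r e : R) (ka := (Ex F (fun=> 1))^-1) : fundom G F C -> det4 s = 1 ->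
  cusp_at_infty [set m | G (conj4 (inv4 s) m)] -> 0 < r -> 0 < e ->
  exists2 S : R, 2^-1 <= S & forall g, det4 g = 1 -> ~ thin G r g ->
    orbN G s S g <= (ka + e) * S ^+ 2.
Proof.
move=> fd ds cS r0 e0; have dG := ci_dg (fd_cusp fd).
have ka0 : 0 < ka by rewrite invr_gt0; exact: (vol_gt0 fd ds cS).
pose eta := Num.min 100^-1 (Num.min (r / 20) (e / (40 * (ka + e)))).
have eta0 : 0 < eta.
  rewrite !lt_min invr_gt0 ltr0Sn (divr_gt0 r0 (ltr0Sn _ _)) divr_gt0//.
  by apply: mulr_gt0; [exact: ltr0Sn|exact: addr_gt0].
have h1 : eta <= 100^-1 by rewrite ge_min lexx.
have h2 : 20 * eta <= r by rewrite mulrC -ler_pdivlMr ?ltr0Sn// !ge_min lexx orbT.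
have h3 : eta * (40 * (ka + e)) <= e.
  rewrite -ler_pdivlMr ?ge_min ?lexx ?orbT//.
  by apply: mulr_gt0; [exact: ltr0Sn|exact: addr_gt0].
have e40 : 0 < e / 4 by apply: divr_gt0 => //; exact: ltr0Sn.
have [S' S1 hS] := good_translate fd ds cS eta0 h1 h2 e40.
have S'0 := lt_le_trans ltr01 S1.
have q0 : 0 < 1 + 10 * eta by move: eta0; clear; lra.
have h1' : eta <= 1 / 100 by rewrite mul1r.
exists (S' / (1 + 10 * eta)).
  by rewrite ler_pdivlMr//; move: h1' S1 eta0; clear; nra.
move=> g dg /(hS g dg)[[u hu]]; rewrite ler_norml => /andP[_ hup] _.
have SS0 : 0 < S' / (1 + 10 * eta) by rewrite divr_gt0.
have := orbN_Up g ds dG cS SS0 eta0 h1 hu; rewrite [(1 + 10 * eta) * _]mulrC mulfVK ?gt_eqF// => hN.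
apply: le_trans hN _; move: hup; rewrite lerBlDr /orby ler_pdivrMr ?exprn_gt0// -/ka => hup.
apply: le_trans hup _; rewrite (_ : (ka + e) * (S' / (1 + 10 * eta)) ^+ 2 =
  (ka + e) / (1 + 10 * eta) ^+ 2 * S' ^+ 2); last by field; rewrite gt_eqF.
rewrite ler_pM2r ?exprn_gt0// ler_pdivlMr ?exprn_gt0//.
have : (1 + 10 * eta) ^+ 2 <= 1 + 21 * eta by move: eta0 h1'; clear; nra.
move: h3 ka0 e0 eta0; clear; set q := (1 + 10 * eta) ^+ 2 => h3 ka0 e0 eta0 hq.
apply: (@le_trans _ _ ((e / 4 + ka) * (1 + 21 * eta))); last by nra.
by rewrite ler_pM2l//; lra.
Qed.

(** Same comparison in the other direction, from a good point [g u^-1] up to [g]. *)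
Lemma thick_lower G F C s (r e : R) (ka := (Ex F (fun=> 1))^-1) : fundom G F C -> det4 s = 1 ->
  cusp_at_infty [set m | G (conj4 (inv4 s) m)] -> 0 < r -> 0 < e ->
  exists2 S : R, 2^-1 <= S & forall g, det4 g = 1 -> ~ thin G r g ->
    (ka - e) * S ^+ 2 <= orbN G s S g.
Proof.
move=> fd ds cS r0 e0; have dG := ci_dg (fd_cusp fd).
have ka0 : 0 < ka by rewrite invr_gt0; exact: (vol_gt0 fd ds cS).
pose eta := Num.min 100^-1 (Num.min (r / 20) (e / (40 * (ka + e)))).
have eta0 : 0 < eta.
  rewrite !lt_min invr_gt0 ltr0Sn (divr_gt0 r0 (ltr0Sn _ _)) divr_gt0//.
  by apply: mulr_gt0; [exact: ltr0Sn|exact: addr_gt0].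
have h1 : eta <= 100^-1 by rewrite ge_min lexx.
have h2 : 20 * eta <= r by rewrite mulrC -ler_pdivlMr ?ltr0Sn// !ge_min lexx orbT.
have h3 : eta * (40 * (ka + e)) <= e.
  rewrite -ler_pdivlMr ?ge_min ?lexx ?orbT//.
  by apply: mulr_gt0; [exact: ltr0Sn|exact: addr_gt0].
have e40 : 0 < e / 4 by apply: divr_gt0 => //; exact: ltr0Sn.
have [S' S1 hS] := good_translate fd ds cS eta0 h1 h2 e40.
have S'0 := lt_le_trans ltr01 S1.
have q0 : 0 < 1 + 10 * eta by move: eta0; clear; lra.
have h1' : eta <= 1 / 100 by rewrite mul1r.
exists ((1 + 10 * eta) * S').
  by move: S1 eta0; rewrite -[2^-1]mul1r; clear; nra.
move=> g dg /(hS g dg)[_ [u hu]]; rewrite ler_norml => /andP[hlo _].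
have du : det4 u = 1 by case: hu.
have := orbN_Up (mul4 g (inv4 u)) ds dG cS S'0 eta0 h1 hu; rewrite mul4VK// => hN.
apply: le_trans _ hN; move: hlo; rewrite lerBrDr /orby ler_pdivlMr ?exprn_gt0// -/ka => hlo.
apply: le_trans _ hlo; rewrite exprMn mulrA ler_pM2r ?exprn_gt0//.
have : (1 + 10 * eta) ^+ 2 <= 1 + 21 * eta by move: eta0 h1'; clear; nra.
have q1 : 1 <= (1 + 10 * eta) ^+ 2 by move: eta0; clear; nra.
move: h3 ka0 e0 eta0 q1; clear; set q := (1 + 10 * eta) ^+ 2 => h3 ka0 e0 eta0 q1 hq.
have [k|k] := leP 0 (ka - e); last by nra.
apply: (@le_trans _ _ ((ka - e) * (1 + 21 * eta))); last by nra.
by rewrite ler_wpM2l.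
Qed.

Lemma cnt_sum (n : nat) (P : nat -> Prop) :
  cnt R [set i | (i < n)%N /\ P i] = \sum_(i < n) (`[< P i >]%:R : R).
Proof.
elim: n => [|n IH].
  by rewrite big_ord0 (_ : [set i | _] = set0) ?cnt0// -subset0 => i [].
rewrite big_ord_recr /= -IH.
have fin k : finite_set [set i | (i < k)%N /\ P i].
  by apply: (sub_finite_set _ (finite_II k)) => i [].
case: (asboolP (P n)) => Pn /=; last first.
  rewrite addr0; congr cnt; apply/seteqP; split=> i [h Pi]; split=> //; last exact: ltnW.
  by move: h; rewrite ltnS leq_eqVlt => /orP[/eqP ni|//]; rewrite ni in Pi.
have -> : [set i | (i < n.+1)%N /\ P i] = [set i | (i < n)%N /\ P i] `|` [set n].
  apply/seteqP; split=> i.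
    by move=> [h Pi]; move: h; rewrite ltnS leq_eqVlt => /orP[/eqP ->|h]; [right|left].
  by move=> [[h Pi]|->]; split=> //; exact: ltnW.
rewrite cntU//; last by rewrite -subset0 => i [[h _] /= e]; rewrite e ltnn in h.
by rewrite {2}/cnt fset_set1 cardfs1.
Qed.

Lemma sector_cells G s (S Q al : R) (n : nat) : det4 s = 1 -> dgroup G ->
  cusp_at_infty [set m | G (conj4 (inv4 s) m)] -> 0 < S -> 0 < Q ->
  let y := S ^+ 2 / Q ^+ 2 in
  cnt R (sector G s one4 Q al (al + n%:R * y)) = \sum_(i < n) orbN G s S (geo (al + i%:R * y) y).
Proof.
move=> ds dG cS S0 Q0 y; have y0 : 0 < y by rewrite divr_gt0 ?exprn_gt0.
rewrite sector_sum ?det41// ?ltW//; apply: eq_bigr => i _.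
rewrite orbN_geo//; congr (cnt _ (sector _ _ _ _ _ _)).
have -> : Num.sqrt y = S / Q.
  by rewrite /y -expr_div_n sqrtr_sqr gtr0_norm// divr_gt0.
by rewrite invf_div mulrCA divff ?mulr1// gt_eqF.
Qed.

(* Sum over cells of slope width S^2/Q^2: thick cells are controlled by ergodicity and
   thin ones are rare by [thin_count]. *)
Lemma count_asymp G F C s (e : R) (ka := (Ex F (fun=> 1))^-1) : fundom G F C -> det4 s = 1 ->
  cusp_at_infty [set m | G (conj4 (inv4 s) m)] -> 0 < e ->
  exists W Q0 : R, [/\ 0 < W, 0 < Q0 & forall Q al be, Q0 <= Q -> W / Q <= be - al ->
    `|cnt R (sector G s one4 Q al be) - ka * (be - al) * Q ^+ 2| <= e * (be - al) * Q ^+ 2].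
Proof.
move=> fd ds cS e0; have cG := fd_cusp fd; have dG := ci_dg cG.
have nu0 := vol_gt0 fd ds cS.
have ka0 : 0 < ka by rewrite invr_gt0.
have [CC [CC1 kaC hCC]] : exists CC : R, [/\ 1 <= CC, ka <= CC &
    forall S m, 2^-1 <= S -> orbN G s S m <= CC * S ^+ 2].
  exists (4 + 200 ^+ 2); split.
  - by apply: ler_wpDr; [apply: exprn_ge0; exact: ler0n|rewrite ler1n].
  - apply: (@le_trans _ _ (cb R)); last by rewrite /cb lerD2r ler1n.
    by rewrite /ka -[X in X <= _]mul1r ler_pdivrMr// (vol_cb fd ds cS).
  - move=> S m Sh; have S0 : 0 < S by apply: lt_le_trans Sh; rewrite invr_gt0 ltr0Sn.
    apply: le_trans (orbN_bound ds dG cS S0 _) _.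
    rewrite mulrDl [200 ^+ 2 * _]mulrC lerD2r.
    by move: Sh; rewrite -[2^-1]mul1r; clear; nra.
have CC0 : 0 < CC := lt_le_trans ltr01 CC1.
have [B4 [B20 [rm [B40 B200 rm0 [rm1 hthin0]]]]] : exists B4 B20 rm : R,
    [/\ 0 < B4, 0 < B20, 0 < rm & rm <= 1 /\ forall r al y n, 0 < r -> r <= rm -> 0 < y -> y <= 1 ->
    cnt R [set i | (i < n)%N /\ thin G r (geo (al + i%:R * y) y)] <=
      B4 * Num.sqrt (r / y) + B20 * (n%:R * r)].
  exists (4 * 1000), (20 * 1000), 1000^-1; split; last first.
    split; last by move=> r al y n r0 r1 y0 y1; exact: thin_count.
    by rewrite (invf_le1 (ltr0Sn _ _)) ler1n.
  - by rewrite invr_gt0 ltr0Sn.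
  - by apply: mulr_gt0; exact: ltr0Sn.
  - by apply: mulr_gt0; exact: ltr0Sn.
pose e1 := Num.min (e / 8) 1.
have e10 : 0 < e1 by rewrite lt_min ltr01 andbT divr_gt0// ltr0Sn.
have e18 : 8 * e1 <= e by rewrite mulrC -ler_pdivlMr ?ltr0Sn// ge_min lexx.
have e11 : e1 <= 1 by rewrite ge_min lexx orbT.
(* A thin cell counts for at most [CC S^2], and about [B20 n r] cells are thin; this choice keeps
   their total below [e1 n S^2]. *)
pose r := Num.min rm (e1 / (B20 * CC)).
have r0 : 0 < r by rewrite lt_min rm0 divr_gt0// mulr_gt0.
have r1 : r <= rm by rewrite ge_min lexx.
have rC : B20 * CC * r <= e1 by rewrite mulrC -ler_pdivlMr ?mulr_gt0// ge_min lexx orbT.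
have rle1 : r <= 1 := le_trans r1 rm1.
have [S1 S1h hS1] := thick_upper fd ds cS r0 e10.
have [S2 S2h hS2] := thick_lower fd ds cS r0 e10.
have half0 : 0 < 2^-1 :> R by rewrite invr_gt0 ltr0Sn.
have S10 := lt_le_trans half0 S1h; have S20 := lt_le_trans half0 S2h.
(* The first summand pays for the incomplete cell at the end, the second for the square root term of
   [thin_count]. [Q0] exceeds both levels, so that cells have width at most 1. *)
pose W := (S1 ^+ 2 + S2 ^+ 2) * (CC + 2) / e1 + B4 * CC * (S1 + S2) / e1 + 1.
pose Q0 := S1 + S2 + 1.
have X0 : 0 <= (S1 ^+ 2 + S2 ^+ 2) * (CC + 2).
  by apply: mulr_ge0; [apply: addr_ge0; exact: sqr_ge0|move: CC0; clear; lra].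
have Y0 : 0 <= B4 * CC * (S1 + S2).
  by apply: mulr_ge0; [apply: mulr_ge0; exact: ltW|apply: addr_ge0; exact: ltW].
have eW : e1 * W = (S1 ^+ 2 + S2 ^+ 2) * (CC + 2) + B4 * CC * (S1 + S2) + e1.
  by rewrite /W; field; rewrite gt_eqF.
have W0 : 0 < W.
  rewrite -(pmulr_rgt0 _ e10) eW; move: X0 Y0 e10; clear.
  set X := _ * (CC + 2); set Y := B4 * CC * _; lra.
have hW1 : (S1 ^+ 2 + S2 ^+ 2) * (CC + 2) <= e1 * W.
  by rewrite eW; move: Y0 e10; set Y := B4 * CC * _; clear; lra.
have hW2 : B4 * CC * (S1 + S2) <= e1 * W.
  by rewrite eW; move: X0 e10; set X := _ * (CC + 2); clear; lra.
have Q00 : 0 < Q0 by rewrite /Q0; move: S10 S20; clear; lra.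
exists W, Q0; split=> // Q al be QQ0 hL; set L := be - al in hL *.
have Qp := lt_le_trans Q00 QQ0.
have L0 : 0 < L by apply: lt_le_trans hL; rewrite divr_gt0.
have WLQ : W <= L * Q by rewrite -ler_pdivrMr.
have Q1 : 1 <= Q by apply: le_trans QQ0; rewrite /Q0; move: S10 S20; clear; lra.
have beE : be = al + L by rewrite /L addrC subrK.
pose LQ := L * Q ^+ 2.
have LQ0 : 0 < LQ by rewrite mulr_gt0// exprn_gt0.
have WQ : W * Q <= LQ by rewrite /LQ expr2 mulrA ler_pM2r.
have WLQ' : W <= LQ by apply: le_trans WQ; rewrite ler_peMr// ltW.
have common S : 0 < S -> 2^-1 <= S -> S ^+ 2 <= S1 ^+ 2 + S2 ^+ 2 -> S <= S1 + S2 ->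
  let y := S ^+ 2 / Q ^+ 2 in
  [/\ 0 < y, y <= 1, S ^+ 2 * (CC + 2) <= e1 * LQ &
      forall n : nat, S ^+ 2 * cnt R [set i | (i < n)%N /\ thin G r (geo (al + i%:R * y) y)] * CC <=
        e1 * LQ + e1 * (n%:R * S ^+ 2)].
  move=> S0 Sh hS hS' y; have S20' : 0 < S ^+ 2 by rewrite exprn_gt0.
  have y0 : 0 < y by rewrite divr_gt0 ?exprn_gt0.
  have SQ : S <= Q by apply: le_trans QQ0; rewrite /Q0; move: hS'; clear; lra.
  have y1 : y <= 1.
    by rewrite ler_pdivrMr ?exprn_gt0// mul1r ler_pXn2r ?nnegrE ?(ltW S0) ?(ltW Qp).
  split=> //.
    apply: (@le_trans _ _ (e1 * W)); last by rewrite ler_pM2l.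
    apply: le_trans hW1; apply: ler_wpM2r => //; move: CC0; clear; lra.
  move=> n; have := hthin0 r al y n r0 r1 y0 y1.
  set c := cnt R _ => hc.
  have c0 : 0 <= c by exact: cnt_ge0.
  have hr : Num.sqrt (r / y) <= Q / S.
    have -> : Q / S = Num.sqrt ((Q / S) ^+ 2) by rewrite sqrtr_sqr gtr0_norm// divr_gt0.
    rewrite ler_sqrt ?sqr_ge0// /y invf_div expr_div_n -[leRHS]mul1r ler_pM2r//.
    by rewrite divr_gt0 ?exprn_gt0.
  apply: (@le_trans _ _ (S ^+ 2 * (B4 * (Q / S) + B20 * (n%:R * r)) * CC)).
    rewrite ler_pM2r// ler_pM2l//; apply: le_trans hc _; rewrite lerD2r ler_pM2l//.
  have -> : S ^+ 2 * (B4 * (Q / S) + B20 * (n%:R * r)) * CC =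
     B4 * CC * S * Q + (B20 * CC * r) * (n%:R * S ^+ 2) by field; rewrite gt_eqF.
  apply: lerD; last by rewrite ler_wpM2r// mulr_ge0// ltW.
  apply: (@le_trans _ _ (e1 * (W * Q))); last by rewrite ler_pM2l.
  rewrite mulrA ler_pM2r//; apply: le_trans hW2.
  by apply: ler_wpM2l => //; apply: mulr_ge0; exact: ltW.
have s12 : S1 ^+ 2 <= S1 ^+ 2 + S2 ^+ 2 by rewrite lerDl sqr_ge0.
have s22 : S2 ^+ 2 <= S1 ^+ 2 + S2 ^+ 2 by rewrite lerDr sqr_ge0.
have s1 : S1 <= S1 + S2 by rewrite lerDl ltW.
have s2 : S2 <= S1 + S2 by rewrite lerDr ltW.
rewrite -!mulrA -/LQ ler_norml; apply/andP; split.
  have [y0 y1 hy hthin] := common S2 S20 S2h s22 s2.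
  set y := S2 ^+ 2 / Q ^+ 2 in y0 y1 hthin.
  have yQ : S2 ^+ 2 = y * Q ^+ 2 by rewrite /y mulfVK// gt_eqF// exprn_gt0.
  (* Rounded down for the lower bound: the cells stay inside the interval, and thin ones are
     estimated from below by 0. *)
  pose n := Num.truncn (L / y).
  have /andP[n1 n2] : n%:R <= L / y < n.+1%:R.
    by apply: truncn_itv; rewrite ltW// divr_gt0.
  have n1' : n%:R * y <= L by rewrite -ler_pdivlMr.
  have n2' : L <= n%:R * y + y by move: (ltW n2); rewrite ler_pdivrMr// -addn1 natrD mulrDl mul1r.
  have nS : n%:R * S2 ^+ 2 <= LQ by rewrite yQ mulrA ler_wpM2r ?sqr_ge0.
  have nS' : LQ <= n%:R * S2 ^+ 2 + S2 ^+ 2.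
    by rewrite yQ mulrA -mulrDl ler_wpM2r ?sqr_ge0.
  have le1 : \sum_(i < n) orbN G s S2 (geo (al + i%:R * y) y) <= cnt R (sector G s one4 Q al be).
    rewrite -sector_cells// -/y; apply: sector_le => //; rewrite ?det41//.
      by rewrite beE lerD2l.
    by rewrite beE lerDl ltW.
  have le2 : \sum_(i < n) ((ka - e1) * S2 ^+ 2 - ka * S2 ^+ 2 * `[< thin G r (geo (al + i%:R * y) y) >]%:R)
      <= \sum_(i < n) orbN G s S2 (geo (al + i%:R * y) y).
    apply: ler_sum => i _; case: (asboolP (thin _ _ _)) => ht.
      rewrite mulr1; apply: le_trans (orbN_ge0 _ _ _ _).
      by rewrite mulrBl addrAC subrr add0r oppr_le0 mulr_ge0 ?sqr_ge0// ltW.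
    by rewrite mulr0 subr0; apply: hS2 => //; exact: det4_geo.
  have := le_trans le2 le1; rewrite sumrB sumr_const card_ord -mulr_sumr -(cnt_sum n (fun i => thin G r (geo (al + i%:R * y) y))).
  rewrite -[_ *+ n]mulr_natl; move: (hthin n); set c := cnt R [set i | _]; set X := cnt R _.
  have c0 : 0 <= c by exact: cnt_ge0.
  have kc : ka * S2 ^+ 2 * c <= S2 ^+ 2 * c * CC.
    by rewrite -mulrA mulrC ler_wpM2l// mulr_ge0 ?sqr_ge0.
  move: nS nS' hy kc e18 e10 ka0 kaC e11 LQ0; clear.
  have -> : n%:R * ((ka - e1) * S2 ^+ 2) = (ka - e1) * (n%:R * S2 ^+ 2) by ring.
  set p := n%:R * S2 ^+ 2; set t := S2 ^+ 2; move=> h1 h2 h3 h4 h5 h6 h7 h8 h9 h10 h11 h12.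
  have tk : ka * t <= e1 * LQ.
    apply: le_trans h3; rewrite mulrC ler_wpM2l ?sqr_ge0//; move: h8; clear; lra.
  have pk : ka * LQ <= ka * p + ka * t by rewrite -mulrDr ler_pM2l.
  have ep : e1 * p <= e1 * LQ by rewrite ler_pM2l.
  have eL : 8 * (e1 * LQ) <= e * LQ by rewrite mulrA ler_pM2r.
  have eL0 : 0 <= e1 * LQ by rewrite mulr_ge0// ltW.
  by move: h12 h11 h4 tk pk ep eL eL0; rewrite mulrBl; clear; lra.
have [y0 y1 hy hthin] := common S1 S10 S1h s12 s1.
set y := S1 ^+ 2 / Q ^+ 2 in y0 y1 hthin.
have yQ : S1 ^+ 2 = y * Q ^+ 2 by rewrite /y mulfVK// gt_eqF// exprn_gt0.
(* Rounded up for the upper bound: the cells cover the interval, and thin ones are estimated by the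
   crude bound [CC S1^2]. *)
pose n := (Num.truncn (L / y)).+1.
have /andP[n1 n2] : (Num.truncn (L / y))%:R <= L / y < n%:R.
  by apply: truncn_itv; rewrite ltW// divr_gt0.
have n2' : L <= n%:R * y by rewrite -ler_pdivrMr// ltW.
have n1' : n%:R * y <= L + y by rewrite /n -addn1 natrD mulrDl mul1r lerD2r -ler_pdivlMr.
have nS : n%:R * S1 ^+ 2 <= LQ + S1 ^+ 2.
  by rewrite yQ mulrA -mulrDl ler_wpM2r ?sqr_ge0.
have le1 : cnt R (sector G s one4 Q al be) <= \sum_(i < n) orbN G s S1 (geo (al + i%:R * y) y).
  rewrite -sector_cells// -/y; apply: sector_le => //; rewrite ?det41//.
    by rewrite beE lerD2l.
  by rewrite lerDl mulr_ge0// ltW.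
have le2 : \sum_(i < n) orbN G s S1 (geo (al + i%:R * y) y) <=
    \sum_(i < n) ((ka + e1) * S1 ^+ 2 + CC * S1 ^+ 2 * `[< thin G r (geo (al + i%:R * y) y) >]%:R).
  apply: ler_sum => i _; case: (asboolP (thin _ _ _)) => ht.
    rewrite mulr1; apply: le_trans (hCC _ _ S1h) _.
    by rewrite lerDr mulr_ge0 ?sqr_ge0// addr_ge0// ltW.
  by rewrite mulr0 addr0; apply: hS1 => //; exact: det4_geo.
have := le_trans le1 le2; rewrite big_split /= sumr_const card_ord -mulr_sumr -(cnt_sum n (fun i => thin G r (geo (al + i%:R * y) y))).
rewrite -[_ *+ n]mulr_natl; move: (hthin n); set c := cnt R [set i | _]; set X := cnt R _.
move: nS hy e18 e10 ka0 kaC e11 LQ0; clear.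
have -> : n%:R * ((ka + e1) * S1 ^+ 2) = (ka + e1) * (n%:R * S1 ^+ 2) by ring.
have -> : CC * S1 ^+ 2 * c = S1 ^+ 2 * c * CC by ring.
set p := n%:R * S1 ^+ 2; set t := S1 ^+ 2; move=> h1 h3 h5 h6 h7 h8 h9 h10 h11 h12.
have tk : (ka + 2 * e1) * t <= e1 * LQ.
  apply: le_trans h3; rewrite mulrC ler_wpM2l ?sqr_ge0//; move: h8 h9; clear; lra.
have pk : (ka + 2 * e1) * p <= (ka + 2 * e1) * LQ + (ka + 2 * e1) * t.
  by rewrite -mulrDr ler_wpM2l//; move: h6 h7; clear; lra.
have eL : 8 * (e1 * LQ) <= e * LQ by rewrite mulrA ler_pM2r.
have eL0 : 0 <= e1 * LQ by rewrite mulr_ge0// ltW.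
by move: h12 h11 tk pk eL eL0; clear; lra.
Qed.

End CountAsymptotics.

(** * Oscillatory sums *)

Section BoundedMeasurable.
Variable R : realType.
Local Notation RM := (measurableTypeR R).
Local Notation leb := (@lebesgue_measure R).
Implicit Types (f g : R -> R) (p q r c x : R).

Definition bmf f := measurable_fun setT (f : RM -> RM) /\ exists c, forall x, `|f x| <= c.

(** Unoriented: it vanishes for [q < p], so additivity needs ordered end points. *)
Definition II f p q : R := \int[leb]_(x in `[p, q]%classic) f x.

Lemma bmf_cst c : bmf (fun=> c).
Proof. by split; [exact: measurable_cst|exists `|c|]. Qed.
Lemma bmfD f g : bmf f -> bmf g -> bmf (fun x => f x + g x).
Proof.
move=> [mf [c hc]] [mg [d hd]]; split; first exact: measurable_funD.
by exists (c + d) => x; rewrite (le_trans (ler_normD _ _))// lerD.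
Qed.
Lemma bmfM f g : bmf f -> bmf g -> bmf (fun x => f x * g x).
Proof.
move=> [mf [c hc]] [mg [d hd]]; split; first exact: measurable_funM.
by exists (c * d) => x; rewrite normrM ler_pM.
Qed.
Lemma bmfZ c f : bmf f -> bmf (fun x => c * f x).
Proof. exact: bmfM (bmf_cst c). Qed.
Lemma bmfB f g : bmf f -> bmf g -> bmf (fun x => f x - g x).
Proof.
move=> bf bg; have := bmfD bf (bmfZ (-1) bg).
by congr bmf; apply/funext => x; rewrite mulN1r.
Qed.
Lemma bmf_norm f : bmf f -> bmf (fun x => `|f x|).
Proof.
move=> [mf [c hc]]; split; first exact: measurableT_comp.
by exists c => x; rewrite normr_id.
Qed.
Lemma bmf_sum (T : eqType) (s : seq T) (f : T -> R -> R) : (forall i, i \in s -> bmf (f i)) ->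
  bmf (fun x => \sum_(i <- s) f i x).
Proof.
elim: s => [|a s IH] h.
  by have := bmf_cst 0; congr bmf; apply/funext => x; rewrite big_nil.
have := bmfD (h a (mem_head _ _)) (IH (fun i hi => h i (mem_behead (s := a :: s) hi))).
by congr bmf; apply/funext => x; rewrite big_cons.
Qed.
Lemma bmf_affine al be f : bmf f -> bmf (fun x => f (al + be * x)).
Proof.
move=> [mf [c hc]]; split; last by exists c => x; exact: hc.
apply: (measurableT_comp mf).
by apply: measurable_funD; [exact: measurable_cst|apply: measurable_funM; [exact: measurable_cst|exact: measurable_id]].
Qed.
Lemma bmf_cont f c : continuous f -> (forall x, `|f x| <= c) -> bmf f.
Proof. by move=> cf fc; split; [exact: continuous_measurable_fun|exists c]. Qed.
Lemma bmf_indic (A : set RM) : measurable A -> bmf (\1_A).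
Proof.
move=> mA; split; first exact: measurable_indic.
by exists 1 => x; rewrite indicE; case: (_ \in _); rewrite ?normr1 ?normr0.
Qed.

Lemma leb_itv_lt p q : (leb (`[p, q]%classic : set RM) < +oo)%E.
Proof. by rewrite lebesgue_measure_itv/=; case: ifP => // _; rewrite -EFinB ltry. Qed.

Lemma bmf_int f p q : bmf f -> leb.-integrable (`[p, q]%classic : set RM) (EFin \o f).
Proof.
move=> [mf [c hc]]; apply: measurable_bounded_integrable.
- exact: measurable_itv.
- exact: leb_itv_lt.
- by apply: measurable_funS mf.
- by exists c; split; [exact: num_real|move=> M cM x _; exact: le_trans (hc x) (ltW cM)].
Qed.

Lemma IID f g p q : bmf f -> bmf g -> II (fun x => f x + g x) p q = II f p q + II g p q.
Proof. by move=> bf bg; apply: RintegralD; [exact: measurable_itv|exact: bmf_int..]. Qed.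
Lemma IIB f g p q : bmf f -> bmf g -> II (fun x => f x - g x) p q = II f p q - II g p q.
Proof. by move=> bf bg; apply: RintegralB; [exact: measurable_itv|exact: bmf_int..]. Qed.
Lemma IIZ c f p q : bmf f -> II (fun x => c * f x) p q = c * II f p q.
Proof. by move=> bf; apply: RintegralZl; [exact: measurable_itv|exact: bmf_int]. Qed.
Lemma II_cst c p q : p <= q -> II (fun=> c) p q = c * (q - p).
Proof.
move=> pq; rewrite /II Rintegral_cst; last exact: measurable_itv.
congr (_ * _); have := @lebesgue_measure_itv R `[p, q] => /= ->; rewrite lte_fin.
by move: pq; rewrite le_eqVlt => /orP[/eqP ->|->]; rewrite ?ltxx ?subrr// -EFinB.
Qed.
Lemma II_le f g p q : bmf f -> bmf g -> (forall x, p <= x <= q -> f x <= g x) -> II f p q <= II g p q.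
Proof.
move=> bf bg fg; apply: le_Rintegral; [exact: measurable_itv|exact: bmf_int..|].
by move=> x /=; rewrite in_itv /= => /fg.
Qed.
Lemma eq_II f g p q : (forall x, p <= x <= q -> f x = g x) -> II f p q = II g p q.
Proof. by move=> fg; apply: eq_Rintegral => x; rewrite inE /= in_itv /= => /fg. Qed.
Lemma II_norm f c p q : bmf f -> p <= q -> (forall x, p <= x <= q -> `|f x| <= c) ->
  `|II f p q| <= c * (q - p).
Proof.
move=> bf pq fc; apply: le_trans (le_normr_Rintegral _ (bmf_int _ _ bf)) _; first exact: measurable_itv.
rewrite -II_cst//; apply: (@II_le _ (fun=> c) p q (bmf_norm bf)) => //; exact: bmf_cst.
Qed.
Lemma II_normle f p q : bmf f -> `|II f p q| <= II (fun x => `|f x|) p q.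
Proof. by move=> bf; apply: (le_normr_Rintegral _ (bmf_int _ _ bf)); exact: measurable_itv. Qed.
Lemma II_ge0 f p q : (forall x, 0 <= f x) -> 0 <= II f p q.
Proof. by move=> f0; apply: Rintegral_ge0 => x _. Qed.
Lemma II_pp f p : II f p p = 0.
Proof. by rewrite /II set_itv1 Rintegral_set1. Qed.
Lemma II_cat f p r q : bmf f -> p <= r -> r <= q -> II f p q = II f p r + II f r q.
Proof.
move=> bf pr rq.
have := @Rintegral_itvB R f (BLeft p) (BRight q) r (bmf_int p q bf).
rewrite !bnd_simp => /(_ pr rq) h.
rewrite /II -(@Rintegral_itv_obnd_cbnd R r (BRight q)); last first.
  have h' := bmf_int r q bf; apply: integrableS h' => //; exact: subset_itv_oc_cc.
by rewrite -h addrC subrK.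
Qed.
Lemma II_sum (T : eqType) (s : seq T) (f : T -> R -> R) p q : (forall i, i \in s -> bmf (f i)) ->
  II (fun x => \sum_(i <- s) f i x) p q = \sum_(i <- s) II (f i) p q.
Proof.
elim: s => [|a s IH] h.
  rewrite big_nil; transitivity (II (fun x => 0 * 0) p q).
    by apply: eq_II => x _; rewrite big_nil mulr0.
  by rewrite (IIZ _ _ _ (bmf_cst 0)) mul0r.
have hs i : i \in s -> bmf (f i) by move=> hi; apply: h; rewrite in_cons hi orbT.
rewrite big_cons -IH// -(IID _ _ (h a (mem_head _ _)) (bmf_sum hs)).
by apply: eq_II => x _; rewrite big_cons.
Qed.

(** The affine change of variables is known for nonnegative integrands, so a bound of [f] is added
    and removed. The end points enter only through an equivalence, which serves both signs of
    [be]. *)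
Lemma II_affine0 al be f p q p' q' : bmf f -> be != 0 ->
  (forall x, (p <= x <= q) = (p' <= al + be * x <= q')) ->
  II (fun x => f (al + be * x)) p q = `|be|^-1 * II f p' q'.
Proof.
move=> bf b0 hpq; have [mf [c hc]] := bf.
have c0 : 0 <= c by apply: le_trans (hc 0).
suff H g : bmf g -> (forall x, 0 <= g x) ->
    II (fun x => g (al + be * x)) p q = `|be|^-1 * II g p' q'.
  have bc := bmf_cst c; have bfc := bmfD bf bc.
  have h1 : II (fun x => f (al + be * x) + c) p q = `|be|^-1 * II (fun x => f x + c) p' q'.
    by apply: H => // x; have := hc x; rewrite ler_norml => /andP[h _]; move: h; clear; lra.
  have h2 : II (fun=> c) p q = `|be|^-1 * II (fun=> c) p' q' by exact: (H (fun=> c)).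
  by move: h1; rewrite (IID _ _ (bmf_affine al be bf) bc) (IID _ _ bf bc) mulrDr h2; apply: addIr.
move=> bg g0; have [mg _] := bg.
pose k (x : R) : \bar R := (\1_(`[p', q']%classic : set RM) x * g x)%:E.
have mk : measurable_fun setT (k : RM -> \bar R).
  by apply/measurable_EFinP; apply: measurable_funM => //; exact: measurable_indic.
have k0 x : (0 <= k x)%E by rewrite lee_fin mulr_ge0.
have := @integral_affine R be al k b0 mk k0.
have kE (f' : R -> R) (u v : R) : (\int[leb]_x (\1_(`[u, v]%classic : set RM) x * f' x)%:E = \int[leb]_(x in `[u, v]%classic) (f' x)%:E)%E.
  rewrite [RHS]integral_mkcond; apply: eq_integral => x _; rewrite patchE indicE.
  by case: ifP => _; rewrite ?mul1r ?mul0r.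
rewrite kE => h; rewrite /II /Rintegral.
rewrite -(kE (fun x => g (al + be * x))).
rewrite (_ : (\int[leb]_x _ = \int[leb]_x k (be * x + al)%R)%E); last first.
  apply: eq_integral => x _; rewrite /k [be * x + al]addrC !indicE; congr ((_ * _)%:E).
  congr (_%:R); congr nat_of_bool.
  by apply/idP/idP; rewrite !inE /= !in_itv /= hpq.
rewrite h fineM//; exact: integrable_fin_num (bmf_int p' q' bg).
Qed.

Lemma II_affine al be f p q : bmf f -> 0 < be ->
  II (fun x => f (al + be * x)) p q = be^-1 * II f (al + be * p) (al + be * q).
Proof.
move=> bf b0; rewrite -{2}(gtr0_norm b0); apply: II_affine0 => //; first by rewrite gt_eqF.
by move=> x; rewrite !lerD2l !ler_pM2l.
Qed.

Lemma II_affineN al be f p q : bmf f -> be < 0 ->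
  II (fun x => f (al + be * x)) p q = `|be|^-1 * II f (al + be * q) (al + be * p).
Proof.
move=> bf b0; apply: II_affine0 => //; first by rewrite lt_eqF.
by move=> x; rewrite !lerD2l !ler_nM2l// andbC.
Qed.

Lemma II_cells f p w e (N : nat) : bmf f -> 0 <= w ->
  (forall i, (i < N)%N -> `|II f (p + i%:R * w) (p + i%:R * w + w)| <= e) ->
  `|II f p (p + N%:R * w)| <= N%:R * e.
Proof.
move=> bf w0; elim: N => [|N IH] h.
  by rewrite !mul0r addr0 II_pp normr0.
have -> : p + N.+1%:R * w = p + N%:R * w + w by rewrite -addn1 natrD; ring.
rewrite (@II_cat f p (p + N%:R * w))//; [|by rewrite lerDl mulr_ge0|by rewrite lerDl].
apply: le_trans (ler_normD _ _) _; rewrite -addn1 natrD mulrDl mul1r lerD//.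
  by apply: IH => i iN; apply: h; exact: ltnW.
exact: h.
Qed.

(** Whole periods cancel and less than one period remains. *)
Lemma II_period f (M p q : R) : bmf f -> (forall x, f (x + 1) = f x) -> (forall x, `|f x| <= M) ->
  II f 0 1 = 0 -> p <= q -> `|II f p q| <= M.
Proof.
move=> bf per fM f01 pq.
have sh (n : nat) u v : II f (u + n%:R) (v + n%:R) = II f u v.
  elim: n => [|n IH]; first by rewrite !addr0.
  rewrite -IH; have := II_affine 1 (u + n%:R) (v + n%:R) bf ltr01.
  have e (z : R) : 1 + 1 * (z + n%:R) = z + n.+1%:R by rewrite -natr1; ring.
  rewrite !e invr1 mul1r => <-.
  by apply: eq_II => x _; rewrite mul1r addrC per.
have per1 u : II f u (u + 1) = 0.
  have h v : 0 <= v -> II f v (v + 1) = 0.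
    move=> v0; pose k := Num.truncn v.
    have /andP[k1 k2] := truncn_itv v0; rewrite -/k in k1 k2; rewrite -natr1 in k2.
    have e1 : II f k%:R (k%:R + 1) = 0 by rewrite -f01 -(sh k 0 1) add0r addrC.
    rewrite (@II_cat _ v (k%:R + 1))//; last 2 first.
    - exact: ltW.
    - by rewrite lerD2r.
    have -> : II f (k%:R + 1) (v + 1) = II f k%:R v by have := sh 1%N k%:R v.
    by rewrite addrC -e1 -II_cat//; exact: ltW.
  pose n := (Num.truncn `|u|).+1.
  have := h (u + n%:R); rewrite addrAC sh; apply.
  have := ltW (truncnS_gt `|u|); rewrite -/n => h1.
  by have := ler_norm (- u); rewrite normrN => h2; move: h1 h2; clear; lra.
have pern (n : nat) u : II f u (u + n%:R) = 0.
  elim: n => [|n IH]; first by rewrite addr0 II_pp.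
  rewrite -natr1 addrA (@II_cat _ u (u + n%:R))// ?lerDl//.
  by rewrite IH per1 addr0.
have d0 : 0 <= q - p by rewrite subr_ge0.
pose n := Num.truncn (q - p); have /andP[n1 n2] := truncn_itv d0; rewrite -/n -natr1 in n1 n2.
rewrite (@II_cat _ p (p + n%:R))// ?lerDl//; last by move: n1; clear; lra.
have pq' : p + n%:R <= q by move: n1; clear; lra.
rewrite pern add0r; apply: le_trans (II_norm bf pq' (fun x _ => fM x)) _.
have M0 : 0 <= M := le_trans (normr_ge0 _) (fM 0).
by rewrite ler_piMr//; move: n2; clear; lra.
Qed.

End BoundedMeasurable.

(** * Fast periodic phases along the curve [t / (1 + t^2)] *)

Section Oscillation.
Variable R : realType.
Implicit Types (p q t u x y : R).

(** The real part of a translate along the horocycle, in the rescaled variable [t], is a constant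
    minus [sfun t / (c^2 y)]. *)
Definition sfun t : R := t / (1 + t ^+ 2).

Lemma oneDsqr_gt0 t : 0 < 1 + t ^+ 2.
Proof. by rewrite ltr_pwDl// sqr_ge0. Qed.

Lemma oneDsqr_ge0 t : 0 <= 1 + t ^+ 2.
Proof. exact: ltW (oneDsqr_gt0 t). Qed.

Lemma sqr_le_pos (u v : R) : 0 < u -> 0 < v -> u ^+ 2 <= v ^+ 2 -> u <= v.
Proof. by move=> /ltW u0 /ltW v0; rewrite ler_pXn2r ?nnegrE. Qed.

(** Second order Taylor estimate, from an exact formula for the remainder. *)
Lemma sfun_lin (Lm t u : R) : `|t| <= Lm -> `|u| <= Lm -> 
  `|sfun u - sfun t - (1 - t ^+ 2) / (1 + t ^+ 2) ^+ 2 * (u - t)| <= (Lm * (Lm ^+ 2 + 1) + 2 * Lm) * (u - t) ^+ 2.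
Proof.
move=> ht hu; have t1 := oneDsqr_gt0 t; have u1 := oneDsqr_gt0 u.
have L0 : 0 <= Lm := le_trans (normr_ge0 _) ht.
have -> : sfun u - sfun t - (1 - t ^+ 2) / (1 + t ^+ 2) ^+ 2 * (u - t) =
   (u - t) ^+ 2 * (u * (t ^+ 2 - 1) - 2 * t) / ((1 + u ^+ 2) * (1 + t ^+ 2) ^+ 2).
  by rewrite /sfun; field; rewrite !gt_eqF.
have d1 : 1 <= (1 + u ^+ 2) * (1 + t ^+ 2) ^+ 2.
  by apply: mulr_ege1; [|apply: exprn_ege1]; rewrite lerDl sqr_ge0.
have d0 : 0 < (1 + u ^+ 2) * (1 + t ^+ 2) ^+ 2 by apply: lt_le_trans d1.
rewrite normrM normfV (gtr0_norm d0) ler_pdivrMr// normrM ger0_norm ?sqr_ge0//.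
have h1 : `|u * (t ^+ 2 - 1) - 2 * t| <= Lm * (Lm ^+ 2 + 1) + 2 * Lm.
  apply: le_trans (ler_normB _ _) _; rewrite !normrM [ `|2|]gtr0_norm//; apply: lerD.
    apply: ler_pM => //; apply: le_trans (ler_normB _ _) _; rewrite normr1 lerD2r normrX.
    by rewrite ler_pXn2r ?nnegrE.
  by rewrite ler_pM2l.
rewrite mulrC; apply: (@le_trans _ _ ((Lm * (Lm ^+ 2 + 1) + 2 * Lm) * (u - t) ^+ 2)).
  by apply: ler_wpM2r => //; exact: sqr_ge0.
by rewrite ler_peMr// mulr_ge0 ?sqr_ge0// (le_trans _ h1).
Qed.

Definition uc (g : R -> R -> R) := forall e : R, 0 < e -> exists2 d : R, 0 < d &
  forall x x' t t', `|x - x'| <= d -> `|t - t'| <= d -> `|g x t - g x' t'| <= e.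

Record oscd (g : R -> R -> R) (M : R) (Th : R -> R) : Prop := OscD {
  gM : forall x t, `|g x t| <= M;
  gper : forall x t, g (x + 1) t = g x t;
  gmean : forall t, II (fun x => g x t) 0 1 = 0;
  guc : uc g;
  gm1 : forall t, bmf (fun x => g x t);
  gm2 : forall A Y, bmf (fun t => g (A - Y * sfun t) (Th t));
  Thuc : forall d : R, 0 < d -> exists2 r : R, 0 < r & forall t t', `|t - t'| <= r -> `|Th t - Th t'| <= d }.

(* On short cells the phase is almost linear, and a mean zero periodic function has
   bounded integrals over arbitrary intervals. *)
Lemma osc_good g (M : R) Th (Lm be e : R) : oscd g M Th -> 0 < Lm -> 0 < be -> 0 < e ->
  exists2 Y0 : R, 0 < Y0 & forall Y A p q : R, Y0 <= Y -> - Lm <= p -> p <= q -> q <= Lm ->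
  (forall t, p <= t <= q -> be <= `|1 - t ^+ 2|) ->
  `|II (fun t => g (A - Y * sfun t) (Th t)) p q| <= e.
Proof.
move=> [gM gper gmean guc gm1 gm2 Thuc] L0 be0 e0.
have M0 : 0 <= M := le_trans (normr_ge0 _) (gM 0 0).
pose e1 := e / (4 * Lm).
have e10 : 0 < e1 by rewrite divr_gt0// mulr_gt0.
have [d d0 hd] := guc _ e10.
have [r r0 hr] := Thuc _ d0.
pose k0 := be / (1 + Lm ^+ 2) ^+ 2.
have k00 : 0 < k0 by rewrite divr_gt0// exprn_gt0// oneDsqr_gt0.
pose CL := Lm * (Lm ^+ 2 + 1) + 2 * Lm.
have CL0 : 0 < CL.
  by rewrite addr_gt0 ?mulr_gt0// ltr_wpDl// sqr_ge0.
(* bounds ensuring tau <= r and N M / (Y k0) <= e/2 *)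
pose m := k0 * e / (8 * (M + 1) * (Lm + 1)).
have M1 : 0 < M + 1 by rewrite ltr_wpDl.
have L1 : 0 < Lm + 1 by rewrite ltr_wpDl// ltW.
have m0 : 0 < m := divr_gt0 (mulr_gt0 k00 e0) (mulr_gt0 (mulr_gt0 (ltr0Sn _ _) M1) L1).
have mE : m = k0 * e / (8 * (M + 1) * (Lm + 1)) by [].
have e1E : e1 = e / (4 * Lm) by [].
have k0E : k0 = be / (1 + Lm ^+ 2) ^+ 2 by [].
have CLE : CL = Lm * (Lm ^+ 2 + 1) + 2 * Lm by [].
clearbody m; clearbody k0 CL e1.
exists (d / (CL * r ^+ 2) + CL / (d * m ^+ 2) + m^-1).
  by rewrite !addr_gt0 ?divr_gt0 ?mulr_gt0 ?invr_gt0 ?exprn_gt0.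
move=> Y A p q hY hp pq hq good.
have a0 : 0 < d / (CL * r ^+ 2) by rewrite divr_gt0 ?mulr_gt0 ?exprn_gt0.
have b0 : 0 < CL / (d * m ^+ 2) by rewrite divr_gt0 ?mulr_gt0 ?exprn_gt0.
have c0 : 0 < m^-1 by rewrite invr_gt0.
have hY1 : d / (CL * r ^+ 2) <= Y by move: hY a0 b0 c0; clear; lra.
have hY2 : CL / (d * m ^+ 2) <= Y by move: hY a0 b0 c0; clear; lra.
have hY3 : m^-1 <= Y by move: hY a0 b0 c0; clear; lra.
have Y0 : 0 < Y by apply: lt_le_trans hY3.
(* Cells of width [tau] deviate from a linear phase by at most [Y CL tau^2 = d], the modulus of
   continuity at hand. Still [Y tau] grows like the square root of [Y], so about [2 Lm / tau] cells
   costing [M / (Y k0)] each are negligible together. *)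
pose tau := Num.sqrt (d / (Y * CL)).
have tau0 : 0 < tau by rewrite sqrtr_gt0 divr_gt0// mulr_gt0.
have tau2 : Y * CL * tau ^+ 2 = d.
  by rewrite sqr_sqrtr ?ltW ?divr_gt0 ?mulr_gt0// mulrC mulfVK// gt_eqF// mulr_gt0.
have taur : tau <= r.
  apply: sqr_le_pos => //.
  by rewrite -(ler_pM2l (mulr_gt0 Y0 CL0)) tau2 -mulrA -ler_pdivrMr ?mulr_gt0 ?exprn_gt0.
have Ytau : m^-1 <= Y * tau.
  apply: sqr_le_pos; [exact: c0|exact: mulr_gt0|].
  have -> : (Y * tau) ^+ 2 = Y * (d / CL) by rewrite -tau2; field; rewrite gt_eqF.
  rewrite -ler_pdivrMr ?divr_gt0//; apply: le_trans hY2.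
  by rewrite le_eqVlt; apply/orP; left; apply/eqP; field; rewrite !gt_eqF.
pose N := (Num.truncn ((q - p) / tau)).+1.
have N0 : 0 < N%:R :> R by rewrite ltr0n.
pose w := (q - p) / N%:R.
have w0 : 0 <= w by rewrite divr_ge0// subr_ge0.
have wt : w <= tau.
  by rewrite ler_pdivrMr// mulrC -ler_pdivrMr// ltW// truncnS_gt.
have Nle : N%:R <= 2 * Lm / tau + 1.
  rewrite /N -natr1 lerD2r; apply: (@le_trans _ _ ((q - p) / tau)).
    by rewrite truncn_le// divr_ge0// ?subr_ge0// ltW.
  by rewrite ler_pM2r ?invr_gt0//; move: hp hq; clear; lra.
pose f := fun t => g (A - Y * sfun t) (Th t).
have bf : bmf f by exact: gm2.
have qE : q = p + N%:R * w by rewrite /w mulrC mulfVK ?gt_eqF// addrC subrK.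
rewrite -/f {1}qE; apply: (@le_trans _ _ (N%:R * (e1 * w + M / (Y * k0)))).
  apply: II_cells => // i iN; set p' := p + i%:R * w.
  have pp' : p <= p' by rewrite lerDl mulr_ge0.
  have q'q : p' + w <= q.
    rewrite qE /p' -addrA lerD2l -[X in _ + X]mul1r -mulrDl ler_wpM2r//.
    by rewrite natr1 ler_nat.
  pose sg := (1 - p' ^+ 2) / (1 + p' ^+ 2) ^+ 2.
  have pL : `|p'| <= Lm.
    by rewrite ler_norml; apply/andP; move: hp pp' q'q hq w0; clear; split; lra.
  have sg0 : k0 <= `|sg|.
    have gp : be <= `|1 - p' ^+ 2| by apply: good; rewrite pp' /=; move: q'q w0; clear; lra.
    have p2 : 0 < (1 + p' ^+ 2) ^+ 2 by apply: exprn_gt0; exact: oneDsqr_gt0.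
    have L2 : 0 < (1 + Lm ^+ 2) ^+ 2 by apply: exprn_gt0; exact: oneDsqr_gt0.
    rewrite /sg k0E normrM normfV (gtr0_norm p2); apply: ler_pM => //; first exact: ltW.
      by rewrite invr_ge0 ltW.
    rewrite lef_pV2 ?posrE// ler_pXn2r ?nnegrE ?oneDsqr_ge0//.
    by rewrite lerD2l -[p' ^+ 2]real_normK ?num_real// ler_pXn2r ?nnegrE// ltW.
  have sgn : sg != 0 by rewrite -normr_gt0; exact: lt_le_trans sg0.
  (* The tangent line of the phase at the left end of the cell; [G] below also freezes the angle
     there. *)
  pose al := A - Y * sfun p' + Y * sg * p'; pose b := - (Y * sg).
  have bn : b != 0 by rewrite oppr_eq0 mulf_neq0// gt_eqF.
  pose G := fun t => g (al + b * t) (Th p').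
  have bG : bmf G by exact: (bmf_affine al b (gm1 (Th p'))).
  have w1 : p' <= p' + w by rewrite lerDl.
  have -> : II f p' (p' + w) = II (fun t => f t - G t) p' (p' + w) + II G p' (p' + w).
    by rewrite (IIB _ _ bf bG) subrK.
  apply: le_trans (ler_normD _ _) _; apply: lerD.
    have := II_norm (bmfB bf bG) w1; rewrite (_ : p' + w - p' = w); last by ring.
    apply => t /andP[t1 t2]; apply: hd; last first.
      apply: hr; apply: le_trans taur; apply: le_trans wt.
      by rewrite ger0_norm; move: t1 t2; clear; lra.
    have tL : `|t| <= Lm.
      by rewrite ler_norml; apply/andP; move: hp pp' q'q hq t1 t2; clear; split; lra.
    have -> : A - Y * sfun t - (al + b * t) = - Y * (sfun t - sfun p' - sg * (t - p')).
      by rewrite /al /b; ring.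
    rewrite normrM normrN (gtr0_norm Y0) -tau2 -mulrA ler_pM2l//.
    apply: le_trans (sfun_lin pL tL) _; rewrite -CLE ler_pM2l// -real_normK ?num_real//.
    rewrite ler_pXn2r ?nnegrE ?(ltW tau0)//; apply: le_trans wt.
    by rewrite ger0_norm; move: t1 t2; clear; lra.
  have YK : 0 < Y * k0 by rewrite mulr_gt0.
  have nb : Y * k0 <= `|b| by rewrite normrN normrM (gtr0_norm Y0) ler_pM2l.
  have ib : `|b|^-1 <= (Y * k0)^-1 by rewrite lef_pV2 ?posrE// normr_gt0.
  have [bp|bp|b0'] := ltgtP b 0; last by rewrite b0' eqxx in bn.
    rewrite /G (II_affineN al p' (p' + w) (gm1 (Th p')) bp) normrM normfV normr_id mulrC.
    apply: ler_pM => //; rewrite ?invr_ge0//.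
    by apply: (II_period (gm1 (Th p'))) => //; rewrite lerD2l ler_nM2l.
  rewrite /G (II_affine al p' (p' + w) (gm1 (Th p')) bp) normrM normfV mulrC.
  apply: ler_pM => //; rewrite ?invr_ge0//.
  by apply: (II_period (gm1 (Th p'))) => //; rewrite lerD2l ler_pM2l.
rewrite mulrDr mulrCA; have -> : N%:R * w = q - p by rewrite /w mulrC mulfVK// gt_eqF.
have h1 : e1 * (q - p) <= e / 2.
  apply: (@le_trans _ _ (e1 * (2 * Lm))); last by rewrite le_eqVlt; apply/orP; left; apply/eqP; rewrite e1E; field; rewrite gt_eqF.
  by rewrite ler_pM2l//; move: hp hq; clear; lra.
have h2 : N%:R * (M / (Y * k0)) <= e / 2.
  apply: (@le_trans _ _ ((2 * Lm / tau + 1) * ((M + 1) / (Y * k0)))).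
    apply: ler_pM => //.
      by apply: divr_ge0 => //; rewrite ltW// mulr_gt0.
    by rewrite ler_pM2r ?invr_gt0 ?mulr_gt0// lerDl.
  have i1 : (Y * tau)^-1 <= m by rewrite invf_ple ?posrE// mulr_gt0.
  have i2 : Y^-1 <= m by rewrite invf_ple ?posrE.
  have -> : (2 * Lm / tau + 1) * ((M + 1) / (Y * k0)) = (M + 1) / k0 * (2 * Lm * (Y * tau)^-1 + Y^-1).
    by field; rewrite !gt_eqF.
  apply: (@le_trans _ _ ((M + 1) / k0 * (2 * (Lm + 1) * m))).
    rewrite ler_pM2l ?divr_gt0//.
    have : Lm * (Y * tau)^-1 <= Lm * m by rewrite ler_pM2l.
    by rewrite -[2 * Lm / _]mulrA; move: i2 m0; clear; set z := Lm / _; move: (Y^-1) => i; set z' := Lm * m; have -> : 2 * (Lm + 1) * m = 2 * z' + 2 * m by [rewrite /z'; ring]; lra.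
  by rewrite mE le_eqVlt; apply/orP; right; rewrite (_ : _ * _ = e / 4); [move: e0; clear; lra|field; rewrite !gt_eqF].
by move: h1 h2; clear; set a := _ * (q - p); set b := _ * (M / _); lra.
Qed.

End Oscillation.

Section OscillationFull.
Variable R : realType.
Implicit Types (p q t u v x y : R).

(** The phase is stationary only at [t = 1] and [t = -1]. Neighbourhoods of radius [be] of these
    points cost at most [2 be M] each, and [osc_good] treats the three remaining pieces. *)
Lemma osc g (M : R) Th (Lm e : R) : oscd g M Th -> 0 < Lm -> 0 < e ->
  exists2 Y0 : R, 0 < Y0 & forall Y A p q : R, Y0 <= Y -> - Lm <= p -> p <= q -> q <= Lm ->
  `|II (fun t => g (A - Y * sfun t) (Th t)) p q| <= e.
Proof.
move=> od L0 e0; have M0 : 0 <= M := le_trans (normr_ge0 _) (gM od 0 0).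
have M1 : 0 < M + 1 by rewrite ltr_wpDl.
have [be [be0 be1 beM]] : exists be : R, [/\ 0 < be, be <= 1 & M * (2 * be) <= e / 8].
  exists (Num.min 1 (e / (16 * (M + 1)))); split.
  - by rewrite lt_min ltr01 divr_gt0// mulr_gt0.
  - by rewrite ge_min lexx.
  - apply: (@le_trans _ _ ((M + 1) * (2 * (e / (16 * (M + 1)))))).
      apply: ler_pM => //; first by rewrite mulr_ge0// le_min ler01 divr_ge0 ?ltW// mulr_gt0.
        by rewrite lerDl.
      by rewrite ler_pM2l// ge_min lexx orbT.
    by rewrite le_eqVlt; apply/orP; left; apply/eqP; field; rewrite gt_eqF.
pose K := Lm + 2.
have K0 : 0 < K by rewrite addr_gt0.
have e8 : 0 < e / 8 by rewrite divr_gt0.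
have [Y0 Y00 hY] := osc_good od K0 be0 e8.
exists Y0 => // Y A p q YY hp pq hq.
set f := fun t => _; have bf : bmf f := gm2 od A Y.
(* Clamping the fixed break points to [[p, q]] handles all relative positions at once. *)
pose cl x := if x < p then p else if q < x then q else x.
have clE x : cl x = if x < p then p else if q < x then q else x by [].
clearbody cl.
have clm u v : u <= v -> cl u <= cl v /\ cl v - cl u <= v - u.
  rewrite !clE => uv; move: pq uv; clear.
  by case: (ltP u p) => ?; case: (ltP v p) => ?; case: (ltP q u) => ?; case: (ltP q v) => ? ? ?; split; lra.
have bad u v : u <= v -> `|II f (cl u) (cl v)| <= M * (v - u).
  move=> uv; have [c1 c2] := clm u v uv.
  apply: le_trans (II_norm bf c1 (fun x _ => gM od _ _)) _.
  by rewrite ler_wpM2l.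
have good u v : u <= v -> - K <= u -> v <= K -> (forall t, u <= t <= v -> be <= `|1 - t ^+ 2|) ->
    `|II f (cl u) (cl v)| <= e / 8.
  move=> uv hu hv hg; have [c1 _] := clm u v uv.
  have [vp|pv] := ltP v p.
    by rewrite !clE vp (le_lt_trans uv vp) II_pp normr0 ltW.
  have [qu|uq] := ltP q u.
    have cq x : q < x -> cl x = q by move=> h; rewrite clE ltNge (le_trans pq (ltW h)) h.
    by rewrite (cq u qu) (cq v (lt_le_trans qu uv)) II_pp normr0 ltW.
  have cu : u <= cl u by rewrite clE; move: uq; clear; case: (ltP u p) => ?; case: (ltP q u) => ? ?; lra.
  have cv : cl v <= v by rewrite clE; move: pv; clear; case: (ltP v p) => ?; case: (ltP q v) => ? ?; lra.
  apply: hY => //; [exact: le_trans hu cu|exact: le_trans cv hv|].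
  by move=> t /andP[t1 t2]; apply: hg; rewrite (le_trans cu t1) (le_trans t2 cv).
have ng (z : R) : be <= z -> be <= `|z| by move=> h; exact: le_trans h (ler_norm _).
have ng' (z : R) : be <= - z -> be <= `|z| by move=> h; rewrite -normrN; exact: le_trans h (ler_norm _).
have c0 : cl (- K) = p by rewrite clE ifT//; move: hp; rewrite /K; clear; lra.
have c5 : cl K = q.
  have qK : q < K by move: hq; rewrite /K; clear; lra.
  by rewrite clE qK ltNge (le_trans pq (ltW qK)).
have o1 : - K <= - 1 - be by rewrite /K; move: L0 be1; clear; lra.
have o2 : - 1 - be <= - 1 + be by move: be0; clear; lra.
have o3 : - 1 + be <= 1 - be by move: be1; clear; lra.
have o4 : 1 - be <= 1 + be by move: be0; clear; lra.
have o5 : 1 + be <= K by rewrite /K; move: L0 be1; clear; lra.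
have g1 : `|II f (cl (- K)) (cl (- 1 - be))| <= e / 8.
  apply: good => //; first by move: o2 o3 o4 o5; clear; lra.
  by move=> t /andP[_ t2]; apply: ng'; move: t2 be0; clear; nra.
have g2 : `|II f (cl (- 1 + be)) (cl (1 - be))| <= e / 8.
  apply: good => //; [by move: o1 o2; clear; lra|by move: o4 o5; clear; lra|].
  by move=> t /andP[t1 t2]; apply: ng; move: t1 t2 be0 be1; clear; nra.
have g3 : `|II f (cl (1 + be)) (cl K)| <= e / 8.
  apply: good => //; first by move: o1 o2 o3 o4; clear; lra.
  by move=> t /andP[t1 _]; apply: ng'; move: t1 be0; clear; nra.
have b1 : `|II f (cl (- 1 - be)) (cl (- 1 + be))| <= e / 8.
  apply: le_trans (bad _ _ o2) _; apply: le_trans beM; rewrite le_eqVlt; apply/orP; left; apply/eqP; ring.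
have b2 : `|II f (cl (1 - be)) (cl (1 + be))| <= e / 8.
  apply: le_trans (bad _ _ o4) _; apply: le_trans beM; rewrite le_eqVlt; apply/orP; left; apply/eqP; ring.
have [m1 _] := clm _ _ o1; have [m2 _] := clm _ _ o2; have [m3 _] := clm _ _ o3.
have [m4 _] := clm _ _ o4; have [m5 _] := clm _ _ o5.
rewrite -c0 -c5 (II_cat bf m1 (le_trans m2 (le_trans m3 (le_trans m4 m5)))).
rewrite (II_cat bf m2 (le_trans m3 (le_trans m4 m5))) (II_cat bf m3 (le_trans m4 m5)) (II_cat bf m4 m5).
move: g1 b1 g2 b2 g3 e0; clear; move: (II f _ _) (II f _ _) (II f _ _) (II f _ _) (II f _ _) => z1 z2 z3 z4 z5.
rewrite !ler_norml => /andP[? ?] /andP[? ?] /andP[? ?] /andP[? ?] /andP[? ?] ?.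
by apply/andP; split; lra.
Qed.

Lemma lip_cont (f : R -> R) (K : R) : 0 < K -> (forall t u, `|f t - f u| <= K * `|t - u|) -> continuous f.
Proof.
move=> K0 hf x; apply/cvgrPdist_le => e e0; near=> t.
apply: le_trans (hf _ _) _; rewrite mulrC -ler_pdivlMr//.
near: t; apply: cvgr_dist_le => //; exact: divr_gt0.
Unshelve. all: by end_near. Qed.

Lemma uc_cont (g : R -> R -> R) (u v : R -> R) : uc g -> continuous u -> continuous v ->
  continuous (fun t => g (u t) (v t)).
Proof.
move=> ug cu cv x; apply/cvgrPdist_le => e e0; have [d d0 hd] := ug e e0.
have hu : \forall t \near x, `|u x - u t| <= d by have /cvgrPdist_le := cu x; exact.
have hv : \forall t \near x, `|v x - v t| <= d by have /cvgrPdist_le := cv x; exact.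
by apply: filterS2 hu hv => t h1 h2; exact: hd.
Qed.

Lemma sfun_lip t u : `|sfun t - sfun u| <= 1 * `|t - u|.
Proof.
have t1 := oneDsqr_gt0 t; have u1 := oneDsqr_gt0 u.
have -> : sfun t - sfun u = (t - u) * ((1 - t * u) / ((1 + t ^+ 2) * (1 + u ^+ 2))).
  by rewrite /sfun; field; rewrite !gt_eqF.
rewrite normrM mul1r ler_piMr// normrM normfV (gtr0_norm (mulr_gt0 t1 u1)).
rewrite ler_pdivrMr ?mulr_gt0// mul1r ler_norml.
apply/andP; split.
  by have := sqr_ge0 (t + u); have := sqr_ge0 (t * u); have := sqr_ge0 t; have := sqr_ge0 u; rewrite exprMn; clear; nra.
by have := sqr_ge0 (t + u); have := sqr_ge0 (t * u); have := sqr_ge0 t; have := sqr_ge0 u; rewrite exprMn; clear; nra.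
Qed.

Lemma bmf_oneDsqrV : bmf (fun t : R => (1 + t ^+ 2)^-1).
Proof.
apply: (@bmf_cont _ _ 1); first by move=> x; exact: continuous_oneDsqrV.
by move=> x; rewrite ger0_norm ?invr_ge0 ?oneDsqr_ge0// invf_le1 ?oneDsqr_gt0// lerDl sqr_ge0.
Qed.

Lemma II_oneDsqrV p q : p <= q -> II (fun t => (1 + t ^+ 2)^-1) p q = atan q - atan p.
Proof.
rewrite le_eqVlt => /orP[/eqP ->|pq]; first by rewrite II_pp subrr.
rewrite /II /Rintegral (@continuous_FTC2 _ _ (@atan R))//.
- by apply: continuous_in_subspaceT => x ?; exact: continuous_oneDsqrV.
- split.
  + by move=> x _; exact: derivable_atan.
  + by apply: cvg_at_right_filter; exact: continuous_atan.
  + by apply: cvg_at_left_filter; exact: continuous_atan.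
- by move=> x x01; rewrite derive1_atan.
Qed.

Lemma atan_lip t u : `|atan t - atan u| <= `|t - u|.
Proof.
wlog ut : t u / u <= t.
  by move=> H; have [|/ltW] := leP u t; [exact: H|move/H; rewrite distrC [X in _ <= X]distrC].
rewrite -II_oneDsqrV// [X in _ <= X]ger0_norm ?subr_ge0// -[X in _ <= X]mul1r.
apply: II_norm => //; first exact: bmf_oneDsqrV.
by move=> x _; rewrite ger0_norm ?invr_ge0 ?oneDsqr_ge0// invf_le1 ?oneDsqr_gt0// lerDl sqr_ge0.
Qed.

Lemma carg1 t : carg t 1 = pi / 2 - atan t.
Proof.
rewrite /carg ler01 expr1n.
have /andP[a1 a2] : - (pi / 2) < atan t < pi / 2 by rewrite atan_gtNpi2 atan_ltpi2.
rewrite -[RHS]cosK; last by rewrite in_itv /=; apply/andP; move: a1 a2; clear; split; lra.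
congr acos; rewrite -[pi / 2 - _]opprB cosN cosBpihalf.
have ca : cos (atan t) != 0 by rewrite cos_atan invr_eq0 gt_eqF// sqrtr_gt0 oneDsqr_gt0.
by rewrite -[sin _](mulfVK ca) -/(tan _) atanK cos_atan [1 + _]addrC.
Qed.

Lemma carg_scale k u v : 0 < k -> carg (k * u) (k * v) = carg u v.
Proof.
move=> k0; rewrite /carg pmulr_rge0// !exprMn -mulrDr sqrtrM ?sqr_ge0// sqrtr_sqr gtr0_norm//.
by rewrite invfM mulrACA divff ?mul1r// gt_eqF.
Qed.

(** Compactness of a period box gives both conclusions. Only the first point is moved into the box;
    the second is moved along by the same periods and may fall outside. *)
Lemma periodic_uc (h : R -> R -> R) : continuous (fun z : R * R => h z.1 z.2) ->
  (forall x t, h (x + 1) t = h x t) -> (forall x t, h x (t + 2 * pi) = h x t) ->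
  uc h /\ exists M : R, forall x t, `|h x t| <= M.
Proof.
move=> ch p1 p2.
have pp : 0 < 2 * pi :> R by rewrite mulr_gt0// pi_gt0.
pose K : set (R * R) := `[0, 1]%classic `*` `[0, 2 * pi]%classic.
have cK : compact K by apply: compact_setX; exact: segment_compact.
have redP (f : R -> R) (P : R) : 0 < P -> (forall x, f (x + P) = f x) -> forall (k : int) x, f (x + k%:~R * P) = f x.
  move=> P0 fP k x; have nat (n : nat) z : f (z + n%:R * P) = f z.
    by elim: n z => [|n IH] z; rewrite ?mul0r ?addr0// -natr1 mulrDl mul1r addrA fP IH.
  case: k => n; first exact: nat.
  by rewrite NegzE -[RHS](nat n.+1) rmorphN /= mulNr; have := nat n.+1 (x - n.+1%:R * P); rewrite subrK => <-; rewrite nat.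
have fl (P x : R) : 0 < P -> exists k : int, 0 <= x + k%:~R * P <= P.
  move=> P0; exists (- Num.floor (x / P)); rewrite rmorphN /= mulNr.
  have := Num.Theory.floor_le (x / P); have := lt_succ_floor (x / P).
  rewrite ltr_pdivrMr// ler_pdivlMr// rmorphD /= mulrDl mul1r => h1 h2.
  by apply/andP; move: h1 h2; clear; split; lra.
have red x t : exists k l : int, K (x + k%:~R, t + l%:~R * (2 * pi)) /\
    forall x' t', h (x' + k%:~R) (t' + l%:~R * (2 * pi)) = h x' t'.
  have [k hk] := fl 1 x ltr01; have [l hl] := fl _ t pp; exists k, l; split.
    by rewrite mulr1 in hk; split; rewrite /= in_itv.
  move=> x' t'; rewrite (redP (h (x' + k%:~R)) _ pp (fun z => p2 _ z)).
  by have := redP (fun z => h z t') 1 ltr01 (fun z => p1 z _) k x'; rewrite mulr1.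
split.
  move=> e e0; have e2 : 0 < e / 2 by rewrite divr_gt0.
  have cov := (compact_near_coveringP K).1 cK R (0^'+)
    (fun d z => forall z' : R * R, `|z.1 - z'.1| <= d -> `|z.2 - z'.2| <= d -> `|h z.1 z.2 - h z'.1 z'.2| <= e).
  have {cov} : \forall d \near 0^'+, K `<=` (fun z => forall z' : R * R, `|z.1 - z'.1| <= d -> `|z.2 - z'.2| <= d -> `|h z.1 z.2 - h z'.1 z'.2| <= e).
    apply: cov => z _.
    have [d /= d0 hd] : exists2 d : R, 0 < d & forall z', `|z.1 - z'.1| < d -> `|z.2 - z'.2| < d -> `|h z.1 z.2 - h z'.1 z'.2| <= e / 2.
      have /cvgrPdist_le/(_ _ e2) := ch z; rewrite -nbhs_ballE => -[d d0 hd].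
      by exists d => // z' z1 z2; apply: hd; split.
    exists (ball z (d / 2), [set x | 0 < x < d / 2]) => /=.
      split; first by apply: nbhsx_ballx; rewrite divr_gt0.
      by near=> x; apply/andP; split; near: x; [exact: nbhs_right_gt|apply: nbhs_right_lt; rewrite divr_gt0].
    move=> [z1 dd] /= [[b1 b2] /andP[dd0 dd1]] z' h1 h2.
    rewrite /ball /= in b1 b2.
    have n1 : `|z.1 - z1.1| < d by move: b1 d0; clear; lra.
    have n2 : `|z.2 - z1.2| < d by move: b2 d0; clear; lra.
    have n3 : `|z.1 - z'.1| < d.
      by rewrite -(subrKA z1.1); apply: le_lt_trans (ler_normD _ _) _; move: b1 h1 dd1; clear; lra.
    have n4 : `|z.2 - z'.2| < d.
      by rewrite -(subrKA z1.2); apply: le_lt_trans (ler_normD _ _) _; move: b2 h2 dd1; clear; lra.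
    have := hd z1 n1 n2; have := hd z' n3 n4.
    by rewrite !ler_norml => /andP[? ?] /andP[? ?]; apply/andP; split; lra.
  rewrite /at_right /within /= => /nbhs_ballP[d /= d0 hd].
  exists (d / 2); first by rewrite divr_gt0.
  move=> x x' t t' hx ht; have [k [l [Kz hkl]]] := red x t.
  have := hd (d / 2) _ _ _ Kz (x' + k%:~R, t' + l%:~R * (2 * pi)); rewrite /= !hkl; apply.
  - by rewrite /ball /= sub0r normrN gtr0_norm ?divr_gt0//; move: d0; clear; lra.
  - by rewrite divr_gt0.
  - by rewrite opprD addrACA subrr addr0.
  - by rewrite opprD addrACA subrr addr0.
have /compact_bounded[M [_ hM]] : compact ((fun z : R * R => h z.1 z.2) @` K).
  by apply: continuous_compact => //; exact: continuous_subspaceT.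
exists (M + 1) => x t; have [k [l [Kz hkl]]] := red x t.
rewrite -hkl; apply: (hM (M + 1)); first by rewrite ltrDl.
by exists (x + k%:~R, t + l%:~R * (2 * pi)).
Unshelve. all: by end_near. Qed.

End OscillationFull.

(** * Indicator windows and the angular integral *)

Section Windows.
Variable R : realType.
Local Notation RM := (measurableTypeR R).
Local Notation leb := (@lebesgue_measure R).
Implicit Types (f g : R -> R) (p q t x : R).

Lemma atan_lim (e : R) : 0 < e -> exists2 Lm : R, 0 < Lm & forall L, Lm <= L -> pi / 2 - atan L <= e.
Proof.
move=> e0; have /cvgrPdist_le/(_ _ e0) := @cvgy_atan R; rewrite /= => -[M [Mr hM]].
exists (Num.max M 0 + 1); first by rewrite ltr_wpDl// le_max lexx orbT.
move=> L hL; apply: le_trans (ler_norm _) _; apply: hM.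
apply: lt_le_trans hL; apply: (@le_lt_trans _ _ (Num.max M 0)); first by rewrite le_max lexx.
by rewrite ltrDl.
Qed.

Lemma II_eq_off f g x0 p q : bmf f -> bmf g -> p <= q -> (forall x, x != x0 -> f x = g x) -> II f p q = II g p q.
Proof.
move=> bf bg pq fg.
have int (k : R -> R) (i : interval R) (u v : R) : bmf k -> [set` i] `<=` `[u, v]%classic -> leb.-integrable ([set` i] : set RM) (EFin \o k).
  by move=> bk iuv; apply: integrableS (bmf_int u v bk).
have half1 u v : v = x0 -> II f u v = II g u v.
  move=> vx; rewrite /II -!Rintegral_itv_bndo_bndc.
  - apply: eq_Rintegral => x; rewrite inE /= in_itv /= => /andP[_ h]; apply: fg.
    by rewrite -vx lt_eqF.
  - exact: (int g `[u, v[ u v bg (@subset_itv_co_cc _ _ _ _)).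
  - exact: (int f `[u, v[ u v bf (@subset_itv_co_cc _ _ _ _)).
have half2 u v : u = x0 -> II f u v = II g u v.
  move=> ux; rewrite /II -!Rintegral_itv_obnd_cbnd.
  - apply: eq_Rintegral => x; rewrite inE /= in_itv /= => /andP[h _]; apply: fg.
    by rewrite -ux gt_eqF.
  - exact: (int g `]u, v] u v bg (@subset_itv_oc_cc _ _ _ _)).
  - exact: (int f `]u, v] u v bf (@subset_itv_oc_cc _ _ _ _)).
have [px|xp] := leP p x0; last by apply: eq_II => x /andP[h _]; apply: fg; rewrite gt_eqF// (lt_le_trans xp).
have [xq|qx] := leP x0 q; last by apply: eq_II => x /andP[_ h]; apply: fg; rewrite lt_eqF// (le_lt_trans h).
by rewrite (II_cat bf px xq) (II_cat bg px xq) half1// half2.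
Qed.

Lemma II_supp f g p q p' q' : (forall x, (if p <= x <= q then f x else 0) = (if p' <= x <= q' then g x else 0)) ->
  II f p q = II g p' q'.
Proof.
move=> h; rewrite /II Rintegral_mkcond [RHS]Rintegral_mkcond; apply: eq_Rintegral => x _.
by rewrite !patchE; have := h x; rewrite !mem_setE /= !in_itv.
Qed.

Definition ind p q t : R := (p <= t <= q)%R%:R.
Definition indo p q t : R := (p <= t < q)%R%:R.

Lemma bmf_ind p q : bmf (ind p q).
Proof.
have := bmf_indic (measurable_itv `[p, q]); congr bmf; apply/funext => t.
by rewrite indicE /ind mem_setE in_itv.
Qed.
Lemma bmf_indo p q : bmf (indo p q).
Proof.
have := bmf_indic (measurable_itv `[p, q[); congr bmf; apply/funext => t.
by rewrite indicE /indo mem_setE in_itv.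
Qed.

Lemma II_window f p q B : bmf f -> (forall t, f t != 0 -> - B <= t <= B) -> - B <= B ->
  II f p q = II (fun t => indo p q t * f t) (- B) B.
Proof.
move=> bf hf B0; rewrite (@II_eq_off (fun t => indo p q t * f t) (fun t => ind p q t * f t) q)//.
- apply: II_supp => x; rewrite /ind; case: ifP => h; rewrite ?mul1r ?mul0r ?if_same//.
  by have [->|/hf ->//] := eqVneq (f x) 0; rewrite if_same.
- exact: bmfM (bmf_indo p q) bf.
- exact: bmfM (bmf_ind p q) bf.
- move=> x xq; congr (_ * _); rewrite /indo /ind; congr (_%:R); congr nat_of_bool.
  by rewrite [x <= q]le_eqVlt (negPf xq).
Qed.

(** The windows cut out a subinterval of [[-Lm, Lm]], up to one end point that does not affect the
    integral. *)
Lemma II_inner f p q w Lm (e : R) : bmf f -> - Lm <= Lm -> 0 <= e ->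
  (forall p' q', - Lm <= p' -> p' <= q' -> q' <= Lm -> `|II f p' q'| <= e) ->
  `|II (fun t => indo p q t * ind (- w) w t * f t) (- Lm) Lm| <= e.
Proof.
move=> bf L0 e0 hf.
rewrite (@II_eq_off _ (fun t => ind p q t * ind (- w) w t * f t) q)//; last first.
- move=> x xq; congr (_ * _ * _); rewrite /indo /ind; congr (_%:R); congr nat_of_bool.
  by rewrite [x <= q]le_eqVlt (negPf xq).
- exact: bmfM (bmfM (bmf_ind _ _) (bmf_ind _ _)) bf.
- exact: bmfM (bmfM (bmf_indo _ _) (bmf_ind _ _)) bf.
pose p1 := Num.max (- Lm) (Num.max p (- w)); pose q1 := Num.min Lm (Num.min q w).
have hx x : (if - Lm <= x <= Lm then ind p q x * ind (- w) w x * f x else 0) = (if p1 <= x <= q1 then f x else 0).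
  rewrite /ind /p1 /q1 !ge_max !le_min.
  case: (- Lm <= x) => //=; case: (x <= Lm); rewrite ?andbF//=.
  case: (p <= x); case: (- w <= x); case: (x <= q); case: (x <= w); rewrite /= ?mul1r ?mul0r//.
rewrite (II_supp hx); have [pq|qp] := leP p1 q1.
  by apply: hf => //; rewrite ?ge_min ?le_max lexx.
rewrite /II set_itv_ge ?Rintegral_set0 ?normr0// -ltNge; exact: qp.
Qed.

Lemma cnt_indic (T : choiceType) (A V : set T) : finite_set V -> A `<=` V ->
  cnt R A = \sum_(v <- fset_set V) \1_A v.
Proof.
move=> fV AV; have fA := sub_finite_set AV fV.
rewrite -fsbig_finite// -(fsbig_widen A V)//; last first.
  by move=> v [_ /= nA]; rewrite indicE memNset.
rewrite fsbig_finite// /cnt -sum1_size natr_sum big_seq [RHS]big_seq.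
by apply: eq_bigr => v; rewrite in_fset_set// indicE => ->.
Qed.

Definition Thf (t : R) : R := - (2 * carg t 1).

Lemma ThfE t : Thf t = - pi + 2 * atan t.
Proof. by rewrite /Thf carg1; field. Qed.

Lemma Thf_lip t u : `|Thf t - Thf u| <= 2 * `|t - u|.
Proof.
rewrite !ThfE (_ : _ - _ = 2 * (atan t - atan u)); last by ring.
by rewrite normrM gtr0_norm// ler_pM2l// atan_lip.
Qed.

(** The substitution [theta = - pi + 2 atan t] has [d theta = 2 dt / (1 + t^2)] and maps the line
    onto an open interval of length [2 pi], one full period; hence the factor [1/2]. *)
Lemma H0_integral (H : R -> R) (M e : R) : continuous H -> (forall x, `|H x| <= M) ->
  (forall x, H (x + 2 * pi) = H x) -> 0 < e ->
  exists2 Lm : R, 0 < Lm & forall L, Lm <= L ->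
    `|II (fun t => H (Thf t) * (1 + t ^+ 2)^-1) (- L) L - 2^-1 * II H 0 (2 * pi)| <= e.
Proof.
move=> cH HM per e0; have M0 : 0 <= M := le_trans (normr_ge0 _) (HM 0).
have M1 : 0 < 2 * (M + 1) by rewrite mulr_gt0// ltr_wpDl.
have [Lm L0 hL] := atan_lim (divr_gt0 e0 M1).
exists Lm => // L /[dup] LL /hL hA.
have Lp := lt_le_trans L0 LL.
have bH : bmf H := bmf_cont cH HM.
have aL : atan (- L) = - atan L by exact: atanN.
have A2 := @atan_ltpi2 R L.
have A0 : 0 <= atan L by rewrite -(@atan0 R); apply: le_atan; exact: ltW.
have cG : continuous (fun x => H (- pi + 2 * x)).
  move=> x; apply: (@continuous_comp _ _ _ (fun x => - pi + 2 * x) H) => //; last exact: cH.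
  apply: (@lip_cont _ _ 2) => // t u; rewrite (_ : _ - _ = 2 * (t - u)); last by ring.
  by rewrite normrM gtr0_norm.
have sub : II (fun t => H (Thf t) * (1 + t ^+ 2)^-1) (- L) L = II (fun x => H (- pi + 2 * x)) (- atan L) (atan L).
  have L2 : - L <= L by move: Lp; clear; lra.
  have dE : derive1 (@atan R) = (fun x => (1 + x ^+ 2)^-1).
    by apply/funext => z; exact: derive1_atan.
  have := @integration_by_substitution_increasing R (@atan R) (fun x => H (- pi + 2 * x)) (- L) L L2.
  rewrite aL /II /Rintegral => ->.
  - congr fine; apply: eq_integral => t _; rewrite /= !fctE /= derive1_atan ThfE //.
  - by move=> x y _ _; exact: lt_atan.
  - move=> x _; rewrite dE.
    exact: continuous_oneDsqrV.
  - apply/cvg_ex; exists ((1 + (- L) ^+ 2)^-1).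
    rewrite dE.
    by apply: cvg_at_right_filter; exact: continuous_oneDsqrV.
  - apply/cvg_ex; exists ((1 + L ^+ 2)^-1).
    rewrite dE.
    by apply: cvg_at_left_filter; exact: continuous_oneDsqrV.
  - split.
    + by move=> x _; exact: derivable_atan.
    + by apply: cvg_at_right_filter; exact: continuous_atan.
    + by apply: cvg_at_left_filter; exact: continuous_atan.
  - exact: continuous_subspaceT.
rewrite sub (II_affine (- pi) (- atan L) (atan L) bH (ltr0Sn R 1)).
have shift : II H 0 (2 * pi) = II H (- (2 * pi)) 0.
  have := II_affine (2 * pi) (- (2 * pi)) 0 bH ltr01.
  rewrite invr1 !mul1r addrN addr0 => <-; apply: eq_II => x _.
  by rewrite mul1r addrC per.
set A := atan L in hA A2 A0 *; rewrite shift -mulrBr.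
have o1 : - (2 * pi) <= - pi + 2 * - A by move: A2; clear; lra.
have o2 : - pi + 2 * - A <= - pi + 2 * A by move: A0; clear; lra.
have o3 : - pi + 2 * A <= 0 by move: A2; clear; lra.
rewrite (II_cat bH o1 (le_trans o2 o3)) (II_cat bH o2 o3).
have b1 := II_norm bH o1 (fun x _ => HM x); have b2 := II_norm bH o3 (fun x _ => HM x).
have e1 : M * (pi / 2 - A) <= e / 2.
  apply: (@le_trans _ _ ((M + 1) * (e / (2 * (M + 1))))).
    by apply: ler_pM => //; [rewrite subr_ge0 ltW|rewrite lerDl].
  by rewrite le_eqVlt; apply/orP; left; apply/eqP; field; rewrite gt_eqF// ltr_wpDl.
have -> : forall u v w : R, u - (v + (u + w)) = - (v + w) by move=> *; ring.
rewrite normrM gtr0_norm ?invr_gt0// normrN ler_pdivrMl//.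
apply: le_trans (ler_normD _ _) _; move: b1 b2 e1; clear.
set z1 := `|_|; set z2 := `|_|.
have -> : M * (- pi + 2 * - A - - (2 * pi)) = 2 * (M * (pi / 2 - A)) by field.
have -> : M * (0 - (- pi + 2 * A)) = 2 * (M * (pi / 2 - A)) by field.
by set Z := M * _; lra.
Qed.

End Windows.

Section MainTerm.
Variable R : realType.
Local Notation RM := (measurableTypeR R).
Local Notation M4 := (RM * RM * RM * RM)%type.
Implicit Types (G : set M4) (s : M4) (F C : set (RM * RM)) (h : R -> R -> R).

(** Term of the unfolded sum for the bottom row [v = (c, d)]: the test says that the imaginary part
    is at least [T], and [A v] stands for [a/c]. All estimates are uniform in [A]. *)
Definition gterm h (T y : R) (A : R * R -> R) (v : R * R) (x : R) : R :=
  let u := v.1 * x + v.2 in let n := u ^+ 2 + (v.1 * y) ^+ 2 in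
  if n <= y / T then h (A v - u / (v.1 * n)) (- (2 * carg u (v.1 * y))) else 0.

Definition hterm h (y : R) (A : R * R -> R) (v : R * R) (t : R) : R :=
  h (A v - (v.1 ^+ 2 * y)^-1 * sfun t) (Thf t).

(** Half the length of the support in [t], solving [c^2 (1 + t^2) = Q^2]. *)
Definition wid (Q : R) (v : R * R) : R := Num.sqrt (Q ^+ 2 / v.1 ^+ 2 - 1).

Lemma wid_ind (Q : R) (v : R * R) t : 0 < v.1 -> v.1 <= Q ->
  ind (- wid Q v) (wid Q v) t = ((v.1 ^+ 2 * (1 + t ^+ 2) <= Q ^+ 2)%R)%:R.
Proof.
move=> c0 cQ; rewrite /ind -ler_norml; congr (_%:R); congr nat_of_bool.
have w0 : 0 <= Q ^+ 2 / v.1 ^+ 2 - 1.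
  by rewrite subr_ge0 ler_pdivlMr ?exprn_gt0// mul1r ler_pXn2r ?nnegrE ?(ltW c0)// (le_trans _ cQ)// ltW.
rewrite -(ler_pXn2r (n := 2)) ?nnegrE ?sqrtr_ge0// sqr_sqrtr// real_normK ?num_real//.
by rewrite lerBrDr ler_pdivlMr ?exprn_gt0// mulrC [t ^+ 2 + 1]addrC.
Qed.

Lemma gterm_subst h (T y Q : R) A v t : 0 < v.1 -> v.1 <= Q -> 0 < y -> 0 < T -> T * y * Q ^+ 2 = 1 ->
  gterm h T y A v (- v.2 / v.1 + y * t) = ind (- wid Q v) (wid Q v) t * hterm h y A v t.
Proof.
move=> c0 cQ y0 T0 TyQ; rewrite wid_ind// /gterm /hterm.
case: v c0 cQ => c d /= c0 cQ.
have -> : c * (- d / c + y * t) + d = (c * y) * t by field; rewrite gt_eqF.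
have cy : 0 < c * y by rewrite mulr_gt0.
have Q2 : Q ^+ 2 = (T * y)^-1.
  by apply: (mulfI (lt0r_neq0 (mulr_gt0 T0 y0))); rewrite TyQ divff// gt_eqF// mulr_gt0.
have -> : ((c * y * t) ^+ 2 + (c * y) ^+ 2 <= y / T) = (c ^+ 2 * (1 + t ^+ 2) <= Q ^+ 2).
  have -> : (c * y * t) ^+ 2 + (c * y) ^+ 2 = y ^+ 2 * (c ^+ 2 * (1 + t ^+ 2)) by ring.
  have -> : y / T = y ^+ 2 * Q ^+ 2 by rewrite Q2; field; rewrite !gt_eqF.
  by rewrite ler_pM2l// exprn_gt0.
case: ifP => _; rewrite ?mul0r// mul1r.
have t0 := oneDsqr_gt0 t.
congr (h (_ - _) _).
  by rewrite /sfun; field; rewrite !gt_eqF// [X in 0 < X](_ : _ = (c * y) ^+ 2 * (1 + t ^+ 2)); [rewrite mulr_gt0// exprn_gt0|ring].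
by rewrite /Thf -[in LHS](mulr1 (c * y)) -mulrA carg_scale ?mul1r//; rewrite -mulrA mul1r.
Qed.

Lemma gterm_int h (T y Q B a b : R) A v : 0 < v.1 -> v.1 <= Q -> 0 < y -> 0 < T -> T * y * Q ^+ 2 = 1 ->
  bmf (gterm h T y A v) -> bmf (hterm h y A v) -> wid Q v <= B ->
  II (gterm h T y A v) a b = y * II (fun t => indo ((a - - v.2 / v.1) / y) ((b - - v.2 / v.1) / y) t *
      ind (- wid Q v) (wid Q v) t * hterm h y A v t) (- B) B.
Proof.
move=> c0 cQ y0 T0 TyQ bg bh wB; set sg := - v.2 / v.1.
have := II_affine sg ((a - sg) / y) ((b - sg) / y) bg y0.
have e z : sg + y * ((z - sg) / y) = z by field; rewrite gt_eqF.
rewrite !e => /(congr1 (fun z => y * z)); rewrite mulrA divff ?gt_eqF// mul1r => <-; congr (y * _).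
have bf : bmf (fun t => ind (- wid Q v) (wid Q v) t * hterm h y A v t) by exact: bmfM (bmf_ind _ _) bh.
have w0 : 0 <= wid Q v by exact: sqrtr_ge0.
transitivity (II (fun t => ind (- wid Q v) (wid Q v) t * hterm h y A v t) ((a - sg) / y) ((b - sg) / y)).
  by apply: eq_II => t _; exact: gterm_subst.
rewrite (@II_window _ _ _ _ B bf); first by apply: eq_II => t _; rewrite mulrA.
- move=> t; rewrite /ind; case: (boolP (_ <= t <= _)) => [/andP[h1 h2] _|_]; last by rewrite mul0r eqxx.
  by apply/andP; move: h1 h2 wB; clear; split; lra.
- by move: w0 wB; clear; lra.
Qed.

(** The wedge of [v] with its image under the unit translation is [c^2]. *)
Lemma orb_c_lower G s v : cusp_at_infty G -> det4 s = 1 ->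
  cusp_at_infty [set m | G (conj4 (inv4 s) m)] -> orb G s v -> 0 < v.1 -> 200^-1 <= v.1.
Proof.
move=> cG ds cS Lv c0; have dG := ci_dg cG.
have Lw : orb G s (rmul v (upper4 1)) by apply: orb_rmul => //; have := ci_upper cG 1.
have [h|] := orb_spacing ds dG cS Lv Lw; rewrite /wedge /rmul /=.
  by move: h c0; rewrite /wedge /rmul /=; clear; nra.
rewrite (_ : _ - _ = v.1 ^+ 2); last by ring.
rewrite ger0_norm ?sqr_ge0// -exprVn; apply: sqr_le_pos => //.
Qed.

Lemma bmf_hterm h (M y : R) A v : uc h -> (forall x t, `|h x t| <= M) -> bmf (hterm h y A v).
Proof.
move=> uh hM; apply: (@bmf_cont _ _ M) => [|t]; last exact: hM.
apply: uc_cont => //; last by apply: (@lip_cont _ _ 2) => // t u; exact: Thf_lip.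
set k := (v.1 ^+ 2 * y)^-1; apply: (@lip_cont _ _ (`|k| + 1)); first by rewrite ltr_wpDl.
move=> t u; rewrite (_ : _ - _ = - k * (sfun t - sfun u)); last by ring.
rewrite normrM normrN; apply: ler_pM => //; first by rewrite lerDl.
by have := sfun_lip t u; rewrite mul1r.
Qed.

Lemma bmf_gterm h (M T y Q : R) A v : uc h -> (forall x t, `|h x t| <= M) ->
  0 < v.1 -> v.1 <= Q -> 0 < y -> 0 < T -> T * y * Q ^+ 2 = 1 -> bmf (gterm h T y A v).
Proof.
move=> uh hM c0 cQ y0 T0 TyQ; set sg := - v.2 / v.1.
have := bmf_affine (- sg / y) y^-1 (bmfM (bmf_ind (- wid Q v) (wid Q v)) (bmf_hterm y A v uh hM)).
congr bmf; apply/funext => x; rewrite -(gterm_subst h A _ c0 cQ y0 T0 TyQ) -/sg; congr gterm.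
by field; rewrite gt_eqF.
Qed.

(** Since [y/T = (y Q)^2], a nonzero term has [c <= Q] and [|c x + d| < y Q]: its slope lies within
    [y K1 Q] of [x]. Only the vectors of one finite sector contribute. *)
Lemma gterm_neq0 h (T y Q a b x K1 : R) A v : 0 < v.1 -> 0 < y -> 0 < T -> 0 < Q -> T * y * Q ^+ 2 = 1 ->
  1 <= K1 * v.1 -> a <= x <= b -> gterm h T y A v x != 0 ->
  v.1 <= Q /\ (a - y * (K1 * Q)) * v.1 <= - v.2 < (b + y * (K1 * Q)) * v.1.
Proof.
case: v => c d /= c0 y0 T0 Q0 TyQ K1c /andP[ax xb]; rewrite /gterm /=; case: ifP => [hn _|]; last by rewrite eqxx.
have yT : y / T = (y * Q) ^+ 2.
  have -> : (y * Q) ^+ 2 = y * (T * y * Q ^+ 2) / T by field; rewrite gt_eqF.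
  by rewrite TyQ mulr1.
rewrite yT in hn; set u := c * x + d in hn.
have yQ : 0 < y * Q by rewrite mulr_gt0.
have cQ : c <= Q.
  rewrite -(ler_pM2l y0) [y * c]mulrC; apply: sqr_le_pos; rewrite ?mulr_gt0//.
  by apply: le_trans hn; rewrite lerDr sqr_ge0.
have u2 : u ^+ 2 < (y * Q) ^+ 2.
  by apply: lt_le_trans hn; rewrite ltrDl exprn_gt0// mulr_gt0.
have : `|u| < y * Q by rewrite -(ltr_pXn2r (n := 2)) ?nnegrE ?(ltW yQ)// real_normK ?num_real.
rewrite ltr_norml => /andP[u1 u3].
have yB : y * Q <= y * (K1 * Q) * c.
  have -> : y * (K1 * Q) * c = y * Q * (K1 * c) by ring.
  by rewrite ler_peMr// ltW.
split=> //; apply/andP; split.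
  rewrite mulrBl; have : a * c <= x * c by rewrite ler_pM2r.
  by move: u1 u3 yB; rewrite /u; clear; move: (y * (K1 * Q) * c) (a * c) => *; lra.
rewrite mulrDl; have : x * c <= b * c by rewrite ler_pM2r.
by move: u1 u3 yB; rewrite /u; clear; move: (y * (K1 * Q) * c) (b * c) => *; lra.
Qed.

End MainTerm.

(** * The main term *)

Section MainLimit.
Variable R : realType.
Local Notation RM := (measurableTypeR R).
Local Notation M4 := (RM * RM * RM * RM)%type.
Implicit Types (G : set M4) (s : M4) (F C : set (RM * RM)) (h : R -> R -> R).

Definition mean h (t : R) : R := II (fun x => h x t) 0 1.

Lemma mean_data h (M : R) : uc h -> (forall x t, `|h x t| <= M) -> (forall x t, h (x + 1) t = h x t) ->
  [/\ continuous (mean h), forall t, `|mean h t| <= M &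
      oscd (fun x t => h x t - mean h t) (2 * M) (@Thf R)].
Proof.
move=> uh hM p1.
have cid : continuous (fun t : R => t) by move=> x; exact: cvg_id.
have bh t : bmf (fun x => h x t).
  by apply: (@bmf_cont _ _ M) => [|x]; [apply: uc_cont => // x; exact: cvg_cst|exact: hM].
have mM t : `|mean h t| <= M.
  by have := II_norm (bh t) (@ler01 R) (fun x _ => hM x t); rewrite subr0 mulr1.
have um : uc (fun _ => mean h).
  move=> e e0; have [d d0 hd] := uh e e0; exists d => // x x' t t' _ tt.
  rewrite /mean -(IIB 0 1 (bh t) (bh t')) -[e]mulr1 -[X in e * X]subr0.
  apply: II_norm => //; first exact: bmfB.
  by move=> z _; apply: hd => //; rewrite subrr normr0 ltW.
have ug : uc (fun x t => h x t - mean h t).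
  move=> e e0; have e2 : 0 < e / 2 by rewrite divr_gt0.
  have [d d0 hd] := uh _ e2; have [d' d'0 hd'] := um _ e2.
  exists (Num.min d d'); first by rewrite lt_min d0 d'0.
  move=> x x' t t'; rewrite !le_min => /andP[x1 x2] /andP[t1 t2].
  have h1 := hd x x' t t' x1 t1; have h2 := hd' x x' t t' x2 t2.
  rewrite (_ : _ - _ = (h x t - h x' t') - (mean h t - mean h t')); last by ring.
  by apply: le_trans (ler_normB _ _) _; move: h1 h2; clear; lra.
have gM x t : `|h x t - mean h t| <= 2 * M.
  by apply: le_trans (ler_normB _ _) _; have := hM x t; have := mM t; clear; lra.
split=> //; first by have := uc_cont um cid cid.
split=> //.
- by move=> x t; rewrite p1.
- by move=> t; rewrite (IIB 0 1 (bh t) (bmf_cst _)) II_cst ?ler01// subr0 mulr1 subrr.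
- by move=> t; exact: bmfB (bh t) (bmf_cst _).
- move=> A Y; apply: (@bmf_cont _ _ (2 * M)) => [|t]; last exact: gM.
  apply: (uc_cont ug); last by apply: (@lip_cont _ _ 2) => // t u; exact: Thf_lip.
  apply: (@lip_cont _ _ (`|Y| + 1)); first by rewrite ltr_wpDl.
  move=> t u; rewrite (_ : _ - _ = - Y * (sfun t - sfun u)); last by ring.
  rewrite normrM normrN; apply: ler_pM => //; first by rewrite lerDl.
  by have := sfun_lip t u; rewrite mul1r.
- move=> d d0; exists (d / 2); first by rewrite divr_gt0.
  move=> t t' tt; apply: le_trans (Thf_lip t t') _.
  by move: tt; clear; lra.
Qed.

(** Exchange of roles: at fixed [t] the windows describe a sector in [v], so that the sum of the
    windows over [v] becomes an orbit count. *)
Lemma chi_sector G s (y Q a b t : R) v : 0 < y -> 0 < v.1 -> v.1 <= Q -> orb G s v ->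
  indo ((a - - v.2 / v.1) / y) ((b - - v.2 / v.1) / y) t * ind (- wid Q v) (wid Q v) t =
  \1_(sector G s one4 (Q / Num.sqrt (1 + t ^+ 2)) (a - y * t) (b - y * t)) v.
Proof.
move=> y0 c0 cQ Lv; rewrite wid_ind// /indo -natrM mulnb indicE; congr (_%:R); congr nat_of_bool.
have s0 : 0 < Num.sqrt (1 + t ^+ 2) by rewrite sqrtr_gt0 oneDsqr_gt0.
have Q0 : 0 < Q := lt_le_trans c0 cQ.
have e1 z : ((z - - v.2 / v.1) / y <= t) = ((z - y * t) * v.1 <= - v.2).
  by rewrite ler_pdivrMr// lerBlDr -lerBlDl [t * y]mulrC ler_pdivlMr.
have e2 z : (t < (z - - v.2 / v.1) / y) = (- v.2 < (z - y * t) * v.1).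
  by rewrite ltr_pdivlMr// ltrBrDr -ltrBrDl [t * y]mulrC ltr_pdivrMr.
have e3 : (v.1 ^+ 2 * (1 + t ^+ 2) <= Q ^+ 2) = (v.1 <= Q / Num.sqrt (1 + t ^+ 2)).
  rewrite ler_pdivlMr// -[RHS](ler_pXn2r (n := 2)) ?nnegrE ?mulr_ge0 ?(ltW c0) ?(ltW s0) ?(ltW Q0)//.
  by rewrite exprMn sqr_sqrtr// oneDsqr_ge0.
rewrite e1 e2 e3; apply/idP/idP.
  by move=> /andP[h1 h2]; apply/mem_set; split=> //; rewrite rmul1 c0 h2.
by rewrite inE => -[_]; rewrite rmul1 => -[/andP[_ h1] h2]; rewrite h1 h2.
Qed.

(** By [T y Q^2 = 1] the prefactor [T y / L] is [1/D] with [D = L Q^2], so errors are measured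
    against [D]. The tails in [t], the passage from [h] to its mean, the count and the truncated
    angular integral each cost at most [e5]. *)
Lemma main_term G F C s h (e : R) (ka := (Ex F (fun=> 1))^-1) : fundom G F C -> det4 s = 1 ->
  cusp_at_infty [set m | G (conj4 (inv4 s) m)] ->
  continuous (fun z : R * R => h z.1 z.2) ->
  (forall x t, h (x + 1) t = h x t) -> (forall x t, h x (t + 2 * pi) = h x t) -> 0 < e ->
  exists T0 Qm X0 : R, [/\ 0 < T0, 0 < Qm, 0 < X0 &
    forall (T y Q a b : R) (A : R * R -> R), T0 <= T -> 0 < y -> 0 < Q -> T * y * Q ^+ 2 = 1 -> Qm <= Q -> a < b ->
    X0 <= Q * (b - a) ->
    `|T / (b - a) * II (fun x => \sum_(v \in [set v | orb G s v /\ 0 < v.1]) gterm h T y A v x) a b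
      - ka / 2 * II (mean h) 0 (2 * pi)| <= e].
Proof.
move=> fd ds cS ch p1 p2 e0; have cG := fd_cusp fd; have dG := ci_dg cG.
have [uh [M hM]] := periodic_uc ch p1 p2.
have [cH HM od] := mean_data uh hM p1; set H := mean h in cH HM od *.
have M0 : 0 <= M := le_trans (normr_ge0 _) (HM 0).
have M1 : 0 < M + 1 by rewrite ltr_wpDl.
have Hper t : H (t + 2 * pi) = H t by apply: eq_II => x _; exact: p2.
have ka0 : 0 < ka by rewrite invr_gt0; exact: (vol_gt0 fd ds cS).
have [K1 [K2 [K10 K20 hK1 hK2]]] : exists K1 K2 : R, [/\ 0 < K1, 0 < K2,
    forall v, orb G s v -> 0 < v.1 -> 1 <= K1 * v.1 &
    forall Q al be : R, 0 < Q -> al <= be -> finite_set (sector G s one4 Q al be) /\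
      cnt R (sector G s one4 Q al be) <= 1 + (be - al) * (Q ^+ 2 * K2)].
  exists 200, (200 ^+ 2); split.
  - exact: ltr0Sn.
  - by apply: exprn_gt0; exact: ltr0Sn.
  - move=> v Lv c0; have := orb_c_lower cG ds cS Lv c0.
    by rewrite -[X in X <= _ -> _]mul1r ler_pdivrMr ?ltr0Sn// mulrC.
  - by move=> Q al be Q0 ab; exact: (sector_bound ds dG cS (@det41 R) Q0 ab).
pose e5 := e / 5.
have e50 : 0 < e5 := divr_gt0 e0 (ltr0Sn _ _).
have e5E : e = 5 * e5 by rewrite /e5; field.
clearbody e5.
have [L1 L10 hL1] := H0_integral cH HM Hper (divr_gt0 e50 ka0).
have q4 : 0 < 4 * (M + 1) * K2 by rewrite !mulr_gt0.
have [L2 L20 hL2] := atan_lim (divr_gt0 e50 q4).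
pose Lm := Num.max L1 L2.
have Lm0 : 0 < Lm by rewrite lt_max L10.
have J := hL1 Lm (ltac:(by rewrite le_max lexx) : L1 <= Lm).
have th := hL2 Lm (ltac:(by rewrite le_max lexx orbT) : L2 <= Lm).
clearbody Lm; clear hL1 hL2.
have q5 : 0 < 1 + K2 * (1 + 2 * K1) by move: K10 K20; clear; nra.
pose e1 := e5 / (1 + K2 * (1 + 2 * K1)).
have e10 : 0 < e1 by rewrite divr_gt0.
have e1E : (1 + K2 * (1 + 2 * K1)) * e1 = e5 by rewrite /e1 mulrC mulfVK// gt_eqF.
clearbody e1.
have [Y0 Y00 hosc] := osc od Lm0 e10.
have q6 : 0 < (M + 1) * (2 * Lm) by rewrite !mulr_gt0.
pose e2 := e5 / ((M + 1) * (2 * Lm)).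
have e20 : 0 < e2 by rewrite divr_gt0.
have e2E : e2 * ((M + 1) * (2 * Lm)) = e5 by rewrite /e2 mulfVK// gt_eqF.
clearbody e2.
have [W [Q0 [W0 Q00 hcnt]]] := count_asymp fd ds cS e20.
pose r : R := Num.sqrt (1 + Lm ^+ 2).
have r0 : 0 < r by rewrite sqrtr_gt0 oneDsqr_gt0.
have rE : r = Num.sqrt (1 + Lm ^+ 2) by [].
clearbody r.
(* [W r] permits [count_asymp] at every radius [Q / sqrt (1 + t^2)] with [|t| <= Lm]; 1 gives
   [Q <= D]; the last term pays for the constant 1 in the count over tails of length up to
   [K1 Q]. *)
pose X0 := W * r + 1 + 4 * (M + 1) * K1 / e5.
have X00 : 0 < 4 * (M + 1) * K1 / e5 by rewrite divr_gt0// !mulr_gt0.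
exists (Y0 + 1), (Q0 * r + Lm / K1 + 1), X0; split.
- by rewrite addr_gt0.
- by apply: addr_gt0 => //; apply: addr_gt0; [exact: mulr_gt0|exact: divr_gt0].
- by apply: addr_gt0 => //; apply: addr_gt0 => //; exact: mulr_gt0.
move=> T y Q a b A hT y0 Qp TyQ hQ ab hX; set L := b - a in hX *.
have L0 : 0 < L by rewrite subr_gt0.
have T1 : 1 <= T by move: hT Y00; clear; lra.
have T0 : 0 < T := lt_le_trans ltr01 T1.
have TY : Y0 <= T by move: hT; clear; lra.
have Q0r : 0 < Q0 * r by rewrite mulr_gt0.
have LK : 0 < Lm / K1 by rewrite divr_gt0.
have Q1 : 1 <= Q by move: hQ Q0r LK; clear; lra.
have QQ0 : Q0 * r <= Q by move: hQ Q0r LK; clear; lra.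
have hB : Lm <= K1 * Q by rewrite mulrC -ler_pdivrMr//; move: hQ Q0r LK; clear; lra.
have Wr : 0 < W * r by rewrite mulr_gt0.
have XW : W * r <= Q * L by apply: le_trans hX; rewrite /X0; move: X00; clear; lra.
have X1 : 1 <= Q * L by apply: le_trans hX; rewrite /X0; move: X00 Wr; clear; lra.
have XK : 4 * (M + 1) * K1 <= e5 * (Q * L).
  by rewrite mulrC [_ * (Q * L)]mulrC -ler_pdivrMr// mulrC; apply: le_trans hX; rewrite /X0 mulrC; move: Wr; clear; lra.
pose B := K1 * Q; pose D := L * Q ^+ 2.
have D0 : 0 < D by rewrite mulr_gt0// exprn_gt0.
have DX : D = Q * L * Q by rewrite /D; ring.
have QD : Q <= D by rewrite DX ler_peMl// ltW.
have B0 : 0 < B by rewrite mulr_gt0.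
pose V := sector G s one4 Q (a - y * B) (b + y * B).
have abB : a - y * B <= b + y * B by have := mulr_gt0 y0 B0; move: ab; clear; lra.
have [fV cV] := hK2 Q _ _ Qp abB; rewrite -/V in fV cV.
have VP v : v \in fset_set V -> [/\ orb G s v, 0 < v.1 & v.1 <= Q].
  by rewrite in_fset_set// inE => -[Lv]; rewrite rmul1 => -[/andP[]].
pose chi v t := indo ((a - - v.2 / v.1) / y) ((b - - v.2 / v.1) / y) t * ind (- wid Q v) (wid Q v) t.
have bchi v : bmf (chi v) by exact: bmfM (bmf_indo _ _) (bmf_ind _ _).
have chi0 v t : 0 <= chi v t by rewrite /chi /indo /ind mulr_ge0.
pose N t := \sum_(v <- fset_set V) chi v t.
have bN : bmf N by apply: bmf_sum.
have Ncnt t : - B <= t <= B -> N t = cnt R (sector G s one4 (Q / Num.sqrt (1 + t ^+ 2)) (a - y * t) (b - y * t)).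
  move=> /andP[t1 t2]; rewrite (@cnt_indic _ _ _ V fV).
    rewrite /N big_seq [RHS]big_seq; apply: eq_bigr => v /VP[Lv c0 cQ].
    exact: chi_sector.
  move=> v [Lv]; rewrite rmul1 => -[/andP[c0 c1] /andP[h1 h2]]; split=> //; rewrite rmul1.
  have st : 1 <= Num.sqrt (1 + t ^+ 2).
    have t1' : 1 <= 1 + t ^+ 2 by rewrite lerDl sqr_ge0.
    by have := ler_wsqrtr t1'; rewrite sqrtr1.
  split.
    rewrite c0 /=; apply: le_trans c1 _; rewrite ler_pdivrMr; last exact: lt_le_trans ltr01 st.
    by rewrite ler_peMr// ltW.
  have y1 : y * t <= y * B by rewrite ler_pM2l.
  have y2 : - (y * B) <= y * t by rewrite -mulrN ler_pM2l.
  apply/andP; split.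
    by apply: le_trans h1; rewrite ler_pM2r// lerD2l lerN2.
  by apply: lt_le_trans h2 _; rewrite ler_pM2r// lerD2l lerNl.
have sq1 t : (Q / Num.sqrt (1 + t ^+ 2)) ^+ 2 = Q ^+ 2 * (1 + t ^+ 2)^-1.
  by rewrite expr_div_n sqr_sqrtr// oneDsqr_ge0.
have lenab t : (b - y * t) - (a - y * t) = L by rewrite /L; ring.
have Nle t : - B <= t <= B -> N t <= 1 + D * K2 * (1 + t ^+ 2)^-1.
  move=> tB; rewrite Ncnt//.
  have sp : 0 < Q / Num.sqrt (1 + t ^+ 2) by rewrite divr_gt0// sqrtr_gt0 oneDsqr_gt0.
  have ab' : a - y * t <= b - y * t by rewrite lerD2r ltW.
  have [_] := hK2 _ _ _ sp ab'; rewrite lenab sq1.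
  by rewrite (_ : L * (Q ^+ 2 * (1 + t ^+ 2)^-1 * K2) = D * K2 * (1 + t ^+ 2)^-1)//; rewrite /D; ring.
have bhv v : bmf (hterm h y A v) := bmf_hterm y A v uh hM.
pose k v t := chi v t * hterm h y A v t.
have bk v : bmf (k v) := bmfM (bchi v) (bhv v).
(* The count is at most [1 + D K2 / (1 + t^2)]: the constant integrates to at most [B], small
   against [D], and the rest is an arctangent tail, small by the choice of [Lm]. *)
have tail p q : - B <= p -> p <= q -> q <= B -> q - p <= B -> atan q - atan p <= pi / 2 - atan Lm ->
    `|\sum_(v <- fset_set V) II (k v) p q| <= (e5 / 2) * D.
  move=> Bp pq qB qp at_.
  apply: (@le_trans _ _ (M * II N p q)).
    rewrite /N (II_sum p q (fun v _ => bchi v)) mulr_sumr; apply: le_trans (ler_norm_sum _ _ _) _.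
    apply: ler_sum => v _; apply: le_trans (II_normle _ _ (bk v)) _.
    rewrite -(IIZ M p q (bchi v)); apply: II_le; [exact: bmf_norm|exact: bmfZ|].
    by move=> t _; rewrite /k normrM (ger0_norm (chi0 v t)) mulrC ler_wpM2r//; exact: hM.
  have bo := @bmf_oneDsqrV R.
  have : II N p q <= B + D * K2 * (pi / 2 - atan Lm).
    apply: (@le_trans _ _ (II (fun t => 1 + D * K2 * (1 + t ^+ 2)^-1) p q)).
      apply: II_le => //; first exact: bmfD (bmf_cst _) (bmfZ _ bo).
      by move=> t /andP[t1 t2]; apply: Nle; rewrite (le_trans Bp t1) (le_trans t2 qB).
    rewrite (IID _ _ (bmf_cst 1) (bmfZ _ bo)) (IIZ _ _ _ bo) II_cst// II_oneDsqrV// mul1r.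
    by apply: lerD => //; rewrite ler_pM2l// mulr_gt0.
  move=> hN; apply: (@le_trans _ _ ((M + 1) * (B + D * K2 * (pi / 2 - atan Lm)))).
    apply: ler_pM => //; [apply: II_ge0 => t; rewrite /N; apply: sumr_ge0 => v _; exact: chi0|by rewrite lerDl].
  have b1 : (M + 1) * B <= e5 / 4 * D.
    rewrite DX /B mulrA [e5 / 4 * _]mulrA ler_pM2r//; move: XK; clear; lra.
  have b2 : (M + 1) * K2 * (pi / 2 - atan Lm) <= e5 / 4.
    rewrite mulrC -ler_pdivlMr ?mulr_gt0//; apply: le_trans th _.
    by rewrite le_eqVlt; apply/orP; left; apply/eqP; field; rewrite !gt_eqF.
  have b3 : (M + 1) * (D * K2 * (pi / 2 - atan Lm)) <= e5 / 4 * D.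
    have -> : (M + 1) * (D * K2 * (pi / 2 - atan Lm)) = ((M + 1) * K2 * (pi / 2 - atan Lm)) * D by ring.
    by rewrite ler_pM2r.
  by rewrite mulrDr; move: b1 b3; clear; lra.
pose HT t := H (Thf t).
have bHT : bmf HT.
  apply: (@bmf_cont _ _ M) => [t|t]; last exact: HM.
  apply: (@continuous_comp _ _ _ (@Thf R) H); last exact: cH.
  by apply: (@lip_cont _ _ 2) => // u v; exact: Thf_lip.
have LmN : - Lm <= Lm by move: Lm0; clear; lra.
(* Each phase coefficient [1/(c^2 y)] is at least [T], so [osc] bounds every term by [e1]. The
   number of terms is [O(D)], as widening the interval by [y B] adds only [O(D)] vectors. *)
have mid1 : `|\sum_(v <- fset_set V) II (fun t => chi v t * (hterm h y A v t - HT t)) (- Lm) Lm| <= e5 * D.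
  apply: (@le_trans _ _ (\sum_(v <- fset_set V) e1)).
    apply: le_trans (ler_norm_sum _ _ _) _; rewrite big_seq [X in _ <= X]big_seq; apply: ler_sum => v /VP[Lv c0 cQ].
    apply: (@II_inner _ (fun t => hterm h y A v t - HT t) ((a - - v.2 / v.1) / y) ((b - - v.2 / v.1) / y)
      (wid Q v) Lm e1 (bmfB (bhv v) bHT) LmN (ltW e10)) => p' q' h1 h2 h3.
    apply: (hosc (v.1 ^+ 2 * y)^-1 (A v) p' q') => //; apply: le_trans TY _.
    rewrite -[T]invrK lef_pV2 ?posrE ?invr_gt0 ?mulr_gt0 ?exprn_gt0//.
    have -> : T^-1 = y * Q ^+ 2 by apply: (mulfI (lt0r_neq0 T0)); rewrite divff ?gt_eqF// mulrA TyQ.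
    by rewrite mulrC ler_pM2l// ler_pXn2r ?nnegrE ?(ltW c0) ?(ltW Qp).
  rewrite big_const_seq count_predT iter_addr_0 -mulr_natl -/(cnt R V).
  have yT : y * B * Q ^+ 2 <= K1 * D.
    have yQ2 : y * Q ^+ 2 = T^-1 by apply: (mulfI (lt0r_neq0 T0)); rewrite divff ?gt_eqF// mulrA TyQ.
    have -> : y * B * Q ^+ 2 = K1 * (Q * T^-1) by rewrite -yQ2 /B; ring.
    rewrite ler_pM2l//; apply: le_trans QD; rewrite ler_piMr ?(ltW Qp)// invf_le1//.
  have D1 : 1 <= D := le_trans Q1 QD.
  have : cnt R V <= D * (1 + K2 * (1 + 2 * K1)).
    apply: le_trans cV _.
    have -> : 1 + (b + y * B - (a - y * B)) * (Q ^+ 2 * K2) = 1 + K2 * D + 2 * K2 * (y * B * Q ^+ 2).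
      by rewrite /D /L; ring.
    by move: yT D1 K20; clear; set Z := y * B * Q ^+ 2; nra.
  move=> hc; apply: (@le_trans _ _ (D * (1 + K2 * (1 + 2 * K1)) * e1)); first by rewrite ler_pM2r.
  by rewrite -mulrA e1E mulrC.
(* [count_asymp] is applied for each fixed [t]: the interval of slopes keeps its length [L] and the
   squared radius is [Q^2 / (1 + t^2)]. *)
have mid2 : `|II (fun t => N t * HT t) (- Lm) Lm - ka * D * II (fun t => HT t * (1 + t ^+ 2)^-1) (- Lm) Lm| <= e5 * D.
  have bo := @bmf_oneDsqrV R; have bHo := bmfM bHT bo.
  rewrite -(IIZ _ _ _ bHo) -(IIB _ _ (bmfM bN bHT) (bmfZ _ bHo)).
  apply: le_trans (II_norm (c := e2 * D * M) (bmfB (bmfM bN bHT) (bmfZ _ bHo)) LmN _) _.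
    move=> t /andP[t1 t2].
    have tB : - B <= t <= B by apply/andP; move: t1 t2 hB; rewrite -/B; clear; split; lra.
    have tr : Num.sqrt (1 + t ^+ 2) <= r.
      rewrite rE; apply: ler_wsqrtr; rewrite lerD2l -[t ^+ 2]real_normK ?num_real// ler_pXn2r ?nnegrE ?(ltW Lm0)//.
      by rewrite ler_norml t1.
    have st : 0 < Num.sqrt (1 + t ^+ 2) by rewrite sqrtr_gt0 oneDsqr_gt0.
    have c1 : Q0 <= Q / Num.sqrt (1 + t ^+ 2).
      rewrite ler_pdivlMr//; apply: le_trans QQ0; by rewrite ler_pM2l.
    have c2 : W / (Q / Num.sqrt (1 + t ^+ 2)) <= (b - y * t) - (a - y * t).
      rewrite lenab invf_div mulrA ler_pdivrMr// [L * Q]mulrC; apply: le_trans XW.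
      by rewrite ler_pM2l.
    have := hcnt _ _ _ c1 c2; rewrite -Ncnt// lenab sq1 => hc.
    have -> : N t * HT t - ka * D * (HT t * (1 + t ^+ 2)^-1) =
      (N t - ka * L * (Q ^+ 2 * (1 + t ^+ 2)^-1)) * HT t by rewrite /D; ring.
    rewrite normrM; apply: ler_pM => //; last exact: HM.
    apply: le_trans hc _.
    have -> : e2 * L * (Q ^+ 2 * (1 + t ^+ 2)^-1) = e2 * D * (1 + t ^+ 2)^-1 by rewrite /D; ring.
    apply: ler_piMr; first by apply: mulr_ge0; exact: ltW.
    by rewrite invf_le1 ?oneDsqr_gt0// lerDl sqr_ge0.
  rewrite -e2E (_ : Lm - - Lm = 2 * Lm); last by ring.
  have -> : e2 * D * M * (2 * Lm) = M * (e2 * D * (2 * Lm)) by ring.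
  have -> : e2 * ((M + 1) * (2 * Lm)) * D = (M + 1) * (e2 * D * (2 * Lm)) by ring.
  by apply: ler_wpM2r; [rewrite !mulr_ge0// ltW|rewrite lerDl].
have -> : II (fun x => \sum_(v \in [set v | orb G s v /\ 0 < v.1]) gterm h T y A v x) a b =
    y * \sum_(v <- fset_set V) II (k v) (- B) B.
  transitivity (II (fun x => \sum_(v <- fset_set V) gterm h T y A v x) a b).
    apply: eq_II => x xab; rewrite -fsbig_finite// -(fsbig_widen V [set v | orb G s v /\ 0 < v.1])//.
      by move=> v [Lv]; rewrite rmul1 => -[/andP[]].
    move=> v [[Lv c0] nV] /=; apply: contrapT => /eqP gn; apply: nV.
    have [cQ hh] := gterm_neq0 c0 y0 T0 Qp TyQ (hK1 v Lv c0) xab gn.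
    by split=> //; rewrite rmul1 c0 cQ.
  rewrite II_sum; last by move=> v /VP[Lv c0 cQ]; exact: (bmf_gterm A uh hM c0 cQ y0 T0 TyQ).
  rewrite mulr_sumr big_seq [RHS]big_seq; apply: eq_bigr => v /VP[Lv c0 cQ].
  apply: (gterm_int a b c0 cQ y0 T0 TyQ (bmf_gterm A uh hM c0 cQ y0 T0 TyQ) (bhv v)).
  apply: (@le_trans _ _ (Q / v.1)).
    rewrite /wid -[Q / v.1]gtr0_norm ?divr_gt0// -sqrtr_sqr; apply: ler_wsqrtr.
    by rewrite expr_div_n gerBl.
  by rewrite ler_pdivrMr// /B mulrAC ler_peMl ?(ltW Qp)//; exact: hK1.
have split v : II (k v) (- B) B = II (k v) (- B) (- Lm) + II (k v) Lm B +
   (II (fun t => chi v t * (hterm h y A v t - HT t)) (- Lm) Lm + II (fun t => chi v t * HT t) (- Lm) Lm).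
  have o1 : - B <= - Lm by rewrite lerN2.
  rewrite (II_cat (bk v) o1 (le_trans LmN hB)) (II_cat (bk v) LmN hB).
  rewrite -(IID _ _ (bmfM (bchi v) (bmfB (bhv v) bHT)) (bmfM (bchi v) bHT)).
  rewrite (_ : II (fun x => _ + _) _ _ = II (k v) (- Lm) Lm); first by ring.
  by apply: eq_II => t _; rewrite /k; ring.
under eq_bigr do rewrite split.
rewrite !big_split /=.
have -> : \sum_(v <- fset_set V) II (fun t => chi v t * HT t) (- Lm) Lm = II (fun t => N t * HT t) (- Lm) Lm.
  rewrite -(II_sum _ _ (fun v _ => bmfM (bchi v) bHT)); apply: eq_II => t _.
  by rewrite /N mulr_suml.
have Tl := @atan_ltpi2 R B.
have t1 : `|\sum_(v <- fset_set V) II (k v) (- B) (- Lm)| <= e5 / 2 * D.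
  apply: tail => //; rewrite ?lerN2// ?atanN; [by move: B0 Lm0; clear; lra|by move: B0 Lm0; clear; lra|].
  by move: Tl; clear; lra.
have t2 : `|\sum_(v <- fset_set V) II (k v) Lm B| <= e5 / 2 * D.
  apply: tail => //; [by move: B0 Lm0; clear; lra|by move: Lm0; clear; lra|by move: Tl; clear; lra].
move: t1 t2 mid1 mid2 J; rewrite -/HT.
set z1 := \sum_(v <- _) _; set z2 := \sum_(v <- _) _; set z3 := \sum_(v <- _) _; set z4 := II _ _ _.
set j := II _ _ _; set i := II H 0 _ => t1 t2 t3 t4 t5.
have -> : T / L * (y * (z1 + z2 + (z3 + z4))) = (z1 + z2 + z3 + z4) / D.
  have -> : T / L * (y * (z1 + z2 + (z3 + z4))) = (T * y * Q ^+ 2) * ((z1 + z2 + z3 + z4) / D).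
    by rewrite /D; field; rewrite !gt_eqF.
  by rewrite TyQ mul1r.
have -> : (z1 + z2 + z3 + z4) / D - ka / 2 * i = ((z1 + z2 + z3 + (z4 - ka * D * j)) / D) + ka * (j - 2^-1 * i).
  by field; rewrite gt_eqF.
apply: le_trans (ler_normD _ _) _; rewrite !normrM normfV (gtr0_norm D0) (gtr0_norm ka0).
have h1 : `|z1 + z2 + z3 + (z4 - ka * D * j)| / D <= 3 * e5.
  rewrite ler_pdivrMr//; move: t1 t2 t3 t4; clear; set w := z4 - _; set u := e5 * D.
  have -> : e5 / 2 * D = u / 2 by rewrite /u; ring.
  have -> : 3 * e5 * D = 3 * u by rewrite /u; ring.
  rewrite !ler_norml => /andP[? ?] /andP[? ?] /andP[? ?] /andP[? ?]; apply/andP; split; lra.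
have h2 : ka * `|j - 2^-1 * i| <= e5 by rewrite mulrC -ler_pdivlMr.
by rewrite e5E; move: h1 h2 e50; clear; lra.
Qed.

End MainLimit.

(** * Matrix groups and the geometric data *)

Section Dictionary.
Variable R : realType.
Local Notation M4 := (R * R * R * R)%type.
Local Notation M2 := 'M[R]_2.
Implicit Types (m n g s : M4) (A B : M2).

Definition to2 m : M2 := mx2 m.1.1.1 m.1.1.2 m.1.2 m.2.
Definition of2 A : M4 := (ma A, mb A, mc A, md A).

Lemma to2E m : (ma (to2 m) = m.1.1.1) * (mb (to2 m) = m.1.1.2) * (mc (to2 m) = m.1.2) * (md (to2 m) = m.2).
Proof. by rewrite /ma /mb /mc /md !mxE. Qed.

Lemma to2K : cancel to2 of2.
Proof. by move=> m; rewrite /of2 !to2E; case: m => [[[]]]. Qed.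

Lemma of2K : cancel of2 to2.
Proof.
move=> A; apply/matrixP => i j; rewrite mxE.
case: i => [[|[|i]]//= hi]; case: j => [[|[|j]]//= hj].
all: by rewrite /ma /mb /mc /md; congr (A _ _); apply: val_inj.
Qed.

Lemma to2M m n : to2 m * to2 n = to2 (mul4 m n).
Proof.
apply/matrixP => i j; rewrite !mxE !big_ord_recl big_ord0 !mxE /=.
by case: i => [[|[|i]]//= hi]; case: j => [[|[|j]]//= hj]; rewrite addr0.
Qed.

Lemma to21 : to2 (@one4 R) = 1.
Proof.
apply/matrixP => i j; rewrite !mxE /=.
by case: i => [[|[|i]]//= hi]; case: j => [[|[|j]]//= hj].
Qed.

Lemma to2N m : to2 (opp4 m) = - to2 m.
Proof.
apply/matrixP => i j; rewrite !mxE /=.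
by case: i => [[|[|i]]//= hi]; case: j => [[|[|j]]//= hj].
Qed.

Lemma det_to2 m : \det (to2 m) = det4 m.
Proof.
rewrite (expand_det_row _ ord0) !big_ord_recl big_ord0 /cofactor !det_mx11 !mxE /=.
by rewrite /det4 /bump /= !add0n ?addn0 expr0 expr1; ring.
Qed.

Lemma invmx_to2 m : det4 m = 1 -> invmx (to2 m) = to2 (inv4 m).
Proof.
move=> dm; have AB : to2 m *m to2 (inv4 m) = 1%:M.
  by have := to2M m (inv4 m); rewrite mul4V// to21.
have [uA _] := mulmx1_unit AB.
by rewrite -[RHS]mul1mx -(mulVmx uA) -mulmxA AB mulmx1.
Qed.

Lemma dgroup_to2 (Gam : set M2) : Fuchsian Gam -> dgroup [set m | Gam (to2 m)].
Proof.
move=> [[Gdet G1 GN GM GV] [e e0 ed]]; split => /=.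
- by move=> m /Gdet; rewrite det_to2.
- by rewrite to21.
- by rewrite to2N to21.
- by move=> m n Gm Gn; rewrite -to2M; exact: GM.
- by move=> m Gm; rewrite -invmx_to2; [exact: GV|rewrite -det_to2; exact: Gdet].
have e20 : 0 < e / 2 by exact: divr_gt0 e0 (ltr0Sn _ _).
have e2e : e / 2 < e by move: e0; clear; lra.
exists (e / 2) => // m Gm [h1 h2 h3 h4].
apply: (can_inj to2K); rewrite to21; apply: ed => // i j; rewrite !mxE.
by case: i => [[|[|i]]//= hi]; case: j => [[|[|j]]//= hj];
   rewrite ?subr0; apply: le_lt_trans e2e.
Qed.

Lemma Gamma_infP m : Gamma_inf (to2 m) <->
  exists b : int, m = upper4 b%:~R \/ m = opp4 (upper4 b%:~R).
Proof.
have E1 (b : int) : mx2 1 b%:~R 0 1 = to2 (upper4 b%:~R) by [].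
have E2 (b : int) : mx2 (-1) (- b%:~R) 0 (-1) = to2 (opp4 (upper4 b%:~R)).
  by rewrite /to2 /= oppr0.
split=> -[b [h|h]]; exists b.
- by left; apply: (can_inj to2K); rewrite h E1.
- by right; apply: (can_inj to2K); rewrite h E2.
- by left; rewrite h E1.
- by right; rewrite h E2.
Qed.

Lemma cusp_to2 (Gam : set M2) : Fuchsian Gam -> stab Gam None = @Gamma_inf R ->
  cusp_at_infty [set m | Gam (to2 m)].
Proof.
move=> fG sG; split; first exact: dgroup_to2.
  move=> b; have : Gamma_inf (to2 (upper4 b%:~R)) by apply/Gamma_infP; exists b; left.
  by rewrite -sG => -[].
move=> m Gm m0; apply/Gamma_infP; rewrite -sG; split => //.
by rewrite /= to2E m0 eqxx.
Qed.

Lemma stab_conj (Gam : set M2) k s g : scaling Gam k (to2 s) ->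
  stab Gam k (to2 g) <->
  exists b : int, conj4 s g = upper4 b%:~R \/ conj4 s g = opp4 (upper4 b%:~R).
Proof.
move=> [ds _ sE]; have ds4 : det4 s = 1 by rewrite -det_to2.
rewrite -Gamma_infP -sE.
have cE n : invmx (to2 s) * to2 n * to2 s = to2 (conj4 s n).
  by rewrite invmx_to2// !to2M.
split=> [sg|[A sA]]; first by exists (to2 g) => //; exact: cE.
rewrite -[A]of2K cE => /(can_inj to2K) /(congr1 (conj4 (inv4 s))).
by rewrite !conj4K// => <-; rewrite of2K.
Qed.

Lemma bmob_conj k s m : det4 s = 1 -> det4 m = 1 -> m.1.2 = 0 ->
  bmob (to2 s) None = k -> bmob (to2 (conj4 (inv4 s) m)) k = k.
Proof.
move=> ds dm m0 <-.
have := mul4VK (mul4 s m) ds; rewrite -[X in mul4 (mul4 X m) _](inv4K s) -/(conj4 (inv4 s) m).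
move: (conj4 (inv4 s) m) => [[[ga gb] gc] gd].
case: s ds => [[[p q] r] t]; case: m dm m0 => [[[a b] c] d] /=.
rewrite /det4 /mul4 /= => dm c0 ds [e1 _ e2 _]; rewrite !to2E /=.
rewrite c0 !mulr0 !addr0 in e1 e2 dm.
have [r0|r0] := eqVneq r 0 => /=.
  have p0 : p != 0 by apply/eqP => p0; move/eqP: ds; rewrite r0 p0 mul0r mulr0 subr0 eq_sym oner_eq0.
  move/eqP: e2; rewrite r0 mul0r mulr0 addr0 mulf_eq0 (negbTE p0) orbF => /eqP ->.
  by rewrite to2E /= eqxx.
rewrite !to2E /=.
have a0 : a != 0 by apply/eqP => a0; move/eqP: dm; rewrite a0 mul0r subr0 eq_sym oner_eq0.
have E2 : gc * (p / r) + gd = a.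
  by apply: (mulIf r0); rewrite [RHS]mulrC -e2; field.
have E1 : ga * (p / r) + gb = p / r * a.
  by apply: (mulIf r0); rewrite mulrAC divfK// -e1; field.
by rewrite E2 (negbTE a0) E1 mulfK.
Qed.

(** In the conjugate group [c = 0] means fixing infinity; transported by [s] this is fixing [k], and
    the scaling condition describes that stabiliser. *)
Lemma cusp_scaling (Gam : set M2) k s : Fuchsian Gam -> scaling Gam k (to2 s) ->
  cusp_at_infty [set m | [set m' | Gam (to2 m')] (conj4 (inv4 s) m)].
Proof.
move=> fG sc; have dG := dgroup_to2 fG.
have ds : det4 s = 1 by case: sc; rewrite det_to2.
split; first by apply: dgroup_conj => //; rewrite det4V.
  move=> b /=; have : stab Gam k (to2 (conj4 (inv4 s) (upper4 b%:~R))).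
    by apply/(stab_conj _ sc); exists b; left; rewrite conj4KV.
  by case.
move=> m Gm m0.
have dm : det4 m = 1 by have := dg_det dG Gm; rewrite det4_conj// det4V.
have /(stab_conj _ sc) : stab Gam k (to2 (conj4 (inv4 s) m)).
  by split => //; apply: bmob_conj => //; case: sc.
by rewrite conj4KV.
Qed.

Lemma mob_to2 g m : det4 g = 1 -> det4 m = 1 ->
  mob (to2 g) (xc m, yc m) = (xc (mul4 g m), yc (mul4 g m)).
Proof.
move=> dg dm; have n0 := nsq_gt0 (det4_bot dm).
have n1 : 0 < nsq (bot (mul4 g m)) by apply: nsq_gt0; apply: det4_bot; rewrite det4M dg dm mulr1.
have E : yc m = det4 m / nsq (bot m) by rewrite dm mul1r.
rewrite /mob !to2E E /xc /yc; move: n0 n1 dm; clear dg E.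
 case: g => [[[a b] c] d]; case: m => [[[p q] r] t].
rewrite /nsq /det4 /bot /mul4 /= => /gt_eqF /negbT n0 /gt_eqF /negbT n1 dm.
have -> : (c * ((p * r + q * t) / (r ^+ 2 + t ^+ 2)) + d) ^+ 2 +
  (c * ((p * t - q * r) / (r ^+ 2 + t ^+ 2))) ^+ 2 =
  ((c * p + d * r) ^+ 2 + (c * q + d * t) ^+ 2) / (r ^+ 2 + t ^+ 2) by field.
have -> : (a * ((p * r + q * t) / (r ^+ 2 + t ^+ 2)) + b) *
   (c * ((p * r + q * t) / (r ^+ 2 + t ^+ 2)) + d) +
   a * c * ((p * t - q * r) / (r ^+ 2 + t ^+ 2)) ^+ 2 =
  ((a * p + b * r) * (c * p + d * r) + (a * q + b * t) * (c * q + d * t)) / (r ^+ 2 + t ^+ 2) by field.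
move: n0 n1; move: ((c * p + d * r) ^+ 2 + _) (_ * (c * p + d * r) + _) (r ^+ 2 + _) => X Y Z Z0 X0.
by rewrite dm; congr (_, _); field; rewrite ?Z0 ?X0.
Qed.

(** The sigma-algebra is the product one, so an open set is exhibited as a countable union of
    rational boxes. *)
Lemma open_measurable2 (U : set (measurableTypeR R * measurableTypeR R)) :
  open (U : set (R * R)) -> measurable U.
Proof.
move=> oU.
pose bx (p q r : rat) : set (measurableTypeR R * measurableTypeR R) :=
  [set z | ratr p - ratr r < z.1 :> R] `&` [set z | z.1 < ratr p + ratr r :> R] `&`
  ([set z | ratr q - ratr r < z.2 :> R] `&` [set z | z.2 < ratr q + ratr r :> R]).
have mb p q r : measurable (bx p q r).
  by do ?apply: measurableI; apply: measurable_ltset;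
     do ?[exact: measurable_cst|exact: measurable_fst|exact: measurable_snd].
pose W p q r := if `[< bx p q r `<=` U >] then bx p q r else set0.
have -> : U = \bigcup_p \bigcup_q \bigcup_r W p q r.
  apply/seteqP; split=> [z Uz|z [p _ [q _ [r _]]]]; last first.
    by rewrite /W; case: asboolP => // h; exact: h.
  have : nbhs (z : R * R) U by exact: open_nbhs_nbhs.
  move=> /nbhs_ballP[e /= e0 be].
  have e4 : 0 < e / 4 by exact: divr_gt0 e0 (ltr0Sn _ _).
  have /rat_in_itvoo[p] : z.1 < z.1 + e / 4 :> R by rewrite ltrDl.
  rewrite in_itv /= => /andP[p1 p2].
  have /rat_in_itvoo[q] : z.2 < z.2 + e / 4 :> R by rewrite ltrDl.
  rewrite in_itv /= => /andP[q1 q2].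
  have /rat_in_itvoo[r] : e / 4 < e / 2 :> R by move: e0; clear; lra.
  rewrite in_itv /= => /andP[r1 r2].
  exists p => //; exists q => //; exists r => //; rewrite /W ifT; last first.
    apply/asboolP => w [[/= w1 w2] [/= w3 w4]]; apply: be; split => /=;
      rewrite /ball /= ltr_norml; apply/andP.
      by move: w1 w2 p1 p2 r1 r2; clear; split; lra.
    by move: w3 w4 q1 q2 r1 r2; clear; split; lra.
  split; split => /=.
  - by move: p1 p2 r1 r2; clear; lra.
  - by move: p1 p2 r1 r2; clear; lra.
  - by move: q1 q2 r1 r2; clear; lra.
  - by move: q1 q2 r1 r2; clear; lra.
by do 3 (apply: bigcupT_measurable_rat => ?); rewrite /W; case: ifP.
Qed.

(** As [F] is open, a point slightly above [(x, y)] also stays in [F] together with its image, so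
    [g] fixes two points on a vertical line. Then [|c z + d|^2 = 1] at two heights, which gives
    [c = 0], [d^2 = 1] and [b = 0]. *)
Lemma mob_fix (F : set (R * R)) g x y : open F -> det4 g = 1 -> 0 < y ->
  F (x, y) -> (forall p, F p -> F (mob (to2 g) p) -> mob (to2 g) p = p) ->
  F (mob (to2 g) (x, y)) -> g = one4 \/ g = opp4 one4.
Proof.
move=> oF dg y0 Fp fix_g Fg.
have pE := fix_g _ Fp Fg.
case: g dg pE fix_g {Fg} => [[[a b] c] d] dg pE fix_g; rewrite /det4 /= in dg.
pose n (t : R) := (c * x + d) ^+ 2 + (c * (y + t)) ^+ 2.
pose X (t : R) := (a * x + b) * (c * x + d) + a * c * (y + t) ^+ 2.
have mE t : mob (to2 (a, b, c, d)) (x, y + t) = (X t / n t, (y + t) / n t).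
  by rewrite /mob !to2E.
have y0E : (x, y) = (x, y + 0) :> R * R by rewrite addr0.
rewrite y0E mE in pE; case: pE => X0 Y0.
have n0 : n 0 != 0.
  apply/eqP => n0; move: Y0; rewrite n0 invr0 mulr0 addr0 => /eqP; by rewrite lt_eqF.
have cy : (y + t) @[t --> (0:R)] --> y + 0 by apply: cvgD; [exact: cvg_cst|exact: cvg_id].
have cn : n t @[t --> (0:R)] --> n 0.
  apply: cvgD; first exact: cvg_cst.
  by rewrite expr2; under eq_fun do rewrite expr2; apply: cvgM; apply: cvgM => //; exact: cvg_cst.
have cX : X t @[t --> (0:R)] --> X 0.
  apply: cvgD; first exact: cvg_cst.
  apply: cvgM; first exact: cvg_cst.
  by rewrite expr2; under eq_fun do rewrite expr2; apply: cvgM.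
have c1 : X t / n t @[t --> (0:R)] --> x by rewrite -[X in _ --> X]X0; apply: cvgM => //; exact: cvgV.
have c2 : (y + t) / n t @[t --> (0:R)] --> y + 0 by rewrite -[X in _ --> X]Y0; apply: cvgM => //; exact: cvgV.
have : nbhs (x, y + 0) F by apply: open_nbhs_nbhs; split => //; rewrite -y0E.
move=> /nbhs_ballP[e /= e0 be].
have /nbhs_ballP[r /= r0 hr] : \forall t \near (0:R), F (x, y + t) /\ F (X t / n t, (y + t) / n t).
  move/cvgrPdist_lt: (c1) => /(_ e e0) h1; move/cvgrPdist_lt: (c2) => /(_ e e0) h2.
  move/cvgrPdist_lt: (cy) => /(_ e e0) h3.
  near=> t; split; apply: be; split => /=; rewrite /ball /=.
  - by rewrite subrr normr0.
  - by near: t.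
  - by near: t.
  - by near: t.
have [F1 F2] : F (x, y + r / 2) /\ F (X (r / 2) / n (r / 2), (y + r / 2) / n (r / 2)).
  apply: hr; rewrite /ball /= sub0r normrN gtr0_norm ?divr_gt0//.
  by move: r0; clear; lra.
have := fix_g _ F1; rewrite mE => /(_ F2) [_ Y1].
have yr : y + r / 2 != 0 by rewrite gt_eqF// addr_gt0// divr_gt0.
have n_1 (t : R) : y + t != 0 -> (y + t) / n t = y + t -> n t = 1.
  move=> h /(congr1 (fun z => z / (y + t))); rewrite divff// mulrAC divff// mul1r => /(congr1 GRing.inv).
  by rewrite invrK invr1.
have nr1 := n_1 _ yr Y1.
have n01 : n 0 = 1 by apply: n_1 => //; rewrite addr0 gt_eqF.
have c0 : c = 0.
  have : c ^+ 2 * (r * (y + r / 4)) = 0.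
    have -> : c ^+ 2 * (r * (y + r / 4)) = n (r / 2) - n 0 by rewrite /n; field.
    by rewrite nr1 n01 subrr.
  move/eqP; rewrite mulf_eq0 sqrf_eq0 => /orP[/eqP //|].
  by rewrite gt_eqF// mulr_gt0// addr_gt0// divr_gt0.
rewrite n01 divr1 in X0; move: n01 X0.
rewrite /n /X c0 !(mul0r, mulr0, add0r, addr0) expr0n /= ?mulr0n addr0 => d1 bd.
have ad : a * d = 1 by rewrite -dg c0 mulr0 subr0.
have da : a = d by rewrite -[LHS]mulr1 -d1 expr2 mulrA ad mul1r.
have b0 : b = 0.
  have : b * d = 0 by move: bd; rewrite mulrDl mulrAC ad mul1r => bdx; apply: (addrI x); rewrite addr0.
  move/eqP; rewrite mulf_eq0 => /orP[/eqP //|/eqP d0].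
  by move/eqP: ad; rewrite d0 mulr0 eq_sym oner_eq0.
rewrite da b0; move/eqP: d1; rewrite sqrf_eq1 => /orP[/eqP ->|/eqP ->]; [left|right] => //.
by rewrite /opp4 /= oppr0.
Unshelve. all: by end_near. Qed.

Lemma fundom_to2 (Gam : set M2) (F : set (R * R)) : Fuchsian Gam ->
  stab Gam None = @Gamma_inf R -> fund_domain Gam F -> (hyp_area F < +oo)%E ->
  fundom [set m | Gam (to2 m)] F (closure F).
Proof.
move=> fG sG [[oF mF Fp] cov inj nul] fin; have dG := dgroup_to2 fG.
have mC : measurable (closure F : set (measurableTypeR R * measurableTypeR R)).
  rewrite -[X in measurable X]setCK; apply: measurableC; apply: open_measurable2.
  by apply: closed_openC; exact: closed_closure.
split => //; first exact: cusp_to2.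
- apply: (@subset_measure0 _ _ _ (L2 R) _ (closure F `\` F)) => //.
  + apply: measurableI; first exact: measurableD.
    by apply: measurable_ltset; [exact: measurable_cst|exact: measurable_snd].
  + exact: measurableD.
- move=> m dm; have [|g Gg] := cov (xc m, yc m); first exact: yc_gt0.
  have Gg4 : Gam (to2 (of2 g)) by rewrite of2K.
  rewrite -[g]of2K mob_to2//; last exact: (dg_det dG Gg4).
  by exists (of2 g).
move=> m g dm Gg F1 F2; have dg := dg_det dG Gg.
apply: (@mob_fix F g (xc m) (yc m)) => //; first exact: yc_gt0.
  by move=> p p1 p2; apply/esym; exact: (inj _ _ (to2 g)).
by rewrite mob_to2.
Qed.

(** The mass is [pi] times the hyperbolic area by [haar_base], and [covol] is [2 pi] times it. *)
Lemma Ex1_covol G C (F : set (R * R)) : fundom G F C ->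
  (Ex F (fun=> 1))^-1 / 2 = (covol F)^-1.
Proof.
move=> fd; rewrite /Ex /quo (_ : mulE _ _ = fun m => (\1_F (xc m, yc m))%:E); last first.
  by apply/funext => m; rewrite /mulE mule1 !indicE; congr (_%:R%:E); congr nat_of_bool; apply/idP/idP; rewrite !inE.
rewrite haar_base; [|exact: (fd_mF fd)|exact: (fd_pos fd)].
rewrite fineM//; last first.
  rewrite ge0_fin_numE; first exact: (fd_fin fd).
  by apply: integral_ge0 => z _; rewrite lee_fin invr_ge0 sqr_ge0.
by rewrite /covol /hyp_area -!mulrA [in RHS]invfM mulrC.
Qed.
End Dictionary.

(** * Unfolding the automorphic function *)

Section Unfolding.
Variable R : realType.
Local Notation M4 := (R * R * R * R)%type.
Local Notation M2 := 'M[R]_2.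
Implicit Types (m n g s M : M4) (h : R -> R -> R).

Definition fterm h T y x M := fT0 h T (mob (to2 M) (x, y)) (mob_angle (to2 M) (x, y) 0).

Lemma ftermE h T y x M : fterm h T y x M =
  if T <= y / ((M.1.2 * x + M.2) ^+ 2 + (M.1.2 * y) ^+ 2)
  then h (((M.1.1.1 * x + M.1.1.2) * (M.1.2 * x + M.2) + M.1.1.1 * M.1.2 * y ^+ 2) /
          ((M.1.2 * x + M.2) ^+ 2 + (M.1.2 * y) ^+ 2))
         (- (2 * carg (M.1.2 * x + M.2) (M.1.2 * y))) else 0.
Proof. by rewrite /fterm /fT0 /mob_angle /mob !to2E /= sub0r. Qed.

Lemma denom_gt0 y x M : 0 < y -> det4 M = 1 ->
  0 < (M.1.2 * x + M.2) ^+ 2 + (M.1.2 * y) ^+ 2.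
Proof.
move=> y0; case: M => [[[p q] c] d] /=; rewrite /det4 /= => dM.
rewrite lt_def addr_ge0 ?sqr_ge0// andbT paddr_eq0 ?sqr_ge0// !sqrf_eq0.
apply/negP => /andP[/eqP h1]; rewrite mulf_eq0 (gt_eqF y0) orbF => /eqP c0.
move: h1 dM; rewrite c0 mul0r add0r => ->; rewrite !mulr0 subrr => /eqP.
by rewrite eq_sym oner_eq0.
Qed.

Lemma periodic_int h : (forall x t, h (x + 1) t = h x t) ->
  forall (b : int) x t, h (x + b%:~R) t = h x t.
Proof.
move=> hp; have hn (n : nat) x t : h (x + n%:R) t = h x t.
  by elim: n x => [|n IH] x; rewrite ?addr0// -natr1 addrA hp IH.
case=> n x t; first exact: hn.
by rewrite NegzE mulrNz -(hn n.+1 (x - _)) subrK.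
Qed.

Lemma fterm_upper h T y x M (b : int) : (forall x t, h (x + 1) t = h x t) ->
  0 < y -> det4 M = 1 -> fterm h T y x (mul4 (upper4 b%:~R) M) = fterm h T y x M.
Proof.
move=> hp y0 dM; have := denom_gt0 x y0 dM; rewrite !ftermE.
case: M {dM} => [[[p q] c] d]; rewrite /mul4 /= !mul0r !add0r !mul1r => /gt_eqF /negbT n0.
set n := (c * x + d) ^+ 2 + (c * y) ^+ 2 in n0 *.
have -> : ((p + b%:~R * c) * x + (q + b%:~R * d)) * (c * x + d) + (p + b%:~R * c) * c * y ^+ 2 =
  (p * x + q) * (c * x + d) + p * c * y ^+ 2 + b%:~R * n by rewrite /n; ring.
by rewrite mulrDl mulfK// periodic_int.
Qed.

Lemma cargN (u v : R) : 0 < v -> carg (- u) (- v) = carg u v - pi.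
Proof.
move=> v0; rewrite /carg !sqrrN oppr_ge0 leNgt v0 /= ltW//.
have r0 : 0 < Num.sqrt (u ^+ 2 + v ^+ 2) by rewrite sqrtr_gt0 ltr_wpDl ?sqr_ge0 ?exprn_gt0.
rewrite mulNr acosN ?opprB// -ler_norml normrM normfV (gtr0_norm r0) ler_pdivrMr// mul1r.
by rewrite -sqrtr_sqr ler_wsqrtr// lerDl sqr_ge0.
Qed.

(** Negating the matrix changes the argument of [c z + d] by [pi], hence the angle by a full
    period. *)
Lemma fterm_opp h T y x M : (forall x t, h x (t + 2 * pi) = h x t) ->
  0 < y -> 0 < M.1.2 -> fterm h T y x (opp4 M) = fterm h T y x M.
Proof.
move=> hp y0; rewrite !ftermE; case: M => [[[p q] c] d]; rewrite /opp4 /= => c0.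
have -> : - c * x + - d = - (c * x + d) by ring.
have -> : - c * y = - (c * y) by ring.
have -> : (- p * x + - q) * - (c * x + d) + - p * - c * y ^+ 2 =
  (p * x + q) * (c * x + d) + p * c * y ^+ 2 by ring.
rewrite !sqrrN cargN ?mulr_gt0//.
have -> : - (2 * (carg (c * x + d) (c * y) - pi)) = - (2 * carg (c * x + d) (c * y)) + 2 * pi by ring.
by rewrite hp.
Qed.

Lemma fterm_zero h T y x M : 0 < M.2 ^+ 2 -> M.1.2 = 0 -> y < T * M.2 ^+ 2 ->
  fterm h T y x M = 0.
Proof.
move=> d0 c0 yT; rewrite ftermE c0 !mul0r add0r expr0n addr0 leNgt.
by rewrite ltr_pdivrMr// yT.
Qed.

Lemma fterm_gterm h T y x M (A : R * R -> R) : 0 < T -> 0 < y -> det4 M = 1 ->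
  0 < M.1.2 -> A (bot M) = M.1.1.1 / M.1.2 -> fterm h T y x M = gterm h T y A (bot M) x.
Proof.
move=> T0 y0 dM c0 AE; have := denom_gt0 x y0 dM; rewrite ftermE /gterm AE.
case: M c0 dM {AE} => [[[p q] c] d]; rewrite /det4 /= => c0 dM n0.
have XE : ((p * x + q) * (c * x + d) + p * c * y ^+ 2) * c =
   p * ((c * x + d) ^+ 2 + (c * y) ^+ 2) - (p * d - q * c) * (c * x + d) by ring.
rewrite dM mul1r in XE.
move: n0 XE; set n := (c * x + d) ^+ 2 + _; set X := _ + p * c * _ => n0 XE.
have cn0 := negbT (gt_eqF c0); have nn0 := negbT (gt_eqF n0).
have -> : (T <= y / n) = (n <= y / T) by rewrite !ler_pdivlMr// mulrC.
have -> : X / n = p / c - (c * x + d) / (c * n) by rewrite -[X](mulfK cn0) XE; field; rewrite ?cn0 ?nn0.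
by [].
Qed.

Lemma upper4M (x y : R) : mul4 (upper4 x) (upper4 y) = upper4 (x + y).
Proof. by rewrite /mul4 /upper4 /=; congr (_, _, _, _); ring. Qed.

(** Cosets correspond to orbit vectors up to sign; those with [c <> 0] have one representative with
    [c > 0]. A coset with [c = 0] gives height [y/d^2], below [T] when [y < T d0], and contributes
    nothing. *)
Lemma phiT0_gterm (Gam : set M2) k s : Fuchsian Gam -> scaling Gam k (to2 s) ->
  exists A : R * R -> R, exists2 d0 : R, 0 < d0 & forall h (T y x : R),
  (forall x t, h (x + 1) t = h x t) -> (forall x t, h x (t + 2 * pi) = h x t) ->
  0 < T -> 0 < y -> y < T * d0 ->
  phiT0 Gam k (to2 s) h T (x, y) 0 =
  \sum_(v \in [set v | orb [set m | Gam (to2 m)] s v /\ 0 < v.1]) gterm h T y A v x.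
Proof.
move=> fG sc; pose G : set M4 := [set m | Gam (to2 m)]; rewrite -/G; pose P := [set v | orb G s v /\ 0 < v.1].
have dG : dgroup G := dgroup_to2 fG; have cS := cusp_scaling fG sc.
have ds : det4 s = 1 by case: sc; rewrite det_to2.
pose st := stab Gam k; pose co g := lcoset st (to2 g).
pose gv v := xget one4 [set m | G m /\ bot (mul4 (inv4 s) m) = v].
have gvP v : orb G s v -> G (gv v) /\ bot (mul4 (inv4 s) (gv v)) = v.
  by move=> [m Gm mv]; apply: (xgetPex one4 (P := [set m | G m /\ bot (mul4 (inv4 s) m) = v])); exists m.
have dsg g : G g -> det4 (mul4 (inv4 s) g) = 1 by move=> Gg; rewrite det4M det4V ds (dg_det dG Gg) mulr1.
have stP g := stab_conj g sc.
have st1 : st 1.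
  by rewrite -to21; apply/stP; exists 0; left; rewrite conj41// /upper4 mulr0z.
have cg m g : mul4 (inv4 s) (mul4 m g) = mul4 (conj4 s m) (mul4 (inv4 s) g).
  by rewrite /conj4 -(mul4A _ s) mulVK4// mul4A.
have rep g : G g -> exists b : int,
    invmx (to2 s) * xget 1 (co g) = to2 (mul4 (upper4 b%:~R) (mul4 (inv4 s) g)) \/
    invmx (to2 s) * xget 1 (co g) = to2 (opp4 (mul4 (upper4 b%:~R) (mul4 (inv4 s) g))).
  move=> Gg; have [kk skk <-] : co g (xget 1 (co g)).
    by apply: (xgetPex 1 (P := co g)); exists (1 * to2 g); exists 1.
  move: skk; rewrite -[kk]of2K => /stP[b be]; exists b.
  by rewrite invmx_to2// !to2M cg; case: be => ->; [left|right]; rewrite ?mulN4.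
have coS g g' : G g -> G g' ->
    wedge (bot (mul4 (inv4 s) g)) (bot (mul4 (inv4 s) g')) = 0 -> co g `<=` co g'.
  move=> Gg Gg' w0.
  have [kk skk gE] : exists2 kk, st (to2 kk) & g = mul4 kk g'.
    have [b be] := orb_same ds dG cS Gg Gg' w0.
    case: be => be; [exists (conj4 (inv4 s) (upper4 b%:~R))|exists (conj4 (inv4 s) (opp4 (upper4 b%:~R)))].
    - by apply/stP; exists b; left; rewrite conj4KV.
    - by apply: (@mul4_injl _ (inv4 s)); rewrite ?det4V// cg conj4KV.
    - by apply/stP; exists b; right; rewrite conj4KV.
    - by apply: (@mul4_injl _ (inv4 s)); rewrite ?det4V// cg conj4KV// mulN4.
  move=> _ [k1 sk1 <-]; move: sk1; rewrite -[k1]of2K => sk1.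
  exists (to2 (mul4 (of2 k1) kk)); last by rewrite !to2M gE mul4A.
  move/stP: sk1 => [b be]; move/stP: skk => [b' be'].
  apply/stP; exists (b + b'); rewrite conj4M// intrD -upper4M.
  by case: be => ->; case: be' => ->; rewrite ?mul4N ?mulN4 ?opp4K; [left|right|right|left].
have coE g g' : G g -> G g' ->
    wedge (bot (mul4 (inv4 s) g)) (bot (mul4 (inv4 s) g')) = 0 -> co g = co g'.
  move=> Gg Gg' w0; apply/seteqP; split; apply: coS => //.
  by move: w0; rewrite /wedge => w0; rewrite -[LHS]opprK -oppr0 -w0; ring.
have coI : set_inj P (fun v => co (gv v)).
  move=> v w /set_mem [Lv v0] /set_mem [Lw w0] e.
  have [Gv bv] := gvP _ Lv; have [Gw bw] := gvP _ Lw.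
  have : co (gv w) (to2 (gv v)) by rewrite -e; exists 1 => //; rewrite mul1r.
  move=> [kk skk kE]; move: skk kE; rewrite -[kk]of2K to2M => /stP[b be] /(can_inj (@to2K R)) gE.
  have : bot (mul4 (inv4 s) (gv v)) = bot (mul4 (inv4 s) (gv v)) by [].
  rewrite [in X in X = _]bv -gE cg; case: be => ->.
    move=> ->; rewrite -[RHS]bw /bot /mul4 /=; congr (_, _); ring.
  move=> vE; have v1 : v.1 = - w.1.
    by rewrite vE -[in RHS]bw /bot /mul4 /=; ring.
  by move: v0 w0; rewrite v1 oppr_gt0 => v0 /lt_trans /(_ v0); rewrite ltxx.
exists (fun v => (mul4 (inv4 s) (gv v)).1.1.1 / v.1).
(* Vectors with first coordinate 0 have zero wedge, so they agree up to sign; the value 1 is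
   arbitrary when there is none. *)
have [d0 d00 hd0] : exists2 d0 : R, 0 < d0 & forall v, orb G s v -> v.1 = 0 -> v.2 ^+ 2 = d0.
  have [[v0 [Lv0 v00]]|nv] := pselect (exists v0, orb G s v0 /\ v0.1 = 0); last first.
    by exists 1 => // v Lv v0; exfalso; apply: nv; exists v.
  exists (v0.2 ^+ 2).
    rewrite lt_def sqr_ge0 andbT sqrf_eq0; apply/negP => /eqP v02.
    by have /eqP := orb_neq0 ds dG Lv0; apply; move: v00 v02; case: (v0) => /= ? ? -> ->.
  move=> v Lv v1; have := orb_wedge0 ds dG cS Lv Lv0.
  by rewrite /wedge v00 v1 mul0r mulr0 subrr => /(_ erefl) [->|->] //=; rewrite sqrrN.
exists d0 => // h T y x hp1 hp2 T0 y0 yT.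
pose t (C : set M2) := let M := invmx (to2 s) * xget 1 C in fT0 h T (mob M (x, y)) (mob_angle M (x, y) 0).
transitivity (\sum_(C \in [set co (gv v) | v in P]) t C).
  apply/esym; apply: fsbig_widen.
    by move=> _ [v [Lv _] <-]; exists (to2 (gv v)) => //; exact: (gvP _ Lv).1.
  move=> _ [[g Gg <-] nP]; rewrite /= -[g]of2K.
  have {}Gg : G (of2 g) by rewrite /G /= of2K.
  move: nP; rewrite -[g]of2K; move: (of2 g) Gg => {}g Gg nP.
  have Lg : orb G s (bot (mul4 (inv4 s) g)) by exists g.
  have c0 : (mul4 (inv4 s) g).1.2 = 0.
    apply/eqP/negP => /negP c0; apply: nP.
    have [c1|c1] := ltP 0 (mul4 (inv4 s) g).1.2.
      have [Gv bv] := gvP _ Lg; exists (bot (mul4 (inv4 s) g)) => //.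
      by apply: coE => //; rewrite bv /wedge mulrC subrr.
    have LN := orb_opp dG Lg; have [Gv bv] := gvP _ LN.
    exists (- bot (mul4 (inv4 s) g)); first by split => //=; rewrite oppr_gt0 lt_neqAle c0.
    by apply: coE => //; rewrite bv /wedge /=; ring.
  have d2 : (mul4 (inv4 s) g).2 ^+ 2 = d0 := hd0 _ Lg c0.
  have [b be] := rep _ Gg; rewrite ?to2K -/st -/(co g) /t.
  have fz : forall M, M.1.2 = 0 -> M.2 ^+ 2 = d0 -> fterm h T y x M = 0.
    by move=> M M0 M2; apply: fterm_zero; rewrite ?M2.
  move: c0 d2 be; move: (mul4 (inv4 s) g) => M c0 d2.
  case=> ->; rewrite -/(fterm h T y x _); apply: fz; rewrite /opp4 /mul4 /=.
  - by rewrite c0 mul0r mulr0 addr0.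
  - by rewrite mul0r add0r mul1r.
  - by rewrite c0 mul0r mulr0 addr0 oppr0.
  - by rewrite mul0r add0r mul1r sqrrN.
rewrite fsbig_image//; apply: eq_fsbigr => v /set_mem [Lv v0].
have [Gv bv] := gvP _ Lv; have dM := dsg _ Gv.
rewrite /t; have [b be] := rep _ Gv.
have c1 : (mul4 (inv4 s) (gv v)).1.2 = v.1.
  by rewrite -[LHS]/((bot (mul4 (inv4 s) (gv v))).1) bv.
have c0 : 0 < (mul4 (inv4 s) (gv v)).1.2 by rewrite c1.
transitivity (fterm h T y x (mul4 (inv4 s) (gv v))); last first.
  by rewrite -[in RHS]bv; apply: fterm_gterm => //; rewrite bv c1.
case: be => ->; rewrite -/(fterm h T y x _); first exact: fterm_upper.
by rewrite fterm_opp ?fterm_upper// /mul4 /= mul0r add0r mul1r.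
Qed.
End Unfolding.

(** * From the length condition to the limit *)

Section Equidistribution.
Variable R : realType.

(** With [z = w/B1], the hypothesis yields [L >= z^(1/2) z^(-delta)], so
    [L / sqrt w >= z^(-delta) / sqrt B1]; the bound on [w] makes this at least [X0]. *)
Lemma length_bound (B1 delta X0 w L T : R) : 0 < B1 -> 0 < delta -> 0 < X0 -> 0 < w ->
  w <= B1 * (((X0 * Num.sqrt B1)^-1) `^ delta^-1) ->
  Num.max (T `^ (- 6^-1)) ((w / B1) `^ (2^-1)) * (w / B1) `^ (- delta) <= L ->
  X0 <= (Num.sqrt w)^-1 * L.
Proof.
move=> B0 d0 X00 w0 wz hL.
have sB : 0 < Num.sqrt B1 by rewrite sqrtr_gt0.
have sw : 0 < Num.sqrt w by rewrite sqrtr_gt0.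
have z0 : 0 < w / B1 by rewrite divr_gt0.
have XB : 0 < X0 * Num.sqrt B1 by rewrite mulr_gt0.
have zd : (w / B1) `^ delta <= (X0 * Num.sqrt B1)^-1.
  have zle : w / B1 <= (X0 * Num.sqrt B1)^-1 `^ delta^-1 by rewrite ler_pdivrMr// mulrC.
  have p0 : 0 <= (X0 * Num.sqrt B1)^-1 by rewrite invr_ge0 ltW.
  rewrite -[X in _ <= X](powRr1 p0) -(mulVf (negbT (gt_eqF d0))) powRrM.
  by apply: ge0_ler_powR => //; rewrite ?nnegrE ?powR_ge0//; exact: ltW.
have zn : X0 * Num.sqrt B1 <= (w / B1) `^ (- delta).
  by rewrite powRN -[X in X <= _]invrK lef_pV2 ?posrE ?invr_gt0// powR_gt0.
have h1 : Num.sqrt w / Num.sqrt B1 * (X0 * Num.sqrt B1) <= L.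
  apply: le_trans hL; apply: ler_pM => //.
  - exact: ltW.
  - rewrite powR12_sqrt ?(ltW z0)// sqrtrM ?(ltW w0)// sqrtrV ?(ltW B0)//.
    by rewrite le_max lexx orbT.
have E : Num.sqrt w / Num.sqrt B1 * (X0 * Num.sqrt B1) = Num.sqrt w * X0.
  by field; rewrite gt_eqF.
by rewrite -(ler_pM2l sw) mulVKf ?gt_eqF// -E.
Qed.

Lemma equidist (Gam : set 'M[R]_2) k (s : 'M[R]_2) (F : set (R * R)) (B1 delta e : R)
    (h : R -> R -> R) :
  Fuchsian Gam -> stab Gam None = @Gamma_inf R -> scaling Gam k s ->
  fund_domain Gam F -> (hyp_area F < +oo)%E -> 0 < B1 -> 0 < delta ->
  continuous (fun z : R * R => h z.1 z.2) ->
  (forall x t, h (x + 1) t = h x t) -> (forall x t, h x (t + 2 * pi) = h x t) -> 0 < e ->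
  exists T0 : R, exists2 c0 : R, 0 < c0 &
    forall T y : R, T0 <= T -> 0 < T * y -> T * y < c0 -> forall a b : R, a < b ->
      Num.max (T `^ (- 6^-1)) ((T * y / B1) `^ (2^-1)) * (T * y / B1) `^ (- delta)
        <= b - a ->
      `|T / (b - a) * II (fun x => phiT0 Gam k s h T (x, y) 0) a b -
        (covol F)^-1 * II (mean h) 0 (2 * pi)| <= e.
Proof.
move=> fG sG; rewrite -[s]of2K; move: (of2 s) => {}s sc fF fin B0 d0 ch hp1 hp2 e0.
have fd := fundom_to2 fG sG fF fin; have cS := cusp_scaling fG sc.
have ds : det4 s = 1 by case: sc; rewrite det_to2.
have [A [dd dd0 hA]] := phiT0_gterm fG sc.
have [T0 [Qm [X0 [T00 Qm0 X00 hM]]]] := main_term fd ds cS ch hp1 hp2 e0.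
exists (Num.max T0 1).
(* The three bounds ensure [Q >= Qm], the vanishing of the terms with [c = 0] (using [T >= 1]), and
   [Q L >= X0]. *)
exists (Num.min ((Qm^-1) ^+ 2) (Num.min dd (B1 * (((X0 * Num.sqrt B1)^-1) `^ delta^-1)))).
  rewrite !lt_min dd0 exprn_gt0 ?invr_gt0//= mulr_gt0// powR_gt0// invr_gt0 mulr_gt0//.
  by rewrite sqrtr_gt0.
move=> T y; rewrite ge_max => /andP[TT0 T1] w0; rewrite !lt_min => /and3P[wQ wd wz] a b ab hL.
have Tp : 0 < T by apply: lt_le_trans T1.
have y0 : 0 < y by move: w0; rewrite pmulr_rgt0.
have sw : 0 < Num.sqrt (T * y) by rewrite sqrtr_gt0.
have hX := length_bound B0 d0 X00 w0 (ltW wz) hL.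
have yT : y < T * dd.
  rewrite -(ltr_pM2l Tp); apply: (lt_le_trans wd); rewrite mulrA ler_peMl ?(ltW dd0)//.
  by rewrite -[1]mulr1; apply: ler_pM.
have := hM T y (Num.sqrt (T * y))^-1 a b A TT0 y0.
rewrite invr_gt0 sw exprVn sqr_sqrtr ?(ltW w0)// mulfV ?gt_eqF// => /(_ isT erefl).
rewrite -(Ex1_covol fd) => hM'.
rewrite (_ : (fun x => phiT0 Gam k (to2 s) h T (x, y) 0) = (fun x =>
  \sum_(v \in [set v | orb [set m | Gam (to2 m)] s v /\ 0 < v.1]) gterm h T y A v x)).
  apply: hM' => //.
  rewrite -[X in X <= _]invrK lef_pV2 ?posrE ?invr_gt0//.
  by rewrite -[X in _ <= X]gtr0_norm ?invr_gt0// -sqrtr_sqr ler_wsqrtr// ltW.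
by apply/funext => x; exact: hA.
Qed.
End Equidistribution.

Theorem theorem1p1 (R : realType) (Gam : set 'M[R]_2) (q : nat)
    (kappa : nat -> option R) (sigma : nat -> 'M[R]_2) (F : set (R * R))
    (B0 B1 : R) (hr hi : R -> R -> R) (j : nat) (delta : R) :
  Fuchsian Gam ->
  (0 < q)%N ->
  cusp_set Gam q kappa ->
  kappa 0%N = None ->
  stab Gam None = @Gamma_inf R ->
  (forall i, (i < q)%N -> scaling Gam (kappa i) (sigma i)) ->
  sigma 0%N = 1 ->
  fund_domain Gam F ->
  F `<=` [set p | 0 <= p.1 <= 1 /\ 0 < p.2] ->
  (hyp_area F < +oo)%E ->
  1 < B0 ->
  (forall B, B0 <= B -> forall i, (i < q)%N ->
     (mob (invmx (sigma i)) @` closure F) `&` [set p | B <= p.2]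
     = [set p | 0 <= p.1 <= 1 /\ B <= p.2]) ->
  B0 < B1 ->
  smooth2 hr -> smooth2 hi ->
  (forall x t, hr (x + 1) t = hr x t /\ hi (x + 1) t = hi x t) ->
  (forall x t, hr x (t + 2 * pi) = hr x t /\ hi x (t + 2 * pi) = hi x t) ->
  (j < q)%N ->
  0 < delta ->
  forall eps : R, 0 < eps ->
  exists T0 : R, exists2 c0 : R, 0 < c0 &
    forall T y : R, T0 <= T -> y < T -> 0 < T * y -> T * y < c0 ->
    forall a b : R, a < b ->
      Num.max (T `^ (- 6^-1)) ((T * y / B1) `^ (2^-1)) * (T * y / B1) `^ (- delta)
        <= b - a ->
      let LHSr := T / (b - a) *
        \int[lebesgue_measure]_(x in `[a, b]%classic)
           phiT0 Gam (kappa j) (sigma j) hr T (x, y) 0 in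
      let LHSi := T / (b - a) *
        \int[lebesgue_measure]_(x in `[a, b]%classic)
           phiT0 Gam (kappa j) (sigma j) hi T (x, y) 0 in
      let RHSr := (covol F)^-1 *
        \int[lebesgue_measure]_(t in `[0, 2 * pi]%classic)
           \int[lebesgue_measure]_(x in `[0, 1]%classic) hr x t in
      let RHSi := (covol F)^-1 *
        \int[lebesgue_measure]_(t in `[0, 2 * pi]%classic)
           \int[lebesgue_measure]_(x in `[0, 1]%classic) hi x t in
      (LHSr - RHSr) ^+ 2 + (LHSi - RHSi) ^+ 2 < eps ^+ 2.
Proof.
move=> fG _ _ _ sG sc _ fF _ fin B01 _ B0B1 sr si hp1 hp2 jq d0 eps e0.
have B10 : 0 < B1 by apply: lt_trans B0B1; apply: lt_trans B01.
have e20 : 0 < eps / 2 by exact: divr_gt0 e0 (ltr0Sn _ _).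
have [_ _ cr] := sr [::]; have [_ _ ci] := si [::].
have [Tr [cr0 cr00 Hr]] := equidist fG sG (sc _ jq) fF fin B10 d0 cr
  (fun x t => (hp1 x t).1) (fun x t => (hp2 x t).1) e20.
have [Ti [ci0 ci00 Hi]] := equidist fG sG (sc _ jq) fF fin B10 d0 ci
  (fun x t => (hp1 x t).2) (fun x t => (hp2 x t).2) e20.
exists (Num.max Tr Ti); exists (Num.min cr0 ci0); first by rewrite lt_min cr00.
move=> T y; rewrite ge_max => /andP[T1 T2] _ w0; rewrite lt_min => /andP[w1 w2] a b ab hL.
have {}Hr := Hr T y T1 w0 w1 a b ab hL; have {}Hi := Hi T y T2 w0 w2 a b ab hL.
have sq (z : R) : `|z| <= eps / 2 -> z ^+ 2 <= (eps / 2) ^+ 2.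
  by move=> hz; rewrite -real_normK ?num_real// lerXn2r ?nnegrE// ltW.
(* Real and imaginary parts are each within [eps/2], so the squared modulus is at most [eps^2/2]. *)
cbv zeta; apply: (le_lt_trans (lerD (sq _ Hr) (sq _ Hi))).
have := exprn_gt0 2 e0; clear; rewrite expr_div_n; lra.
Qed.
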